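(* Assume that $g_\theta$ and $g_\kappa$ both have radius of convergence $R>0$ and are holomorphic in some domain $\Delta_0$, that $g_\kappa^{\{1\}}(R)=1$ and $0<g_\kappa^{\{2\}}(R)<\infty$, and that for some $\theta^*\ge0$, $\delta>0$, as $z\to R$, $z\in\Delta_0$, $$g_\theta(z)=-\theta^*\log(1-z/R)+O((1-z/R)^\delta),\quad g_\kappa(z)=g_\kappa(R)-(1-z/R)+\tfrac12g_\kappa^{\{2\}}(R)(1-z/R)^2+O((1-z/R)^{2+\delta}).$$ Let $f:\Delta_0\to\mathbb C$ be holomorphic with $f(z)=1+O((1-z/R)^\delta)$ as $z\to R$, $z\in\Delta_0$. Then for any $u\ge0$, as $N\to\infty$, $$[z^N]\big[f(z)\exp\{e^{-u/\sqrt N}G_N(z)\}\big]\sim\frac{\exp\{Ng_\kappa(R)-\sqrt N\,u\,g_\kappa(R)+\tfrac12u^2g_\kappa(R)\}}{R^N}\big(\tfrac12Nb_2(R)\big)^{(\theta^*-1)/2}\frac{J_{\tilde u}(\theta^* )}{2\pi i},$$ where $\tilde u=u\sqrt{2/b_2(R)}$. In particular, $$H_N\sim\frac{\exp\{Ng_\kappa(R)\}\cdot\big(\tfrac12Nb_2(R)\big)^{(\theta^*-1)/2}}{2R^N\,\Gamma\big(\frac{1+\theta^*}{2}\big)},\qquad N\to\infty.$$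
   Context: $(\theta_j)_{j\ge1}$, $(\kappa_j)_{j\ge1}$ are sequences of nonnegative reals; $g_\theta(z)=\sum_{j\ge1}\theta_jz^j/j$, $g_\kappa(z)=\sum_{j\ge1}\kappa_jz^j/j$, $G_N=g_\theta+Ng_\kappa$. $[z^N]F(z)$ is the coefficient of $z^N$. $H_N=\frac1{N!}\sum_{\sigma\in S_N}\prod_{j=1}^N(\theta_j+N\kappa_j)^{C_j(\sigma)}$, $C_j(\sigma)$ the number of $j$-cycles of $\sigma$. $g^{\{n\}}(z)=z^ng^{(n)}(z)$, $g_\kappa^{\{n\}}(R):=\lim_{r\uparrow R}g_\kappa^{\{n\}}(r)$; $b_2(R)=g_\kappa^{\{1\}}(R)+g_\kappa^{\{2\}}(R)$. Domain: for $\eta>0$, $\varphi\in(0,\pi/2)$, $\Delta_0=\{z\in\mathbb C:|z|<R|1+\eta e^{i\varphi}|,\ z\ne R,\ |\arg(z-R)|>\varphi\}$. Logs and powers use principal branches. Standing assumption: $(\kappa_j)$ is non-arithmetic (no integer $j_0>1$ such that $\kappa_j\ne0$ implies $j_0\mid j$) and $\kappa_j>0$ for some $j\ge2$. The function $J_\xi(\sigma)$ ($\xi\in\mathbb R$, $\sigma\in\mathbb C$): fix $\varphi'\in(\pi/4,\pi/2)$ and $\epsilon>0$; let $\gamma'$ be the contour coming from $\infty e^{-i\varphi'}$ along the ray $\{ye^{-i\varphi'}:y\ge\epsilon\}$ to $\epsilon e^{-i\varphi'}$, then along the arc $\{\epsilon e^{-it}:t\in[\varphi',2\pi-\varphi']\}$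 (passing through $-\epsilon$) to $\epsilon e^{i\varphi'}$, then out along the ray $\{ye^{i\varphi'}:y\ge\epsilon\}$ to $\infty e^{i\varphi'}$; $J_\xi(\sigma)=\int_{\gamma'}(-w)^{-\sigma}\exp\{-\xi w+w^2\}\,dw$, with the principal branch of $(-w)^{-\sigma}$ (the integral is independent of $\varphi',\epsilon$). *)

(* Defs.v *)
From Stdlib Require Import Reals Lra Factorial.
From Coquelicot Require Import Coquelicot.
From mathcomp Require Import ssreflect ssrfun ssrbool eqtype ssrnat seq choice
  fintype finfun bigop finset fingroup perm ssralg.
From mathcomp Require Import Rstruct.

Set Implicit Arguments.
Unset Strict Implicit.

Open Scope R_scope.

Definition cexp (z : C) : C :=
  (exp (Re z) * cos (Im z), exp (Re z) * sin (Im z)).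

(** principal argument, with values in (-PI, PI]; carg 0 = 0 *)
Definition carg (z : C) : R :=
  let x := Re z in let y := Im z in
  match Rlt_dec 0 x with
  | left _ => atan (y / x)
  | right _ =>
    match Rlt_dec x 0 with
    | left _ => match Rle_dec 0 y with
                | left _ => atan (y / x) + PI
                | right _ => atan (y / x) - PI
                end
    | right _ =>
      match Rlt_dec 0 y with
      | left _ => PI / 2
      | right _ => match Rlt_dec y 0 with
                   | left _ => - (PI / 2)
                   | right _ => 0
                   end
      end
    end
  end.

Definition clog (z : C) : C := (ln (Cmod z), carg z).

Definition cpow (a b : C) : C :=
  match Ceq_dec a 0 with
  | left _ => 0%C
  | right _ => cexp (Cmult b (clog a))
  end.

Definition cseries (a : nat -> C) : C :=
  (Series (fun n => Re (a n)), Series (fun n => Im (a n))).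

Definition holomorphic_on (U : C -> Prop) (f : C -> C) : Prop :=
  forall z, U z -> exists l : C, @is_derive C_AbsRing C_NormedModule f z l.

Fixpoint cderive_n (n : nat) (f : C -> C) : C -> C :=
  match n with
  | O => f
  | S m => C_derive (cderive_n m f)
  end.

Definition zcoef (N : nat) (F : C -> C) : C :=
  Cdiv (cderive_n N F 0%C) (RtoC (INR (fact N))).

Definition gcoef (c : nat -> R) (n : nat) : R :=
  match n with O => 0 | _ => c n / INR n end.

Definition gser (c : nat -> R) (z : C) : C :=
  cseries (fun n => Cmult (RtoC (gcoef c n)) (Cpow z n)).

Definition greal (c : nat -> R) (r : R) : R := PSeries (gcoef c) r.

Definition GN (theta kappa : nat -> R) (N : nat) (z : C) : C :=
  Cplus (gser theta z) (Cmult (RtoC (INR N)) (gser kappa z)).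

Definition gbrace (c : nat -> R) (n : nat) (r : R) : R :=
  r ^ n * Derive_n (greal c) n r.

Definition gbrace_at_R_is (c : nat -> R) (n : nat) (Rad v : R) : Prop :=
  filterlim (gbrace c n) (at_left Rad) (locally v).

Definition non_arithmetic (kappa : nat -> R) : Prop :=
  ~ (exists j0 : nat, (1 < j0)%nat /\
       forall j : nat, (1 <= j)%nat -> kappa j <> 0 -> Nat.divide j0 j).

Definition Delta0 (Rad eta phi : R) (z : C) : Prop :=
  Cmod z < Rad * Cmod (Cplus 1 (Cmult (RtoC eta) (cexp (0, phi))))
  /\ z <> RtoC Rad
  /\ Rabs (carg (Cminus z (RtoC Rad))) > phi.

Definition bigO_near (U : C -> Prop) (Rad : R) (h k : C -> C) : Prop :=
  exists M eps : R, 0 < eps /\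
    forall z, U z -> Cmod (Cminus z (RtoC Rad)) < eps ->
      Cmod (h z) <= M * Cmod (k z).

Definition cint_to_infty (h : R -> C) (a : R) : C :=
  @RInt_gen C_R_CompleteNormedModule h (at_point a) (Rbar_locally p_infty).

Definition cint (h : R -> C) (a b : R) : C :=
  @RInt C_R_CompleteNormedModule h a b.

(** contour integral over gamma' with phi' = PI/3 and eps = 1 (the integral
    is independent of these choices) *)
Definition Jfun (xi : R) (sigma : C) : C :=
  let phi' := PI / 3 in
  let eps := 1 in
  let h (w : C) : C :=
    Cmult (cpow (Copp w) (Copp sigma))
          (cexp (Cplus (Copp (Cmult (RtoC xi) w)) (Cmult w w))) in
  let em := cexp (0, - phi') in
  let ep := cexp (0, phi') in
  (* incoming ray from oo e^{-i phi'} to eps e^{-i phi'} *)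
  let I1 := Copp (cint_to_infty (fun y => Cmult (h (Cmult (RtoC y) em)) em) eps) in
  (* arc w = eps e^{-it}, t in [phi', 2 PI - phi'], dw = -i eps e^{-it} dt *)
  let I2 := cint (fun t => Cmult (h (Cmult (RtoC eps) (cexp (0, - t))))
                   (Cmult (Copp Ci) (Cmult (RtoC eps) (cexp (0, - t)))))
                 phi' (2 * PI - phi') in
  let I3 := cint_to_infty (fun y => Cmult (h (Cmult (RtoC y) ep)) ep) eps in
  Cplus I1 (Cplus I2 I3).

Definition Gamma (s : R) : R :=
  RInt_gen (fun t => Rpower t (s - 1) * exp (- t)) (at_right 0) (Rbar_locally p_infty).

Definition asym_equiv (a b : nat -> C) : Prop :=
  forall eps : R, 0 < eps -> exists N0 : nat, forall N : nat, (N0 <= N)%nat ->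
    Cmod (Cminus (a N) (b N)) <= eps * Cmod (b N).

Definition cycle_count (N : nat) (s : 'S_N) (j : nat) : nat :=
  #|[set c in porbits s | #|c| == j]|.

Definition HN (theta kappa : nat -> R) (N : nat) : R :=
  / INR (fact N) *
  (\sum_(s : 'S_N) \prod_(j < N)
      GRing.exp (theta j.+1 + INR N * kappa j.+1) (cycle_count s j.+1))%R.

(* Main.v *)
(** With [mu = sqrt (2 / b2) / sqrt N], Cauchy's formula on the circle of radius [R exp (- mu)], which
    stays inside the disc of convergence, writes the [N]-th coefficient as an integral over the points
    [z = R exp (- mu w)], [w = 1 - i s], [|s| <= PI / mu].  By the singular expansions the normalised
    integrand tends to [w^(- theta_star) exp (u~ w + w^2)], uniformly for bounded [s]; since [kappa] is
    non-arithmetic, [Re g_kappa (r e^(it)) <= g_kappa r - c t^2] uniformly in [r] close to [R], which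
    gives a Gaussian dominating function.

    The limit is [J] on a vertical line: in the coordinate [-w = e^v] the integrand of [J] is entire, so
    that the contour can be moved.  It does not vanish because of its differential equation in [xi], and
    its value at [xi = 0] is found by showing that its product with [Gamma] is periodic in [theta_star].

    The generating function of the cycle index identifies [H_N] with the [N]-th coefficient of
    [exp G_N]. *)
Require Import Defs.
From Stdlib Require Import Reals Lra Lia Psatz ClassicalEpsilon.
From Coquelicot Require Import Coquelicot.
From Stdlib Require Import ssreflect.
From mathcomp Require ssrnat.
Open Scope R_scope.

(** * Limits of complex-valued functions *)

(** The radius is forced by a coalescence. Since $g_\kappa^{\{1\}}(R)=1$, the linear terms of
    [N * gser kappa] and of [- N * ln z] cancel at the singularity itself, so saddle point and
    singularity merge at scale [1 / sqrt N]. With [w = mu * (1 - i s)] the second-order terms add up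
    to [N * b2 / 2 * w^2]; the choice of [mu] turns this into [(1 - i s)^2], while the logarithm
    survives as a power of [1 - i s]. The circle stays inside the disc, so no contour enters the
    rest of [Delta0], which serves for holomorphy, for the expansions at [R] and for a bound on [f]
    up to the boundary circle. Equivalence is a relative error, which is why J must not vanish.
    Periodicity alone does not determine the product of J with [Gamma]: Laplace's method at infinity
    shows that it is constant, and [theta_star = 1] gives the constant. Coefficients are iterated
    derivatives at 0. Cauchy's theory is developed in the logarithmic coordinate, where circles are
    vertical segments, so that Goursat's theorem is needed for rectangles only. *)

Definition Clim {T : Type} (F : (T -> Prop) -> Prop) (u : T -> C) (a : C) :=
  forall eps, 0 < eps -> F (fun x => Cmod (u x - a) < eps).

Lemma Fimp {T : Type} {F : (T -> Prop) -> Prop} {FF : Filter F} {P Q : T -> Prop} :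
  F P -> (forall x, P x -> Q x) -> F Q.
Proof. by move=> HP H; apply: filter_imp HP. Qed.

Lemma Cmod_sub_sym (a b : C) : Cmod (a - b) = Cmod (b - a).
Proof. by rewrite -Cmod_opp; congr Cmod; ring. Qed.

Lemma Cmod_triangle_sub (a b : C) : Cmod a <= Cmod b + Cmod (a - b).
Proof.
have -> : a = (b + (a - b))%C by ring.
have := Cmod_triangle b (a - b).
have -> : (b + (a - b) - b)%C = (a - b)%C by ring.
by [].
Qed.

Section Clim.
Context {T : Type} {F : (T -> Prop) -> Prop} {FF : Filter F}.

Lemma Clim_const (a : C) : Clim F (fun _ => a) a.
Proof.
move=> e He; apply: filter_forall => _.
have -> : (a - a)%C = 0 by ring.
by rewrite Cmod_0.
Qed.

Lemma Clim_ext_loc (u v : T -> C) (a : C) :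
  F (fun x => u x = v x) -> Clim F u a -> Clim F v a.
Proof.
move=> H Hu e He; apply: (Fimp (filter_and _ _ H (Hu e He))) => x [Hx H1]; by rewrite -Hx.
Qed.

Lemma Clim_ext (u v : T -> C) (a : C) :
  (forall x, u x = v x) -> Clim F u a -> Clim F v a.
Proof. by move=> H; apply: Clim_ext_loc; apply: filter_forall. Qed.

Lemma Clim_squeeze (u : T -> C) (v : T -> R) (a : C) :
  F (fun x => Cmod (u x - a) <= v x) ->
  (forall eps, 0 < eps -> F (fun x => v x < eps)) -> Clim F u a.
Proof.
move=> H1 H2 e He; apply: (Fimp (filter_and _ _ H1 (H2 e He))) => x []; lra.
Qed.

Lemma Clim_plus (u v : T -> C) (a b : C) :
  Clim F u a -> Clim F v b -> Clim F (fun x => u x + v x)%C (a + b)%C.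
Proof.
move=> Hu Hv e He.
have He2 : 0 < e / 2 by lra.
apply: (Fimp (filter_and _ _ (Hu _ He2) (Hv _ He2))) => x [H1 H2].
have -> : (u x + v x - (a + b))%C = ((u x - a) + (v x - b))%C by ring.
have := Cmod_triangle (u x - a) (v x - b); lra.
Qed.

Lemma Clim_opp (u : T -> C) (a : C) :
  Clim F u a -> Clim F (fun x => - u x)%C (- a)%C.
Proof.
move=> Hu e He; apply: (Fimp (Hu e He)) => x.
have -> : (- u x - - a)%C = (- (u x - a))%C by ring.
by rewrite Cmod_opp.
Qed.

Lemma Clim_minus (u v : T -> C) (a b : C) :
  Clim F u a -> Clim F v b -> Clim F (fun x => u x - v x)%C (a - b)%C.
Proof. by move=> Hu Hv; apply: Clim_plus => //; apply: Clim_opp. Qed.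

Lemma Clim_bounded (u : T -> C) (a : C) :
  Clim F u a -> F (fun x => Cmod (u x) < Cmod a + 1).
Proof.
move=> H0; apply: (Fimp (H0 1 Rlt_0_1)) => x H.
have := Cmod_triangle_sub (u x) a; lra.
Qed.

Lemma Clim_0_mult_bounded (u v : T -> C) (M : R) :
  Clim F u 0 -> F (fun x => Cmod (v x) <= M) -> Clim F (fun x => u x * v x)%C 0.
Proof.
move=> Hu Hv e He.
have HM : 0 < Rabs M + 1 by have := Rabs_pos M; lra.
have He2 : 0 < e / (Rabs M + 1) by apply: Rdiv_lt_0_compat.
apply: (Fimp (filter_and _ _ (Hu _ He2) Hv)) => x [H1 H2].
have -> : (u x * v x - 0)%C = ((u x - 0) * v x)%C by ring.
rewrite Cmod_mult.
have H3 : Cmod (v x) < Rabs M + 1 by have := Rle_abs M; lra.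
have -> : e = e / (Rabs M + 1) * (Rabs M + 1) by field; lra.
by apply: Rmult_le_0_lt_compat => //; apply: Cmod_ge_0.
Qed.

Lemma Clim_sub0 (u : T -> C) (a : C) :
  Clim F (fun x => u x - a)%C 0 -> Clim F u a.
Proof.
move=> Hu e He; apply: (Fimp (Hu e He)) => x.
have -> : (u x - a - 0)%C = (u x - a)%C by ring.
by [].
Qed.

Lemma Clim_mult (u v : T -> C) (a b : C) :
  Clim F u a -> Clim F v b -> Clim F (fun x => u x * v x)%C (a * b)%C.
Proof.
move=> Hu Hv; apply: Clim_sub0.
apply: (Clim_ext (fun x => (u x - a) * v x + (v x - b) * a)%C).
  by move=> x; ring.
have -> : RtoC 0 = (0 + 0)%C by ring.
apply: Clim_plus; apply: Clim_0_mult_bounded.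
- have -> : RtoC 0 = (a - a)%C by ring.
  by apply: Clim_minus => //; apply: Clim_const.
- by apply: (Fimp (Clim_bounded _ _ Hv)) => x; apply: Rlt_le.
- have -> : RtoC 0 = (b - b)%C by ring.
  by apply: Clim_minus => //; apply: Clim_const.
- by apply: filter_forall => _; apply: Rle_refl.
Qed.

Lemma Clim_inv (u : T -> C) (a : C) :
  a <> 0 -> Clim F u a -> Clim F (fun x => / u x)%C (/ a)%C.
Proof.
move=> Ha Hu; apply: Clim_sub0.
have Ha' : 0 < Cmod a by apply/Cmod_gt_0.
have Ha2 : 0 < Cmod a / 2 by lra.
apply: (Clim_ext_loc (fun x => (u x - a) * (- (/ u x * / a)))%C).
  apply: (Fimp (Hu _ Ha2)) => x H.
  have Hx : u x <> 0.
    move=> H0; move: H; rewrite H0 Cmod_sub_sym.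
    have -> : (a - 0)%C = a by ring.
by lra.
  by field.
(* Once [Cmod (u x)] exceeds half of [Cmod a], this bounds [/ (u x * a)]. *)
apply: (Clim_0_mult_bounded _ _ (2 / Cmod a * / Cmod a)).
  have -> : RtoC 0 = (a - a)%C by ring.
  by apply: Clim_minus => //; apply: Clim_const.
apply: (Fimp (Hu _ Ha2)) => x H.
have Hm : Cmod a / 2 < Cmod (u x).
  have := Cmod_triangle_sub a (u x); rewrite Cmod_sub_sym; lra.
have Hx : u x <> 0 by apply/Cmod_gt_0; lra.
rewrite Cmod_opp Cmod_mult !Cmod_inv //.
apply: Rmult_le_compat_r; first by left; apply: Rinv_0_lt_compat.
have -> : 2 / Cmod a = / (Cmod a / 2) by field; lra.
by apply: Rinv_le_contravar; lra.
Qed.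

Lemma Clim_div (u v : T -> C) (a b : C) :
  b <> 0 -> Clim F u a -> Clim F v b -> Clim F (fun x => u x / v x)%C (a / b)%C.
Proof. by move=> Hb Hu Hv; apply: Clim_mult => //; apply: Clim_inv. Qed.

Lemma Clim_RtoC (u : T -> R) (a : R) :
  filterlim u F (locally a) -> Clim F (fun x => RtoC (u x)) a.
Proof.
move=> /filterlim_locally H e He; apply: (Fimp (H (mkposreal e He))) => x; rewrite /ball /= /AbsRing_ball /= /abs /= /minus /plus /opp /=.
by rewrite -RtoC_minus Cmod_R.
Qed.

Lemma Clim_Re (u : T -> C) (a : C) :
  Clim F u a -> filterlim (fun x => Re (u x)) F (locally (Re a)).
Proof.
move=> H; apply/filterlim_locally => e; apply: (Fimp (H e (cond_pos e))) => x H1; rewrite /ball /= /AbsRing_ball /= /abs /= /minus /plus /opp /=.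
have := re_le_Cmod (u x - a); rewrite re_plus re_opp; lra.
Qed.

Lemma Clim_pow (u : T -> C) (a : C) (n : nat) :
  Clim F u a -> Clim F (fun x => u x ^ n)%C (a ^ n)%C.
Proof.
move=> H; elim: n => [|n IH] /=; first exact: Clim_const.
exact: Clim_mult.
Qed.

Lemma Clim_unique (u : T -> C) (a b : C) :
  ProperFilter' F -> Clim F u a -> Clim F u b -> a = b.
Proof.
move=> PF Ha Hb; case: (Ceq_dec a b) => // Hab; exfalso.
have H : 0 < Cmod (a - b) / 2.
  have : (a - b)%C <> 0 by move=> H; apply: Hab; apply/Ceq_minus.
  by move/Cmod_gt_0; lra.
apply: (@filter_not_empty _ F PF).
apply: (Fimp (filter_and _ _ (Ha _ H) (Hb _ H))) => x [H1 H2].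
have := Cmod_triangle (a - u x) (u x - b).
have -> : (a - u x + (u x - b))%C = (a - b)%C by ring.
rewrite (Cmod_sub_sym a (u x)); lra.
Qed.

End Clim.

(** The uniform structure on [C] is that of a product, so its balls are squares; [sqrt 2] is the
    price of passing from discs to squares. *)
Lemma locally_C (z : C) (P : C -> Prop) :
  locally z P <-> exists d, 0 < d /\ forall w, Cmod (w - z) < d -> P w.
Proof.
split.
- case=> d Hd; exists d; split; first exact: cond_pos.
  by move=> w Hw; apply: Hd; apply: C_NormedModule_mixin_compat1.
- case=> d [Hd H].
  have Hd2 : 0 < d / sqrt 2.
    by apply: Rdiv_lt_0_compat => //; apply: sqrt_lt_R0; lra.
  exists (mkposreal _ Hd2) => w [/= H1 H2]; apply: H.
  apply: Rle_lt_trans; first exact: Cmod_2Rmax.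
  have Hs : 0 < sqrt 2 by apply: sqrt_lt_R0; lra.
  have -> : d = sqrt 2 * (d / sqrt 2) by field; lra.
  by apply: Rmult_lt_compat_l => //; apply: Rmax_lub_lt.
Qed.

Lemma locally_R (t : R) (P : R -> Prop) :
  locally t P <-> exists d, 0 < d /\ forall s, Rabs (s - t) < d -> P s.
Proof.
split.
- by case=> d Hd; exists d; split; first exact: cond_pos.
- by case=> d [Hd H]; exists (mkposreal d Hd).
Qed.

Lemma Clim_locally {T : Type} (F : (T -> Prop) -> Prop) {FF : Filter F}
    (u : T -> C) (a : C) : Clim F u a <-> filterlim u F (locally a).
Proof.
split.
- move=> H P /locally_C [d [Hd HP]]; apply: (Fimp (H d Hd)) => x; apply: HP.
- move=> H e He; apply: (H (fun w => Cmod (w - a) < e)).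
  by apply/locally_C; exists e.
Qed.

Lemma Clim_comp {T : Type} (F : (T -> Prop) -> Prop) {FF : Filter F}
    (u : T -> C) (f : C -> C) (a b : C) :
  Clim F u a -> Clim (locally a) f b -> Clim F (fun x => f (u x)) b.
Proof. by move=> Hu Hf e He; exact: (proj1 (Clim_locally F u a) Hu _ (Hf e He)). Qed.

Lemma Clim_id (a : C) : Clim (locally a) (fun z => z) a.
Proof. by move=> e He; apply/locally_C; exists e. Qed.

(** * The complex exponential *)

Lemma cexp_plus (a b : C) : cexp (a + b) = (cexp a * cexp b)%C.
Proof.
rewrite /cexp re_plus im_plus exp_plus cos_plus sin_plus.
by apply: injective_projections => /=; ring.
Qed.

Lemma cexp_0 : cexp 0 = 1.
Proof. by rewrite /cexp /= exp_0 cos_0 sin_0; apply: injective_projections => /=; ring. Qed.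

Lemma Cmod_cexp (z : C) : Cmod (cexp z) = exp (Re z).
Proof.
rewrite /Cmod /cexp /=.
have -> : exp (Re z) * cos (Im z) * (exp (Re z) * cos (Im z) * 1) +
  exp (Re z) * sin (Im z) * (exp (Re z) * sin (Im z) * 1) =
  Rsqr (exp (Re z)) * (Rsqr (sin (Im z)) + Rsqr (cos (Im z))) by rewrite /Rsqr; ring.
by rewrite sin2_cos2 Rmult_1_r sqrt_Rsqr //; left; apply: exp_pos.
Qed.

Lemma cexp_neq_0 (z : C) : cexp z <> 0.
Proof. by apply/Cmod_gt_0; rewrite Cmod_cexp; apply: exp_pos. Qed.

Lemma cexp_opp (z : C) : cexp (- z) = (/ cexp z)%C.
Proof.
have H : (cexp (- z) * cexp z)%C = 1.
  by rewrite -cexp_plus (_ : (- z + z)%C = 0); [exact: cexp_0 | ring].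
have Hz := cexp_neq_0 z.
by rewrite -[cexp (- z)]Cmult_1_r -(Cinv_r _ Hz) Cmult_assoc H; ring.
Qed.

Lemma cexp_RtoC (x : R) : cexp x = exp x.
Proof. by rewrite /cexp /= cos_0 sin_0; apply: injective_projections => /=; ring. Qed.

Lemma cexp_nat (n : nat) (z : C) : cexp (INR n * z) = (cexp z ^ n)%C.
Proof.
elim: n => [|n IH].
  by rewrite /= Cmult_0_l cexp_0.
rewrite S_INR RtoC_plus Cmult_plus_distr_r Cmult_1_l cexp_plus IH /=; ring.
Qed.

(** * Complex derivatives *)

(** Two mean value arguments, the second for [f t - f1 0 * t]. The usual factor 1/2 is given up,
    which is harmless for every use below. *)
Lemma taylor2_bound (f f1 f2 : R -> R) (M : R) :
  (forall t, 0 <= t <= 1 -> is_derive f t (f1 t)) ->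
  (forall t, 0 <= t <= 1 -> is_derive f1 t (f2 t)) ->
  (forall t, 0 <= t <= 1 -> Rabs (f2 t) <= M) ->
  Rabs (f 1 - f 0 - f1 0) <= M.
Proof.
move=> H1 H2 HM.
have HM0 : 0 <= M by apply: Rle_trans (HM 0 _); [exact: Rabs_pos | lra].
have Hf1 : forall t, 0 <= t <= 1 -> Rabs (f1 t - f1 0) <= M.
  move=> t Ht.
  case: (MVT_gen f1 0 t f2).
  - by rewrite Rmin_left ?Rmax_right; try lra; move=> x Hx; apply: H2; lra.
  - rewrite Rmin_left ?Rmax_right; try lra; move=> x Hx.
    apply: derivable_continuous_pt; exists (f2 x); apply/is_derive_Reals; apply: H2; lra.
  - rewrite Rmin_left ?Rmax_right; try lra; move=> x [Hx ->].
    rewrite Rminus_0_r Rabs_mult (Rabs_right t); last lra.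
    have := HM x; have := Rabs_pos (f2 x); nra.
case: (MVT_gen (fun t => f t - f1 0 * t) 0 1 (fun t => f1 t - f1 0)).
- rewrite Rmin_left ?Rmax_right; try lra; move=> x Hx.
  apply: is_derive_minus; first by apply: H1; lra.
  by auto_derive => //; ring.
- rewrite Rmin_left ?Rmax_right; try lra; move=> x Hx.
  apply: continuity_pt_minus.
    apply: derivable_continuous_pt; exists (f1 x); apply/is_derive_Reals; apply: H1; lra.
  by apply: continuity_pt_mult; [apply: continuity_pt_const | apply: continuity_pt_id].
- rewrite Rmin_left ?Rmax_right; try lra; move=> x [Hx Heq].
  have -> : f 1 - f 0 - f1 0 = (f1 x - f1 0) * (1 - 0) by lra.
  have -> : (f1 x - f1 0) * (1 - 0) = f1 x - f1 0 by ring.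
  by apply: Hf1; lra.
Qed.

Lemma Cmod_le_sum (z : C) : Cmod z <= Rabs (Re z) + Rabs (Im z).
Proof.
have -> : z = (RtoC (Re z) + Ci * RtoC (Im z))%C.
  by apply: injective_projections; rewrite /Re /Im /=; ring.
apply: Rle_trans; first exact: Cmod_triangle.
rewrite Cmod_mult Cmod_Ci !Cmod_R /=.
by apply: Req_le; congr (Rabs _ + _); [ring | rewrite Rmult_1_l; congr Rabs; ring].
Qed.

Lemma im_le_Cmod (c : C) : Rabs (Im c) <= Cmod c.
Proof. by apply: Rle_trans (Rmax_Cmod c); apply: Rmax_r. Qed.

(** Real and imaginary part of [cexp (t * h)] are expanded separately in the real variable [t],
    whence the factor 2. *)
Lemma cexp_sub1_sub_le (h : C) :
  Cmod (cexp h - 1 - h) <= 2 * Cmod h ^ 2 * exp (Cmod h).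
Proof.
set x := Re h; set y := Im h.
have Hb : forall t, 0 <= t <= 1 -> Cmod (h * h * cexp (t * h)) <= Cmod h ^ 2 * exp (Cmod h).
  move=> t Ht; rewrite !Cmod_mult Cmod_cexp.
  have -> : Cmod h ^ 2 = Cmod h * Cmod h by ring.
  apply: Rmult_le_compat_l; first by apply: Rmult_le_pos; apply: Cmod_ge_0.
  case: (Req_dec (Re (t * h)) (Cmod h)) => [->|Hne]; first by right.
  left; apply: exp_increasing; rewrite re_scal_l in Hne *.
  have := re_le_Cmod h; have := Rle_abs (Re h); have := Cmod_ge_0 h; nra.
apply: Rle_trans; first exact: Cmod_le_sum.
have -> : 2 * Cmod h ^ 2 * exp (Cmod h) = Cmod h ^ 2 * exp (Cmod h) + Cmod h ^ 2 * exp (Cmod h) by ring.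
apply: Rplus_le_compat.
- have := taylor2_bound (fun t => exp (t * x) * cos (t * y))
    (fun t => exp (t * x) * (x * cos (t * y) - y * sin (t * y)))
    (fun t => Re (h * h * cexp (t * h))) (Cmod h ^ 2 * exp (Cmod h)).
  rewrite !Rmult_0_l !Rmult_1_l exp_0 cos_0 sin_0.
  have -> : Re (cexp h - 1 - h) = exp x * cos y - 1 * 1 - 1 * (x * 1 - y * 0).
    by rewrite /x /y /cexp /Re /Im /=; ring.
  apply.
  + by move=> t _; auto_derive => //; ring.
  + move=> t _; auto_derive => //.
    by rewrite /cexp re_mult (re_mult h) (im_mult h) re_scal_l im_scal_l -/x -/y /=; ring.
  + by move=> t Ht; apply: Rle_trans (Hb t Ht); apply: re_le_Cmod.
- have := taylor2_bound (fun t => exp (t * x) * sin (t * y))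
    (fun t => exp (t * x) * (x * sin (t * y) + y * cos (t * y)))
    (fun t => Im (h * h * cexp (t * h))) (Cmod h ^ 2 * exp (Cmod h)).
  rewrite !Rmult_0_l !Rmult_1_l exp_0 cos_0 sin_0.
  have -> : Im (cexp h - 1 - h) = exp x * sin y - 1 * 0 - 1 * (x * 0 + y * 1).
    by rewrite /x /y /cexp /Re /Im /=; ring.
  apply.
  + by move=> t _; auto_derive => //; ring.
  + move=> t _; auto_derive => //.
    by rewrite /cexp im_mult (re_mult h) (im_mult h) re_scal_l im_scal_l -/x -/y /=; ring.
  + by move=> t Ht; apply: Rle_trans (Hb t Ht); apply: im_le_Cmod.
Qed.

(** The 7 is [2 * 3 + 1], from the preceding bound with [exp 1 <= 3]. *)
Lemma cexp_sub1_le (h : C) : Cmod h <= 1 -> Cmod (cexp h - 1) <= 7 * Cmod h.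
Proof.
move=> Hh; have H := cexp_sub1_sub_le h.
have H1 := Cmod_triangle (cexp h - 1 - h) h.
have H2 : exp (Cmod h) <= 3.
  apply: Rle_trans exp_le_3; case: Hh => [Hh|->]; [left; exact: exp_increasing | by right].
move: H1; have -> : (cexp h - 1 - h + h)%C = (cexp h - 1)%C by ring.
have := Cmod_ge_0 h; have := exp_pos (Cmod h); nra.
Qed.

Lemma Clim_cexp {T : Type} (F : (T -> Prop) -> Prop) {FF : Filter F} (u : T -> C) (a : C) :
  Clim F u a -> Clim F (fun x => cexp (u x)) (cexp a).
Proof.
move=> Hu; apply: (Clim_ext (fun x => cexp a * (1 + (cexp (u x - a) - 1)))%C).
  move=> x; have -> : (1 + (cexp (u x - a) - 1))%C = cexp (u x - a) by ring.
  by rewrite -cexp_plus; congr cexp; ring.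
have {2}-> : cexp a = (cexp a * (1 + 0))%C by ring.
apply: Clim_mult; first exact: Clim_const.
apply: Clim_plus; first exact: Clim_const.
move=> e He.
have He' : 0 < Rmin 1 (e / 7) by apply: Rmin_pos; lra.
apply: (Fimp (Hu _ He')) => x Hx.
have H1 := Rmin_l 1 (e / 7); have H2 := Rmin_r 1 (e / 7).
have -> : (cexp (u x - a) - 1 - 0)%C = (cexp (u x - a) - 1)%C by ring.
have := cexp_sub1_le (u x - a); lra.
Qed.

Definition rcont (g : R -> C) (t : R) := Clim (locally t) g (g t).
Definition ccont (f : C -> C) (z : C) := Clim (locally z) f (f z).

(** Caratheodory's form of differentiability: [p] is the slope function, continuous at [z]. Product
    and chain rule become algebra on slopes, and [p] is itself the difference quotient that Cauchy's
    formula integrates. *)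
Definition cdiff (f : C -> C) (z l : C) :=
  exists p : C -> C, (forall w, f w = f z + p w * (w - z))%C /\ p z = l /\
    Clim (locally z) p l.

Definition rdiff (g : R -> C) (t : R) (l : C) :=
  exists p : R -> C, (forall s, g s = g t + p s * RtoC (s - t))%C /\ p t = l /\
    Clim (locally t) p l.

Lemma Csub_neq0 (a b : C) : a <> b -> (a - b)%C <> 0.
Proof. by move=> H H0; apply: H; apply/Ceq_minus. Qed.

Lemma cdiff_eps (f : C -> C) (z l : C) :
  (forall e, 0 < e -> exists d, 0 < d /\ forall w, Cmod (w - z) < d ->
     Cmod (f w - f z - (w - z) * l) <= e * Cmod (w - z)) -> cdiff f z l.
Proof.
move=> H.
exists (fun w => match Ceq_dec w z with left _ => l | right _ => ((f w - f z) / (w - z))%C end).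
split; last split.
- move=> w; case: Ceq_dec => [->|Hw]; first ring.
  by field; apply: Csub_neq0.
- by case: Ceq_dec.
- move=> e He.
  have He2 : 0 < e / 2 by lra.
  case: (H _ He2) => d [Hd0 Hd].
  apply/locally_C; exists d; split=> //.
  move=> w Hw; case: Ceq_dec => [_|Hne].
    have -> : (l - l)%C = 0 by ring.
    by rewrite Cmod_0.
  have {}Hd := Hd w Hw.
  have Hne' := Csub_neq0 _ _ Hne.
  have -> : ((f w - f z) / (w - z) - l)%C = ((f w - f z - (w - z) * l) / (w - z))%C by field.
  rewrite Cmod_div //.
  have Hpos : 0 < Cmod (w - z) by apply/Cmod_gt_0.
  apply: (Rle_lt_trans _ (e / 2)); last lra.
  apply: (Rmult_le_reg_r _ _ _ Hpos).
  by rewrite /Rdiv Rmult_assoc Rinv_l; lra.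
Qed.

Lemma cdiff_derive (f : C -> C) (z l : C) :
  cdiff f z l <-> @is_derive C_AbsRing C_NormedModule f z l.
Proof.
split.
- case=> p [Hp [Hz Hl]]; split; first exact: is_linear_scal_l.
  move=> x Hx e.
  have <- : z = x.
    apply: (@is_filter_lim_locally_unique _ (AbsRing_NormedModule C_AbsRing)) => //.
  case/locally_C: (Hl _ (cond_pos e)) => d [Hd H].
  exists (mkposreal d Hd) => w Hw.
  change (Cmod (f w - f z - (w - z) * l) <= e * Cmod (w - z)).
  rewrite Hp.
  have -> : (f z + p w * (w - z) - f z - (w - z) * l)%C = ((p w - l) * (w - z))%C by ring.
  rewrite Cmod_mult; apply: Rmult_le_compat_r; first exact: Cmod_ge_0.
  by left; apply: H.
- case=> _ H; apply: cdiff_eps => e He.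
  case: (H z (fun P HP => HP) (mkposreal e He)) => d Hd.
  by exists d; split; [exact: cond_pos | exact: Hd].
Qed.

Lemma norm_C_R (z : C) : @norm R_AbsRing C_R_NormedModule z = Cmod z.
Proof.
change (sqrt (Rabs (fst z) ^ 2 + Rabs (snd z) ^ 2) = Cmod z).
by rewrite !pow2_abs.
Qed.

Lemma rdiff_derive (g : R -> C) (t : R) (l : C) :
  rdiff g t l -> @is_derive R_AbsRing C_R_NormedModule g t l.
Proof.
case=> p [Hp [Hz Hl]]; split; first exact: is_linear_scal_l.
move=> x Hx e.
have <- : t = x by apply: is_filter_lim_locally_unique.
case/locally_R: (Hl _ (cond_pos e)) => d [Hd H].
exists (mkposreal d Hd) => w Hw.
rewrite !norm_C_R.
change (Cmod (g w - g t - scal (w - t) l) <= e * Rabs (w - t)).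
rewrite Hp scal_R_Cmult.
have -> : (g t + p w * RtoC (w - t) - g t - RtoC (w - t) * l)%C = ((p w - l) * RtoC (w - t))%C by ring.
rewrite Cmod_mult Cmod_R; apply: Rmult_le_compat_r; first exact: Rabs_pos.
by left; apply: H.
Qed.

Lemma derive_rdiff (g : R -> C) (t : R) (l1 l2 : R) :
  is_derive (fun s => Re (g s)) t l1 -> is_derive (fun s => Im (g s)) t l2 ->
  rdiff g t (l1, l2).
Proof.
move=> [_ H1] [_ H2].
have {}H1 := H1 t (fun P HP => HP).
have {}H2 := H2 t (fun P HP => HP).
exists (fun s => match Req_dec_T s t with left _ => (l1, l2) | right _ => ((g s - g t) / RtoC (s - t))%C end).
split; last split.
+ move=> w; case: Req_dec_T => [->|Hw]; first by rewrite Rminus_diag; ring.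
  by field => /RtoC_inj; lra.
+ by case: Req_dec_T.
+ move=> e He.
  have He2 : 0 < e / 4 by lra.
  case: (filter_and _ _ (H1 (mkposreal _ He2)) (H2 (mkposreal _ He2))) => d Hd.
  apply/locally_R; exists d; split; first exact: cond_pos.
  move=> w Hw; case: Req_dec_T => [_|Hne].
    have -> : ((l1, l2) - (l1, l2))%C = 0 by ring.
    by rewrite Cmod_0.
  case: (Hd w Hw) => {}H1 {}H2.
  have {}H1 : Rabs (Re (g w) - Re (g t) - (w - t) * l1) <= e / 4 * Rabs (w - t) := H1.
  have {}H2 : Rabs (Im (g w) - Im (g t) - (w - t) * l2) <= e / 4 * Rabs (w - t) := H2.
  have Hne' : RtoC (w - t) <> 0 by move/RtoC_inj; lra.
  have -> : ((g w - g t) / RtoC (w - t) - (l1, l2))%C = ((g w - g t - RtoC (w - t) * (l1, l2)) / RtoC (w - t))%C by field.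
  rewrite Cmod_div // Cmod_R.
  have Hpos : 0 < Rabs (w - t) by apply: Rabs_pos_lt; lra.
  apply: (Rle_lt_trans _ (e / 2)); last lra.
  apply: (Rmult_le_reg_r _ _ _ Hpos).
  rewrite /Rdiv Rmult_assoc Rinv_l; last lra.
  rewrite Rmult_1_r.
  apply: Rle_trans; first exact: Cmod_le_sum.
  have -> : Re (g w - g t - RtoC (w - t) * (l1, l2)) = Re (g w) - Re (g t) - (w - t) * l1.
    by rewrite /Re /Im /=; ring.
  have -> : Im (g w - g t - RtoC (w - t) * (l1, l2)) = Im (g w) - Im (g t) - (w - t) * l2.
    by rewrite /Re /Im /=; ring.
  lra.
Qed.

Lemma cdiff_cont (f : C -> C) (z l : C) : cdiff f z l -> ccont f z.
Proof.
case=> p [Hp [_ Hl]].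
apply: (Clim_ext (fun w => f z + p w * (w - z))%C) => [w|]; first by rewrite -Hp.
have {2}-> : f z = (f z + l * (z - z))%C by ring.
apply: Clim_plus; first exact: Clim_const.
apply: Clim_mult => //; apply: Clim_minus; [exact: Clim_id | exact: Clim_const].
Qed.

Lemma Clim_RtoC_id (t : R) : Clim (locally t) RtoC t.
Proof. by apply: Clim_RtoC; apply: filterlim_id. Qed.

Lemma rdiff_cont (g : R -> C) (t : R) (l : C) : rdiff g t l -> rcont g t.
Proof.
case=> p [Hp [_ Hl]].
apply: (Clim_ext (fun s => g t + p s * (RtoC s - RtoC t))%C) => [w|].
  by rewrite [RHS]Hp RtoC_minus.
have {2}-> : g t = (g t + l * (RtoC t - RtoC t))%C by ring.
apply: Clim_plus; first exact: Clim_const.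
apply: Clim_mult => //; apply: Clim_minus; [exact: Clim_RtoC_id | exact: Clim_const].
Qed.

Lemma cdiff_unique (f : C -> C) (z l : C) : cdiff f z l -> C_derive f z = l.
Proof. by move/cdiff_derive; apply: is_C_derive_unique. Qed.

Lemma cdiff_ext_loc (f g : C -> C) (z l : C) :
  locally z (fun w => f w = g w) -> cdiff f z l -> cdiff g z l.
Proof.
move=> H /cdiff_derive Hf; apply/cdiff_derive.
apply: is_derive_ext_loc Hf; case/locally_C: H => d [Hd H].
by exists (mkposreal d Hd) => w; apply: H.
Qed.

Lemma cdiff_const (a z : C) : cdiff (fun _ => a) z 0.
Proof.
exists (fun _ => 0); split; last split => //; last exact: Clim_const.
by move=> w; ring.
Qed.

Lemma cdiff_id (z : C) : cdiff (fun w => w) z 1.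
Proof.
exists (fun _ => 1); split; last split => //; last exact: Clim_const.
by move=> w; ring.
Qed.

Lemma cdiff_plus (f g : C -> C) (z a b : C) :
  cdiff f z a -> cdiff g z b -> cdiff (fun w => f w + g w)%C z (a + b)%C.
Proof.
case=> p [Hp [Hz Hl]] [q [Hq [Hz' Hl']]].
exists (fun w => p w + q w)%C; split; last split.
- by move=> w; rewrite Hp Hq; ring.
- by rewrite Hz Hz'.
- exact: Clim_plus.
Qed.

Lemma cdiff_mult (f g : C -> C) (z a b : C) :
  cdiff f z a -> cdiff g z b -> cdiff (fun w => f w * g w)%C z (a * g z + f z * b)%C.
Proof.
move=> Hf Hg; have Hc := cdiff_cont _ _ _ Hg; move: Hf Hg.
case=> p [Hp [Hz Hl]] [q [Hq [Hz' Hl']]].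
exists (fun w => p w * g w + f z * q w)%C; split; last split.
- by move=> w; rewrite {1}Hp {2}Hq; rewrite {1}(Hq w); ring.
- by rewrite Hz Hz'.
- apply: Clim_plus; apply: Clim_mult => //; exact: Clim_const.
Qed.

Lemma cdiff_scal (f : C -> C) (k z a : C) :
  cdiff f z a -> cdiff (fun w => k * f w)%C z (k * a)%C.
Proof.
case=> p [Hp [Hz Hl]]; exists (fun w => k * p w)%C; split; last split.
- by move=> w; rewrite Hp; ring.
- by rewrite Hz.
- by apply: Clim_mult => //; exact: Clim_const.
Qed.

Lemma cdiff_minus (f g : C -> C) (z a b : C) :
  cdiff f z a -> cdiff g z b -> cdiff (fun w => f w - g w)%C z (a - b)%C.
Proof.
case=> p [Hp [Hz Hl]] [q [Hq [Hz' Hl']]].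
exists (fun w => p w - q w)%C; split; last split.
- by move=> w; rewrite Hp Hq; ring.
- by rewrite Hz Hz'.
- exact: Clim_minus.
Qed.

Lemma cdiff_inv (z : C) : z <> 0 -> cdiff Cinv z (- / (z * z))%C.
Proof.
move=> Hz.
(* The slope identity has to hold at every [w], including [w = 0], where it fails for [Cinv]. There
   the function is changed to its affine approximation, which does not affect it near [z]. *)
apply: (cdiff_ext_loc (fun w => match Ceq_dec w 0 with left _ => / z + - / (z * z) * (w - z) | _ => / w end)%C).
  apply/locally_C; exists (Cmod z); split; first exact/Cmod_gt_0.
  move=> w Hw; case: Ceq_dec => // H0; move: Hw; rewrite H0 Cmod_sub_sym.
  have -> : (z - 0)%C = z by ring.
  lra.
exists (fun w => match Ceq_dec w 0 with left _ => - / (z * z) | _ => - / (w * z) end)%C; split; last split.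
- move=> w; case: (Ceq_dec z 0) => // _; case: Ceq_dec => // Hw; by field.
- by case: Ceq_dec.
- apply: (Clim_ext_loc (fun w => - / (w * z))%C).
    apply/locally_C; exists (Cmod z); split; first exact/Cmod_gt_0.
    move=> w Hw; case: Ceq_dec => // H0; move: Hw; rewrite H0 Cmod_sub_sym.
    have -> : (z - 0)%C = z by ring.
    lra.
  apply: Clim_opp; apply: Clim_inv; first exact: Cmult_neq_0.
  by apply: Clim_mult; [exact: Clim_id | exact: Clim_const].
Qed.

Lemma cdiff_comp (f g : C -> C) (z a b : C) :
  cdiff f (g z) a -> cdiff g z b -> cdiff (fun w => f (g w)) z (a * b)%C.
Proof.
move=> Hf Hg; have Hc := cdiff_cont _ _ _ Hg; move: Hf Hg.
case=> p [Hp [Hz Hl]] [q [Hq [Hz' Hl']]].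
exists (fun w => p (g w) * q w)%C; split; last split.
- by move=> w; rewrite (Hp (g w)) {2}(Hq w); ring.
- by rewrite Hz Hz'.
- apply: Clim_mult => //; exact: (Clim_comp _ g p (g z)).
Qed.

Lemma cdiff_curve (f : C -> C) (g : R -> C) (t : R) (a b : C) :
  cdiff f (g t) a -> rdiff g t b -> rdiff (fun s => f (g s)) t (a * b)%C.
Proof.
move=> Hf Hg; have Hc := rdiff_cont _ _ _ Hg; move: Hf Hg.
case=> p [Hp [Hz Hl]] [q [Hq [Hz' Hl']]].
exists (fun w => p (g w) * q w)%C; split; last split.
- by move=> w; rewrite (Hp (g w)) {2}(Hq w); ring.
- by rewrite Hz Hz'.
- apply: Clim_mult => //; exact: (Clim_comp _ g p (g t)).
Qed.

Lemma cdiff_pow (z : C) (n : nat) :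
  cdiff (fun w => w ^ S n)%C z (RtoC (INR (S n)) * z ^ n)%C.
Proof.
elim: n => [|n IH].
  have -> : (RtoC (INR 1) * z ^ 0)%C = (1 * 1 + z * 0)%C by rewrite /=; ring.
  apply: (cdiff_mult (fun w => w)); [exact: cdiff_id | exact: cdiff_const].
have -> : (RtoC (INR (S (S n))) * z ^ S n)%C = (1 * z ^ S n + z * (RtoC (INR (S n)) * z ^ n))%C.
  by rewrite (S_INR (S n)) RtoC_plus /=; ring.
by apply: (cdiff_mult (fun w => w) (fun w => w ^ S n)%C) => //; exact: cdiff_id.
Qed.

(* A quadratic remainder bound is the form in which kernels are differentiated under the integral sign. *)
Lemma cdiff_quad (f : C -> C) (z l : C) (M d : R) :
  0 < d ->
  (forall w, Cmod (w - z) < d -> Cmod (f w - f z - l * (w - z)) <= M * Cmod (w - z) ^ 2) ->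
  cdiff f z l.
Proof.
move=> Hd H; apply: cdiff_eps => e He.
have HM : 0 < Rabs M + 1 by have := Rabs_pos M; lra.
have Hm : 0 < Rmin d (e / (Rabs M + 1)).
  by apply: Rmin_pos => //; apply: Rdiv_lt_0_compat.
exists (Rmin d (e / (Rabs M + 1))); split=> // w Hw.
have H1 := Rmin_l d (e / (Rabs M + 1)); have H2 := Rmin_r d (e / (Rabs M + 1)).
have {}H := H w ltac:(lra).
rewrite (Cmult_comm (w - z)).
have H3 : Cmod (w - z) * (Rabs M + 1) <= e.
  have -> : e = e / (Rabs M + 1) * (Rabs M + 1) by field; lra.
  by apply: Rmult_le_compat_r; lra.
have := Rle_abs M; have := Cmod_ge_0 (w - z); nra.
Qed.

Lemma cdiff_cexp (z : C) : cdiff cexp z (cexp z).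
Proof.
apply: (cdiff_quad _ _ _ (Cmod (cexp z) * 6) 1); first lra.
move=> w Hw.
have -> : (cexp w - cexp z - cexp z * (w - z))%C = (cexp z * (cexp (w - z) - 1 - (w - z)))%C.
  have {1}-> : w = (z + (w - z))%C by ring.
  by rewrite cexp_plus; ring.
rewrite Cmod_mult Rmult_assoc; apply: Rmult_le_compat_l; first exact: Cmod_ge_0.
have H := cexp_sub1_sub_le (w - z).
have H2 : exp (Cmod (w - z)) <= 3.
  by apply: Rle_trans exp_le_3; left; apply: exp_increasing.
have := pow2_ge_0 (Cmod (w - z)); nra.
Qed.

Lemma rdiff_affine (a b : C) (t : R) : rdiff (fun s => a + RtoC s * b)%C t b.
Proof.
exists (fun _ => b); split; last split => //; last exact: Clim_const.
by move=> w; rewrite RtoC_minus; ring.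
Qed.

Lemma rdiff_mult (f g : R -> C) (z : R) (a b : C) :
  rdiff f z a -> rdiff g z b -> rdiff (fun w => f w * g w)%C z (a * g z + f z * b)%C.
Proof.
move=> Hf Hg; have Hc := rdiff_cont _ _ _ Hg; move: Hf Hg.
case=> p [Hp [Hz Hl]] [q [Hq [Hz' Hl']]].
exists (fun w => p w * g w + f z * q w)%C; split; last split.
- by move=> w; rewrite {1}Hp {2}Hq; rewrite {1}(Hq w); ring.
- by rewrite Hz Hz'.
- apply: Clim_plus; apply: Clim_mult => //; exact: Clim_const.
Qed.

Lemma rdiff_minus (f g : R -> C) (z : R) (a b : C) :
  rdiff f z a -> rdiff g z b -> rdiff (fun w => f w - g w)%C z (a - b)%C.
Proof.
case=> p [Hp [Hz Hl]] [q [Hq [Hz' Hl']]].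
exists (fun w => p w - q w)%C; split; last split.
- by move=> w; rewrite Hp Hq; ring.
- by rewrite Hz Hz'.
- exact: Clim_minus.
Qed.

Lemma rdiff_scal (f : R -> C) (k : C) (z : R) (a : C) :
  rdiff f z a -> rdiff (fun w => k * f w)%C z (k * a)%C.
Proof.
case=> p [Hp [Hz Hl]]; exists (fun w => k * p w)%C; split; last split.
- by move=> w; rewrite Hp; ring.
- by rewrite Hz.
- by apply: Clim_mult => //; exact: Clim_const.
Qed.

(** * Goursat's theorem *)

Definition Cis (h : R -> C) (a b : R) (l : C) := @is_RInt C_R_NormedModule h a b l.

Lemma Cis_unique (h : R -> C) (a b : R) (l : C) : Cis h a b l -> cint h a b = l.
Proof. exact: (@is_RInt_unique C_R_CompleteNormedModule). Qed.

Lemma Cis_cint (h : R -> C) (a b : R) :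
  a <= b -> (forall t, a <= t <= b -> rcont h t) -> Cis h a b (cint h a b).
Proof.
move=> Hab H; apply: (@RInt_correct C_R_CompleteNormedModule).
apply: (@ex_RInt_continuous C_R_CompleteNormedModule) => z.
rewrite Rmin_left ?Rmax_right // => Hz.
exact: (proj1 (Clim_locally _ _ _) (H z Hz)).
Qed.

Lemma Cis_ext (f g : R -> C) (a b : R) (l : C) :
  a <= b -> (forall t, a < t < b -> f t = g t) -> Cis f a b l -> Cis g a b l.
Proof.
move=> Hab H; apply: is_RInt_ext => t; rewrite Rmin_left ?Rmax_right //; exact: H.
Qed.

Lemma Cis_plus (f g : R -> C) (a b : R) (l m : C) :
  Cis f a b l -> Cis g a b m -> Cis (fun t => f t + g t)%C a b (l + m)%C.
Proof. exact: is_RInt_plus. Qed.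

Lemma Cis_minus (f g : R -> C) (a b : R) (l m : C) :
  Cis f a b l -> Cis g a b m -> Cis (fun t => f t - g t)%C a b (l - m)%C.
Proof. exact: is_RInt_minus. Qed.

(** The factor is complex, while the module structure behind [Cis] is real; hence the passage to
    components. *)
Lemma Cis_scal (f : R -> C) (a b : R) (k l : C) :
  Cis f a b l -> Cis (fun t => k * f t)%C a b (k * l)%C.
Proof.
move=> H.
have H1 := is_RInt_fct_extend_fst _ _ _ _ H.
have H2 := is_RInt_fct_extend_snd _ _ _ _ H.
apply: is_RInt_fct_extend_pair => /=.
- have := is_RInt_minus _ _ _ _ _ _ (is_RInt_scal _ _ _ (fst k) _ H1) (is_RInt_scal _ _ _ (snd k) _ H2).
  exact.
- have := is_RInt_plus _ _ _ _ _ _ (is_RInt_scal _ _ _ (fst k) _ H2) (is_RInt_scal _ _ _ (snd k) _ H1).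
  exact.
Qed.

Lemma Cis_Chasles (f : R -> C) (a b c : R) (l m : C) :
  Cis f a b l -> Cis f b c m -> Cis f a c (l + m)%C.
Proof. exact: is_RInt_Chasles. Qed.

Lemma Cis_bound (h : R -> C) (g : R -> R) (a b : R) (l : C) (m : R) :
  a <= b -> (forall t, a <= t <= b -> Cmod (h t) <= g t) ->
  Cis h a b l -> is_RInt g a b m -> Cmod l <= m.
Proof.
move=> Hab H Hl Hm; rewrite -norm_C_R.
by apply: (norm_RInt_le h g a b) => // t Ht; rewrite norm_C_R; apply: H.
Qed.

Lemma Cis_bound_const (h : R -> C) (a b : R) (l : C) (M : R) :
  a <= b -> (forall t, a <= t <= b -> Cmod (h t) <= M) ->
  Cis h a b l -> Cmod l <= (b - a) * M.
Proof.
move=> Hab H Hl; rewrite -norm_C_R.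
by apply: (norm_RInt_le_const h a b) => // t Ht; rewrite norm_C_R; apply: H.
Qed.

Lemma Cis_bound_abs (h : R -> C) (a b : R) (l : C) (M : R) :
  (forall t, Rmin a b <= t <= Rmax a b -> Cmod (h t) <= M) ->
  Cis h a b l -> Cmod l <= Rabs (b - a) * M.
Proof.
move=> H Hl; rewrite -norm_C_R.
by apply: (norm_RInt_le_const_abs h a b) => // t Ht; rewrite norm_C_R; apply: H.
Qed.

Lemma Cis_ex (h : R -> C) (a b : R) :
  (forall t, Rmin a b <= t <= Rmax a b -> rcont h t) -> Cis h a b (cint h a b).
Proof.
move=> H; apply: (@RInt_correct C_R_CompleteNormedModule).
apply: (@ex_RInt_continuous C_R_CompleteNormedModule) => z Hz.
exact: (proj1 (Clim_locally _ _ _) (H z Hz)).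
Qed.

Lemma Cis_FTC (f df : R -> C) (a b : R) :
  a <= b -> (forall t, a <= t <= b -> rdiff f t (df t)) ->
  (forall t, a <= t <= b -> rcont df t) -> Cis df a b (f b - f a)%C.
Proof.
move=> Hab H1 H2; apply: (@is_RInt_derive C_R_CompleteNormedModule) => t;
  rewrite Rmin_left ?Rmax_right // => Ht.
- by apply: rdiff_derive; apply: H1.
- exact: (proj1 (Clim_locally _ _ _) (H2 t Ht)).
Qed.

Lemma Cis_const (a b : R) (k : C) : Cis (fun _ => k) a b (RtoC (b - a) * k)%C.
Proof.
have := @is_RInt_const C_R_CompleteNormedModule a b k.
by rewrite scal_R_Cmult.
Qed.

Lemma Cis_comp_lin (f : R -> C) (u v a b : R) (l : C) :
  Cis f (u * a + v) (u * b + v) l -> Cis (fun y => RtoC u * f (u * y + v)%R)%C a b l.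
Proof.
move=> /(is_RInt_comp_lin _ _ _ _ _ _); apply: is_RInt_ext => x _.
by rewrite scal_R_Cmult.
Qed.

Lemma Cis_swap (f : R -> C) (a b : R) (l : C) : Cis f a b l -> Cis f b a (- l)%C.
Proof. exact: is_RInt_swap. Qed.

Lemma nested_intervals (a b : nat -> R) :
  (forall n, a n <= a (S n)) -> (forall n, b (S n) <= b n) -> (forall n, a n <= b n) ->
  exists x, forall n, a n <= x <= b n.
Proof.
move=> Ha Hb Hab.
have Hma : forall n k, a n <= a (n + k)%nat.
  move=> n; elim=> [|k IH]; first by rewrite Nat.add_0_r; right.
  by rewrite Nat.add_succ_r; apply: Rle_trans IH _.
have Hmb : forall n k, b (n + k)%nat <= b n.
  move=> n; elim=> [|k IH]; first by rewrite Nat.add_0_r; right.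
  by rewrite Nat.add_succ_r; apply: Rle_trans IH.
have Hall : forall n m, a n <= b m.
  move=> n m; apply: Rle_trans (Hma n m) _; apply: Rle_trans (Hab _) _.
  by rewrite Nat.add_comm.
case: (completeness (fun x => exists n, x = a n)).
- by exists (b 0%nat) => x [n ->].
- by exists (a 0%nat); exists 0%nat.
- move=> x [H1 H2]; exists x => n; split; first by apply: H1; exists n.
  by apply: H2 => y [m ->].
Qed.

Lemma half_pow_lt (l d : R) : 0 < d -> exists n : nat, l / 2 ^ n < d.
Proof.
move=> Hd.
case: (Rle_dec l 0) => Hl; first by exists 0%nat; rewrite /= Rdiv_1_r; lra.
have Hl' : 0 < l by lra.
case: (pow_lt_1_zero (/ 2) _ (d / l)); first by rewrite Rabs_right; lra.
  exact: Rdiv_lt_0_compat.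
move=> n /(_ n (Nat.le_refl _)); rewrite -RPow_abs Rabs_right; last lra.
rewrite pow_inv => H; exists n.
have -> : d = l * (d / l) by field; lra.
by apply: Rmult_lt_compat_l.
Qed.

Section Bisection.
Variable P : R -> R -> R -> R -> Prop.

Let quad := ((R * R) * (R * R))%type.
Let Q (q : quad) := P (fst (fst q)) (snd (fst q)) (fst (snd q)) (snd (snd q)).
Let step (q : quad) : quad :=
  let: ((a, b), (c, d)) := q in
  let m := (a + b) / 2 in let n := (c + d) / 2 in
  if excluded_middle_informative (~ P a m c n) is left _ then ((a, m), (c, n)) else
  if excluded_middle_informative (~ P m b c n) is left _ then ((m, b), (c, n)) else
  if excluded_middle_informative (~ P a m n d) is left _ then ((a, m), (n, d)) else
  ((m, b), (n, d)).

(** Compactness as an induction principle. If [P] failed, some quarter would fail again, and the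
    nested failing rectangles would shrink to a point, against the local hypothesis. It serves
    Goursat's theorem, bounds on the disc and, with a degenerate side, uniformity on segments. *)
Lemma rect_induction (a b c d : R) :
  a <= b -> c <= d ->
  (forall a b c d, a <= b -> c <= d ->
     P a ((a + b) / 2) c ((c + d) / 2) -> P ((a + b) / 2) b c ((c + d) / 2) ->
     P a ((a + b) / 2) ((c + d) / 2) d -> P ((a + b) / 2) b ((c + d) / 2) d -> P a b c d) ->
  (forall x y, a <= x <= b -> c <= y <= d -> exists r, 0 < r /\
     forall a' b' c' d', a <= a' <= x -> x <= b' <= b -> c <= c' <= y -> y <= d' <= d ->
       b' - a' < r -> d' - c' < r -> P a' b' c' d') ->
  P a b c d.
Proof.
move=> Hab Hcd Hsplit Hloc; apply: NNPP => HP.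
pose q := fix q (n : nat) : quad := match n with O => ((a, b), (c, d)) | S k => step (q k) end.
pose a_ n := fst (fst (q n)); pose b_ n := snd (fst (q n)).
pose c_ n := fst (snd (q n)); pose d_ n := snd (snd (q n)).
have Hq : forall n, a_ n <= b_ n /\ c_ n <= d_ n /\ ~ P (a_ n) (b_ n) (c_ n) (d_ n) /\
    b_ n - a_ n = (b - a) / 2 ^ n /\ d_ n - c_ n = (d - c) / 2 ^ n.
  elim=> [|n]; first by rewrite /a_ /b_ /c_ /d_ /= !Rdiv_1_r.
  rewrite /a_ /b_ /c_ /d_ /=.
  case: (q n) => [[a1 b1] [c1 d1]] /= [H1 [H2 [H3 [H4 H5]]]].
  have Hp : 2 ^ n <> 0 by apply: pow_nonzero; lra.
  have E4 : (b - a) / (2 * 2 ^ n) = (b1 - a1) / 2 by rewrite H4; field.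
  have E5 : (d - c) / (2 * 2 ^ n) = (d1 - c1) / 2 by rewrite H5; field.
  rewrite E4 E5.
  do 3 (case: excluded_middle_informative => [N|/NNPP ?] /=; first by do ! split => //; lra).
  do ! split => //; try lra.
  by move=> ?; apply: H3; apply: Hsplit.
have Hstep : forall n, a_ n <= a_ (S n) /\ b_ (S n) <= b_ n /\ c_ n <= c_ (S n) /\ d_ (S n) <= d_ n.
  move=> n; have := Hq n; rewrite /a_ /b_ /c_ /d_ /=.
  case: (q n) => [[a1 b1] [c1 d1]] /= [H1 [H2 _]].
  do 3 (case: excluded_middle_informative => [N|/NNPP ?] /=; first by lra).
  lra.
case: (nested_intervals a_ b_) => [n|n|n|x Hx].
- by case: (Hstep n). - by case: (Hstep n) => _ []. - by case: (Hq n).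
case: (nested_intervals c_ d_) => [n|n|n|y Hy].
- by case: (Hstep n) => _ [_ []]. - by case: (Hstep n) => _ [_ []]. - by case: (Hq n) => _ [].
have Hin : forall n, a <= a_ n /\ b_ n <= b /\ c <= c_ n /\ d_ n <= d.
  elim=> [|n IH]; first by rewrite /a_ /b_ /c_ /d_ /=; lra.
  have := Hstep n; lra.
have Hx0 := Hx 0%nat; have Hy0 := Hy 0%nat.
case: (Hloc x y Hx0 Hy0) => r [Hr H].
case: (half_pow_lt (Rmax (b - a) (d - c)) r Hr) => n Hn.
have Hpn : 0 < / 2 ^ n by apply: Rinv_0_lt_compat; apply: pow_lt; lra.
have H1 := Rmax_l (b - a) (d - c); have H2 := Rmax_r (b - a) (d - c).
case: (Hq n) => Q1 [Q2 [Q3 [Q4 Q5]]]; case: (Hin n) => I1 [I2 [I3 I4]].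
have := Hx n; have := Hy n => ? ?.
apply: Q3; apply: H; try lra.
- by rewrite Q4; apply: Rle_lt_trans Hn; apply: Rmult_le_compat_r; lra.
- by rewrite Q5; apply: Rle_lt_trans Hn; apply: Rmult_le_compat_r; lra.
Qed.

End Bisection.

Definition Hint (f : C -> C) (y a b : R) : C := cint (fun x => f (x, y)) a b.
Definition Vint (f : C -> C) (x c d : R) : C := cint (fun y => f (x, y)) c d.
(** The integral of [f] dz around the rectangle, counterclockwise. *)
Definition bd (f : C -> C) (a b c d : R) : C :=
  (Hint f c a b + Ci * Vint f b c d - Hint f d a b - Ci * Vint f a c d)%C.

Definition in_rect (a b c d : R) (z : C) := a <= fst z <= b /\ c <= snd z <= d.

Lemma rdiff_horizontal (y t : R) : rdiff (fun x => (x, y)) t 1.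
Proof. by apply: (derive_rdiff _ _ 1 0); rewrite /Re /Im /=; auto_derive. Qed.

Lemma rdiff_vertical (x t : R) : rdiff (fun y => (x, y)) t Ci.
Proof. by apply: (derive_rdiff _ _ 0 1); rewrite /Re /Im /=; auto_derive. Qed.

Lemma ccont_horizontal (f : C -> C) (x y : R) : ccont f (x, y) -> rcont (fun x => f (x, y)) x.
Proof.
move=> H; apply: (Clim_comp _ (fun x => (x, y)) f) H.
exact: rdiff_cont (rdiff_horizontal y x).
Qed.

Lemma ccont_vertical (f : C -> C) (x y : R) : ccont f (x, y) -> rcont (fun y => f (x, y)) y.
Proof.
move=> H; apply: (Clim_comp _ (fun y => (x, y)) f) H.
exact: rdiff_cont (rdiff_vertical x y).
Qed.

Lemma Hint_correct (f : C -> C) (y a b : R) :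
  a <= b -> (forall x, a <= x <= b -> ccont f (x, y)) -> Cis (fun x => f (x, y)) a b (Hint f y a b).
Proof. by move=> Hab H; apply: Cis_cint => // t Ht; apply: ccont_horizontal; apply: H. Qed.

Lemma Vint_correct (f : C -> C) (x c d : R) :
  c <= d -> (forall y, c <= y <= d -> ccont f (x, y)) -> Cis (fun y => f (x, y)) c d (Vint f x c d).
Proof. by move=> Hab H; apply: Cis_cint => // t Ht; apply: ccont_vertical; apply: H. Qed.

Lemma Hint_Chasles (f : C -> C) (y a b c : R) :
  a <= b -> b <= c -> (forall x, a <= x <= c -> ccont f (x, y)) ->
  Hint f y a c = (Hint f y a b + Hint f y b c)%C.
Proof.
move=> Hab Hbc H; apply: Cis_unique; apply: Cis_Chasles; apply: Hint_correct => // x Hx;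
  apply: H; lra.
Qed.

Lemma Vint_Chasles (f : C -> C) (x a b c : R) :
  a <= b -> b <= c -> (forall y, a <= y <= c -> ccont f (x, y)) ->
  Vint f x a c = (Vint f x a b + Vint f x b c)%C.
Proof.
move=> Hab Hbc H; apply: Cis_unique; apply: Cis_Chasles; apply: Vint_correct => // y Hy;
  apply: H; lra.
Qed.

Lemma bd_split (f : C -> C) (a m b c n d : R) :
  a <= m <= b -> c <= n <= d -> (forall z, in_rect a b c d z -> ccont f z) ->
  bd f a b c d = (bd f a m c n + bd f m b c n + bd f a m n d + bd f m b n d)%C.
Proof.
move=> Hm Hn H; rewrite /bd.
have HH : forall y, c <= y <= d -> Hint f y a b = (Hint f y a m + Hint f y m b)%C.
  move=> y Hy; apply: Hint_Chasles; try lra; move=> x Hx; apply: H; split; rewrite /=; lra.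
have HV : forall x, a <= x <= b -> Vint f x c d = (Vint f x c n + Vint f x n d)%C.
  move=> x Hx; apply: Vint_Chasles; try lra; move=> y Hy; apply: H; split; rewrite /=; lra.
rewrite (HH c) ?(HH d) ?(HV a) ?(HV b); try lra.
ring.
Qed.

Lemma bd_primitive (P f : C -> C) (a b c d : R) :
  a <= b -> c <= d -> (forall z, in_rect a b c d z -> cdiff P z (f z)) ->
  (forall z, in_rect a b c d z -> ccont f z) -> bd f a b c d = 0.
Proof.
move=> Hab Hcd HP Hf.
have HH : forall y, c <= y <= d -> Hint f y a b = (P (b, y) - P (a, y))%C.
  move=> y Hy; apply: Cis_unique.
  apply: (Cis_FTC (fun x => P (x, y))) => // t Ht.
    rewrite -[f _]Cmult_1_r; apply: cdiff_curve; last exact: rdiff_horizontal.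
    by apply: HP; split; rewrite /=; lra.
  by apply: ccont_horizontal; apply: Hf; split; rewrite /=; lra.
have HV : forall x, a <= x <= b -> (Ci * Vint f x c d)%C = (P (x, d) - P (x, c))%C.
  move=> x Hx.
  rewrite -(Cis_unique _ _ _ _ (Cis_scal _ _ _ Ci _ (Vint_correct f x c d Hcd _))); last first.
    by move=> y Hy; apply: Hf; split; rewrite /=; lra.
  apply: Cis_unique.
  apply: (Cis_FTC (fun y => P (x, y))) => // t Ht.
    rewrite Cmult_comm; apply: cdiff_curve; last exact: rdiff_vertical.
    by apply: HP; split; rewrite /=; lra.
  apply: Clim_mult; first exact: Clim_const.
  by apply: ccont_vertical; apply: Hf; split; rewrite /=; lra.
rewrite /bd HH ?HH ?HV ?HV; try lra.
ring.
Qed.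

Lemma bd_bound (f : C -> C) (a b c d M : R) :
  a <= b -> c <= d -> (forall z, in_rect a b c d z -> ccont f z) ->
  (forall z, in_rect a b c d z -> Cmod (f z) <= M) ->
  Cmod (bd f a b c d) <= 2 * ((b - a) + (d - c)) * M.
Proof.
move=> Hab Hcd Hf HM.
have HH : forall y, c <= y <= d -> Cmod (Hint f y a b) <= (b - a) * M.
  move=> y Hy; apply: (Cis_bound_const (fun x => f (x, y))) => //.
    by move=> t Ht; apply: HM; split; rewrite /=; lra.
  by apply: Hint_correct => // x Hx; apply: Hf; split; rewrite /=; lra.
have HV : forall x, a <= x <= b -> Cmod (Ci * Vint f x c d) <= (d - c) * M.
  move=> x Hx; rewrite Cmod_mult Cmod_Ci Rmult_1_l.
  apply: (Cis_bound_const (fun y => f (x, y))) => //.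
    by move=> t Ht; apply: HM; split; rewrite /=; lra.
  by apply: Vint_correct => // y Hy; apply: Hf; split; rewrite /=; lra.
rewrite /bd.
have T1 := Cmod_triangle (Hint f c a b + Ci * Vint f b c d - Hint f d a b) (- (Ci * Vint f a c d)).
have T2 := Cmod_triangle (Hint f c a b + Ci * Vint f b c d) (- Hint f d a b).
have T3 := Cmod_triangle (Hint f c a b) (Ci * Vint f b c d).
rewrite !Cmod_opp in T1 T2.
have := HH c; have := HH d; have := HV a; have := HV b.
rewrite /Cminus in T1 T2 T3 *.
lra.
Qed.

Lemma bd_minus (f g : C -> C) (a b c d : R) :
  a <= b -> c <= d -> (forall z, in_rect a b c d z -> ccont f z) ->
  (forall z, in_rect a b c d z -> ccont g z) ->
  bd (fun z => f z - g z)%C a b c d = (bd f a b c d - bd g a b c d)%C.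
Proof.
move=> Hab Hcd Hf Hg.
have HH : forall y, c <= y <= d -> Hint (fun z => f z - g z)%C y a b = (Hint f y a b - Hint g y a b)%C.
  move=> y Hy; apply: Cis_unique; apply: Cis_minus; apply: Hint_correct => // x Hx;
  [apply: Hf | apply: Hg]; split; rewrite /=; lra.
have HV : forall x, a <= x <= b -> Vint (fun z => f z - g z)%C x c d = (Vint f x c d - Vint g x c d)%C.
  move=> x Hx; apply: Cis_unique; apply: Cis_minus; apply: Vint_correct => // y Hy;
  [apply: Hf | apply: Hg]; split; rewrite /=; lra.
rewrite /bd HH ?HH ?HV ?HV; try lra.
ring.
Qed.

Lemma cdiff_affine_primitive (k l z w : C) :
  cdiff (fun w => k * w + l / 2 * (w - z) ^ 2)%C w (k + l * (w - z))%C.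
Proof.
have Hs : cdiff (fun w => w - z)%C w (1 - 0)%C.
  by apply: cdiff_minus; [exact: cdiff_id | exact: cdiff_const].
have H2 := cdiff_comp (fun v => v ^ 2)%C (fun w => w - z)%C w _ _ (cdiff_pow _ 1) Hs.
have := cdiff_plus _ _ _ _ _ (cdiff_scal _ k _ _ (cdiff_id w)) (cdiff_scal _ (l / 2)%C _ _ H2).
have -> : (k * 1 + l / 2 * (INR 2 * (w - z) ^ 1 * (1 - 0)))%C = (k + l * (w - z))%C.
  have -> : INR 2 = 2 by rewrite /=; ring.
  by rewrite /=; field.
exact.
Qed.

(** The bound [e * (half perimeter)^2] passes from the four quarters to the whole, because the half
    perimeters halve. It holds near every point: the affine part of [f] has a primitive and
    contributes nothing, and the remainder is at most [e / 2] times the distance. *)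
Theorem goursat (f : C -> C) (a b c d : R) :
  a <= b -> c <= d -> (forall z, in_rect a b c d z -> exists l, cdiff f z l) ->
  bd f a b c d = 0.
Proof.
move=> Hab Hcd Hf.
have Hc : forall z, in_rect a b c d z -> ccont f z.
  by move=> z /Hf [l]; apply: cdiff_cont.
apply: Cmod_eq_0; apply: Rle_antisym; last exact: Cmod_ge_0.
set L := (b - a) + (d - c).
apply: le_epsilon => e0 He0; rewrite Rplus_0_l.
have HL : 0 <= L by rewrite /L; lra.
pose e := e0 / (L ^ 2 + 1).
have He : 0 < e by apply: Rdiv_lt_0_compat => //; nra.
have : Cmod (bd f a b c d) <= e * ((b - a) + (d - c)) ^ 2.
  pose P a' b' c' d' := a <= a' /\ b' <= b /\ c <= c' /\ d' <= d ->
    Cmod (bd f a' b' c' d') <= e * ((b' - a') + (d' - c')) ^ 2.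
  suff : P a b c d by apply; lra.
  apply: rect_induction => //.
  - move=> a1 b1 c1 d1 H1 H2 Q1 Q2 Q3 Q4 Hin.
    rewrite (bd_split f a1 ((a1 + b1) / 2) b1 c1 ((c1 + d1) / 2) d1); try lra; last first.
      by move=> z [? ?]; apply: Hc; split; lra.
    have {}Q1 := Q1 ltac:(lra); have {}Q2 := Q2 ltac:(lra).
    have {}Q3 := Q3 ltac:(lra); have {}Q4 := Q4 ltac:(lra).
    apply: Rle_trans; first exact: Cmod_triangle.
    apply: Rle_trans; first by apply: Rplus_le_compat_r; exact: Cmod_triangle.
    apply: Rle_trans; first by apply: Rplus_le_compat_r; apply: Rplus_le_compat_r; exact: Cmod_triangle.
    nra.
  - move=> x y Hx Hy.
    case: (Hf (x, y)) => [|l [p [Hp [Hpz Hl]]]]; first by split; rewrite /=; lra.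
    have He2 : 0 < e / 2 by lra.
    case/locally_C: (Hl _ He2) => r [Hr H].
    exists (r / 2); split; first lra.
    move=> a' b' c' d' Ha' Hb' Hc' Hd' Hs1 Hs2 _.
    pose g w := (f (x, y) + l * (w - (x, y)))%C.
    have Hsub : forall z, in_rect a' b' c' d' z -> in_rect a b c d z.
      by move=> z [? ?]; split; lra.
    have Hg : forall z, ccont g z.
      move=> z; apply: Clim_plus; first exact: Clim_const.
      apply: Clim_mult; first exact: Clim_const.
      by apply: Clim_minus; [exact: Clim_id | exact: Clim_const].
    have Hbg : bd g a' b' c' d' = 0.
      apply: (bd_primitive (fun w => f (x, y) * w + l / 2 * (w - (x, y)) ^ 2)%C) => //; try lra.
      by move=> z _; apply: cdiff_affine_primitive.
    have -> : bd f a' b' c' d' = bd (fun z => f z - g z)%C a' b' c' d'.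
      rewrite bd_minus ?Hbg //; try lra; first ring.
      by move=> z /Hsub; apply: Hc.
    have -> : e * (b' - a' + (d' - c')) ^ 2 =
        2 * ((b' - a') + (d' - c')) * (e / 2 * ((b' - a') + (d' - c'))) by field.
    apply: bd_bound; try lra.
      by move=> z /Hsub Hz; apply: Clim_minus; [exact: Hc | exact: Hg].
    move=> z [Hz1 Hz2].
    have -> : (f z - g z)%C = ((p z - l) * (z - (x, y)))%C by rewrite /g Hp; ring.
    have Hz : Cmod (z - (x, y)) <= (b' - a') + (d' - c').
      apply: Rle_trans; first exact: Cmod_le_sum.
      apply: Rplus_le_compat; rewrite /Re /Im /=; apply: Rabs_le; lra.
    rewrite Cmod_mult; apply: Rmult_le_compat; try exact: Cmod_ge_0; last done.
    by left; apply: H; lra.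
move=> H; apply: Rle_trans H _.
have -> : e0 = e * (L ^ 2 + 1) by rewrite /e; field; nra.
rewrite -/L; nra.
Qed.

(* On a vertical strip the primitive is the integral along an L-shaped path; Goursat lets the two legs be exchanged. *)
Theorem strip_primitive (D : R -> Prop) (f : C -> C) (x0 : R) :
  D x0 -> (forall a b x, D a -> D b -> a <= x <= b -> D x) ->
  (forall x, D x -> exists r, 0 < r /\ forall x', Rabs (x' - x) < r -> D x') ->
  (forall z, D (fst z) -> exists l, cdiff f z l) ->
  exists P : C -> C, forall z, D (fst z) -> cdiff P z (f z).
Proof.
move=> Dx0 Dint Dopen Hf.
have Hc : forall z, D (fst z) -> ccont f z by move=> z /Hf [l]; apply: cdiff_cont.
have Dmm : forall a b t, D a -> D b -> Rmin a b <= t <= Rmax a b -> D t.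
  move=> a b t Da Db Ht; apply: (Dint (Rmin a b) (Rmax a b)) => //.
    by rewrite /Rmin; case: Rle_dec. by rewrite /Rmax; case: Rle_dec.
have HexH : forall y a b, D a -> D b -> Cis (fun x => f (x, y)) a b (Hint f y a b).
  move=> y a b Da Db; apply: Cis_ex => t Ht; apply: ccont_horizontal; apply: Hc.
  exact: (Dmm a b).
have HexV : forall x c d, D x -> Cis (fun y => f (x, y)) c d (Vint f x c d).
  by move=> x c d Dx; apply: Cis_ex => t Ht; apply: ccont_vertical; apply: Hc.
have Hsw : forall y a b, D a -> D b -> Hint f y b a = (- Hint f y a b)%C.
  by move=> y a b Da Db; apply: Cis_unique; apply: Cis_swap; apply: HexH.
have Vsw : forall x c d, D x -> Vint f x d c = (- Vint f x c d)%C.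
  by move=> x c d Dx; apply: Cis_unique; apply: Cis_swap; apply: HexV.
(* The increments of the primitive may have either sign, so Goursat is extended to rectangles with
   reversed sides. *)
have G0 : forall a b c d, D a -> D b -> a <= b -> bd f a b c d = 0.
  move=> a b c d Da Db Hab.
  have G1 : forall c d, c <= d -> bd f a b c d = 0.
    move=> c1 d1 Hcd; apply: goursat => // z [Hz _]; apply: Hf; exact: (Dint a b).
  case: (Rle_dec c d) => Hcd; first exact: G1.
  have := G1 d c ltac:(lra); rewrite /bd (Vsw b d c) // (Vsw a d c) // => H.
  have -> : (Hint f c a b + Ci * - Vint f b d c - Hint f d a b - Ci * - Vint f a d c)%C =
    (- (Hint f d a b + Ci * Vint f b d c - Hint f c a b - Ci * Vint f a d c))%C by ring.
  by rewrite H; ring.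
have G : forall a b c d, D a -> D b -> bd f a b c d = 0.
  move=> a b c d Da Db; case: (Rle_dec a b) => Hab; first exact: G0.
  have := G0 b a c d Db Da ltac:(lra); rewrite /bd (Hsw c b a) // (Hsw d b a) // => H.
  have -> : (- Hint f c b a + Ci * Vint f b c d - - Hint f d b a - Ci * Vint f a c d)%C =
    (- (Hint f c b a + Ci * Vint f a c d - Hint f d b a - Ci * Vint f b c d))%C by ring.
  by rewrite H; ring.
exists (fun z => Hint f 0 x0 (fst z) + Ci * Vint f (fst z) 0 (snd z))%C => [[x y]] /= Dx.
apply: cdiff_eps => e He.
have He2 : 0 < e / 2 by lra.
case/locally_C: (Hc (x, y) Dx _ He2) => r1 [Hr1 Hcr].
case: (Dopen x Dx) => r2 [Hr2 HDr].
exists (Rmin r1 r2 / 2).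
have M1 := Rmin_l r1 r2; have M2 := Rmin_r r1 r2.
have M3 : 0 < Rmin r1 r2 by apply: Rmin_pos.
split=> [|[x' y'] /= Hw]; first lra.
have Hx' := re_le_Cmod ((x', y') - (x, y)); have Hy' := im_le_Cmod ((x', y') - (x, y)).
rewrite /Re /Im /= in Hx' Hy'.
have Dx' : D x' by apply: HDr; have -> : x' - x = x' + - x by []; lra.
have E1 : Hint f 0 x0 x' = (Hint f 0 x0 x + Hint f 0 x x')%C.
  by apply: Cis_unique; apply: Cis_Chasles; apply: HexH.
have E2 : Vint f x' 0 y' = (Vint f x' 0 y + Vint f x' y y')%C.
  by apply: Cis_unique; apply: Cis_Chasles; apply: HexV.
have E3 := G x x' 0 y Dx Dx'; rewrite /bd in E3.
have E4 : Hint f 0 x x' = (Hint f y x x' + Ci * Vint f x 0 y - Ci * Vint f x' 0 y)%C.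
  have -> : Hint f 0 x x' = (Hint f 0 x x' + Ci * Vint f x' 0 y - Hint f y x x' - Ci * Vint f x 0 y +
    (Hint f y x x' + Ci * Vint f x 0 y - Ci * Vint f x' 0 y))%C by ring.
  by rewrite E3; ring.
have -> : (Hint f 0 x0 x' + Ci * Vint f x' 0 y' - (Hint f 0 x0 x + Ci * Vint f x 0 y) -
  ((x', y') - (x, y)) * f (x, y))%C =
  ((Hint f y x x' - RtoC (x' - x) * f (x, y)) + Ci * (Vint f x' y y' - RtoC (y' - y) * f (x, y)))%C.
  rewrite E1 E2 E4.
  have -> : ((x', y') - (x, y))%C = (RtoC (x' - x) + Ci * RtoC (y' - y))%C.
    by apply: injective_projections; rewrite /=; ring.
  ring.
apply: Rle_trans; first exact: Cmod_triangle.
have B1 : Cmod (Hint f y x x' - RtoC (x' - x) * f (x, y)) <= Rabs (x' - x) * (e / 2).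
  apply: (Cis_bound_abs (fun t => f (t, y) - f (x, y))%C); last first.
    by apply: Cis_minus; [exact: HexH | exact: Cis_const].
  move=> t Ht; left; apply: Hcr; apply: Rle_lt_trans; first exact: Cmod_le_sum.
  rewrite /Re /Im /= Rplus_opp_r Rabs_R0 Rplus_0_r.
  have : Rabs (t + - x) <= Rabs (x' + - x).
    move: Ht; rewrite /Rmin /Rmax; case: Rle_dec => ? ?; rewrite /Rabs; do 2 case: Rcase_abs; lra.
  lra.
have B2 : Cmod (Vint f x' y y' - RtoC (y' - y) * f (x, y)) <= Rabs (y' - y) * (e / 2).
  apply: (Cis_bound_abs (fun t => f (x', t) - f (x, y))%C); last first.
    by apply: Cis_minus; [exact: HexV | exact: Cis_const].
  move=> t Ht; left; apply: Hcr; apply: Rle_lt_trans; first exact: Cmod_le_sum.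
  rewrite /Re /Im /=.
  have : Rabs (t + - y) <= Rabs (y' + - y).
    move: Ht; rewrite /Rmin /Rmax; case: Rle_dec => ? ?; rewrite /Rabs; do 2 case: Rcase_abs; lra.
  lra.
rewrite Cmod_mult Cmod_Ci Rmult_1_l.
have C1 : Rabs (x' - x) * (e / 2) <= Cmod ((x', y') - (x, y)) * (e / 2).
  by apply: Rmult_le_compat_r => //; lra.
have C2 : Rabs (y' - y) * (e / 2) <= Cmod ((x', y') - (x, y)) * (e / 2).
  by apply: Rmult_le_compat_r => //; lra.
lra.
Qed.

(** * Cauchy's formula *)

(** This makes integrals over vertical segments continuous in the abscissa. The rectangles of the
    induction are degenerate; only the second side is bisected. *)
Lemma unif_vertical (h : C -> C) (x0 c d : R) :
  c <= d -> (forall t, c <= t <= d -> ccont h (x0, t)) ->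
  forall e, 0 < e -> exists r, 0 < r /\ forall x t, c <= t <= d -> Rabs (x - x0) < r ->
    Cmod (h (x, t) - h (x0, t)) < e.
Proof.
move=> Hcd Hc e He.
pose P (a b c d : R) := exists r, 0 < r /\ forall x t, c <= t <= d -> Rabs (x - x0) < r ->
    Cmod (h (x, t) - h (x0, t)) < e.
suff : P 0 0 c d by [].
apply: rect_induction => //; first lra.
- move=> a1 b1 c1 d1 _ H1 [r1 [Hr1 Q1]] _ [r2 [Hr2 Q2]] _.
  have M1 := Rmin_l r1 r2; have M2 := Rmin_r r1 r2.
  exists (Rmin r1 r2); split; first exact: Rmin_pos.
  move=> x t Ht Hx; case: (Rle_dec t ((c1 + d1) / 2)) => H; [apply: Q1 | apply: Q2]; lra.
- move=> x1 y _ Hy.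
  have He2 : 0 < e / 2 by lra.
  case/locally_C: (Hc y Hy _ He2) => r [Hr H].
  exists (r / 2); split; first lra.
  move=> a' b' c' d' _ _ Hc' Hd' _ Hs.
  exists (r / 2); split; first lra.
  move=> x t Ht Hx.
  have Hty : Rabs (t - y) < r / 2 by apply: Rabs_def1; lra.
  have K1 : Cmod (h (x, t) - h (x0, y)) < e / 2.
    apply: H; apply: Rle_lt_trans; first exact: Cmod_le_sum.
    by rewrite /Re /Im /=; move: Hx Hty; rewrite /Rminus; lra.
  have K2 : Cmod (h (x0, t) - h (x0, y)) < e / 2.
    apply: H; apply: Rle_lt_trans; first exact: Cmod_le_sum.
    by rewrite /Re /Im /= Rplus_opp_r Rabs_R0; move: Hty; rewrite /Rminus; lra.
  have := Cmod_triangle (h (x, t) - h (x0, y)) (- (h (x0, t) - h (x0, y))).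
  rewrite Cmod_opp.
  have -> : (h (x, t) - h (x0, y) + - (h (x0, t) - h (x0, y)))%C = (h (x, t) - h (x0, t))%C by ring.
  lra.
Qed.

Lemma bounded_segment (h : R -> C) (c d : R) :
  c <= d -> (forall t, c <= t <= d -> rcont h t) ->
  exists M, 0 <= M /\ forall t, c <= t <= d -> Cmod (h t) <= M.
Proof.
move=> Hcd Hc.
pose P (a b c d : R) := exists M, 0 <= M /\ forall t, c <= t <= d -> Cmod (h t) <= M.
suff : P 0 0 c d by [].
apply: rect_induction => //; first lra.
- move=> a1 b1 c1 d1 _ H1 [r1 [Hr1 Q1]] _ [r2 [Hr2 Q2]] _.
  have M1 := Rmax_l r1 r2; have M2 := Rmax_r r1 r2.
  exists (Rmax r1 r2); split; first lra.
  move=> t Ht; case: (Rle_dec t ((c1 + d1) / 2)) => H;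
    [apply: Rle_trans M1; apply: Q1 | apply: Rle_trans M2; apply: Q2]; lra.
- move=> x1 y _ Hy.
  case/locally_R: (Hc y Hy 1 Rlt_0_1) => r [Hr H].
  exists r; split => // a' b' c' d' _ _ Hc' Hd' _ Hs.
  exists (Cmod (h y) + 1); split; first by have := Cmod_ge_0 (h y); lra.
  move=> t Ht.
  have Hty : Rabs (t - y) < r by apply: Rabs_def1; lra.
  have := H t Hty; have := Cmod_triangle_sub (h t) (h y); lra.
Qed.

Definition holo (r : R) (f : C -> C) := forall z, Cmod z < r -> exists l, cdiff f z l.

(** The integral over the circle of radius [exp x], in the logarithmic coordinate. *)
Definition circ (f : C -> C) (x : R) : C := Vint (fun w => f (cexp w)) x (- PI) PI.

Lemma PI_le : - PI <= PI.
Proof. have := PI_RGT_0; lra. Qed.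

Lemma Cmod_cexp_pair (x y : R) : Cmod (cexp (x, y)) = exp x.
Proof. by rewrite Cmod_cexp. Qed.

Lemma ccont_cexp (z : C) : ccont cexp z.
Proof. exact: cdiff_cont (cdiff_cexp z). Qed.

Lemma ccont_comp_cexp (f : C -> C) (z : C) : ccont f (cexp z) -> ccont (fun w => f (cexp w)) z.
Proof. by move=> H; apply: (Clim_comp _ cexp f) H; apply: ccont_cexp. Qed.

Lemma circ_correct (f : C -> C) (x : R) :
  (forall z, Cmod z = exp x -> ccont f z) ->
  Cis (fun t => f (cexp (x, t))) (- PI) PI (circ f x).
Proof.
move=> H; apply: (Vint_correct (fun w => f (cexp w))); first exact: PI_le.
by move=> y _; apply: ccont_comp_cexp; apply: H; rewrite Cmod_cexp_pair.
Qed.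

Lemma cexp_PI (x : R) : cexp (x, PI) = cexp (x, - PI).
Proof. by rewrite /cexp /= cos_neg sin_neg sin_PI cos_PI; apply: injective_projections => /=; ring. Qed.

(** In the logarithmic coordinate the annulus is a rectangle of height [2 * PI]. The integrals over
    its horizontal sides cancel by periodicity, and Goursat equates the vertical ones. *)
Lemma circ_annulus (f : C -> C) (x x' : R) :
  x <= x' -> (forall z, exp x <= Cmod z <= exp x' -> exists l, cdiff f z l) ->
  circ f x = circ f x'.
Proof.
move=> Hx Hf.
have : bd (fun w => f (cexp w)) x x' (- PI) PI = 0.
  apply: goursat => //; first exact: PI_le.
  move=> z [Hz _]; case: (Hf (cexp z)) => [|l Hl].
    rewrite Cmod_cexp /Re; split.
      by case: Hz => [[Hz|->] _]; [left; apply: exp_increasing | right].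
    by case: Hz => [_ [Hz|->]]; [left; apply: exp_increasing | right].
  by exists (l * cexp z)%C; apply: cdiff_comp => //; apply: cdiff_cexp.
rewrite /bd.
have -> : Hint (fun w => f (cexp w)) (- PI) x x' = Hint (fun w => f (cexp w)) PI x x'.
  rewrite /Hint /cint; apply: (@RInt_ext C_R_CompleteNormedModule) => t _.
  by rewrite cexp_PI.
rewrite -/(circ f x) -/(circ f x') => H.
have {}H : (Ci * (circ f x' - circ f x))%C = 0 by rewrite -H; ring.
apply: Logic.eq_sym; apply/Ceq_minus.
have -> : (circ f x' - circ f x)%C = (- Ci * (Ci * (circ f x' - circ f x)))%C.
  by apply: injective_projections; rewrite /Ci /=; ring.
by rewrite H; ring.
Qed.

Lemma circ_cont (f : C -> C) (x0 r : R) :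
  exp x0 < r -> (forall z, Cmod z < r -> ccont f z) ->
  forall e, 0 < e -> exists d, 0 < d /\ forall x, Rabs (x - x0) < d -> exp x < r ->
    Cmod (circ f x - circ f x0) <= e.
Proof.
move=> Hx0 Hf e He.
have HP := PI_RGT_0.
have He' : 0 < e / (2 * PI) by apply: Rdiv_lt_0_compat; lra.
case: (unif_vertical (fun w => f (cexp w)) x0 (- PI) PI PI_le _ _ He') => [t _|d [Hd H]].
  by apply: ccont_comp_cexp; apply: Hf; rewrite Cmod_cexp_pair.
exists d; split=> // x Hx Hxr.
have -> : e = (PI - - PI) * (e / (2 * PI)) by field; lra.
apply: (Cis_bound_const (fun t => f (cexp (x, t)) - f (cexp (x0, t)))%C); first exact: PI_le.
  by move=> t Ht; left; apply: (H x t).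
by apply: Cis_minus; apply: circ_correct => z Hz; apply: Hf; rewrite Hz.
Qed.

Lemma ln_small (d : R) : 0 < d -> forall x, x <= ln d -> exp x <= d.
Proof.
move=> Hd x [Hx|->]; last by rewrite exp_ln //; right.
by left; rewrite -(exp_ln d) //; apply: exp_increasing.
Qed.

(* [k z = z (f z - f z0) / (z - z0)]: its circle integral is locally constant on both sides of the
   circle through [z0], continuous across it, and tends to 0 at the origin. *)
Lemma cauchy_quotient (f p : C -> C) (r : R) (z0 : C) (x : R) :
  holo r f -> Cmod z0 < r -> exp x < r ->
  (forall w, f w = f z0 + p w * (w - z0))%C -> Clim (locally z0) p (p z0) ->
  circ (fun w => w * p w)%C x = 0.
Proof.
move=> Hf Hz0 Hx Hp Hpc.
set k := (fun w => w * p w)%C.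
have Hpd : forall z, Cmod z < r -> z <> z0 -> exists l, cdiff p z l.
  move=> z Hz Hne; case: (Hf z Hz) => l Hl.
  have Hne' := Csub_neq0 _ _ Hne.
  have D1 : cdiff (fun w => w - z0)%C z (1 - 0)%C.
    by apply: cdiff_minus; [exact: cdiff_id | exact: cdiff_const].
  have D2 := cdiff_comp Cinv (fun w => w - z0)%C z _ _ (cdiff_inv _ Hne') D1.
  have D3 := cdiff_minus _ _ _ _ _ Hl (cdiff_const (f z0) z).
  have D4 := cdiff_mult _ _ _ _ _ D3 D2.
  eexists; apply: cdiff_ext_loc D4.
  apply/locally_C; exists (Cmod (z - z0)); split; first exact/Cmod_gt_0.
  move=> w Hw; rewrite {1}(Hp w); field.
  apply: Csub_neq0 => H; move: Hw; rewrite H Cmod_sub_sym; lra.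
have Hkd : forall z, Cmod z < r -> z <> z0 -> exists l, cdiff k z l.
  move=> z Hz Hne; case: (Hpd z Hz Hne) => l Hl.
  by eexists; apply: cdiff_mult Hl; apply: cdiff_id.
have Hpcont : forall z, Cmod z < r -> ccont p z.
  move=> z Hz; case: (Ceq_dec z z0) => [->|Hne]; first exact: Hpc.
  by case: (Hpd z Hz Hne) => l; apply: cdiff_cont.
have Hkc : forall z, Cmod z < r -> ccont k z.
  by move=> z Hz; apply: Clim_mult; [exact: Clim_id | exact: Hpcont].
have HP := PI_RGT_0.
have Hr : 0 < r by apply: Rle_lt_trans Hz0; apply: Cmod_ge_0.
(* Near the origin [p] is bounded, and the factor [w] makes the integral of the order of the
   radius. *)
have Hsmall : forall e, 0 < e -> exists X, forall y, y <= X -> Cmod (circ k y) <= e.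
  move=> e He.
  case/locally_C: (Hpcont 0 ltac:(rewrite Cmod_0; lra) 1 Rlt_0_1) => d [Hd Hpd0].
  pose M := Cmod (p 0) + 1.
  have HM : 0 < M by rewrite /M; have := Cmod_ge_0 (p 0); lra.
  pose m := Rmin (Rmin (d / 2) (r / 2)) (e / (2 * PI * M)).
  have M1 : m <= Rmin (d / 2) (r / 2) := Rmin_l _ _.
  have M2 : m <= e / (2 * PI * M) := Rmin_r _ _.
  have M3 := Rmin_l (d / 2) (r / 2); have M4 := Rmin_r (d / 2) (r / 2).
  have Hm : 0 < m.
    apply: Rmin_pos; first by apply: Rmin_pos; lra.
    by apply: Rdiv_lt_0_compat => //; apply: Rmult_lt_0_compat => //; lra.
  exists (ln m) => y Hy; have {}Hy := ln_small m Hm y Hy.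
  have -> : e = (PI - - PI) * (e / (2 * PI * M) * M) by field; lra.
  apply: (Cis_bound_const (fun t => k (cexp (y, t)))); first exact: PI_le; last first.
    by apply: circ_correct => z Hz; apply: Hkc; lra.
  move=> t Ht; rewrite /k Cmod_mult Cmod_cexp_pair.
  apply: Rmult_le_compat; [left; apply: exp_pos | exact: Cmod_ge_0 | lra |].
  have := Hpd0 (cexp (y, t)); have := Cmod_triangle_sub (p (cexp (y, t))) (p 0).
  have -> : (cexp (y, t) - 0)%C = cexp (y, t) by ring.
  rewrite Cmod_cexp_pair /M => H1 H2; have := H2 ltac:(lra); lra.
have Hmain : forall y, exp y < r -> (forall z, Cmod z <= exp y -> z <> z0) -> circ k y = 0.
  move=> y Hy Hno; apply: Cmod_eq_0; apply: Rle_antisym; last exact: Cmod_ge_0.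
  apply: le_epsilon => e He; rewrite Rplus_0_l.
  case: (Hsmall e He) => X HX.
  have M1 := Rmin_l X y; have M2 := Rmin_r X y.
  rewrite -(circ_annulus k (Rmin X y) y) //; first exact: HX.
  by move=> z Hz; apply: Hkd; [lra | apply: Hno; lra].
(* For [z0 = 0] there is no circle through [z0]: every circle is shrunk directly, and no annulus
   used contains 0. *)
case: (Ceq_dec z0 0) => Hz00.
  rewrite /circ.
  have Hnn : forall y z, exp y <= Cmod z -> z <> z0.
    move=> y z H E; move: H; rewrite E Hz00 Cmod_0; have := exp_pos y; lra.
  apply: Cmod_eq_0; apply: Rle_antisym; last exact: Cmod_ge_0.
  apply: le_epsilon => e He; rewrite Rplus_0_l.
  case: (Hsmall e He) => X HX.
  have M1 := Rmin_l X x; have M2 := Rmin_r X x.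
  rewrite -/(circ k x) -(circ_annulus k (Rmin X x) x) //; first exact: HX.
  by move=> z [H1 H2]; apply: Hkd; [lra | exact: (Hnn _ _ H1)].
have Hm0 : 0 < Cmod z0 by apply/Cmod_gt_0.
pose x0 := ln (Cmod z0).
have Ex0 : exp x0 = Cmod z0 by apply: exp_ln.
have Hlow : forall y, y < x0 -> circ k y = 0.
  move=> y Hy; have Hy' := exp_increasing _ _ Hy.
  apply: Hmain; first lra.
  by move=> z Hz E; move: Hz; rewrite E; lra.
have Hmid : circ k x0 = 0.
  apply: Cmod_eq_0; apply: Rle_antisym; last exact: Cmod_ge_0.
  apply: le_epsilon => e He; rewrite Rplus_0_l.
  case: (circ_cont k x0 r ltac:(lra) Hkc e He) => d [Hd H].
  have Hlt : x0 - d / 2 < x0 by lra.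
  have := H (x0 - d / 2) _ _; rewrite (Hlow _ Hlt).
  have -> : (0 - circ k x0)%C = (- circ k x0)%C by ring.
  rewrite Cmod_opp; apply.
    by rewrite Rabs_left; lra.
  by have := exp_increasing _ _ Hlt; lra.
case: (Rle_dec x x0) => Hxx; first by case: Hxx => [|->] //; apply: Hlow.
apply: Cmod_eq_0; apply: Rle_antisym; last exact: Cmod_ge_0.
apply: le_epsilon => e He; rewrite Rplus_0_l.
case: (circ_cont k x0 r ltac:(lra) Hkc e He) => d [Hd H].
(* The circle [y] lies just outside the one through [z0]: close enough for continuity, and separated
   from [x] by an annulus without [z0]. *)
pose y := Rmin x (x0 + d / 2).
have M1 : y <= x := Rmin_l _ _; have M2 : y <= x0 + d / 2 := Rmin_r _ _.
have M3 : x0 < y by apply: Rmin_glb_lt; lra.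
have Hyx : exp y <= exp x by case: M1 => [M1|->]; [left; apply: exp_increasing | right].
rewrite -(circ_annulus k y x) //; last first.
  move=> z [H1 H2]; apply: Hkd; first lra.
  by move=> E; move: H1; rewrite E -Ex0; have := exp_increasing _ _ M3; lra.
have := H y _ _; rewrite Hmid.
have -> : (circ k y - 0)%C = circ k y by ring.
apply; last lra.
by rewrite Rabs_right; lra.
Qed.

(** Outside [z0] the integral does not depend on the radius, and on large circles [w / (w - z0)]
    tends to 1. *)
Lemma circ_kernel (z0 : C) (x : R) :
  Cmod z0 < exp x -> circ (fun w => w / (w - z0))%C x = RtoC (2 * PI).
Proof.
move=> Hz0; have HP := PI_RGT_0; have Hm := Cmod_ge_0 z0.
set k := (fun w => w / (w - z0))%C.
have Hne : forall z, Cmod z0 < Cmod z -> (z - z0)%C <> 0.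
  by move=> z Hz; apply: Csub_neq0 => E; move: Hz; rewrite E; lra.
have Hkd : forall z, Cmod z0 < Cmod z -> exists l, cdiff k z l.
  move=> z Hz.
  have D1 : cdiff (fun w => w - z0)%C z (1 - 0)%C.
    by apply: cdiff_minus; [exact: cdiff_id | exact: cdiff_const].
  have D2 := cdiff_comp Cinv (fun w => w - z0)%C z _ _ (cdiff_inv _ (Hne _ Hz)) D1.
  by eexists; apply: cdiff_mult D2; apply: cdiff_id.
apply/Ceq_minus.
apply: Cmod_eq_0; apply: Rle_antisym; last exact: Cmod_ge_0.
apply: le_epsilon => e He; rewrite Rplus_0_l.
(* On this circle the kernel differs from 1 by at most [Cmod z0 / (r - Cmod z0)], which times
   [2 * PI] is at most [e]. *)
pose r := Rmax (exp x) (Cmod z0 + 2 * PI * (Cmod z0 + 1) / e).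
have R1 : exp x <= r := Rmax_l _ _.
have R2 : Cmod z0 + 2 * PI * (Cmod z0 + 1) / e <= r := Rmax_r _ _.
have Hrp : 0 < r by have := exp_pos x; lra.
have Hx : x <= ln r.
  case: R1 => [R1|R1].
    by left; rewrite -(ln_exp x); apply: ln_increasing => //; apply: exp_pos.
  by right; rewrite -R1 ln_exp.
rewrite (circ_annulus k x (ln r)) //; last by move=> z Hz; apply: Hkd; lra.
have -> : RtoC (2 * PI) = (RtoC (PI - - PI) * 1)%C by rewrite Cmult_1_r; congr RtoC; ring.
have Hg : 0 < 2 * PI * (Cmod z0 + 1) / e by apply: Rdiv_lt_0_compat => //; nra.
have Hrz : 0 < r - Cmod z0 by lra.
have Hle : (PI - - PI) * (Cmod z0 / (r - Cmod z0)) <= e.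
  apply: (Rmult_le_reg_r _ _ _ Hrz).
  have -> : (PI - - PI) * (Cmod z0 / (r - Cmod z0)) * (r - Cmod z0) = 2 * PI * Cmod z0 by field; lra.
  apply: (Rle_trans _ (e * (2 * PI * (Cmod z0 + 1) / e))); last by apply: Rmult_le_compat_l; lra.
  have -> : e * (2 * PI * (Cmod z0 + 1) / e) = 2 * PI * (Cmod z0 + 1) by field; lra.
  nra.
apply: Rle_trans Hle.
apply: (Cis_bound_const (fun t => k (cexp (ln r, t)) - 1)%C); first exact: PI_le; last first.
  apply: Cis_minus; last exact: Cis_const.
  apply: circ_correct => z; rewrite exp_ln // => Hz.
  by case: (Hkd z ltac:(lra)) => l; apply: cdiff_cont.
move=> t Ht; rewrite /k.
set z := cexp (ln r, t).
have Hz : Cmod z = r by rewrite /z Cmod_cexp_pair exp_ln.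
have Hzz := Hne z ltac:(lra).
have -> : (z / (z - z0) - 1)%C = (z0 / (z - z0))%C by field.
rewrite Cmod_div //; apply: Rmult_le_compat_l => //.
apply: Rinv_le_contravar => //.
have := Cmod_triangle_sub z z0; lra.
Qed.

(** On the circle the integrand is [f z0 * (w / (w - z0)) + w * p w] with the slope [p] of [f] at
    [z0]; the first part is [circ_kernel], the second integrates to 0. *)
Theorem cauchy_formula (f : C -> C) (r : R) (z0 : C) (x : R) :
  holo r f -> Cmod z0 < exp x -> exp x < r ->
  circ (fun w => f w * (w / (w - z0)))%C x = (RtoC (2 * PI) * f z0)%C.
Proof.
move=> Hf Hz0 Hx.
case: (Hf z0 ltac:(lra)) => l [p [Hp [Hpz Hpc]]].
have Hk := cauchy_quotient f p r z0 x Hf ltac:(lra) Hx Hp ltac:(by rewrite Hpz).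
have Hone := circ_kernel z0 x Hz0.
have Hne : forall z, Cmod z = exp x -> (z - z0)%C <> 0.
  by move=> z Hz; apply: Csub_neq0 => E; move: Hz; rewrite E; lra.
have Hkc : forall z, Cmod z = exp x -> ccont (fun w => w / (w - z0))%C z.
  move=> z Hz; apply: Clim_div; [exact: Hne | exact: Clim_id |].
  by apply: Clim_minus; [exact: Clim_id | exact: Clim_const].
have Hc1 := Cis_scal _ _ _ (f z0) _ (circ_correct _ x Hkc).
have Hc2 : Cis (fun t => cexp (x, t) * p (cexp (x, t)))%C (- PI) PI (circ (fun w => w * p w)%C x).
  apply: (circ_correct (fun w => w * p w)%C) => z Hz.
  have H : ccont (fun w => w * ((f w - f z0) / (w - z0)))%C z.
    apply: Clim_mult; first exact: Clim_id.
    apply: Clim_div; first exact: Hne.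
      apply: Clim_minus; last exact: Clim_const.
      by case: (Hf z ltac:(lra)) => l'; apply: cdiff_cont.
    by apply: Clim_minus; [exact: Clim_id | exact: Clim_const].
  have Heq : forall w, w <> z0 -> (w * ((f w - f z0) / (w - z0)))%C = (w * p w)%C.
    by move=> w Hw; rewrite {1}(Hp w); field; apply: Csub_neq0.
  have Hzz : z <> z0 by move=> E; apply: (Hne z Hz); rewrite E; ring.
  rewrite /ccont -(Heq z Hzz).
  apply: Clim_ext_loc H.
  apply/locally_C; exists (Cmod (z - z0)); split; first by apply/Cmod_gt_0; apply: Hne.
  move=> w Hw; apply: Heq => E; move: Hw; rewrite E Cmod_sub_sym; lra.
have := Cis_plus _ _ _ _ _ _ Hc1 Hc2.
rewrite Hk Hone => H.
have -> : (RtoC (2 * PI) * f z0)%C = (f z0 * RtoC (2 * PI) + 0)%C by ring.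
apply: Cis_unique; apply: Cis_ext H; first exact: PI_le.
move=> t _ /=; set w := cexp (x, t).
rewrite (Hp w); field; apply: Hne; exact: Cmod_cexp_pair.
Qed.

(** * Taylor coefficients *)

(** A quadratic remainder that is uniform in [t] survives integration, so the derivative passes
    under the integral without an interchange of limits. *)
Lemma cdiff_RInt_kernel (K K' : R -> C -> C) (I : C -> C) (phi : R -> C) (z L : C) (a b B M d : R) :
  a <= b -> 0 < d -> 0 <= B ->
  (forall t, a <= t <= b -> Cmod (phi t) <= B) ->
  (forall t w, a <= t <= b -> Cmod (w - z) < d ->
     Cmod (K t w - K t z - K' t z * (w - z)) <= M * Cmod (w - z) ^ 2) ->
  (forall w, Cmod (w - z) < d -> Cis (fun t => phi t * K t w)%C a b (I w)) ->
  Cis (fun t => phi t * K' t z)%C a b L ->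
  cdiff I z L.
Proof.
move=> Hab Hd HB Hphi HK HI HL.
apply: (cdiff_quad _ _ _ ((b - a) * (B * M)) d) => // w Hw.
have Hzz : Cmod (z - z) < d.
  have -> : (z - z)%C = 0 by ring.
  by rewrite Cmod_0.
have -> : (b - a) * (B * M) * Cmod (w - z) ^ 2 = (b - a) * (B * (M * Cmod (w - z) ^ 2)) by ring.
rewrite (Cmult_comm L).
apply: (Cis_bound_const (fun t => phi t * K t w - phi t * K t z - (w - z) * (phi t * K' t z))%C) => //; last first.
  apply: Cis_minus; last exact: Cis_scal.
  by apply: Cis_minus; apply: HI.
move=> t Ht.
have -> : (phi t * K t w - phi t * K t z - (w - z) * (phi t * K' t z))%C =
  (phi t * (K t w - K t z - K' t z * (w - z)))%C by ring.
rewrite Cmod_mult; apply: Rmult_le_compat; try exact: Cmod_ge_0.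
- exact: Hphi.
- exact: HK.
Qed.

Lemma Cpow_neq0 (z : C) (n : nat) : z <> 0 -> (z ^ n)%C <> 0.
Proof. exact: Cpow_nz. Qed.

Lemma Cmod_sub_lb (z w : C) (r d : R) :
  Cmod z = r -> Cmod w <= r - d -> d <= Cmod (z - w).
Proof. by move=> H1 H2; have := Cmod_triangle_sub z w; lra. Qed.

Lemma Cmod_inv_le (z : C) (d : R) : 0 < d -> d <= Cmod z -> Cmod (/ z) <= / d.
Proof.
move=> Hd H; rewrite Cmod_inv; last by apply/Cmod_gt_0; lra.
exact: Rinv_le_contravar.
Qed.

Section CauchyDerivative.
Variables (f f' : C -> C) (r : R).
Hypothesis Hf : forall z, Cmod z < r -> cdiff f z (f' z).

Let Hholo : holo r f.
Proof. by move=> z Hz; exists (f' z); apply: Hf. Qed.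

(** Two differentiations of Cauchy's kernel under the integral: the first represents [f'], the
    second shows that [f'] is differentiable in turn. This makes [holo] stable under [C_derive]. *)
Lemma cauchy_derivative (z : C) (x : R) :
  Cmod z < exp x -> exp x < r ->
  circ (fun w => f w * (w / ((w - z) * (w - z))))%C x = (RtoC (2 * PI) * f' z)%C /\
  exists l, cdiff f' z l.
Proof.
move=> Hz Hx.
have HP := PI_RGT_0.
have Hcont : forall w, Cmod w = exp x -> ccont f w.
  by move=> w Hw; apply: cdiff_cont (Hf w _); lra.
have Hphi : forall t, rcont (fun t => f (cexp (x, t)) * cexp (x, t))%C t.
  move=> t; apply: (ccont_vertical (fun w => f (cexp w) * cexp w)%C).
  apply: (ccont_comp_cexp (fun w => f w * w)%C); apply: Clim_mult; last exact: Clim_id.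
  by apply: Hcont; apply: Cmod_cexp_pair.
case: (bounded_segment _ (- PI) PI PI_le (fun t _ => Hphi t)) => B [HB0 HB].
have Hk : forall (n : nat) (w v : C), Cmod w < exp x -> Cmod v = exp x ->
    ccont (fun v => f v * v * (/ (v - w)) ^ n)%C v.
  move=> n w v Hw Hv; apply: Clim_mult.
    by apply: Clim_mult; [exact: Hcont | exact: Clim_id].
  apply: Clim_pow; apply: Clim_inv.
    by apply: Csub_neq0 => E; move: Hw; rewrite -E; lra.
  by apply: Clim_minus; [exact: Clim_id | exact: Clim_const].
have HCis : forall n w, Cmod w < exp x ->
    Cis (fun t => f (cexp (x, t)) * cexp (x, t) * (/ (cexp (x, t) - w)) ^ n)%C (- PI) PI
      (circ (fun v => f v * v * (/ (v - w)) ^ n)%C x).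
  by move=> n w Hw; apply: (circ_correct (fun v => f v * v * (/ (v - w)) ^ n)%C) => v; apply: Hk.
have D1 : forall w, Cmod w < exp x ->
    cdiff (fun w => circ (fun v => f v * v * (/ (v - w)) ^ 1)%C x) w
      (circ (fun v => f v * v * (/ (v - w)) ^ 2)%C x).
  move=> w Hw.
  pose d := (exp x - Cmod w) / 2.
  have Hd : 0 < d by rewrite /d; lra.
  apply: (cdiff_RInt_kernel (fun t w => (/ (cexp (x, t) - w)) ^ 1)%C
    (fun t w => (/ (cexp (x, t) - w)) ^ 2)%C _ _ _ _ _ _ B (/ d * / d * / d) d PI_le Hd HB0 HB).
  - move=> t v Ht Hv.
    set e := cexp (x, t).
    have He : Cmod e = exp x by apply: Cmod_cexp_pair.
    have E1 : d <= Cmod (e - w) by apply: (Cmod_sub_lb _ _ _ _ He); rewrite /d; lra.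
    have E2 : d <= Cmod (e - v).
      by apply: (Cmod_sub_lb _ _ _ _ He); have := Cmod_triangle_sub v w; move: Hv; rewrite /d; lra.
    have N1 : (e - w)%C <> 0 by apply/Cmod_gt_0; lra.
    have N2 : (e - v)%C <> 0 by apply/Cmod_gt_0; lra.
    have -> : ((/ (e - v)) ^ 1 - (/ (e - w)) ^ 1 - (/ (e - w)) ^ 2 * (v - w))%C =
      ((/ (e - v) * / (e - w) * / (e - w)) * ((v - w) * (v - w)))%C by rewrite /=; field.
    rewrite !Cmod_mult.
    have -> : Cmod (v - w) ^ 2 = Cmod (v - w) * Cmod (v - w) by ring.
    apply: Rmult_le_compat_r; first by apply: Rmult_le_pos; exact: Cmod_ge_0.
    apply: Rmult_le_compat; first by apply: Rmult_le_pos; exact: Cmod_ge_0.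
    + exact: Cmod_ge_0.
    + apply: Rmult_le_compat; try exact: Cmod_ge_0; exact: Cmod_inv_le.
    + exact: Cmod_inv_le.
  - move=> v Hv; apply: HCis.
    by have := Cmod_triangle_sub v w; move: Hv; rewrite /d; lra.
  - exact: HCis.
have D2 : forall w, Cmod w < exp x ->
    cdiff (fun w => circ (fun v => f v * v * (/ (v - w)) ^ 2)%C x) w
      (2 * circ (fun v => f v * v * (/ (v - w)) ^ 3)%C x)%C.
  move=> w Hw.
  pose d := (exp x - Cmod w) / 2.
  have Hd : 0 < d by rewrite /d; lra.
  apply: (cdiff_RInt_kernel (fun t w => (/ (cexp (x, t) - w)) ^ 2)%C
    (fun t w => 2 * (/ (cexp (x, t) - w)) ^ 3)%C _ _ _ _ _ _ B (3 * (/ d * / d * / d * / d)) d PI_le Hd HB0 HB).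
  - move=> t v Ht Hv.
    set e := cexp (x, t).
    have He : Cmod e = exp x by apply: Cmod_cexp_pair.
    have E1 : d <= Cmod (e - w) by apply: (Cmod_sub_lb _ _ _ _ He); rewrite /d; lra.
    have E2 : d <= Cmod (e - v).
      by apply: (Cmod_sub_lb _ _ _ _ He); have := Cmod_triangle_sub v w; move: Hv; rewrite /d; lra.
    have N1 : (e - w)%C <> 0 by apply/Cmod_gt_0; lra.
    have N2 : (e - v)%C <> 0 by apply/Cmod_gt_0; lra.
    have -> : ((/ (e - v)) ^ 2 - (/ (e - w)) ^ 2 - 2 * (/ (e - w)) ^ 3 * (v - w))%C =
      ((/ (e - v) * / (e - v) * / (e - w) * / (e - w) +
        2 * (/ (e - v) * / (e - w) * / (e - w) * / (e - w))) * ((v - w) * (v - w)))%C by rewrite /=; field.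
    rewrite Cmod_mult (Cmod_mult (v - w)).
    have -> : Cmod (v - w) ^ 2 = Cmod (v - w) * Cmod (v - w) by ring.
    apply: Rmult_le_compat_r; first by apply: Rmult_le_pos; exact: Cmod_ge_0.
    apply: Rle_trans; first exact: Cmod_triangle.
    rewrite !Cmod_mult Cmod_R (Rabs_right 2); last lra.
    have I1 := Cmod_inv_le _ _ Hd E1; have I2 := Cmod_inv_le _ _ Hd E2.
    have P1 := Cmod_ge_0 (/ (e - v)); have P2 := Cmod_ge_0 (/ (e - w)).
    have Q2 : Cmod (/ (e - v)) * Cmod (/ (e - w)) <= / d * / d by apply: Rmult_le_compat.
    have Q3 : Cmod (/ (e - w)) * Cmod (/ (e - w)) <= / d * / d by apply: Rmult_le_compat.
    have Q4 : (Cmod (/ (e - v)) * Cmod (/ (e - w))) * (Cmod (/ (e - v)) * Cmod (/ (e - w))) <= (/ d * / d) * (/ d * / d).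
      by apply: Rmult_le_compat => //; apply: Rmult_le_pos.
    have Q5 : (Cmod (/ (e - v)) * Cmod (/ (e - w))) * (Cmod (/ (e - w)) * Cmod (/ (e - w))) <= (/ d * / d) * (/ d * / d).
      by apply: Rmult_le_compat => //; apply: Rmult_le_pos.
    lra.
  - move=> v Hv; apply: HCis.
    by have := Cmod_triangle_sub v w; move: Hv; rewrite /d; lra.
  - have := Cis_scal _ _ _ 2 _ (HCis 3%nat w Hw).
    by apply: Cis_ext => [|t _]; [exact: PI_le | ring].
have H2P : RtoC (2 * PI) <> 0 by move/RtoC_inj; lra.
have F1 : forall w, Cmod w < exp x ->
    f w = (/ RtoC (2 * PI) * circ (fun v => f v * v * (/ (v - w)) ^ 1)%C x)%C.
  move=> w Hw.
  have -> : circ (fun v => f v * v * (/ (v - w)) ^ 1)%C x = circ (fun v => f v * (v / (v - w)))%C x.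
    rewrite /circ /Vint /cint; apply: (@RInt_ext C_R_CompleteNormedModule) => t _.
    by rewrite /Cdiv /=; ring.
  by rewrite (cauchy_formula f r w x Hholo Hw Hx); field.
have F2 : forall w, Cmod w < exp x ->
    f' w = (/ RtoC (2 * PI) * circ (fun v => f v * v * (/ (v - w)) ^ 2)%C x)%C.
  move=> w Hw.
  rewrite -(cdiff_unique _ _ _ (Hf w ltac:(lra))).
  apply: cdiff_unique.
  apply: cdiff_ext_loc (cdiff_scal _ _ _ _ (D1 w Hw)).
  apply/locally_C; exists (exp x - Cmod w); split; first lra.
  move=> v Hv; rewrite -F1 //.
  by have := Cmod_triangle_sub v w; lra.
split.
  rewrite F2 // Cmult_assoc Cinv_r // Cmult_1_l.
  rewrite /circ /Vint /cint; apply: (@RInt_ext C_R_CompleteNormedModule) => t _.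
  have N : (cexp (x, t) - z)%C <> 0.
    by apply: Csub_neq0 => E; move: Hz; rewrite -E Cmod_cexp_pair; lra.
  by rewrite /Cdiv /=; field.
eexists; apply: cdiff_ext_loc (cdiff_scal _ (/ RtoC (2 * PI))%C _ _ (D2 z Hz)).
apply/locally_C; exists (exp x - Cmod z); split; first lra.
move=> v Hv; rewrite -F2 //.
by have := Cmod_triangle_sub v z; lra.
Qed.

End CauchyDerivative.

Lemma holo_ext (r : R) (f g : C -> C) :
  (forall z, Cmod z < r -> f z = g z) -> holo r f -> holo r g.
Proof.
move=> H Hf z Hz; case: (Hf z Hz) => l Hl; exists l; apply: cdiff_ext_loc Hl.
apply/locally_C; exists (r - Cmod z); split; first lra.
by move=> w Hw; apply: H; have := Cmod_triangle_sub w z; lra.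
Qed.

Lemma holo_C_derive (r : R) (f : C -> C) (z : C) :
  holo r f -> Cmod z < r -> cdiff f z (C_derive f z).
Proof. by move=> Hf Hz; case: (Hf z Hz) => l Hl; rewrite (cdiff_unique _ _ _ Hl). Qed.

Lemma holo_derive (r : R) (f : C -> C) : holo r f -> holo r (C_derive f).
Proof.
move=> Hf z Hz.
pose s := (Cmod z + r) / 2.
have Hm := Cmod_ge_0 z.
have Es : exp (ln s) = s by apply: exp_ln; rewrite /s; lra.
case: (cauchy_derivative f (C_derive f) r (fun w Hw => holo_C_derive r f w Hf Hw) z (ln s)).
- by rewrite Es /s; lra.
- by rewrite Es /s; lra.
- by [].
Qed.

Lemma holo_plus (r : R) (f g : C -> C) : holo r f -> holo r g -> holo r (fun z => f z + g z)%C.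
Proof.
move=> Hf Hg z Hz; case: (Hf z Hz) => l Hl; case: (Hg z Hz) => m Hm.
by exists (l + m)%C; apply: cdiff_plus.
Qed.

Lemma holo_mult (r : R) (f g : C -> C) : holo r f -> holo r g -> holo r (fun z => f z * g z)%C.
Proof.
move=> Hf Hg z Hz; case: (Hf z Hz) => l Hl; case: (Hg z Hz) => m Hm.
by eexists; apply: cdiff_mult; eassumption.
Qed.

Lemma holo_scal (r : R) (k : C) (f : C -> C) : holo r f -> holo r (fun z => k * f z)%C.
Proof.
by move=> Hf z Hz; case: (Hf z Hz) => l Hl; eexists; apply: cdiff_scal; eassumption.
Qed.

Lemma holo_cexp (r : R) (f : C -> C) : holo r f -> holo r (fun z => cexp (f z)).
Proof.
move=> Hf z Hz; case: (Hf z Hz) => l Hl.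
by exists (cexp (f z) * l)%C; apply: cdiff_comp => //; apply: cdiff_cexp.
Qed.

Lemma holo_pow (r : R) (n : nat) : holo r (fun z => z ^ n)%C.
Proof.
move=> z Hz; case: n => [|n]; first by exists 0; exact: cdiff_const.
by eexists; apply: cdiff_pow.
Qed.

(** * Coefficients as circle integrals *)

Lemma cderive_n_S (n : nat) (f : C -> C) (z : C) :
  cderive_n (S n) f z = cderive_n n (C_derive f) z.
Proof.
have H : forall n f, cderive_n (S n) f = cderive_n n (C_derive f).
  by elim=> [|m IH] g //; rewrite -[LHS]/(C_derive (cderive_n (S m) g)) IH.
by rewrite H.
Qed.

Lemma zcoef_S (n : nat) (f : C -> C) :
  zcoef (S n) f = (zcoef n (C_derive f) / RtoC (INR (S n)))%C.
Proof.
rewrite /zcoef cderive_n_S fact_simpl mult_INR RtoC_mult.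
have H1 : RtoC (INR (Factorial.fact n)) <> 0 by move/RtoC_inj; exact: INR_fact_neq_0.
have H2 : RtoC (INR (S n)) <> 0 by move/RtoC_inj; apply: not_0_INR.
by field.
Qed.

Lemma zcoef_0 (f : C -> C) : zcoef 0 f = f 0.
Proof. by rewrite /zcoef /=; field. Qed.

Lemma circ_ext (f g : C -> C) (x : R) :
  (forall z, Cmod z = exp x -> f z = g z) -> circ f x = circ g x.
Proof.
move=> H; rewrite /circ /Vint /cint; apply: (@RInt_ext C_R_CompleteNormedModule) => t _.
by apply: H; rewrite Cmod_cexp_pair.
Qed.

Lemma exp_circle_neq0 (z : C) (x : R) : Cmod z = exp x -> z <> 0.
Proof. by move=> H; apply/Cmod_gt_0; rewrite H; apply: exp_pos. Qed.

(** Induction by integration by parts: the derivative of [f z / z^(n+1)] along the closed circle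
    integrates to 0, which trades [n + 1] times the integral for [f] at exponent [n + 1] against
    that for [C_derive f] at exponent [n]. Since dz is [i z] dt, no further power of [z] appears. *)
Theorem zcoef_circ (n : nat) (f : C -> C) (r x : R) :
  holo r f -> exp x < r ->
  circ (fun z => f z / z ^ n)%C x = (RtoC (2 * PI) * zcoef n f)%C.
Proof.
move=> Hf Hx; elim: n f Hf => [|n IH] f Hf.
  rewrite zcoef_0 -(cauchy_formula f r 0 x Hf); last done; last first.
    by rewrite Cmod_0; apply: exp_pos.
  apply: circ_ext => z /exp_circle_neq0 Hz /=.
  by field.
rewrite zcoef_S.
have HI := IH _ (holo_derive r f Hf).
have H2 : RtoC (INR (S n)) <> 0 by move/RtoC_inj; apply: not_0_INR.
have -> : (RtoC (2 * PI) * (zcoef n (C_derive f) / RtoC (INR (S n))))%C =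
  (RtoC (2 * PI) * zcoef n (C_derive f) / RtoC (INR (S n)))%C by field.
rewrite -HI.
have Hcont : forall g m, holo r g -> forall z, Cmod z = exp x -> ccont (fun z => g z / z ^ m)%C z.
  move=> g m Hg z Hz; apply: Clim_div.
  - by apply: Cpow_neq0; apply: exp_circle_neq0 Hz.
  - by case: (Hg z ltac:(lra)) => l; apply: cdiff_cont.
  - by apply: Clim_pow; apply: Clim_id.
have C1 := circ_correct _ x (Hcont _ n (holo_derive r f Hf)).
have C2 := Cis_scal _ _ _ (RtoC (INR (S n))) _ (circ_correct _ x (Hcont _ (S n) Hf)).
have C3 := Cis_scal _ _ _ Ci _ (Cis_minus _ _ _ _ _ _ C1 C2).
pose F t := (f (cexp (x, t)) * (/ cexp (x, t)) ^ S n)%C.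
have Hd : forall t, rdiff F t (Ci * (C_derive f (cexp (x, t)) / cexp (x, t) ^ n -
    RtoC (INR (S n)) * (f (cexp (x, t)) / cexp (x, t) ^ S n)))%C.
  move=> t.
  have N : cexp (x, t) <> 0 by apply: cexp_neq_0.
  have E1 : rdiff (fun t => cexp (x, t)) t (cexp (x, t) * Ci)%C.
    by apply: (cdiff_curve cexp (fun t => (x, t))); [exact: cdiff_cexp | exact: rdiff_vertical].
  have E2 := cdiff_curve _ (fun t => cexp (x, t)) t _ _
    (holo_C_derive r f (cexp (x, t)) Hf ltac:(rewrite Cmod_cexp_pair; lra)) E1.
  have E3 := cdiff_curve _ (fun t => cexp (x, t)) t _ _ (cdiff_inv _ N) E1.
  have E4 := cdiff_curve _ (fun t => / cexp (x, t))%C t _ _ (cdiff_pow (/ cexp (x, t))%C n) E3.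
  have := rdiff_mult _ _ _ _ _ E2 E4.
  rewrite /F.
  set a := cexp (x, t) in N *.
  have -> : (C_derive f a * (a * Ci) * (/ a) ^ S n +
    f a * (RtoC (INR (S n)) * (/ a) ^ n * (- / (a * a) * (a * Ci))))%C =
    (Ci * (C_derive f a / a ^ n - RtoC (INR (S n)) * (f a / a ^ S n)))%C.
    have Nn := Cpow_neq0 a n N.
    by rewrite !Cpow_inv //= ; field.
  exact.
have C4 : Cis (fun t => Ci * (C_derive f (cexp (x, t)) / cexp (x, t) ^ n -
    RtoC (INR (S n)) * (f (cexp (x, t)) / cexp (x, t) ^ S n)))%C (- PI) PI (F PI - F (- PI)%R)%C.
  apply: Cis_FTC; [exact: PI_le | by move=> t _; exact: Hd |].
  move=> t _.
  apply: (ccont_vertical (fun w => Ci * (C_derive f (cexp w) / cexp w ^ n -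
    RtoC (INR (S n)) * (f (cexp w) / cexp w ^ S n)))%C).
  apply: (ccont_comp_cexp (fun w => Ci * (C_derive f w / w ^ n -
    RtoC (INR (S n)) * (f w / w ^ S n)))%C).
  have Hm := Cmod_cexp_pair x t.
  apply: Clim_mult; first exact: Clim_const.
  apply: Clim_minus; first by apply: Hcont => //; apply: holo_derive.
  by apply: Clim_mult; [exact: Clim_const | exact: (Hcont f (S n))].
have E : (F PI - F (- PI)%R)%C = 0 by rewrite /F cexp_PI; ring.
have := Cis_unique _ _ _ _ C3.
rewrite (Cis_unique _ _ _ _ C4) E => H.
set A' := circ _ x in H *; set A := circ _ x in H *.
have {}H : (A' - RtoC (INR (S n)) * A)%C = 0.
  have -> : (A' - RtoC (INR (S n)) * A)%C = (- Ci * (Ci * (A' - RtoC (INR (S n)) * A)))%C.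
    by apply: injective_projections; rewrite /Ci /=; ring.
  by rewrite -H; ring.
have -> := proj2 (Ceq_minus _ _) H.
by field.
Qed.

Fixpoint csum (a : nat -> C) (n : nat) : C :=
  match n with O => 0 | S m => (csum a m + a m)%C end.

Lemma csum_ext (a b : nat -> C) (n : nat) :
  (forall k, (k < n)%nat -> a k = b k) -> csum a n = csum b n.
Proof.
elim: n => [|n IH] H //=; rewrite (H n); last lia.
by rewrite IH // => k Hk; apply: H; lia.
Qed.

Lemma csum_plus (a b : nat -> C) (n : nat) :
  csum (fun k => a k + b k)%C n = (csum a n + csum b n)%C.
Proof. by elim: n => [|n IH] /=; [ring | rewrite IH; ring]. Qed.

Lemma csum_scal (c : C) (a : nat -> C) (n : nat) :
  csum (fun k => c * a k)%C n = (c * csum a n)%C.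
Proof. by elim: n => [|n IH] /=; [ring | rewrite IH; ring]. Qed.

Lemma csum_S_r (a : nat -> C) (n : nat) : csum a (S n) = (csum a n + a n)%C.
Proof. by []. Qed.

Lemma csum_S_l (a : nat -> C) (n : nat) :
  csum a (S n) = (a O + csum (fun k => a (S k)) n)%C.
Proof. by elim: n => [|n IH]; [rewrite /=; ring | rewrite -/csum [LHS]/= -/(csum a (S n)) IH /=; ring]. Qed.

(** The functions agree on a disc only, while [zcoef] iterates derivatives of global functions. The
    circle integral sees just the values on the circle of radius [r / 2]. *)
Lemma zcoef_ext (n : nat) (f g : C -> C) (r : R) :
  0 < r -> holo r f -> (forall z, Cmod z < r -> f z = g z) -> zcoef n f = zcoef n g.
Proof.
move=> Hr Hf H.
have Es : exp (ln (r / 2)) = r / 2 by apply: exp_ln; lra.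
have H2P : RtoC (2 * PI) <> 0 by move/RtoC_inj; have := PI_RGT_0; lra.
have E1 := zcoef_circ n f r (ln (r / 2)) Hf ltac:(lra).
have E2 := zcoef_circ n g r (ln (r / 2)) (holo_ext _ _ _ H Hf) ltac:(lra).
have E3 : circ (fun z => f z / z ^ n)%C (ln (r / 2)) = circ (fun z => g z / z ^ n)%C (ln (r / 2)).
  by apply: circ_ext => z Hz; rewrite H //; lra.
have -> : zcoef n f = (/ RtoC (2 * PI) * (RtoC (2 * PI) * zcoef n f))%C by field.
by rewrite -E1 E3 E2; field.
Qed.

Lemma ccont_coef (f : C -> C) (n : nat) (r : R) (z : C) :
  holo r f -> Cmod z < r -> z <> 0 -> ccont (fun z => f z / z ^ n)%C z.
Proof.
move=> Hf Hz H0; apply: Clim_div.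
- exact: Cpow_neq0.
- by case: (Hf z Hz) => l; apply: cdiff_cont.
- by apply: Clim_pow; apply: Clim_id.
Qed.

Lemma circ_coef_correct (f : C -> C) (n : nat) (r x : R) :
  holo r f -> exp x < r ->
  Cis (fun t => f (cexp (x, t)) / cexp (x, t) ^ n)%C (- PI) PI (RtoC (2 * PI) * zcoef n f)%C.
Proof.
move=> Hf Hx; rewrite -(zcoef_circ n f r x) //.
apply: (circ_correct (fun z => f z / z ^ n)%C) => z Hz.
apply: (ccont_coef _ _ r) => //; first lra.
exact: exp_circle_neq0 Hz.
Qed.

Lemma Cmult_2PI_inj (a b : C) : (RtoC (2 * PI) * a = RtoC (2 * PI) * b)%C -> a = b.
Proof.
move=> H; have H2P : RtoC (2 * PI) <> 0 by move/RtoC_inj; have := PI_RGT_0; lra.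
have -> : a = (/ RtoC (2 * PI) * (RtoC (2 * PI) * a))%C by field.
by rewrite H; field.
Qed.

Lemma zcoef_plus (n : nat) (f g : C -> C) (r : R) :
  0 < r -> holo r f -> holo r g ->
  zcoef n (fun z => f z + g z)%C = (zcoef n f + zcoef n g)%C.
Proof.
move=> Hr Hf Hg; apply: Cmult_2PI_inj.
have Es : exp (ln (r / 2)) < r by rewrite exp_ln; lra.
rewrite Cmult_plus_distr_l.
have H := Cis_plus _ _ _ _ _ _ (circ_coef_correct f n r _ Hf Es) (circ_coef_correct g n r _ Hg Es).
rewrite -(Cis_unique _ _ _ _ H); apply: Logic.eq_sym.
rewrite -(Cis_unique _ _ _ _ (circ_coef_correct _ n r _ (holo_plus _ _ _ Hf Hg) Es)).
apply: (@RInt_ext C_R_CompleteNormedModule) => t _.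
by symmetry; apply: Cmult_plus_distr_r.
Qed.

Lemma zcoef_scal (n : nat) (k : C) (f : C -> C) (r : R) :
  0 < r -> holo r f -> zcoef n (fun z => k * f z)%C = (k * zcoef n f)%C.
Proof.
move=> Hr Hf; apply: Cmult_2PI_inj.
have Es : exp (ln (r / 2)) < r by rewrite exp_ln; lra.
have H := Cis_scal _ _ _ k _ (circ_coef_correct f n r _ Hf Es).
have -> : (RtoC (2 * PI) * (k * zcoef n f))%C = (k * (RtoC (2 * PI) * zcoef n f))%C by ring.
rewrite -(Cis_unique _ _ _ _ H); apply: Logic.eq_sym.
rewrite -(Cis_unique _ _ _ _ (circ_coef_correct _ n r _ (holo_scal _ k _ Hf) Es)).
apply: (@RInt_ext C_R_CompleteNormedModule) => t _.
exact: Cmult_assoc.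
Qed.

Lemma C_derive_mult (f g : C -> C) (r : R) (z : C) :
  holo r f -> holo r g -> Cmod z < r ->
  C_derive (fun z => f z * g z)%C z = (C_derive f z * g z + f z * C_derive g z)%C.
Proof.
move=> Hf Hg Hz; apply: cdiff_unique.
by apply: cdiff_mult; apply: (holo_C_derive r).
Qed.

Lemma INR_S_neq0 (n : nat) : RtoC (INR (S n)) <> 0.
Proof. by move/RtoC_inj; apply: not_0_INR. Qed.

(** The product rule under the induction: the weight [n + 1] is split as [k + (n + 1 - k)], whose
    two parts are the coefficients of [f' g] and [f g']. *)
Theorem zcoef_mult (n : nat) (f g : C -> C) (r : R) :
  0 < r -> holo r f -> holo r g ->
  zcoef n (fun z => f z * g z)%C = csum (fun k => zcoef k f * zcoef (n - k) g)%C (S n).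
Proof.
move=> Hr; elim: n f g => [|n IH] f g Hf Hg; first by rewrite /= !zcoef_0; ring.
have Hf' := holo_derive _ _ Hf; have Hg' := holo_derive _ _ Hg.
rewrite zcoef_S (zcoef_ext n _ (fun z => C_derive f z * g z + f z * C_derive g z)%C r) //; last first.
- by move=> z Hz; apply: (C_derive_mult _ _ r).
- by apply: holo_derive; apply: holo_mult.
rewrite (zcoef_plus n _ _ r) //; try by apply: holo_mult.
rewrite (IH _ _ Hf' Hg) (IH _ _ Hf Hg').
have Ef : forall k, zcoef k (C_derive f) = (RtoC (INR (S k)) * zcoef (S k) f)%C.
  by move=> k; rewrite zcoef_S; field; apply: INR_S_neq0.
have Eg : forall k, zcoef k (C_derive g) = (RtoC (INR (S k)) * zcoef (S k) g)%C.
  by move=> k; rewrite zcoef_S; field; apply: INR_S_neq0.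
set N := RtoC (INR (S n)).
have HN : N <> 0 by apply: INR_S_neq0.
suff : (csum (fun k => zcoef k (C_derive f) * zcoef (n - k) g) (S n) +
   csum (fun k => zcoef k f * zcoef (n - k) (C_derive g)) (S n))%C =
   (N * csum (fun k => zcoef k f * zcoef (S n - k) g) (S (S n)))%C by move=> ->; field.
rewrite -csum_scal.
rewrite (csum_ext (fun k => N * (zcoef k f * zcoef (S n - k) g))%C
  (fun k => RtoC (INR k) * (zcoef k f * zcoef (S n - k) g) +
     RtoC (INR (S n - k)) * (zcoef k f * zcoef (S n - k) g))%C); last first.
  move=> k Hk; rewrite -Cmult_plus_distr_r -RtoC_plus -plus_INR.
  by rewrite /N; congr (RtoC (INR _) * _)%C; lia.
rewrite csum_plus; congr Cplus.
- rewrite [RHS]csum_S_l [INR 0]/= Cmult_0_l Cplus_0_l.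
  by apply: csum_ext => k Hk; rewrite Ef Nat.sub_succ; ring.
- rewrite [RHS]csum_S_r Nat.sub_diag [INR 0]/= Cmult_0_l Cplus_0_r.
  apply: csum_ext => k Hk; rewrite Eg.
  have -> : (S n - k)%nat = S (n - k)%nat by lia.
  ring.
Qed.

(** Coefficients of [(exp G)' = G' exp G]. The cycle index will be shown to obey the same
    recurrence. *)
Lemma exp_coef_rec (G : C -> C) (r : R) (n : nat) :
  0 < r -> holo r G ->
  (RtoC (INR (S n)) * zcoef (S n) (fun z => cexp (G z)))%C =
  csum (fun k => RtoC (INR (S k)) * zcoef (S k) G * zcoef (n - k) (fun z => cexp (G z)))%C (S n).
Proof.
move=> Hr HG.
have HE := holo_cexp _ _ HG.
rewrite zcoef_S.
have -> : zcoef n (C_derive (fun z => cexp (G z))) = zcoef n (fun z => C_derive G z * cexp (G z))%C.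
  apply: (zcoef_ext n _ _ r) => //; first exact: holo_derive.
  move=> z Hz; rewrite Cmult_comm; apply: cdiff_unique.
  by apply: cdiff_comp; [exact: cdiff_cexp | exact: (holo_C_derive r)].
rewrite (zcoef_mult n _ _ r) //; last exact: holo_derive.
have HN := INR_S_neq0 n.
have -> : (RtoC (INR (S n)) * (csum (fun k => zcoef k (C_derive G) * zcoef (n - k) (fun z => cexp (G z))) (S n) / RtoC (INR (S n))))%C =
  csum (fun k => zcoef k (C_derive G) * zcoef (n - k) (fun z => cexp (G z)))%C (S n) by field.
apply: csum_ext => k Hk; congr Cmult.
by rewrite zcoef_S; field; apply: INR_S_neq0.
Qed.

Lemma zcoef_const (n : nat) (a : C) : zcoef (S n) (fun _ => a) = 0.
Proof.
rewrite zcoef_S.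
have E : zcoef n (C_derive (fun _ => a)) = zcoef n (fun _ => 0).
  apply: (zcoef_ext n _ _ 1); [lra | | by move=> z _; apply: cdiff_unique; apply: cdiff_const].
  by apply: holo_derive => z _; exists 0; apply: cdiff_const.
rewrite E.
have -> : zcoef n (fun _ => 0) = 0.
  have := zcoef_scal n 0 (fun _ => 0) 1 ltac:(lra) (fun z _ => ex_intro _ _ (cdiff_const 0 z)).
  rewrite [X in _ = X -> _]Cmult_0_l => H0; rewrite -[RHS]H0; apply: (zcoef_ext n _ _ 1); [lra | | by move=> z _; ring].
  by move=> z _; exists 0; apply: cdiff_const.
by rewrite /Cdiv Cmult_0_l.
Qed.

Lemma zcoef_pow (n m : nat) :
  zcoef n (fun z => z ^ m)%C = if Nat.eqb n m then RtoC 1 else RtoC 0.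
Proof.
elim: n m => [|n IH] [|m].
- by rewrite zcoef_0.
- by rewrite zcoef_0 /=; ring.
- exact: zcoef_const.
- rewrite zcoef_S.
  rewrite (zcoef_ext n _ (fun z => RtoC (INR (S m)) * z ^ m)%C 1); first last.
  + by move=> z _; apply: cdiff_unique; apply: cdiff_pow.
  + by apply: holo_derive; apply: holo_pow.
  + lra.
  rewrite (zcoef_scal n _ _ 1) ?IH; [|lra|exact: holo_pow].
  rewrite /=; case: Nat.eqb_spec => [->|H].
    by rewrite -/(INR (S m)); field; apply: (INR_S_neq0 m).
  by rewrite /Cdiv !Cmult_0_r Cmult_0_l.
Qed.

Lemma holo_csum (r : R) (a : nat -> C) (N : nat) : holo r (fun z => csum (fun m => a m * z ^ m)%C N).
Proof.
elim: N => [|N IH] /=; first by move=> z _; exists 0; apply: cdiff_const.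
by apply: holo_plus => //; apply: holo_scal; apply: holo_pow.
Qed.

Lemma zcoef_csum (n : nat) (a : nat -> C) (N : nat) :
  (n < N)%nat -> zcoef n (fun z => csum (fun m => a m * z ^ m)%C N) = a n.
Proof.
have H : forall N, zcoef n (fun z => csum (fun m => a m * z ^ m)%C N) = if Nat.ltb n N then a n else 0.
  elim=> [|M IH].
    case: n => [|n]; first by rewrite zcoef_0.
    exact: zcoef_const.
  rewrite /= (zcoef_plus n _ _ 1) ?IH; [|lra|exact: holo_csum|by apply: holo_scal; apply: holo_pow].
  rewrite (zcoef_scal n _ _ 1) ?zcoef_pow; [|lra|exact: holo_pow].
  case: (Nat.ltb_spec n M) => H1; case: (Nat.ltb_spec n (S M)) => H2; try lia;
    case: (Nat.eqb_spec n M) => H3; try lia; try ring.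
  by rewrite H3; ring.
by rewrite H => /Nat.ltb_lt ->.
Qed.

Lemma zcoef_bound (n : nat) (f : C -> C) (r x M : R) :
  holo r f -> exp x < r -> (forall z, Cmod z = exp x -> Cmod (f z) <= M) ->
  Cmod (zcoef n f) <= M / exp x ^ n.
Proof.
move=> Hf Hx HM; have HP := PI_RGT_0.
have Hp : 0 < exp x ^ n by apply: pow_lt; apply: exp_pos.
have := Cis_bound_const _ _ _ _ (M / exp x ^ n) PI_le _ (circ_coef_correct f n r x Hf Hx).
rewrite Cmod_mult Cmod_R Rabs_right; last lra.
have -> : PI - - PI = 2 * PI by ring.
move=> H; apply: (Rmult_le_reg_l (2 * PI)); first lra.
apply: H => t _; rewrite Cmod_div; last by apply: Cpow_neq0; apply: cexp_neq_0.
rewrite Cmod_pow Cmod_cexp_pair; apply: Rmult_le_compat_r; first by left; apply: Rinv_0_lt_compat.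
by apply: HM; rewrite Cmod_cexp_pair.
Qed.

(** * Coefficients of a convergent power series *)

Lemma Re_csum (a : nat -> C) (n : nat) : Re (csum a (S n)) = sum_n (fun k => Re (a k)) n.
Proof.
elim: n => [|n IH]; first by rewrite sum_O /= Rplus_0_l.
by rewrite sum_Sn -IH.
Qed.

Lemma Im_csum (a : nat -> C) (n : nat) : Im (csum a (S n)) = sum_n (fun k => Im (a k)) n.
Proof.
elim: n => [|n IH]; first by rewrite sum_O /= Rplus_0_l.
by rewrite sum_Sn -IH.
Qed.

Lemma Series_tail_le (u b : nat -> R) (N : nat) :
  (forall n, Rabs (u n) <= b n) -> ex_series b ->
  Rabs (Series u - sum_n u N) <= Series b - sum_n b N.
Proof.
move=> Hu Hb.
have Eu : ex_series (fun n => Rabs (u n)).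
  by apply: (@ex_series_le R_AbsRing R_CompleteNormedModule _ b) => // n; rewrite /norm /= /abs /= Rabs_Rabsolu.
have Eu' := ex_series_Rabs _ Eu.
rewrite (Series_incr_n u (S N)) //; last lia.
rewrite (Series_incr_n b (S N)) //; last lia.
rewrite /= -!sum_n_Reals.
have -> : sum_n u N + Series (fun k => u (S (N + k))) - sum_n u N = Series (fun k => u (S (N + k))) by ring.
have -> : sum_n b N + Series (fun k => b (S (N + k))) - sum_n b N = Series (fun k => b (S (N + k))) by ring.
have T1 : ex_series (fun k => Rabs (u (S (N + k)))).
  exact: (proj1 (ex_series_incr_n (fun n => Rabs (u n)) (S N)) Eu).
have T2 : ex_series (fun k => b (S (N + k))).
  exact: (proj1 (ex_series_incr_n b (S N)) Hb).
apply: Rle_trans; first exact: Series_Rabs.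
by apply: Series_le => // n; split; [exact: Rabs_pos | exact: Hu].
Qed.

(** The factor 2 is due to [cseries] summing real and imaginary parts separately. *)
Lemma cseries_approx (a : nat -> C) (b : nat -> R) (N : nat) :
  (forall n, Cmod (a n) <= b n) -> ex_series b ->
  Cmod (cseries a - csum a (S N)) <= 2 * (Series b - sum_n b N).
Proof.
move=> Ha Hb; apply: Rle_trans; first exact: Cmod_le_sum.
rewrite re_plus im_plus re_opp im_opp Re_csum Im_csum.
have H1 := Series_tail_le (fun n => Re (a n)) b N
  (fun n => Rle_trans _ _ _ (re_le_Cmod _) (Ha n)) Hb.
have H2 := Series_tail_le (fun n => Im (a n)) b N
  (fun n => Rle_trans _ _ _ (im_le_Cmod _) (Ha n)) Hb.
rewrite /cseries /Re /Im /= in H1 H2 *.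
rewrite /Rminus in H1 H2 *; lra.
Qed.

Lemma gcoef_nonneg (c : nat -> R) (n : nat) :
  (forall j, (1 <= j)%nat -> 0 <= c j) -> 0 <= gcoef c n.
Proof.
move=> H; case: n => [|n]; first by right.
apply: Rmult_le_pos; first by apply: H; lia.
by left; apply: Rinv_0_lt_compat; apply: lt_0_INR; lia.
Qed.

Lemma gcoef_summable (c : nat -> R) (Rad r : R) :
  CV_radius (gcoef c) = Finite Rad -> 0 <= r < Rad ->
  ex_series (fun n => Rabs (gcoef c n) * r ^ n).
Proof.
move=> HR Hr.
have := CV_disk_inside (gcoef c) r.
rewrite HR /CV_disk /= Rabs_right; last lra.
move=> /(_ (proj2 Hr)); apply: ex_series_ext => n.
by rewrite Rabs_mult (Rabs_right (r ^ n)) //; apply: Rle_ge; apply: pow_le; lra.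
Qed.

(** On the circle of radius [Rad / 2] a partial sum [P] approximates the series as closely as
    desired. Its coefficients are known, and Cauchy's estimate bounds that of the difference. *)
Theorem zcoef_gser (c : nat -> R) (Rad : R) (n : nat) :
  0 < Rad -> CV_radius (gcoef c) = Finite Rad -> holo Rad (gser c) ->
  zcoef n (gser c) = RtoC (gcoef c n).
Proof.
move=> HR0 HR Hh.
have Es : exp (ln (Rad / 2)) = Rad / 2 by apply: exp_ln; lra.
pose b n := Rabs (gcoef c n) * (Rad / 2) ^ n.
have Hb : ex_series b by apply: (gcoef_summable _ Rad) => //; lra.
apply/Ceq_minus; apply: Cmod_eq_0; apply: Rle_antisym; last exact: Cmod_ge_0.
apply: le_epsilon => e He; rewrite Rplus_0_l.
have Hp : 0 < (Rad / 2) ^ n by apply: pow_lt; lra.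
have Hlim : exists N, (n <= N)%nat /\ 2 * (Series b - sum_n b N) <= e * (Rad / 2) ^ n.
  have He' : 0 < e * (Rad / 2) ^ n / 2 by apply: Rdiv_lt_0_compat; [apply: Rmult_lt_0_compat | lra].
  have := Series_correct _ Hb.
  move=> /filterlim_locally /(_ (mkposreal _ He')) [N0 H].
  exists (Nat.max n N0); split; first lia.
  have {}H : Rabs (sum_n b (Nat.max n N0) - Series b) < e * (Rad / 2) ^ n / 2.
    exact: (H (Nat.max n N0) ltac:(lia)).
  by move/Rabs_def2: H; lra.
case: Hlim => N [HnN HN].
pose P z := csum (fun m => RtoC (gcoef c m) * z ^ m)%C (S N).
have HPh : holo Rad P by apply: (holo_csum _ (fun m => RtoC (gcoef c m))).
have -> : (zcoef n (gser c) - RtoC (gcoef c n))%C = zcoef n (fun z => gser c z + (- (1)) * P z)%C.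
  rewrite (zcoef_plus n _ _ Rad) //; last exact: holo_scal.
  rewrite (zcoef_scal n _ _ Rad) // (zcoef_csum n (fun m => RtoC (gcoef c m))); last lia.
  ring.
apply: Rle_trans.
  apply: (zcoef_bound n _ Rad (ln (Rad / 2)) (e * (Rad / 2) ^ n)).
  - by apply: holo_plus => //; apply: holo_scal.
  - lra.
  - move=> z Hz; apply: Rle_trans HN.
    have -> : (gser c z + - (1) * P z)%C = (gser c z - P z)%C by ring.
    apply: cseries_approx => // m.
    by rewrite Cmod_mult Cmod_R Cmod_pow Hz Es; right.
by rewrite Es; right; field; lra.
Qed.

(** * Integrals over the line *)

(** Only symmetric truncations are taken. Under a bound [K / (1 + s * s)], [line_asym] gives the
    limit with independent end points. *)
Definition is_line (h : R -> C) (L : C) :=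
  Clim (Rbar_locally p_infty) (fun S => cint h (- S) S) L.

Lemma is_RInt_inv_sqr (K a b : R) :
  0 < a <= b -> is_RInt (fun s => K / (s * s)) a b (K / a - K / b).
Proof.
move=> Hab.
have -> : K / a - K / b = minus (- (K / b)) (- (K / a)).
  by rewrite /minus /plus /opp /=; ring.
apply: (is_RInt_derive (fun s => - (K / s))) => x; rewrite Rmin_left ?Rmax_right; try lra; move=> Hx.
- by auto_derive; [lra | field; lra].
- apply: (ex_derive_continuous (fun s => K / (s * s))); auto_derive; nra.
Qed.

Lemma inv_1_sqr_le (K s : R) : 0 <= K -> s <> 0 -> K / (1 + s * s) <= K / (s * s).
Proof.
move=> HK Hs; apply: Rmult_le_compat_l => //; apply: Rinv_le_contravar; nra.
Qed.

Lemma tail_right (h : R -> C) (K a b : R) (l : C) :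
  0 <= K -> 0 < a <= b -> (forall s, a <= s <= b -> Cmod (h s) <= K / (1 + s * s)) ->
  Cis h a b l -> Cmod l <= K / a.
Proof.
move=> HK Hab H Hl.
apply: (Rle_trans _ (K / a - K / b)).
  apply: (Cis_bound h (fun s => K / (s * s)) a b) => //; first lra.
    move=> s Hs; apply: Rle_trans (H s Hs) _; apply: inv_1_sqr_le; lra.
  exact: is_RInt_inv_sqr.
have : 0 <= K / b by apply: Rmult_le_pos => //; left; apply: Rinv_0_lt_compat; lra.
lra.
Qed.

Lemma tail_left (h : R -> C) (K a b : R) (l : C) :
  0 <= K -> 0 < a <= b -> (forall s, a <= s <= b -> Cmod (h (- s)) <= K / (1 + s * s)) ->
  Cis h (- b) (- a) l -> Cmod l <= K / a.
Proof.
move=> HK Hab H Hl.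
have Hl' : Cis (fun s => - h (- s)%R)%C b a l.
  by apply: is_RInt_comp_opp; exact: Hl.
rewrite -Cmod_opp.
apply: (tail_right (fun s => - h (- s)%R)%C K a b) => //.
  by move=> s Hs; rewrite Cmod_opp; apply: H.
exact: Cis_swap.
Qed.

Lemma cint_tail (h : R -> C) (K a b b' : R) :
  0 <= K -> 0 < a <= b -> a <= b' -> (forall s, - b' <= s <= b -> rcont h s) ->
  (forall s, - b' <= s <= b -> Cmod (h s) <= K / (1 + s * s)) ->
  Cmod (cint h (- b') b - cint h (- a) a) <= 2 * K / a.
Proof.
move=> HK Hab Hab' Hc H.
have C1 : Cis h (- b') (- a) (cint h (- b') (- a)) by apply: Cis_cint => [|t Ht]; [lra | apply: Hc; lra].
have C2 : Cis h (- a) a (cint h (- a) a) by apply: Cis_cint => [|t Ht]; [lra | apply: Hc; lra].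
have C3 : Cis h a b (cint h a b) by apply: Cis_cint => [|t Ht]; [lra | apply: Hc; lra].
rewrite (Cis_unique _ _ _ _ (Cis_Chasles _ _ _ _ _ _ (Cis_Chasles _ _ _ _ _ _ C1 C2) C3)).
have -> : (cint h (- b') (- a) + cint h (- a) a + cint h a b - cint h (- a) a)%C =
  (cint h (- b') (- a) + cint h a b)%C by ring.
apply: Rle_trans; first exact: Cmod_triangle.
have -> : 2 * K / a = K / a + K / a by field; lra.
apply: Rplus_le_compat.
- apply: (tail_left h K a b') C1 => //; first lra.
  move=> s Hs; have -> : s * s = (- s) * (- s) by ring.
  by apply: H; lra.
- by apply: (tail_right h K a b) C3 => // s Hs; apply: H; lra.
Qed.

Lemma cint_sym_tail (h : R -> C) (K a b : R) :
  0 <= K -> 0 < a <= b -> (forall s, - b <= s <= b -> rcont h s) ->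
  (forall s, - b <= s <= b -> Cmod (h s) <= K / (1 + s * s)) ->
  Cmod (cint h (- b) b - cint h (- a) a) <= 2 * K / a.
Proof. by move=> HK Hab Hc H; apply: cint_tail => //; lra. Qed.

Lemma Clim_Cmod_le {T : Type} (F : (T -> Prop) -> Prop) {FF : ProperFilter F} (u : T -> C) (a b : C) (M : R) :
  Clim F u a -> F (fun x => Cmod (u x - b) <= M) -> Cmod (a - b) <= M.
Proof.
move=> Hu HM; apply: le_epsilon => e He.
have HF : F (fun x => Cmod (u x - a) < e /\ Cmod (u x - b) <= M) by apply: filter_and => //; apply: Hu.
case: (filter_ex _ HF) => x [H1 H2].
have := Cmod_triangle (a - u x) (u x - b).
have -> : (a - u x + (u x - b))%C = (a - b)%C by ring.
rewrite (Cmod_sub_sym a (u x)); lra.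
Qed.

Lemma line_ex (h : R -> C) (K : R) :
  0 <= K -> (forall s, rcont h s) -> (forall s, Cmod (h s) <= K / (1 + s * s)) ->
  exists L, is_line h L.
Proof.
move=> HK Hc H.
case: (proj1 (filterlim_locally_cauchy (F := Rbar_locally p_infty) (U := C_R_CompleteNormedModule) (fun S => cint h (- S) S))).
- move=> eps.
  pose A := 4 * K / eps + 1.
  have HA : 0 < A.
    have : 0 <= 4 * K / eps.
      by apply: Rmult_le_pos; [lra | left; apply: Rinv_0_lt_compat; exact: cond_pos].
    by rewrite /A; lra.
  have HA2 : 2 * K / A < eps / 2 \/ K = 0.
    case: (Req_dec K 0) => HK0; [by right | left].
    have He := cond_pos eps.
    apply: (Rmult_lt_reg_r A) => //.
    have -> : 2 * K / A * A = 2 * K by field; lra.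
    have -> : eps / 2 * A = 2 * K + eps / 2 by rewrite /A; field; lra.
    lra.
  exists (fun S => A < S); split; first by exists A.
  move=> u v Hu Hv; apply: C_NormedModule_mixin_compat1.
  change (Cmod (cint h (- v) v - cint h (- u) u) < eps).
  have H1 := cint_sym_tail h K A u HK ltac:(lra) (fun s _ => Hc s) (fun s _ => H s).
  have H2 := cint_sym_tail h K A v HK ltac:(lra) (fun s _ => Hc s) (fun s _ => H s).
  have := Cmod_triangle (cint h (- v) v - cint h (- A) A) (- (cint h (- u) u - cint h (- A) A)).
  rewrite Cmod_opp.
  have -> : (cint h (- v) v - cint h (- A) A + - (cint h (- u) u - cint h (- A) A))%C =
    (cint h (- v) v - cint h (- u) u)%C by ring.
  case: HA2 => HA2; first lra.
  have He := cond_pos eps.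
  by move: H1 H2; rewrite HA2 Rmult_0_r /Rdiv Rmult_0_l; lra.
- move=> L HL; exists L; exact: (proj2 (Clim_locally _ _ _) HL).
Qed.

Lemma line_tail (h : R -> C) (K A : R) (L : C) :
  0 <= K -> (forall s, rcont h s) -> (forall s, Cmod (h s) <= K / (1 + s * s)) ->
  is_line h L -> 0 < A -> Cmod (L - cint h (- A) A) <= 2 * K / A.
Proof.
move=> HK Hc H HL HA.
apply: (Clim_Cmod_le (Rbar_locally p_infty) _ L _ _ HL).
exists A => S HS; apply: cint_sym_tail => //; lra.
Qed.

Lemma line_tail_asym (h : R -> C) (K A B B' : R) (L : C) :
  0 <= K -> (forall s, rcont h s) -> (forall s, Cmod (h s) <= K / (1 + s * s)) ->
  is_line h L -> 0 < A -> A <= B -> A <= B' -> Cmod (cint h (- B') B - L) <= 4 * K / A.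
Proof.
move=> HK Hc H HL HA HB HB'.
have H1 := line_tail h K A L HK Hc H HL HA.
have H2 := cint_tail h K A B B' HK ltac:(lra) HB' (fun s _ => Hc s) (fun s _ => H s).
have := Cmod_triangle (cint h (- B') B - cint h (- A) A) (- (L - cint h (- A) A)).
rewrite Cmod_opp.
have -> : (cint h (- B') B - cint h (- A) A + - (L - cint h (- A) A))%C = (cint h (- B') B - L)%C by ring.
have -> : 4 * K / A = 2 * K / A + 2 * K / A by field; lra.
lra.
Qed.

Lemma line_asym (h : R -> C) (K : R) (L : C) :
  0 <= K -> (forall s, rcont h s) -> (forall s, Cmod (h s) <= K / (1 + s * s)) ->
  is_line h L -> forall e, 0 < e -> exists A, 0 < A /\ forall B B', A <= B -> A <= B' ->
    Cmod (cint h (- B') B - L) < e.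
Proof.
move=> HK Hc H HL e He.
exists (4 * K / e + 1).
have Hp : 0 <= 4 * K / e by apply: Rmult_le_pos; [lra | left; exact: Rinv_0_lt_compat].
split=> [|B B' HB HB']; first lra.
apply: (Rle_lt_trans _ (4 * K / (4 * K / e + 1))).
  by apply: (line_tail_asym h K) => //; lra.
apply: (Rmult_lt_reg_r (4 * K / e + 1)); first lra.
have -> : 4 * K / (4 * K / e + 1) * (4 * K / e + 1) = 4 * K by field; lra.
have -> : e * (4 * K / e + 1) = 4 * K + e by field; lra.
lra.
Qed.

(** The shift [nu] destroys the symmetry of the truncation, so the asymmetric limit is what carries
    the substitution. *)
Lemma line_affine (h : R -> C) (K mu nu : R) (L : C) :
  0 <= K -> (forall s, rcont h s) -> (forall s, Cmod (h s) <= K / (1 + s * s)) ->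
  0 < mu -> is_line h L -> is_line (fun y => RtoC mu * h (mu * y + nu)%R)%C L.
Proof.
move=> HK Hc H Hmu HL e He.
case: (line_asym h K L HK Hc H HL e He) => A [HA HAB].
exists (Rmax 0 ((A + Rabs nu) / mu)) => S HS.
have M1 := Rmax_l 0 ((A + Rabs nu) / mu); have M2 := Rmax_r 0 ((A + Rabs nu) / mu).
have H1 : A + Rabs nu < mu * S.
  have -> : A + Rabs nu = mu * ((A + Rabs nu) / mu) by field; lra.
  by apply: Rmult_lt_compat_l; lra.
have N1 := Rle_abs nu; have N2 := Rle_abs (- nu); rewrite Rabs_Ropp in N2.
have := HAB (mu * S + nu) (mu * S - nu) ltac:(lra) ltac:(lra).
have E : mu * - S + nu = - (mu * S - nu) by ring.
suff -> : cint (fun y => RtoC mu * h (mu * y + nu)%R)%C (- S) S = cint h (- (mu * S - nu)) (mu * S + nu) by [].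
apply: Cis_unique; apply: Cis_comp_lin; rewrite E.
by apply: Cis_cint => //; lra.
Qed.

Lemma line_unique (h : R -> C) (L L' : C) : is_line h L -> is_line h L' -> L = L'.
Proof. exact: Clim_unique. Qed.

Lemma line_plus (f g : R -> C) (L M : C) :
  (forall s, rcont f s) -> (forall s, rcont g s) ->
  is_line f L -> is_line g M -> is_line (fun s => f s + g s)%C (L + M)%C.
Proof.
move=> Hf Hg HL HM.
apply: Clim_ext_loc (Clim_plus _ _ _ _ HL HM).
exists 0 => S HS; apply: Logic.eq_sym; apply: Cis_unique.
by apply: Cis_plus; apply: Cis_cint => //; lra.
Qed.

Lemma line_scal (f : R -> C) (k L : C) :
  (forall s, rcont f s) -> is_line f L -> is_line (fun s => k * f s)%C (k * L)%C.
Proof.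
move=> Hf HL.
apply: Clim_ext_loc (Clim_mult _ _ _ _ (Clim_const k) HL).
exists 0 => S HS; apply: Logic.eq_sym; apply: Cis_unique.
by apply: Cis_scal; apply: Cis_cint => //; lra.
Qed.

Lemma line_bound (f : R -> C) (K : R) (L : C) :
  0 <= K -> (forall s, rcont f s) -> (forall s, Cmod (f s) <= K / (1 + s * s)) ->
  is_line f L -> Cmod L <= 4 * K.
Proof.
move=> HK Hc H HL.
have H1 := line_tail f K 1 L HK Hc H HL Rlt_0_1.
have H2 : Cmod (cint f (- (1)) 1) <= (1 - - (1)) * K.
  apply: (Cis_bound_const f) => //; first lra; last by apply: Cis_cint => //; lra.
  move=> t Ht; apply: Rle_trans (H t) _.
  rewrite -[X in _ <= X]Rdiv_1_r; apply: Rmult_le_compat_l => //.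
  by apply: Rinv_le_contravar; nra.
have := Cmod_triangle_sub L (cint f (- (1)) 1); lra.
Qed.

(** Uniform convergence on [|s| <= A] is made a limit along a filter on pairs, so that the rules for
    [Clim] apply to it unchanged. *)
Definition unif (A : R) (P : nat * R -> Prop) :=
  exists N0 : nat, forall N s, (N0 <= N)%nat -> Rabs s <= A -> P (N, s).

#[global] Instance unif_filter (A : R) : Filter (unif A).
Proof.
constructor.
- by exists 0%nat.
- move=> P Q [N1 H1] [N2 H2]; exists (Nat.max N1 N2) => N s HN Hs.
  by split; [apply: H1 | apply: H2] => //; lia.
- by move=> P Q H [N1 H1]; exists N1 => N s HN Hs; apply: H; apply: H1.
Qed.

(** The domination enters only through tails of size [K / A], uniform for large [N]. Hence [I N] may
    be an integral over the whole line or over an interval growing with [N]. *)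
Lemma dominated_convergence (I : nat -> C) (h : nat -> R -> C) (L : C) (g : R -> C) (K : R) :
  0 <= K -> (forall s, rcont g s) ->
  (forall A, 0 < A -> unif A (fun p => rcont (h (fst p)) (snd p))) ->
  (forall A, 0 < A -> eventually (fun N => Cmod (I N - cint (h N) (- A) A) <= K / A)) ->
  (forall A, 0 < A -> Cmod (L - cint g (- A) A) <= K / A) ->
  (forall A, 0 < A -> Clim (unif A) (fun p => h (fst p) (snd p) - g (snd p))%C 0) ->
  Clim eventually I L.
Proof.
move=> HK Hg Hh HI HL Hlim e He.
pose A := 4 * K / e + 1.
have HA : 0 < A.
  have : 0 <= 4 * K / e by apply: Rmult_le_pos; [lra | left; exact: Rinv_0_lt_compat].
  by rewrite /A; lra.
have HKA : K / A <= e / 4.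
  apply: (Rmult_le_reg_r A) => //.
  have -> : K / A * A = K by field; lra.
  have -> : e / 4 * A = K + e / 4 by rewrite /A; field; lra.
  lra.
have He' : 0 < e / (8 * A) by apply: Rdiv_lt_0_compat; lra.
case: (Hh A HA) => N1 H1; case: (HI A HA) => N2 H2; case: (Hlim A HA _ He') => N3 H3.
exists (Nat.max N1 (Nat.max N2 N3)) => N HN.
have {}H2 := H2 N ltac:(lia).
have H4 := HL A HA.
have H5 : Cmod (cint (h N) (- A) A - cint g (- A) A) <= (A - - A) * (e / (8 * A)).
  apply: (Cis_bound_const (fun s => h N s - g s)%C); first lra; last first.
    apply: Cis_minus; apply: Cis_cint => //; try lra.
    by move=> t Ht; apply: (H1 N t); [lia | apply: Rabs_le; lra].
  move=> t Ht; left.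
  have := H3 N t ltac:(lia) ltac:(apply: Rabs_le; lra).
  by have -> : (h (fst (N, t)) (snd (N, t)) - g (snd (N, t)) - 0)%C = (h N t - g t)%C by rewrite /=; ring.
have E : (A - - A) * (e / (8 * A)) = e / 4 by field; lra.
have T1 := Cmod_triangle (I N - cint (h N) (- A) A) (cint (h N) (- A) A - cint g (- A) A - (L - cint g (- A) A)).
have T2 := Cmod_triangle (cint (h N) (- A) A - cint g (- A) A) (- (L - cint g (- A) A)).
rewrite Cmod_opp in T2.
have E1 : (I N - cint (h N) (- A) A + (cint (h N) (- A) A - cint g (- A) A - (L - cint g (- A) A)))%C = (I N - L)%C by ring.
rewrite E1 in T1; rewrite /Cminus in T1 T2 H2 H4 H5 *; lra.
Qed.

(** * The kernel of J on a vertical line *)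

Lemma clog_right (x y : R) : 0 < x -> clog (x, y) = (ln (Cmod (x, y)), atan (y / x)).
Proof. by move=> Hx; rewrite /clog /carg /=; case: Rlt_dec. Qed.

Lemma Cmod_sqrt (x y : R) : Cmod (x, y) = sqrt (x * x + y * y).
Proof. by rewrite /Cmod /=; congr sqrt; ring. Qed.

Lemma cexp_clog_right (z : C) : 0 < Re z -> cexp (clog z) = z.
Proof.
case: z => x y /= Hx; rewrite clog_right // /cexp /= exp_ln; last first.
  by apply/Cmod_gt_0 => H; move: Hx; rewrite (_ : x = fst (x, y)) // H /=; lra.
rewrite cos_atan sin_atan Cmod_sqrt.
have -> : x * x + y * y = (x * x) * (1 + (y / x)²) by rewrite /Rsqr; field; lra.
have Hp : 0 < 1 + (y / x)² by have := Rle_0_sqr (y / x); lra.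
rewrite sqrt_mult; [|nra|lra].
rewrite sqrt_square; last lra.
have Hs : 0 < sqrt (1 + (y / x)²) by apply: sqrt_lt_R0.
by apply: injective_projections => /=; field; lra.
Qed.

(** The open strip avoids the cut. On each branch of [carg] the argument is [atan (tan y)] up to a
    shift by 0, [PI] or [- PI]; the imaginary axis is treated apart. *)
Lemma clog_cexp (x y : R) : - PI < y < PI -> clog (cexp (x, y)) = (x, y).
Proof.
move=> Hy; rewrite /clog Cmod_cexp /= ln_exp; congr pair.
rewrite /carg /cexp /=.
have Hex := exp_pos x.
have HP := PI_RGT_0.
case: Rlt_dec => H1.
- have Hc : 0 < cos y by apply: (Rmult_lt_reg_l (exp x)) => //; lra.
  have -> : exp x * sin y / (exp x * cos y) = tan y by rewrite /tan; field; lra.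
  rewrite atan_tan //.
  case: (Rlt_dec y (PI / 2)) => A1; case: (Rlt_dec (- PI / 2) y) => A2; try lra.
  + by have := cos_le_0 (- y); rewrite cos_neg => /(_ ltac:(lra) ltac:(lra)); lra.
  + by have := cos_le_0 y ltac:(lra) ltac:(lra); lra.
- have Hc : cos y <= 0 by apply: Rnot_lt_le => H; apply: H1; apply: Rmult_lt_0_compat.
  have Hrange : PI / 2 <= y \/ y <= - (PI / 2).
    case: (Rle_dec (PI / 2) y) => A1; first by left.
    case: (Rle_dec y (- (PI / 2))) => A2; first by right.
    by have := cos_gt_0 y ltac:(lra) ltac:(lra); lra.
  case: Rlt_dec => H2.
  + have Hc' : cos y <> 0 by move=> E; move: H2; rewrite E; lra.
    have -> : exp x * sin y / (exp x * cos y) = tan y by rewrite /tan; field; lra.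
    case: Rle_dec => H3.
    * have Hy2 : PI / 2 <= y.
        case: Hrange => // H.
        have : 0 < sin (- y) by apply: sin_gt_0; lra.
        by rewrite sin_neg; nra.
      have Hy3 : PI / 2 < y.
        by case: Hy2 => // E; move: Hc'; rewrite -E cos_PI2; lra.
      have -> : tan y = tan (y - PI).
        by rewrite /tan sin_minus cos_minus sin_PI cos_PI; field.
      rewrite atan_tan; lra.
    * have Hy2 : y <= - (PI / 2).
        case: Hrange => // H.
        have : 0 < sin y by apply: sin_gt_0; lra.
        by move=> ?; exfalso; apply: H3; nra.
      have Hy3 : y < - (PI / 2).
        by case: Hy2 => // E; move: Hc'; rewrite E cos_neg cos_PI2; lra.
      have -> : tan y = tan (y + PI).
        by rewrite /tan sin_plus cos_plus sin_PI cos_PI; field.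
      rewrite atan_tan; lra.
  + have Hc0 : cos y = 0 by nra.
    case: Hrange => H.
    * have Hs : 0 < sin y by apply: sin_gt_0; lra.
      case: Rlt_dec => H3; last by exfalso; apply: H3; nra.
      case: H => // H.
      have : cos y < 0 by apply: cos_lt_0; lra.
      lra.
    * have Hs : sin y < 0 by have : 0 < sin (- y); [apply: sin_gt_0; lra | rewrite sin_neg; lra].
      case: Rlt_dec => H3; first by exfalso; nra.
      case: Rlt_dec => H4; last by exfalso; apply: H4; nra.
      case: H => // H.
      have : cos (- y) < 0 by apply: cos_lt_0; lra.
      rewrite cos_neg; lra.
Qed.

Lemma carg_right_bound (z : C) : 0 < Re z -> - PI / 2 < Im (clog z) < PI / 2.
Proof. by case: z => x y Hx; rewrite clog_right //; exact: atan_bound. Qed.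

(** The two arguments are below [PI / 2] in absolute value, so their sum does not leave the
    principal strip. *)
Lemma clog_mult_right (a b : C) : 0 < Re a -> 0 < Re b -> clog (a * b) = (clog a + clog b)%C.
Proof.
move=> Ha Hb.
have A1 := carg_right_bound a Ha; have B1 := carg_right_bound b Hb.
rewrite -{1}(cexp_clog_right a Ha) -{1}(cexp_clog_right b Hb) -cexp_plus.
have -> : (clog a + clog b)%C = (Re (clog a) + Re (clog b), Im (clog a) + Im (clog b)) by [].
apply: clog_cexp; lra.
Qed.

(** With this orientation [Rad * exp (- mu * zl 1 s)] runs through its circle with the increasing
    argument [mu * s]. *)
Definition zl (c s : R) : C := (c, - s).

(** With [z = c - i s], [lk c sg xi s = z^(-sg) exp (xi z + z^2)]. *)
Definition lk (c sg xi s : R) : C :=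
  cexp (- RtoC sg * clog (zl c s) + (RtoC xi * zl c s + zl c s * zl c s)).

Lemma zl_neq0 (c s : R) : 0 < c -> zl c s <> 0.
Proof. by move=> Hc H; move: Hc; rewrite (_ : c = fst (zl c s)) // H /=; lra. Qed.

Lemma rdiff_zl (c s : R) : rdiff (zl c) s (- Ci)%C.
Proof.
by apply: (derive_rdiff _ _ (- 0) (- 1)); rewrite /zl /Re /Im /=; auto_derive => //; ring.
Qed.

Lemma rdiff_clog_zl (c s : R) : 0 < c -> rdiff (fun s => clog (zl c s)) s (- Ci / zl c s)%C.
Proof.
move=> Hc.
have Hp : 0 < c * c + s * s by nra.
have -> : (- Ci / zl c s)%C = (s / (c * c + s * s), - c / (c * c + s * s)).
  by apply: injective_projections; rewrite /zl /=; field; nra.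
have E : forall s, clog (zl c s) = (ln (sqrt (c * c + s * s)), atan (- s / c)).
  by move=> t; rewrite /zl clog_right // Cmod_sqrt; congr (ln (sqrt _), _); ring.
apply: derive_rdiff.
- apply: (is_derive_ext (fun s => ln (sqrt (c * c + s * s)))) => [t|]; first by rewrite E.
  have Hs : 0 < sqrt (c * c + s * s) by apply: sqrt_lt_R0.
  auto_derive; first by do ! split => //.
  have {3}-> : c * c + s * s = sqrt (c * c + s * s) * sqrt (c * c + s * s) by rewrite sqrt_sqrt; lra.
  by field; lra.
- apply: (is_derive_ext (fun s => atan (- s / c))) => [t|]; first by rewrite E.
  auto_derive; first lra.
  by rewrite /Rsqr; field; split; nra.
Qed.

Lemma lk_succ (c sg xi s : R) : 0 < c -> lk c (sg + 1) xi s = (lk c sg xi s / zl c s)%C.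
Proof.
move=> Hc; rewrite /lk.
have -> : (- RtoC (sg + 1) * clog (zl c s) + (RtoC xi * zl c s + zl c s * zl c s))%C =
  ((- RtoC sg * clog (zl c s) + (RtoC xi * zl c s + zl c s * zl c s)) + - clog (zl c s))%C.
  by rewrite RtoC_plus; ring.
by rewrite cexp_plus cexp_opp cexp_clog_right.
Qed.

Lemma lk_pred (c sg xi s : R) : 0 < c -> lk c (sg - 1) xi s = (lk c sg xi s * zl c s)%C.
Proof.
move=> Hc; have -> : sg = (sg - 1) + 1 by ring.
rewrite lk_succ //; have -> : sg - 1 + 1 - 1 = sg - 1 by ring.
by field; apply: zl_neq0.
Qed.

Lemma rdiff_lk (c sg xi s : R) : 0 < c ->
  rdiff (lk c sg xi) s (- Ci * (- RtoC sg * lk c (sg + 1) xi s + RtoC xi * lk c sg xi s +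
     2 * lk c (sg - 1) xi s))%C.
Proof.
move=> Hc.
have Hz := zl_neq0 c s Hc.
have D0 := rdiff_zl c s.
have D1 := rdiff_scal _ (- RtoC sg)%C _ _ (rdiff_clog_zl c s Hc).
have D2 := rdiff_scal _ (RtoC xi) _ _ D0.
have D3 := rdiff_mult _ _ _ _ _ D0 D0.
have D4 := rdiff_minus _ _ _ _ _ D1 (rdiff_minus _ _ _ _ _ (rdiff_scal _ (- (1))%C _ _ D2) D3).
have D5 := cdiff_curve cexp _ s _ _ (cdiff_cexp _) D4.
rewrite lk_succ // lk_pred //.
have E : forall t, lk c sg xi t = cexp (- RtoC sg * clog (zl c t) - (- (1) * (RtoC xi * zl c t) - zl c t * zl c t)).
  by move=> t; rewrite /lk; congr cexp; ring.
case: D5 => p [Hp [Hps Hpl]].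
exists p; split; last split.
- by move=> t; rewrite !E; apply: Hp.
- by rewrite Hps E; field.
- have -> : (- Ci * (- RtoC sg * (lk c sg xi s / zl c s) + RtoC xi * lk c sg xi s + 2 * (lk c sg xi s * zl c s)))%C = p s; last by rewrite Hps.
  by rewrite Hps E; field.
Qed.

Lemma rcont_lk (c sg xi s : R) : 0 < c -> rcont (lk c sg xi) s.
Proof. by move=> Hc; apply: rdiff_cont; apply: rdiff_lk. Qed.

Lemma ln_Cmod_zl (c s : R) : 0 < c -> Rabs (ln (Cmod (zl c s))) <= Rabs (ln c) + c + Rabs s.
Proof.
move=> Hc.
have H1 : c <= Cmod (zl c s).
  by have := re_le_Cmod (zl c s); rewrite /zl /Re /= Rabs_right; lra.
have H2 : Cmod (zl c s) <= c + Rabs s.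
  apply: Rle_trans; first exact: Cmod_le_sum.
  by rewrite /zl /Re /Im /= Rabs_Ropp (Rabs_right c); lra.
have H3 : ln c <= ln (Cmod (zl c s)).
  by case: H1 => [H1|<-]; [left; apply: ln_increasing | right].
have H4 : ln (Cmod (zl c s)) <= Cmod (zl c s).
  have := exp_ineq1_le (ln (Cmod (zl c s))); rewrite exp_ln; lra.
have := Rabs_pos s; have := Rabs_pos (ln c).
have := Rle_abs (- ln c); rewrite Rabs_Ropp => ? ? ?.
by apply: Rabs_le; lra.
Qed.

Lemma Cmod_lk (c sg xi s : R) :
  Cmod (lk c sg xi s) = exp (- sg * ln (Cmod (zl c s)) + (xi * c + (c * c - s * s))).
Proof.
rewrite /lk Cmod_cexp; congr exp.
by rewrite /clog /zl /Re /Im /=; ring.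
Qed.

Lemma exp_le (x y : R) : x <= y -> exp x <= exp y.
Proof. by case=> [H|->]; [left; apply: exp_increasing | right]. Qed.

Lemma exp_half_sqr_le (s : R) : exp (- (s * s) / 2) <= 2 / (1 + s * s).
Proof.
have H := exp_ineq1_le (s * s / 2).
have -> : - (s * s) / 2 = - (s * s / 2) by field.
rewrite exp_Ropp.
have Hp := exp_pos (s * s / 2).
have -> : 2 / (1 + s * s) = / ((1 + s * s) / 2) by field; nra.
by apply: Rinv_le_contravar; nra.
Qed.

Lemma exp_linear_sqr_le (a b s : R) : 0 <= b ->
  exp (a + b * Rabs s - s * s) <= 2 * exp (a + b * b / 2) / (1 + s * s).
Proof.
move=> Hb.
apply: (Rle_trans _ (exp (a + b * b / 2) * exp (- (s * s) / 2))).
  rewrite -exp_plus; apply: exp_le.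
  have -> : s * s = Rabs s * Rabs s by rewrite -Rabs_mult Rabs_right //; nra.
  have := pow2_ge_0 (b - Rabs s); nra.
have -> : 2 * exp (a + b * b / 2) / (1 + s * s) = exp (a + b * b / 2) * (2 / (1 + s * s)) by field; nra.
apply: Rmult_le_compat_l; first by left; exact: exp_pos.
exact: exp_half_sqr_le.
Qed.

(** The power of [z] grows at most like [exp (|sg| * |s|)], which the Gaussian factor absorbs
    together with the weight. The weight leaves room for differentiating in [xi]. *)
Lemma lk_bound (c sg xi b : R) : 0 < c -> 0 <= b ->
  exists K, 0 <= K /\ forall s, Cmod (lk c sg xi s) * exp (b * Rabs s) <= K / (1 + s * s).
Proof.
move=> Hc Hb.
pose a := Rabs sg * (Rabs (ln c) + c) + xi * c + c * c.
have Hsg := Rabs_pos sg.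
exists (2 * exp (a + (Rabs sg + b) * (Rabs sg + b) / 2)); split.
  by have := exp_pos (a + (Rabs sg + b) * (Rabs sg + b) / 2); lra.
move=> s; rewrite Cmod_lk -exp_plus.
apply: (Rle_trans _ (exp (a + (Rabs sg + b) * Rabs s - s * s))); last by apply: exp_linear_sqr_le; lra.
apply: exp_le.
have H := ln_Cmod_zl c s Hc.
have H2 : - sg * ln (Cmod (zl c s)) <= Rabs sg * (Rabs (ln c) + c + Rabs s).
  apply: Rle_trans; first exact: Rle_abs.
  rewrite Rabs_mult Rabs_Ropp; exact: Rmult_le_compat_l.
rewrite /a; lra.
Qed.

Lemma lk_bound0 (c sg xi : R) : 0 < c ->
  exists K, 0 <= K /\ forall s, Cmod (lk c sg xi s) <= K / (1 + s * s).
Proof.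
move=> Hc; case: (lk_bound c sg xi 0 Hc (Rle_refl 0)) => K [HK H]; exists K; split=> // s.
by have := H s; rewrite Rmult_0_l exp_0 Rmult_1_r.
Qed.

(** A total function, for use in derivatives with respect to [xi]; for [0 < c] the choice is the
    actual limit by [LI_correct]. *)
Definition LI (c sg xi : R) : C := epsilon (inhabits (RtoC 0)) (is_line (lk c sg xi)).

Lemma LI_correct (c sg xi : R) : 0 < c -> is_line (lk c sg xi) (LI c sg xi).
Proof.
move=> Hc; apply: epsilon_spec; case: (lk_bound0 c sg xi Hc) => K [HK H].
exact: (line_ex _ K HK (fun s => rcont_lk c sg xi s Hc) H).
Qed.

Lemma bound_Clim_0 (h : R -> C) (K : R) :
  0 <= K -> (forall s, Cmod (h s) <= K / (1 + s * s)) ->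
  Clim (Rbar_locally p_infty) h 0 /\ Clim (Rbar_locally p_infty) (fun s => h (- s)) 0.
Proof.
move=> HK H.
have Hv : forall e, 0 < e -> Rbar_locally p_infty (fun s => K / (1 + s * s) < e).
  move=> e He; exists (Rmax 1 (K / e)) => s Hs.
  have M1 := Rmax_l 1 (K / e); have M2 := Rmax_r 1 (K / e).
  apply: (Rmult_lt_reg_r (1 + s * s)); first nra.
  have -> : K / (1 + s * s) * (1 + s * s) = K by field; nra.
  have : K / e * e < s * e by apply: Rmult_lt_compat_r => //; lra.
  have -> : K / e * e = K by field; lra.
  nra.
split; apply: (Clim_squeeze _ (fun s => K / (1 + s * s)) _ _ Hv); apply: filter_forall => s.
- by have -> : (h s - 0)%C = h s by ring.
- have -> : (h (- s)%R - 0)%C = h (- s) by ring.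
  by have -> : s * s = (- s) * (- s) by ring.
Qed.

(* Integration by parts over the whole line. *)
Lemma LI_rec (c sg xi : R) : 0 < c ->
  (RtoC sg * LI c (sg + 1) xi = RtoC xi * LI c sg xi + 2 * LI c (sg - 1) xi)%C.
Proof.
move=> Hc.
have C1 := LI_correct c (sg + 1) xi Hc; have C2 := LI_correct c sg xi Hc.
have C3 := LI_correct c (sg - 1) xi Hc.
have R1 := fun s => rcont_lk c (sg + 1) xi s Hc; have R2 := fun s => rcont_lk c sg xi s Hc.
have R3 := fun s => rcont_lk c (sg - 1) xi s Hc.
have sc : forall (k : C) f, (forall s, rcont f s) -> forall s, rcont (fun s => k * f s)%C s.
  by move=> k f Hf s; apply: Clim_mult; [exact: Clim_const | exact: Hf].
have pl : forall f g, (forall s, rcont f s) -> (forall s, rcont g s) -> forall s, rcont (fun s => f s + g s)%C s.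
  by move=> f g Hf Hg s; apply: Clim_plus; [exact: Hf | exact: Hg].
have P12 := line_plus _ _ _ _ (sc (- RtoC sg)%C _ R1) (sc (RtoC xi) _ R2)
   (line_scal _ (- RtoC sg)%C _ R1 C1) (line_scal _ (RtoC xi) _ R2 C2).
have R12 := pl _ _ (sc (- RtoC sg)%C _ R1) (sc (RtoC xi) _ R2).
have P123 := line_plus _ _ _ _ R12 (sc (RtoC 2) _ R3) P12 (line_scal _ (RtoC 2) _ R3 C3).
have R123 := pl _ _ R12 (sc (RtoC 2) _ R3).
have P := line_scal _ (- Ci)%C _ R123 P123.
have RR := sc (- Ci)%C _ R123.
have Z : is_line (fun s => - Ci * (- RtoC sg * lk c (sg + 1) xi s + RtoC xi * lk c sg xi s +
     2 * lk c (sg - 1) xi s))%C 0.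
  case: (lk_bound0 c sg xi Hc) => K [HK H].
  case: (bound_Clim_0 _ K HK H) => Z1 Z2.
  have -> : RtoC 0 = (0 - 0)%C by ring.
  apply: Clim_ext_loc (Clim_minus _ _ _ _ Z1 Z2).
  exists 0 => S HS; apply: Logic.eq_sym; apply: Cis_unique.
  apply: Cis_FTC; [lra | by move=> t _; exact: rdiff_lk | by move=> t _; exact: RR].
have := line_unique _ _ _ P Z => E.
have {}E : (- RtoC sg * LI c (sg + 1) xi + RtoC xi * LI c sg xi + 2 * LI c (sg - 1) xi)%C = 0.
  have -> : (- RtoC sg * LI c (sg + 1) xi + RtoC xi * LI c sg xi + 2 * LI c (sg - 1) xi)%C =
    (Ci * (- Ci * (- RtoC sg * LI c (sg + 1) xi + RtoC xi * LI c sg xi + 2 * LI c (sg - 1) xi)))%C.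
    by apply: injective_projections; rewrite /Ci /=; ring.
  by rewrite E; ring.
have -> : (RtoC xi * LI c sg xi + 2 * LI c (sg - 1) xi)%C =
  ((- RtoC sg * LI c (sg + 1) xi + RtoC xi * LI c sg xi + 2 * LI c (sg - 1) xi) + RtoC sg * LI c (sg + 1) xi)%C by ring.
by rewrite E; ring.
Qed.

Lemma is_derive_quad (f : R -> R) (t l M : R) :
  (forall h, Rabs h <= 1 -> Rabs (f (t + h) - f t - l * h) <= M * (h * h)) -> is_derive f t l.
Proof.
move=> H; apply/is_derive_Reals => e He.
have HM : 0 < Rabs M + 1 by have := Rabs_pos M; lra.
have Hm : 0 < Rmin 1 (e / (Rabs M + 1)) by apply: Rmin_pos; [lra | apply: Rdiv_lt_0_compat].
exists (mkposreal _ Hm) => h Hh /= Hlt.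
have M1 := Rmin_l 1 (e / (Rabs M + 1)); have M2 := Rmin_r 1 (e / (Rabs M + 1)).
have {}H := H h ltac:(lra).
have Hpos : 0 < Rabs h by apply: Rabs_pos_lt.
have -> : (f (t + h) - f t) / h - l = (f (t + h) - f t - l * h) / h by field.
rewrite Rabs_div //; apply: (Rmult_lt_reg_r (Rabs h)) => //.
rewrite /Rdiv Rmult_assoc Rinv_l; last lra.
rewrite Rmult_1_r; apply: Rle_lt_trans H _.
have -> : h * h = Rabs h * Rabs h by rewrite -Rabs_mult Rabs_right //; nra.
have : Rabs h * (Rabs M + 1) < e.
  have -> : e = e / (Rabs M + 1) * (Rabs M + 1) by field; lra.
  by apply: Rmult_lt_compat_r; lra.
have := Rle_abs M; nra.
Qed.

(** A derivative in [xi] brings down a factor [z], that is, lowers [sg] by one. In the remainder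
    [h^2 z^2 exp |h z|] the square is absorbed by passing to [sg - 2] and the exponential by the
    weight [b = 1]. *)
Lemma LI_derive (c sg xi : R) : 0 < c ->
  is_derive (fun xi => Re (LI c sg xi)) xi (Re (LI c (sg - 1) xi)).
Proof.
move=> Hc.
case: (lk_bound c (sg - 2) xi 1 Hc Rle_0_1) => K [HK H].
pose M := 2 * exp c * K.
have HM : 0 <= M by rewrite /M; have := exp_pos c; nra.
apply: (is_derive_quad _ _ _ (4 * M)) => h Hh.
have C0 := LI_correct c sg xi Hc; have C1 := LI_correct c sg (xi + h) Hc.
have C2 := LI_correct c (sg - 1) xi Hc.
have R0 := fun s => rcont_lk c sg xi s Hc; have R1 := fun s => rcont_lk c sg (xi + h) s Hc.
have R2 := fun s => rcont_lk c (sg - 1) xi s Hc.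
have sc : forall (k : C) f, (forall s, rcont f s) -> forall s, rcont (fun s => k * f s)%C s.
  by move=> k f Hf s; apply: Clim_mult; [exact: Clim_const | exact: Hf].
have pl : forall f g, (forall s, rcont f s) -> (forall s, rcont g s) -> forall s, rcont (fun s => f s + g s)%C s.
  by move=> f g Hf Hg s; apply: Clim_plus; [exact: Hf | exact: Hg].
have P01 := line_plus _ _ _ _ R1 (sc (- (1))%C _ R0) C1 (line_scal _ (- (1))%C _ R0 C0).
have R01 := pl _ _ R1 (sc (- (1))%C _ R0).
have P := line_plus _ _ _ _ R01 (sc (- RtoC h)%C _ R2) P01 (line_scal _ (- RtoC h)%C _ R2 C2).
have RR := pl _ _ R01 (sc (- RtoC h)%C _ R2).
have E : Cmod (LI c sg (xi + h) + - (1) * LI c sg xi + - RtoC h * LI c (sg - 1) xi) <= 4 * (M * (h * h)).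
  apply: line_bound P => //; first by apply: Rmult_le_pos => //; nra.
  move=> s.
  set z := zl c s.
  have Ez : lk c sg (xi + h) s = (lk c sg xi s * cexp (RtoC h * z))%C.
    by rewrite /lk -cexp_plus; congr cexp; rewrite RtoC_plus -/z; ring.
  have -> : (lk c sg (xi + h) s + - (1) * lk c sg xi s + - RtoC h * lk c (sg - 1) xi s)%C =
    (lk c sg xi s * (cexp (RtoC h * z) - 1 - RtoC h * z))%C.
    by rewrite Ez lk_pred // -/z; ring.
  have B := cexp_sub1_sub_le (RtoC h * z).
  have Hz : Cmod z <= c + Rabs s.
    apply: Rle_trans; first exact: Cmod_le_sum.
    by rewrite /z /zl /Re /Im /= Rabs_Ropp (Rabs_right c); lra.
  have Hz0 := Cmod_ge_0 z.
  have Ehz : Cmod (RtoC h * z) = Rabs h * Cmod z by rewrite Cmod_mult Cmod_R.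
  rewrite Ehz in B.
  have E2 : exp (Rabs h * Cmod z) <= exp c * exp (1 * Rabs s).
    rewrite -exp_plus; apply: exp_le; have := Rabs_pos h; nra.
  have E3 : Cmod (lk c (sg - 2) xi s) = Cmod (lk c sg xi s) * (Cmod z * Cmod z).
    have -> : sg - 2 = sg - 1 - 1 by ring.
    by rewrite !lk_pred // -/z !Cmod_mult; ring.
  have Hs := H s; rewrite E3 in Hs.
  rewrite Cmod_mult.
  apply: (Rle_trans _ (Cmod (lk c sg xi s) * (2 * (Rabs h * Cmod z) ^ 2 * (exp c * exp (1 * Rabs s))))).
    apply: Rmult_le_compat_l; first exact: Cmod_ge_0.
    apply: Rle_trans B _; apply: Rmult_le_compat_l => //.
    by have := pow2_ge_0 (Rabs h * Cmod z); lra.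
  have -> : Cmod (lk c sg xi s) * (2 * (Rabs h * Cmod z) ^ 2 * (exp c * exp (1 * Rabs s))) =
    (2 * exp c * (Rabs h * Rabs h)) * (Cmod (lk c sg xi s) * (Cmod z * Cmod z) * exp (1 * Rabs s)) by ring.
  have -> : M * (h * h) / (1 + s * s) = (2 * exp c * (h * h)) * (K / (1 + s * s)) by rewrite /M; field; nra.
  have -> : Rabs h * Rabs h = h * h by rewrite -Rabs_mult Rabs_right //; nra.
  apply: Rmult_le_compat_l => //.
  by apply: Rmult_le_pos; [have := exp_pos c; lra | nra].
have {1}-> : Re (LI c sg (xi + h)) - Re (LI c sg xi) - Re (LI c (sg - 1) xi) * h =
  Re (LI c sg (xi + h) + - (1) * LI c sg xi + - RtoC h * LI c (sg - 1) xi).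
  by rewrite /Re /=; ring.
apply: Rle_trans; first exact: re_le_Cmod.
by apply: Rle_trans E _; lra.
Qed.

(** * From the Hankel contour to a vertical line *)

(** The integrand of [Jfun] in the coordinate [-w = exp v], where it becomes entire. *)
Definition jker (sg xi : R) (v : C) : C :=
  cexp ((1 - RtoC sg) * v + (RtoC xi * cexp v + cexp v * cexp v)).

Lemma jker_cdiff (sg xi : R) (v : C) : exists l, cdiff (jker sg xi) v l.
Proof.
have D := cdiff_cexp v.
eexists; apply: cdiff_comp; first exact: cdiff_cexp.
apply: cdiff_plus; first by apply: cdiff_scal; exact: cdiff_id.
by apply: cdiff_plus; [apply: cdiff_scal; exact: D | apply: cdiff_mult; exact: D].
Qed.

(** With an entire primitive every piece of contour becomes a difference of end values, so moving
    the contour amounts to comparing end points at infinity. *)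
Lemma jker_primitive (sg xi : R) : exists P, forall v, cdiff P v (jker sg xi v).
Proof.
case: (strip_primitive (fun _ => True) (jker sg xi) 0) => // [x _|z _|P H].
- by exists 1; split; [lra |].
- exact: jker_cdiff.
- by exists P => v; apply: H.
Qed.

Lemma jker_cont (sg xi : R) (v : C) : ccont (jker sg xi) v.
Proof. by case: (jker_cdiff sg xi v) => l; apply: cdiff_cont. Qed.

Section Primitive.
Variables (sg xi : R) (P : C -> C).
Hypothesis HP : forall v, cdiff P v (jker sg xi v).

Lemma primitive_vertical (x a b M : R) :
  a <= b -> (forall t, a <= t <= b -> Cmod (jker sg xi (x, t)) <= M) ->
  Cmod (P (x, b) - P (x, a)) <= (b - a) * M.
Proof.
move=> Hab HM.
apply: (Cis_bound_const (fun t => jker sg xi (x, t) * Ci)%C) => //.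
  by move=> t Ht; rewrite Cmod_mult Cmod_Ci Rmult_1_r; apply: HM.
apply: (Cis_FTC (fun t => P (x, t))) => // t _.
  by apply: cdiff_curve; [exact: HP | exact: rdiff_vertical].
by apply: Clim_mult; [apply: ccont_vertical; exact: jker_cont | exact: Clim_const].
Qed.

Lemma jker_clog (c s : R) : 0 < c -> jker sg xi (clog (zl c s)) = (lk c sg xi s * zl c s)%C.
Proof.
move=> Hc; have Ez := cexp_clog_right (zl c s) Hc.
rewrite /jker /lk Ez -[X in _ = (_ * X)%C]Ez -cexp_plus.
by congr cexp; ring.
Qed.

Lemma primitive_line (c a b : R) : 0 < c -> a <= b ->
  Cis (fun s => - Ci * lk c sg xi s)%C a b (P (clog (zl c b)) - P (clog (zl c a)))%C.
Proof.
move=> Hc Hab.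
apply: (Cis_FTC (fun s => P (clog (zl c s)))) => // t _; last first.
  by apply: Clim_mult; [exact: Clim_const | exact: rcont_lk].
have -> : (- Ci * lk c sg xi t)%C = (jker sg xi (clog (zl c t)) * (- Ci / zl c t))%C.
  by rewrite jker_clog //; field; apply: zl_neq0.
by apply: cdiff_curve; [exact: HP | exact: rdiff_clog_zl].
Qed.

Lemma cos_range (x t : R) : 0 <= x -> - (2 * PI / 3) <= t <= 2 * PI / 3 -> cos t <= x -> cos t ^ 2 <= / 4 + x ^ 2.
Proof.
move=> Hx Ht Hc.
have : - / 2 <= cos t.
  have HP0 := PI_RGT_0.
  have E : cos (2 * PI / 3) = - / 2.
    have -> : 2 * PI / 3 = 2 * (PI / 3) by field.
    by rewrite cos_2PI3; field.
  case: (Rle_dec 0 t) => H0.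
  - by rewrite -E; apply: cos_decr_1; lra.
  - by rewrite -(cos_neg t) -E; apply: cos_decr_1; lra.
by move=> H; case: (Rle_dec 0 (cos t)) => H0; nra.
Qed.

Lemma Re_jker (x t : R) :
  Cmod (jker sg xi (x, t)) =
  exp ((1 - sg) * x + (xi * (exp x * cos t) + (exp x) ^ 2 * (2 * cos t ^ 2 - 1))).
Proof.
rewrite /jker Cmod_cexp; congr exp.
rewrite /cexp /Re /Im /=.
have := sin2_cos2 t; rewrite /Rsqr => H.
have -> : exp x * sin t * (exp x * sin t) = exp x * exp x * (sin t * sin t) by ring.
have -> : sin t * sin t = 1 - cos t * cos t by lra.
ring.
Qed.

(** The condition on [cos t] describes the region between the vertical line of abscissa [c] and the
    rays of angle [2 * PI / 3]. There the real part of the square of [exp v] is at most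
    [2 c^2 - exp (2 x) / 2], which beats the linear terms collected in [B]. *)
Lemma jker_decay (c : R) : 0 < c -> exists K, 0 <= K /\ forall x t,
  0 <= x -> cos t ^ 2 <= / 4 + (c / exp x) ^ 2 ->
  Cmod (jker sg xi (x, t)) <= K / (1 + exp x * exp x).
Proof.
move=> Hc.
pose B := 2 * (Rabs (1 - sg) + Rabs xi).
pose D := 2 * (c * c).
have HB : 0 <= B by rewrite /B; have := Rabs_pos (1 - sg); have := Rabs_pos xi; lra.
have H4 : exists K, 0 <= K /\ forall y, 0 <= y -> exp (B * y + D - y * y / 2) <= K / (1 + y * y).
  exists (2 * (2 * exp (D + B * B))); split; first by have := exp_pos (D + B * B); lra.
  move=> y Hy.
  have := exp_half_sqr_le (y * sqrt (/ 2)).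
  have Hs : sqrt (/ 2) * sqrt (/ 2) = / 2 by rewrite sqrt_sqrt; lra.
  have -> : y * sqrt (/ 2) * (y * sqrt (/ 2)) = y * y / 2.
    have -> : y * sqrt (/ 2) * (y * sqrt (/ 2)) = y * y * (sqrt (/ 2) * sqrt (/ 2)) by ring.
    by rewrite Hs.
  move=> H.
  apply: (Rle_trans _ (exp (D + B * B) * exp (- (y * y / 2) / 2))).
    by rewrite -exp_plus; apply: exp_le; have := pow2_ge_0 (B - y / 2); nra.
  apply: (Rle_trans _ (exp (D + B * B) * (2 / (1 + y * y / 2)))).
    by apply: Rmult_le_compat_l => //; left; exact: exp_pos.
  have -> : 2 * (2 * exp (D + B * B)) / (1 + y * y) = exp (D + B * B) * (4 / (1 + y * y)) by field; nra.
  apply: Rmult_le_compat_l; first by left; exact: exp_pos.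
  apply: (Rmult_le_reg_r ((1 + y * y / 2) * (1 + y * y))); first nra.
  have -> : 2 / (1 + y * y / 2) * ((1 + y * y / 2) * (1 + y * y)) = 2 * (1 + y * y) by field; nra.
  have -> : 4 / (1 + y * y) * ((1 + y * y / 2) * (1 + y * y)) = 4 * (1 + y * y / 2) by field; nra.
  nra.
case: H4 => K [HK H4]; exists K; split=> // x t Hx H3.
have Hy := exp_pos x.
rewrite Re_jker; apply: Rle_trans (H4 (exp x) (Rlt_le _ _ Hy)).
apply: exp_le.
have Hy1 : x <= exp x by have := exp_ineq1_le x; lra.
have H1 : (1 - sg) * x <= Rabs (1 - sg) * exp x.
  have := Rle_abs (1 - sg); have := Rabs_pos (1 - sg); nra.
have Hcos := COS_bound t.
have H2 : xi * (exp x * cos t) <= Rabs xi * exp x.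
  apply: Rle_trans; first exact: Rle_abs.
  rewrite Rabs_mult; apply: Rmult_le_compat_l; first exact: Rabs_pos.
  rewrite Rabs_mult (Rabs_right (exp x)); last lra.
  have : Rabs (cos t) <= 1 by apply: Rabs_le; lra.
  have := Rabs_pos (cos t); nra.
have H5 : exp x ^ 2 * (2 * cos t ^ 2 - 1) <= D - exp x * exp x / 2.
  have -> : D - exp x * exp x / 2 = exp x ^ 2 * (2 * (/ 4 + (c / exp x) ^ 2) - 1).
    by rewrite /D; field; lra.
  apply: Rmult_le_compat_l; [exact: pow2_ge_0 | lra].
have := Rabs_pos (1 - sg); have := Rabs_pos xi; rewrite /B; nra.
Qed.

(* Both directions of the line are handled at once through the sign [e]. *)
Lemma primitive_ray_line (c e : R) : 0 < c -> e * e = 1 ->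
  Clim (Rbar_locally p_infty)
    (fun S => P (ln (sqrt (c * c + S * S)%R), (e * (2 * PI / 3))%R) - P (clog (zl c (- (e * S))%R)))%C 0.
Proof.
move=> Hc He.
case: (jker_decay c Hc) => K [HK H].
have HP0 := PI_RGT_0.
apply: (Clim_squeeze _ (fun S => PI * (K / (1 + (c * c + S * S))))).
  exists 1 => S HS.
  have Hr : 0 < c * c + S * S by nra.
  have Hq : 0 < sqrt (c * c + S * S) by apply: sqrt_lt_R0.
  set x := ln (sqrt (c * c + S * S)).
  have Ex : exp x = sqrt (c * c + S * S) by apply: exp_ln.
  have Exx : exp x * exp x = c * c + S * S by rewrite Ex sqrt_sqrt; lra.
  have Hx : 0 <= x.
    rewrite -ln_1 /x; left; apply: ln_increasing; first lra.
    rewrite -sqrt_1; apply: sqrt_lt_1; nra.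
  (* The point of the line and the point of the ray with the same modulus are joined by an arc. In
     the coordinate [v] it is a vertical segment of length at most [PI], running from [th] to
     [2 * PI / 3], on which [jker_decay] applies. *)
  pose th := atan (S / c).
  have Hth : 0 < th < PI / 2.
    split; last by case: (atan_bound (S / c)).
    rewrite -atan_0; apply: atan_increasing; apply: Rdiv_lt_0_compat; lra.
  have Ecl : clog (zl c (- (e * S))%R) = (x, e * th).
    rewrite /zl clog_right // Cmod_sqrt; congr pair.
      have -> : - - (e * S) * - - (e * S) = (e * e) * (S * S) by ring.
      by rewrite He Rmult_1_l.
    have : e = 1 \/ e = - 1.
      have : (e - 1) * (e + 1) = 0 by ring_simplify; lra.
      by move/Rmult_integral; lra.
    case=> ->.
      have -> : - - (1 * S) / c = S / c by field; lra.
      by rewrite /th; ring.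
    have -> : - - (-1 * S) / c = - (S / c) by field; lra.
    by rewrite atan_opp /th; ring.
  have Hcosth : exp x * cos th = c.
    rewrite /th cos_atan Ex.
    have -> : c * c + S * S = c * c * (1 + (S / c)²) by rewrite /Rsqr; field; lra.
    have Hp : 0 < 1 + (S / c)² by have := Rle_0_sqr (S / c); lra.
    rewrite sqrt_mult ?sqrt_square; try nra.
    by field; have := sqrt_lt_R0 _ Hp; lra.
  have Hdec : forall t, th <= t <= 2 * PI / 3 -> cos t ^ 2 <= / 4 + (c / exp x) ^ 2.
    move=> t Ht.
    have Hce : c / exp x = cos th by rewrite -Hcosth; field; have := exp_pos x; lra.
    rewrite Hce; apply: cos_range; [by left; apply: cos_gt_0; lra | lra |].
    by apply: cos_decr_1; lra.
  rewrite Ecl.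
  have -> : (P (x, (e * (2 * PI / 3))%R) - P (x, (e * th)%R) - 0)%C = (P (x, (e * (2 * PI / 3))%R) - P (x, (e * th)%R))%C by ring.
  have : e = 1 \/ e = - 1.
    have : (e - 1) * (e + 1) = 0 by ring_simplify; lra.
    by move/Rmult_integral; lra.
  rewrite -Exx.
  have HM : 0 <= K / (1 + exp x * exp x).
    by apply: Rmult_le_pos => //; left; apply: Rinv_0_lt_compat; nra.
  case=> ->.
  - rewrite !Rmult_1_l.
    apply: (Rle_trans _ ((2 * PI / 3 - th) * (K / (1 + exp x * exp x)))); last by apply: Rmult_le_compat_r => //; lra.
    apply: primitive_vertical; first lra.
    by move=> t Ht; apply: H; [done | exact: Hdec].
  - rewrite Cmod_sub_sym.
    apply: (Rle_trans _ ((-1 * th - -1 * (2 * PI / 3)) * (K / (1 + exp x * exp x)))); last by apply: Rmult_le_compat_r => //; lra.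
    apply: primitive_vertical; first lra.
    move=> t Ht; apply: H; first done.
    by rewrite -cos_neg; apply: Hdec; lra.
move=> d Hd.
exists (Rmax 1 (PI * K / d)) => S HS.
have M1 := Rmax_l 1 (PI * K / d); have M2 := Rmax_r 1 (PI * K / d).
have Hp : 0 < 1 + (c * c + S * S) by nra.
apply: (Rmult_lt_reg_r (1 + (c * c + S * S))) => //.
have -> : PI * (K / (1 + (c * c + S * S))) * (1 + (c * c + S * S)) = PI * K by field; lra.
have : PI * K / d * d < S * d by apply: Rmult_lt_compat_r; lra.
have -> : PI * K / d * d = PI * K by field; lra.
have : S * d <= (1 + (c * c + S * S)) * d by apply: Rmult_le_compat_r; nra.
lra.
Qed.

(** The limit at each end is needed separately, whereas [is_line] would only give their
    difference. *)
Lemma primitive_line_cauchy (c e : R) : 0 < c -> e * e = 1 ->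
  exists L, Clim (Rbar_locally p_infty) (fun S => P (clog (zl c (- (e * S))%R))) L.
Proof.
move=> Hc He.
case: (lk_bound0 c sg xi Hc) => K [HK H].
case: (proj1 (filterlim_locally_cauchy (F := Rbar_locally p_infty) (U := C_R_CompleteNormedModule)
   (fun S => P (clog (zl c (- (e * S))%R))))); last first.
  by move=> L HL; exists L; exact: (proj2 (Clim_locally _ _ _) HL).
have E : e = 1 \/ e = - 1.
  have : (e - 1) * (e + 1) = 0 by ring_simplify; lra.
  by move/Rmult_integral; lra.
have HT : forall a b, 0 < a <= b -> Cmod (P (clog (zl c (- (e * b)))) - P (clog (zl c (- (e * a))))) <= K / a.
  move=> a b Hab.
  have HCi : forall s, Cmod (- Ci * lk c sg xi s) <= K / (1 + s * s).
    by move=> s; rewrite Cmod_mult Cmod_opp Cmod_Ci Rmult_1_l.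
  case: E => ->.
  - rewrite !Rmult_1_l Cmod_sub_sym.
    apply: (tail_left (fun s => - Ci * lk c sg xi s)%C K a b) => //.
      by move=> s _; have -> : s * s = - s * - s by ring; apply: HCi.
    by apply: primitive_line => //; lra.
  - have -> : - (-1 * b) = b by ring.
    have -> : - (-1 * a) = a by ring.
    apply: (tail_right (fun s => - Ci * lk c sg xi s)%C K a b) => //.
    by apply: primitive_line => //; lra.
move=> eps; have Heps := cond_pos eps.
exists (fun S => 2 * K / eps + 1 < S); split; first by exists (2 * K / eps + 1).
have HK2 : 0 <= 2 * K / eps by apply: Rmult_le_pos; [lra | left; exact: Rinv_0_lt_compat].
have HKa : forall a, 2 * K / eps + 1 < a -> K / a < eps.
  move=> a Ha; apply: (Rmult_lt_reg_r a); first lra.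
  have -> : K / a * a = K by field; lra.
  have : 2 * K / eps * eps < a * eps by apply: Rmult_lt_compat_r; lra.
  have -> : 2 * K / eps * eps = 2 * K by field; lra.
  move=> ?; case: (Req_dec K 0) => HK0; last lra.
  rewrite HK0; nra.
move=> u v Hu Hv; apply: C_NormedModule_mixin_compat1.
change (Cmod (P (clog (zl c (- (e * v)))) - P (clog (zl c (- (e * u))))) < eps).
case: (Rle_dec u v) => Huv.
- apply: Rle_lt_trans (HKa u Hu); apply: HT; lra.
- rewrite Cmod_sub_sym; apply: Rle_lt_trans (HKa v Hv); apply: HT; lra.
Qed.

End Primitive.

Lemma filterlim_sqrt_shift (c : R) : 0 < c ->
  filterlim (fun Y => sqrt (Y * Y - c * c)) (Rbar_locally p_infty) (Rbar_locally p_infty).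
Proof.
move=> Hc Q [M HM]; exists (Rabs M + c) => Y HY; apply: HM.
have HM0 := Rabs_pos M; have HM1 := Rle_abs M.
apply: (Rle_lt_trans _ (sqrt (Rabs M * Rabs M))); first by rewrite sqrt_square.
by apply: sqrt_lt_1; nra.
Qed.

(** The line is parametrised by height and the ray by modulus; [S = sqrt (Y^2 - c^2)] matches the
    moduli. *)
Lemma primitive_ray (sg xi : R) (P : C -> C) (c e : R) (L : C) :
  (forall v, cdiff P v (jker sg xi v)) -> 0 < c -> e * e = 1 ->
  Clim (Rbar_locally p_infty) (fun S => P (clog (zl c (- (e * S))%R))) L ->
  Clim (Rbar_locally p_infty) (fun Y => P (ln Y, (e * (2 * PI / 3))%R)) L.
Proof.
move=> HP Hc He HL.
have H := Clim_plus _ _ _ _ (primitive_ray_line sg xi P HP c e Hc He) HL.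
rewrite Cplus_0_l in H.
have {}H : Clim (Rbar_locally p_infty) (fun S => P (ln (sqrt (c * c + S * S)%R), (e * (2 * PI / 3))%R)) L.
  by apply: Clim_ext (H _) => S; ring.
move=> d Hd.
have := filterlim_sqrt_shift c Hc _ (H d Hd); rewrite /filtermap => H1.
have H2 : Rbar_locally p_infty (fun Y => c < Y) by exists c.
apply: (Fimp (filter_and _ _ H1 H2)) => Y [H3 H4].
have E : sqrt (c * c + sqrt (Y * Y - c * c) * sqrt (Y * Y - c * c)) = Y.
  rewrite sqrt_sqrt; last nra.
  have -> : c * c + (Y * Y - c * c) = Y * Y by ring.
  by rewrite sqrt_square; lra.
by rewrite E in H3.
Qed.

Lemma cint_to_infty_eq (g : R -> C) (a : R) (I : R -> C) (L : C) :
  (forall b, a <= b -> Cis g a b (I b)) -> Clim (Rbar_locally p_infty) I L ->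
  cint_to_infty g a = L.
Proof.
move=> HI HL.
suff H : @is_RInt_gen C_R_NormedModule g (at_point a) (Rbar_locally p_infty) L.
  exact: (@is_RInt_gen_unique C_R_CompleteNormedModule _ _ (Proper_StrongProper _ (at_point_filter a))
    (Proper_StrongProper _ (Rbar_locally_filter p_infty)) _ _ H).
move=> Q HQ.
have H1 : Rbar_locally p_infty (fun b => Q (I b)) by exact: (proj1 (Clim_locally _ _ _) HL Q HQ).
have H2 : Rbar_locally p_infty (fun b => a < b) by exists a.
apply: (Filter_prod _ _ _ (fun x => x = a) (fun b => a < b /\ Q (I b))) => //.
- exact: filter_and H2 H1.
- move=> x y -> [Hy HQy]; exists (I y); split=> //=.
  by apply: HI; lra.
Qed.

Lemma cexp_sub_PI (x t : R) : cexp (x, t - PI) = (- cexp (x, t))%C.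
Proof.
by rewrite /cexp /= cos_minus sin_minus cos_PI sin_PI; apply: injective_projections; rewrite /=; ring.
Qed.

Lemma cexp_ln (y t : R) : 0 < y -> (RtoC y * cexp (0, t))%C = cexp (ln y, t).
Proof.
by move=> Hy; rewrite /cexp /= exp_ln // exp_0; apply: injective_projections; rewrite /=; ring.
Qed.

(** As [v] lies in the principal strip, the branch of the power is [exp (- sg * v)]. The division by
    [cexp v] is undone by the Jacobian of [-w = exp v]. *)
Lemma Jfun_integrand (sg xi : R) (w v : C) :
  - PI < Im v < PI -> (- w)%C = cexp v ->
  (cpow (- w) (- RtoC sg) * cexp (- (RtoC xi * w) + w * w))%C = (jker sg xi v / cexp v)%C.
Proof.
move=> Hv Hw.
have -> : (- (RtoC xi * w) + w * w)%C = (RtoC xi * cexp v + cexp v * cexp v)%C by rewrite -Hw; ring.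
rewrite Hw /cpow; case: Ceq_dec => H; first by case: (cexp_neq_0 v).
have -> : clog (cexp v) = v by case: (v) Hv => x y; exact: clog_cexp.
rewrite /jker.
have -> : ((1 - RtoC sg) * v + (RtoC xi * cexp v + cexp v * cexp v))%C =
  (v + (- RtoC sg * v + (RtoC xi * cexp v + cexp v * cexp v)))%C by ring.
rewrite (cexp_plus v) (cexp_plus (- RtoC sg * v)).
by field; exact: cexp_neq_0.
Qed.

Section JLine.
Variables (sg xi : R) (P : C -> C).
Hypothesis HP : forall v, cdiff P v (jker sg xi v).
Let h (w : C) := (cpow (- w) (- RtoC sg) * cexp (- (RtoC xi * w) + w * w))%C.

(** Here [t'] is the argument of [w] and [t] that of [-w]; they differ by [PI], so the rays at
    [- PI / 3] and [PI / 3] become horizontal lines at heights [2 * PI / 3] and [- (2 * PI / 3)]. *)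
Lemma Jfun_ray (t t' : R) (L : C) :
  - PI < t < PI -> cexp (0, t') = (- cexp (0, t))%C ->
  Clim (Rbar_locally p_infty) (fun Y => P (ln Y, t)) L ->
  cint_to_infty (fun y => h (RtoC y * cexp (0, t')) * cexp (0, t'))%C 1 = (P (0, t) - L)%C.
Proof.
move=> Ht Et HL.
apply: (cint_to_infty_eq _ _ (fun Y => P (0, t) - P (ln Y, t))%C); last first.
  by apply: Clim_minus => //; exact: Clim_const.
move=> b Hb.
pose g y := (jker sg xi (ln y, t) * ((/ y)%R, 0))%C.
have Hln : forall y, 0 < y -> rdiff (fun y => (ln y, t)) y (/ y, 0).
  by move=> y Hy; apply: derive_rdiff; rewrite /Re /Im /=; auto_derive => //; lra.
have F : Cis g 1 b (P (ln b, t) - P (ln 1, t))%C.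
  apply: (Cis_FTC (fun y => P (ln y, t))) => // y Hy.
    by apply: cdiff_curve; [exact: HP | apply: Hln; lra].
  apply: Clim_mult.
    apply: (Clim_comp _ (fun y => (ln y, t)) (jker sg xi)); last exact: jker_cont.
    by apply: rdiff_cont; apply: Hln; lra.
  apply: (rdiff_cont (fun y => (/ y, 0)) y (- / (y * y), 0)).
  by apply: derive_rdiff; rewrite /Re /Im /=; auto_derive => //; lra.
have {}F := Cis_scal _ _ _ (- (1))%C _ F.
have -> : (P (0, t) - P (ln b, t))%C = (- (1) * (P (ln b, t) - P (ln 1, t)))%C by rewrite ln_1; ring.
apply: Cis_ext F => // y Hy.
have Hy0 : 0 < y by lra.
have Ew : (- (RtoC y * cexp (0, t')))%C = cexp (ln y, t).
  by rewrite -cexp_ln // Et; ring.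
rewrite /h (Jfun_integrand sg xi _ (ln y, t)) //= /g.
have -> : cexp (0, t') = (- (/ RtoC y * cexp (ln y, t)))%C.
  by rewrite -cexp_ln // Et; field; move/RtoC_inj; lra.
have -> : (/ y, 0) = (/ RtoC y)%C by rewrite -RtoC_inv //; lra.
by field; split; [move/RtoC_inj; lra | exact: cexp_neq_0].
Qed.

Lemma Jfun_arc :
  cint (fun t => h (RtoC 1 * cexp (0, (- t)%R)) * (- Ci * (RtoC 1 * cexp (0, (- t)%R))))%C
    (PI / 3) (2 * PI - PI / 3) = (P (0, (2 * PI / 3)%R) - P (0, (- (2 * PI / 3))%R))%C.
Proof.
have HP0 := PI_RGT_0.
apply: Cis_unique.
have Hv : forall t, rdiff (fun t => (0, PI - t)) t (- Ci)%C.
  by move=> t; apply: (derive_rdiff _ _ (- 0) (- 1)); rewrite /Re /Im /=; auto_derive => //; ring.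
pose g t := (jker sg xi (0, (PI - t)%R) * (- Ci))%C.
have F : Cis g (PI / 3) (2 * PI - PI / 3) (P (0, (PI - (2 * PI - PI / 3))%R) - P (0, (PI - PI / 3)%R))%C.
  apply: (Cis_FTC (fun t => P (0, (PI - t)%R))) => [|t _|t _]; first lra.
    by apply: cdiff_curve; [exact: HP | exact: Hv].
  apply: Clim_mult; last exact: Clim_const.
  apply: (Clim_comp _ (fun t => (0, PI - t)) (jker sg xi)); last exact: jker_cont.
  by apply: rdiff_cont; exact: Hv.
have {}F := Cis_scal _ _ _ (- (1))%C _ F.
have -> : (P (0, (2 * PI / 3)%R) - P (0, (- (2 * PI / 3))%R))%C =
  (- (1) * (P (0, (PI - (2 * PI - PI / 3))%R) - P (0, (PI - PI / 3)%R)))%C.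
  have -> : PI - (2 * PI - PI / 3) = - (2 * PI / 3) by field.
  have -> : PI - PI / 3 = 2 * PI / 3 by field.
  ring.
apply: Cis_ext F => [|t Ht]; first lra.
have Ew : (- (RtoC 1 * cexp (0, (- t)%R)))%C = cexp (0, PI - t).
  have -> : - t = (PI - t) - PI by ring.
  by rewrite cexp_sub_PI; ring.
rewrite /h (Jfun_integrand sg xi _ (0, PI - t)) //; last by rewrite /Im /=; lra.
have -> : (RtoC 1 * cexp (0, (- t)%R))%C = (- cexp (0, (PI - t)%R))%C by rewrite -Ew; ring.
by rewrite /g; field; exact: cexp_neq_0.
Qed.

End JLine.

(** The finite end points of the two rays and of the arc cancel, leaving [Lp - Lm], the values of
    the primitive at the far ends. The vertical line has the same far ends, since nothing is lost
    between it and the rays. *)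
Theorem Jfun_line (c sg xi : R) : 0 < c -> Jfun xi (RtoC sg) = (Ci * LI c sg xi)%C.
Proof.
move=> Hc; have HP0 := PI_RGT_0.
case: (jker_primitive sg xi) => P HP.
case: (primitive_line_cauchy sg xi P HP c 1 Hc ltac:(ring)) => Lp HLp.
case: (primitive_line_cauchy sg xi P HP c (-1) Hc ltac:(ring)) => Lm HLm.
have Rp := primitive_ray sg xi P c 1 Lp HP Hc ltac:(ring) HLp.
have Rm := primitive_ray sg xi P c (-1) Lm HP Hc ltac:(ring) HLm.
have E1 : 1 * (2 * PI / 3) = 2 * PI / 3 by ring.
have E2 : -1 * (2 * PI / 3) = - (2 * PI / 3) by ring.
rewrite E1 in Rp; rewrite E2 in Rm.
have HL : (Lm - Lp)%C = (- Ci * LI c sg xi)%C.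
  have S1 := line_scal _ (- Ci)%C _ (fun s => rcont_lk c sg xi s Hc) (LI_correct c sg xi Hc).
  apply: (Clim_unique (F := Rbar_locally p_infty) _ _ _ _ _ S1).
  apply: Clim_ext_loc (Clim_minus _ _ _ _ HLm HLp).
  exists 0 => S HS; apply: Logic.eq_sym.
  have -> : - (-1 * S) = S by ring.
  have -> : - (1 * S) = - S by ring.
  by apply: Cis_unique; apply: primitive_line => //; lra.
rewrite /Jfun /=.
rewrite (Jfun_ray sg xi P HP (2 * PI / 3) (- (PI / 3)) Lp); first last.
- done.
- have -> : - (PI / 3) = 2 * PI / 3 - PI by field.
  exact: cexp_sub_PI.
- lra.
rewrite (Jfun_ray sg xi P HP (- (2 * PI / 3)) (PI / 3) Lm); first last.
- done.
- have -> : - (2 * PI / 3) = PI / 3 - PI by field.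
  by rewrite cexp_sub_PI; ring.
- lra.
rewrite (Jfun_arc sg xi P HP).
have -> : (Ci * LI c sg xi)%C = (- (Lm - Lp))%C by rewrite HL; ring.
ring.
Qed.

(** * The Gamma function *)

(** The integrand of [Gamma a] in the coordinate [t = exp v]. *)
Definition gl (a v : R) : C := RtoC (exp (a * v - exp v)).

Lemma rdiff_gl (a v : R) : rdiff (gl a) v (RtoC a * gl a v - gl (a + 1) v)%C.
Proof.
have -> : (RtoC a * gl a v - gl (a + 1) v)%C = ((a - exp v) * exp (a * v - exp v), 0).
  rewrite /gl; have -> : (a + 1) * v - exp v = v + (a * v - exp v) by ring.
  by rewrite exp_plus; apply: injective_projections; rewrite /=; ring.
apply: derive_rdiff; rewrite /gl /Re /Im /=; auto_derive => //.
by rewrite /Rminus; ring.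
Qed.

Lemma rcont_gl (a v : R) : rcont (gl a) v.
Proof. by apply: rdiff_cont; apply: rdiff_gl. Qed.

Lemma exp_ge_quarter_sqr (x : R) : 0 <= x -> 1 + x * x / 4 <= exp x.
Proof.
move=> Hx.
have -> : x = x / 2 + x / 2 by field.
rewrite exp_plus.
have := exp_ineq1_le (x / 2); nra.
Qed.

Lemma gl_bound (a : R) : 0 < a ->
  exists K, 0 <= K /\ forall v, Cmod (gl a v) <= K / (1 + v * v).
Proof.
move=> Ha.
(* [K1] serves [0 <= v], where [exp v >= 1 + v^2 / 4] allows completing the square; [K2] serves
   [v < 0], where the decay is that of [exp (a * v)]. *)
pose K1 := 8 * exp (2 * (a * a)).
pose K2 := 1 + 4 / (a * a).
have P1 : 0 < K1 by rewrite /K1; have := exp_pos (2 * (a * a)); lra.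
have P2 : 0 < 4 / (a * a) by apply: Rdiv_lt_0_compat; nra.
exists (K1 + K2); split; first by rewrite /K2; lra.
move=> v; rewrite /gl Cmod_R Rabs_right; last by left; exact: exp_pos.
have Hv : 0 < 1 + v * v by nra.
have Hin : 0 < / (1 + v * v) by exact: Rinv_0_lt_compat.
case: (Rle_dec 0 v) => H.
- apply: (Rle_trans _ (K1 / (1 + v * v))); last by apply: Rmult_le_compat_r; rewrite /K2; lra.
  have H1 := exp_ge_quarter_sqr v H.
  apply: (Rle_trans _ (exp (2 * (a * a)) * exp (- (v / 2 * (v / 2)) / 2))).
    by rewrite -exp_plus; apply: exp_le; have := pow2_ge_0 (2 * a - v / 2); nra.
  have H2 := exp_half_sqr_le (v / 2).
  apply: (Rle_trans _ (exp (2 * (a * a)) * (2 / (1 + v / 2 * (v / 2))))).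
    by apply: Rmult_le_compat_l => //; left; exact: exp_pos.
  rewrite /K1.
  have -> : 8 * exp (2 * (a * a)) / (1 + v * v) = exp (2 * (a * a)) * (8 / (1 + v * v)) by field; lra.
  apply: Rmult_le_compat_l; first by left; exact: exp_pos.
  apply: (Rmult_le_reg_r ((1 + v / 2 * (v / 2)) * (1 + v * v))); first nra.
  have -> : 2 / (1 + v / 2 * (v / 2)) * ((1 + v / 2 * (v / 2)) * (1 + v * v)) = 2 * (1 + v * v) by field; nra.
  have -> : 8 / (1 + v * v) * ((1 + v / 2 * (v / 2)) * (1 + v * v)) = 8 * (1 + v / 2 * (v / 2)) by field; nra.
  nra.
- apply: (Rle_trans _ (K2 / (1 + v * v))); last by apply: Rmult_le_compat_r; lra.
  have Hav : 0 <= - (a * v) by nra.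
  apply: (Rle_trans _ (exp (- - (a * v)))).
    by apply: exp_le; have := exp_pos v; lra.
  rewrite exp_Ropp.
  have H1 := exp_ge_quarter_sqr _ Hav.
  apply: (Rle_trans _ (/ (1 + - (a * v) * - (a * v) / 4))); first by apply: Rinv_le_contravar; nra.
  apply: (Rmult_le_reg_r ((1 + - (a * v) * - (a * v) / 4) * (1 + v * v))); first nra.
  have -> : / (1 + - (a * v) * - (a * v) / 4) * ((1 + - (a * v) * - (a * v) / 4) * (1 + v * v)) = 1 + v * v by field; nra.
  have -> : K2 / (1 + v * v) * ((1 + - (a * v) * - (a * v) / 4) * (1 + v * v)) = K2 * (1 + a * a * (v * v) / 4) by field; nra.
  have -> : K2 * (1 + a * a * (v * v) / 4) = 1 + v * v + 4 / (a * a) + a * a * (v * v) / 4 by rewrite /K2; field; lra.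
  have : 0 <= a * a * (v * v) by apply: Rmult_le_pos; nra.
  lra.
Qed.

Lemma is_RInt_Gamma (a x y : R) (l : C) : 0 < x <= y ->
  Cis (gl a) (ln x) (ln y) l ->
  is_RInt (fun t => Rpower t (a - 1) * exp (- t)) x y (Re l).
Proof.
move=> Hxy H.
have := is_RInt_fct_extend_fst _ _ _ _ H => {}H.
have Hc : forall v, continuous (fun v => exp (a * v - exp v)) v.
  by move=> v; apply: (ex_derive_continuous (fun v => exp (a * v - exp v))); auto_derive.
have := is_RInt_comp (fun v => exp (a * v - exp v)) ln (fun t => / t) x y.
rewrite Rmin_left ?Rmax_right; try lra.
move=> H1.
have E : RInt (fun v => exp (a * v - exp v)) (ln x) (ln y) = Re l by apply: is_RInt_unique.
rewrite -E.
apply: is_RInt_ext; last first.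
  apply: H1 => t Ht; first exact: Hc.
  split; first by auto_derive; [lra | field; lra].
  by apply: (ex_derive_continuous (fun t => / t)); auto_derive; lra.
move=> t; rewrite Rmin_left ?Rmax_right; try lra.
move=> Ht; rewrite /scal /= /mult /= exp_ln; last lra.
rewrite /Rpower /Rminus exp_plus Rmult_plus_distr_r exp_plus.
have -> : -1 * ln t = - ln t by ring.
by rewrite (exp_Ropp (ln t)) exp_ln; [ring | lra].
Qed.

Lemma Gamma_line (a : R) (L : C) : 0 < a -> is_line (gl a) L -> Gamma a = Re L.
Proof.
move=> Ha HL; case: (gl_bound a Ha) => K [HK H].
suff G : @is_RInt_gen R_NormedModule (fun t => Rpower t (a - 1) * exp (- t)) (at_right 0) (Rbar_locally p_infty) (Re L).
  exact: (@is_RInt_gen_unique R_CompleteNormedModule _ _ (Proper_StrongProper _ (at_right_proper_filter 0))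
    (Proper_StrongProper _ (Rbar_locally_filter p_infty)) _ _ G).
move=> Q /locally_R [e [He HQ]].
case: (line_asym _ _ _ HK (rcont_gl a) H HL e He) => S [HS HSB].
apply: (Filter_prod _ _ _ (fun x => 0 < x < exp (- S)) (fun y => exp S < y)).
- exists (mkposreal _ (exp_pos (- S))) => x Hx Hx0; split=> //.
  have {}Hx : Rabs (x - 0) < exp (- S) := Hx.
  by move: Hx; rewrite Rminus_0_r Rabs_right; lra.
- by exists (exp S).
- move=> x y [Hx0 Hx] Hy.
  have Hex := exp_pos S.
  have Hlx : ln x < - S by rewrite -(ln_exp (- S)); apply: ln_increasing.
  have Hly : S < ln y by rewrite -(ln_exp S); apply: ln_increasing.
  have Hxy : x <= y by apply: (Rle_trans _ (exp (- S))); [lra | apply: (Rle_trans _ (exp S)); [apply: exp_le; lra | lra]].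
  have C1 : Cis (gl a) (ln x) (ln y) (cint (gl a) (ln x) (ln y)).
    by apply: Cis_cint => [|t _]; [lra | exact: rcont_gl].
  exists (Re (cint (gl a) (ln x) (ln y))); split; first by apply: is_RInt_Gamma C1 => //.
  apply: HQ.
  have E : ln x = - (- ln x) by ring.
  have := HSB (ln y) (- ln x) ltac:(lra) ltac:(lra).
  rewrite -E => HC; apply: Rle_lt_trans HC.
  have -> : Re (cint (gl a) (ln x) (ln y)) - Re L = Re (cint (gl a) (ln x) (ln y) - L) by rewrite re_plus re_opp.
  exact: re_le_Cmod.
Qed.

Lemma Gamma_is_line (a : R) : 0 < a -> is_line (gl a) (RtoC (Gamma a)).
Proof.
move=> Ha; case: (gl_bound a Ha) => K [HK H].
case: (line_ex _ K HK (rcont_gl a) H) => L HL.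
rewrite (Gamma_line a L Ha HL).
suff E : Im L = 0.
  have -> : RtoC (Re L) = L by apply: injective_projections; rewrite /= -?E.
  by [].
have HI : forall S, 0 < S -> Im (cint (gl a) (- S) S) = 0.
  move=> S HS.
  have C1 : Cis (gl a) (- S) S (cint (gl a) (- S) S) by apply: Cis_cint => [|t _]; [lra | exact: rcont_gl].
  have := is_RInt_unique _ _ _ _ (is_RInt_fct_extend_snd _ _ _ _ C1).
  by rewrite /= RInt_const /scal /= /mult /= Rmult_0_r => <-.
apply: Rabs_eq_0; apply: Rle_antisym; last exact: Rabs_pos.
apply: le_epsilon => e He; rewrite Rplus_0_l.
case: (HL e He) => M HM.
have M1 := Rmax_l 1 (M + 1); have M2 := Rmax_r 1 (M + 1).
have := HM (Rmax 1 (M + 1)) ltac:(lra) => H1.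
have := im_le_Cmod (cint (gl a) (- Rmax 1 (M + 1)) (Rmax 1 (M + 1)) - L).
rewrite im_plus im_opp HI; last lra.
by rewrite Rplus_0_l Rabs_Ropp; lra.
Qed.

(** Integration by parts in the logarithmic coordinate: [a * gl a - gl (a + 1)] is the derivative of
    [gl a], which vanishes at both ends. *)
Lemma Gamma_succ (a : R) : 0 < a -> Gamma (a + 1) = a * Gamma a.
Proof.
move=> Ha.
have L0 := Gamma_is_line a Ha; have L1 := Gamma_is_line (a + 1) ltac:(lra).
have sc : forall (k : C) f, (forall s, rcont f s) -> forall s, rcont (fun s => k * f s)%C s.
  by move=> k f Hf s; apply: Clim_mult; [exact: Clim_const | exact: Hf].
have P := line_plus _ _ _ _ (sc (RtoC a) _ (rcont_gl a)) (sc (- (1))%C _ (rcont_gl (a + 1)))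
  (line_scal _ (RtoC a) _ (rcont_gl a) L0) (line_scal _ (- (1))%C _ (rcont_gl (a + 1)) L1).
case: (gl_bound a Ha) => K [HK H].
case: (bound_Clim_0 _ K HK H) => Z1 Z2.
have Z : is_line (fun s => RtoC a * gl a s + - (1) * gl (a + 1) s)%C 0.
  have -> : RtoC 0 = (0 - 0)%C by ring.
  apply: Clim_ext_loc (Clim_minus _ _ _ _ Z1 Z2).
  exists 0 => S HS; apply: Logic.eq_sym; apply: Cis_unique.
  apply: Cis_FTC => [|t _|t _]; first lra.
  - have -> : (RtoC a * gl a t + - (1) * gl (a + 1) t)%C = (RtoC a * gl a t - gl (a + 1) t)%C by ring.
    exact: rdiff_gl.
  - by apply: Clim_plus; apply: sc; exact: rcont_gl.
have E := line_unique _ _ _ P Z.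
have {}E : (RtoC a * RtoC (Gamma a))%C = RtoC (Gamma (a + 1)).
  have -> : (RtoC a * RtoC (Gamma a))%C = ((RtoC a * RtoC (Gamma a) + - (1) * RtoC (Gamma (a + 1))) + RtoC (Gamma (a + 1)))%C by ring.
  by rewrite E; ring.
by move: E; rewrite -RtoC_mult => /RtoC_inj.
Qed.

Lemma Gamma_1 : Gamma 1 = 1.
Proof.
apply: RtoC_inj; apply: (line_unique (gl 1)); first by apply: Gamma_is_line; lra.
have E : forall S, 0 < S -> cint (gl 1) (- S) S = RtoC (exp (- exp (- S)) - exp (- exp S)).
  move=> S HS; apply: Cis_unique.
  have -> : RtoC (exp (- exp (- S)) - exp (- exp S)) =
    ((- (1)) * RtoC (exp (- exp S)) - (- (1)) * RtoC (exp (- exp (- S))))%C.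
    by rewrite RtoC_minus; ring.
  apply: (Cis_FTC (fun v => - (1) * RtoC (exp (- exp v)))%C) => [|t _|t _]; [lra | | exact: rcont_gl].
  have -> : gl 1 t = (exp t * exp (- exp t), 0).
    by rewrite /gl /Rminus exp_plus Rmult_1_l.
  by apply: derive_rdiff; rewrite /Re /Im /=; auto_derive => //; ring.
move=> e He.
exists (Rmax 0 (4 / e)) => S HS.
have M1 := Rmax_l 0 (4 / e); have M2 := Rmax_r 0 (4 / e).
rewrite E; last lra.
rewrite -RtoC_minus Cmod_R.
have H1 : exp (- S) <= e / 4.
  rewrite exp_Ropp; have -> : e / 4 = / (4 / e) by field; lra.
  have H4 : 0 < 4 / e by apply: Rdiv_lt_0_compat; lra.
  by apply: Rinv_le_contravar => //; have := exp_ineq1_le S; lra.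
have H2 : 1 - exp (- S) <= exp (- exp (- S)) by have := exp_ineq1_le (- exp (- S)); lra.
have H3 : exp (- exp (- S)) <= 1 by rewrite -[X in _ <= X]exp_0; apply: exp_le; have := exp_pos (- S); lra.
have H4 : exp (- exp S) <= exp (- S) by apply: exp_le; have := exp_ineq1_le S; lra.
have H5 := exp_pos (- exp S).
apply: Rabs_def1; lra.
Qed.

(** Both lines compute the same Hankel integral. *)
Lemma LI_indep (c c' sg xi : R) : 0 < c -> 0 < c' -> LI c sg xi = LI c' sg xi.
Proof.
move=> Hc Hc'; have E := Jfun_line c sg xi Hc; rewrite (Jfun_line c' sg xi Hc') in E.
have -> : LI c sg xi = (- Ci * (Ci * LI c sg xi))%C.
  by apply: injective_projections; rewrite /Ci /=; ring.
by rewrite -E; apply: injective_projections; rewrite /Ci /=; ring.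
Qed.

(* For [sg = 1], [xi = 0] the kernel [exp (exp 2v)] has period [i PI] and tends to 1 on the far left. *)
Lemma LI_1 (c : R) : 0 < c -> LI c 1 0 = RtoC PI.
Proof.
move=> Hc; have HP0 := PI_RGT_0.
case: (jker_primitive 1 0) => P HP.
have Ej : forall v, jker 1 0 v = cexp (cexp v * cexp v).
  by move=> v; rewrite /jker; congr cexp; ring.
pose V x := Vint (jker 1 0) x (- PI / 3) (2 * PI / 3).
have HVc : forall x, Cis (fun t => jker 1 0 (x, t)) (- PI / 3) (2 * PI / 3) (V x).
  by move=> x; apply: Vint_correct => [|y _]; [lra | exact: jker_cont].
have Hper : forall x, jker 1 0 (x, - PI / 3) = jker 1 0 (x, 2 * PI / 3).
  move=> x; rewrite !Ej; have -> : - PI / 3 = 2 * PI / 3 - PI by field.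
  by rewrite cexp_sub_PI; congr cexp; ring.
have HV : forall x x', x <= x' -> V x = V x'.
  move=> x x' Hx.
  have : bd (jker 1 0) x x' (- PI / 3) (2 * PI / 3) = 0.
    by apply: goursat => //; [lra | move=> z _; exact: jker_cdiff].
  rewrite /bd.
  have -> : Hint (jker 1 0) (- PI / 3) x x' = Hint (jker 1 0) (2 * PI / 3) x x'.
    rewrite /Hint /cint; apply: (@RInt_ext C_R_CompleteNormedModule) => t _.
    exact: Hper.
  rewrite -/(V x) -/(V x') => H.
  apply: Logic.eq_sym; apply/Ceq_minus.
  have -> : (V x' - V x)%C = (- Ci * (Ci * (V x' - V x)))%C.
    by apply: injective_projections; rewrite /Ci /=; ring.
  have -> : (Ci * (V x' - V x))%C = 0 by rewrite -H; ring.
  ring.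
(* Moving the segment to the left does not change its integral, and there the integrand tends to 1;
   [PI] is the length of the segment. *)
have HVpi : forall x, V x = RtoC PI.
  move=> x; apply/Ceq_minus; apply: Cmod_eq_0; apply: Rle_antisym; last exact: Cmod_ge_0.
  apply: le_epsilon => e He; rewrite Rplus_0_l.
  pose d := Rmin 1 (e / (7 * PI)).
  have D1 : d <= 1 := Rmin_l _ _.
  have D2 : d <= e / (7 * PI) := Rmin_r _ _.
  have Hd : 0 < d by apply: Rmin_pos; [lra | apply: Rdiv_lt_0_compat; lra].
  pose y := Rmin x (ln d).
  have Y1 : y <= x := Rmin_l _ _.
  have Y2 : exp y <= d by rewrite -[X in _ <= X]exp_ln //; apply: exp_le; exact: Rmin_r.
  rewrite -(HV y x Y1).
  have -> : e = (2 * PI / 3 - - PI / 3) * (7 * (e / (7 * PI))) by field; lra.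
  have -> : RtoC PI = (RtoC (2 * PI / 3 - - PI / 3) * 1)%C by rewrite Cmult_1_r; congr RtoC; field.
  apply: (Cis_bound_const (fun t => jker 1 0 (y, t) - 1)%C); first lra; last first.
    by apply: Cis_minus; [exact: HVc | exact: Cis_const].
  move=> t _; rewrite Ej.
  have Hm : Cmod (cexp (y, t) * cexp (y, t)) <= d.
    rewrite Cmod_mult !Cmod_cexp /Re /=; have := exp_pos y; nra.
  by apply: Rle_trans (cexp_sub1_le _ _) _; lra.
have HPd : forall x, (P (x, (2 * PI / 3)%R) - P (x, (- PI / 3)%R))%C = (Ci * RtoC PI)%C.
  move=> x; rewrite -(HVpi x).
  rewrite -(Cis_unique _ _ _ _ (Cis_scal _ _ _ Ci _ (HVc x))).
  apply: Logic.eq_sym; apply: Cis_unique.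
  apply: (Cis_FTC (fun t => P (x, t))) => [|t _|t _]; first lra.
    by rewrite Cmult_comm; apply: cdiff_curve; [exact: HP | exact: rdiff_vertical].
  by apply: Clim_mult; [exact: Clim_const | apply: ccont_vertical; exact: jker_cont].
case: (primitive_line_cauchy 1 0 P HP c 1 Hc ltac:(ring)) => Lp HLp.
case: (primitive_line_cauchy 1 0 P HP c (-1) Hc ltac:(ring)) => Lm HLm.
have Rp := primitive_ray 1 0 P c 1 Lp HP Hc ltac:(ring) HLp.
have Rm := primitive_ray 1 0 P c (-1) Lm HP Hc ltac:(ring) HLm.
have E1 : 1 * (2 * PI / 3) = 2 * PI / 3 by ring.
have E2 : -1 * (2 * PI / 3) = - (2 * PI / 3) by ring.
rewrite E1 in Rp; rewrite E2 in Rm.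
have HL : (Lm - Lp)%C = (- Ci * LI c 1 0)%C.
  have S1 := line_scal _ (- Ci)%C _ (fun s => rcont_lk c 1 0 s Hc) (LI_correct c 1 0 Hc).
  apply: (Clim_unique (F := Rbar_locally p_infty) _ _ _ _ _ S1).
  apply: Clim_ext_loc (Clim_minus _ _ _ _ HLm HLp).
  exists 0 => S HS; apply: Logic.eq_sym.
  have -> : - (-1 * S) = S by ring.
  have -> : - (1 * S) = - S by ring.
  by apply: Cis_unique; apply: primitive_line => //; lra.
(* The lower end of the period segment is at [- PI / 3], the lower ray at [- (2 * PI / 3)]. Between
   them [|cos t| <= 1 / 2], so the kernel decays and the two limits coincide. *)
have HD : Clim (Rbar_locally p_infty) (fun Y => P (ln Y, (- PI / 3)%R) - P (ln Y, (- (2 * PI / 3))%R))%C 0.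
  case: (jker_decay 1 0 1 Rlt_0_1) => K [HK H].
  apply: (Clim_squeeze _ (fun Y => PI * (K / (1 + Y * Y)))).
    exists 1 => Y HY.
    have Ey : exp (ln Y) = Y by apply: exp_ln; lra.
    have HM : 0 <= K / (1 + Y * Y) by apply: Rmult_le_pos => //; left; apply: Rinv_0_lt_compat; nra.
    have -> : (P (ln Y, (- PI / 3)%R) - P (ln Y, (- (2 * PI / 3))%R) - 0)%C = (P (ln Y, (- PI / 3)%R) - P (ln Y, (- (2 * PI / 3))%R))%C by ring.
    apply: (Rle_trans _ ((- PI / 3 - - (2 * PI / 3)) * (K / (1 + Y * Y)))); last by apply: Rmult_le_compat_r => //; lra.
    apply: (primitive_vertical 1 0 P HP); first lra.
    move=> t Ht.
    have -> : Y * Y = exp (ln Y) * exp (ln Y) by rewrite Ey.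
    apply: H.
      by rewrite -ln_1; left; apply: ln_increasing; lra.
    have C1 : cos t <= / 2.
      have <- : cos (- PI / 3) = / 2.
        have -> : - PI / 3 = - (PI / 3) by field.
        by rewrite cos_neg cos_PI3; field.
      rewrite -(cos_neg t) -(cos_neg (- PI / 3)); apply: cos_decr_1; lra.
    have C2 : - / 2 <= cos t.
      have <- : cos (- (2 * PI / 3)) = - / 2.
        rewrite cos_neg; have -> : 2 * PI / 3 = 2 * (PI / 3) by field.
        by rewrite cos_2PI3; field.
      rewrite -(cos_neg t) (cos_neg (2 * PI / 3)); apply: cos_decr_1; lra.
    have := pow2_ge_0 (1 / exp (ln Y)); nra.
  move=> e He; exists (Rmax 1 (PI * K / e)) => Y HY.
  have M1 := Rmax_l 1 (PI * K / e); have M2 := Rmax_r 1 (PI * K / e).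
  have Hp : 0 < 1 + Y * Y by nra.
  apply: (Rmult_lt_reg_r (1 + Y * Y)) => //.
  have -> : PI * (K / (1 + Y * Y)) * (1 + Y * Y) = PI * K by field; lra.
  have : PI * K / e * e < Y * e by apply: Rmult_lt_compat_r; lra.
  have -> : PI * K / e * e = PI * K by field; lra.
  have : Y * e <= (1 + Y * Y) * e by apply: Rmult_le_compat_r; nra.
  lra.
have HF : (Lp - Lm)%C = (Ci * RtoC PI)%C.
  apply: (Clim_unique (F := Rbar_locally p_infty) _ _ _ _ (Clim_minus _ _ _ _ Rp Rm)).
  rewrite -[X in Clim _ _ X]Cplus_0_r.
  apply: (Clim_ext (fun Y => Ci * RtoC PI + (P (ln Y, (- PI / 3)%R) - P (ln Y, (- (2 * PI / 3))%R)))%C); last first.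
    by apply: Clim_plus => //; exact: Clim_const.
  move=> Y.
  rewrite -(HPd (ln Y)); ring.
have -> : LI c 1 0 = (Ci * (- Ci * LI c 1 0))%C.
  by apply: injective_projections; rewrite /Ci /=; ring.
rewrite -HL.
have -> : (Ci * (Lm - Lp))%C = (- Ci * (Lp - Lm))%C by ring.
by rewrite HF; apply: injective_projections; rewrite /Ci /=; ring.
Qed.

(** * Laplace's method for Gamma and for J at 0 *)

(** The third-order remainder appears as [u^2] times a factor vanishing with [u], valid for all real
    [u]. *)
Lemma exp_taylor2 (u : R) : Rabs (exp u - 1 - u - u * u / 2) <= u * u * (exp (Rabs u) - 1).
Proof.
have := taylor2_bound (fun t => exp (t * u) - t * t * (u * u) / 2)
  (fun t => u * exp (t * u) - t * (u * u)) (fun t => u * u * exp (t * u) - u * u)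
  (u * u * (exp (Rabs u) - 1)).
rewrite !Rmult_0_l !Rmult_1_l exp_0.
have -> : exp u - u * u / 2 - (1 - 0 / 2) - (u * 1 - 0) = exp u - 1 - u - u * u / 2 by field.
apply.
- by move=> t _; auto_derive => //; field.
- by move=> t _; auto_derive => //; ring.
- move=> t Ht.
  have -> : u * u * exp (t * u) - u * u = u * u * (exp (t * u) - 1) by ring.
  rewrite Rabs_mult (Rabs_right (u * u)); last nra.
  apply: Rmult_le_compat_l; first nra.
  have U1 := Rle_abs u; have U2 := Rle_abs (- u); rewrite Rabs_Ropp in U2.
  have U0 := Rabs_pos u.
  have E1 : exp (t * u) <= exp (Rabs u) by apply: exp_le; nra.
  have E2 : exp (- Rabs u) <= exp (t * u) by apply: exp_le; nra.
  have E3 := exp_ineq1_le (Rabs u); have E4 := exp_ineq1_le (- Rabs u).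
  apply: Rabs_le; lra.
Qed.

(** A quadratic lower bound cannot hold on the left, where [exp u - 1 - u] grows only linearly; the
    denominator covers both regimes. For negative [u] the claim is multiplied out and its derivative
    inspected. *)
Lemma exp_sub_lb (u : R) : u * u / (2 * (1 + Rabs u)) <= exp u - 1 - u.
Proof.
case: (Rle_dec 0 u) => Hu.
- rewrite Rabs_right; last lra.
  apply: (Rle_trans _ (u * u / 2)).
    rewrite /Rdiv; apply: Rmult_le_compat_l; first nra.
    by apply: Rinv_le_contravar; lra.
  case: (MVT_gen (fun t => exp t - 1 - t - t * t / 2) 0 u (fun t => exp t - 1 - t)).
  + by move=> x _; auto_derive => //; field.
  + move=> x _; apply: derivable_continuous_pt; exists (exp x - 1 - x); apply/is_derive_Reals.
    by auto_derive => //; field.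
  + rewrite Rmin_left ?Rmax_right; try lra; move=> x [Hx Heq].
    rewrite exp_0 in Heq; have := exp_ineq1_le x; nra.
- rewrite Rabs_left; last lra.
  pose w := - u.
  have -> : u = - w by rewrite /w; ring.
  rewrite Ropp_involutive; have Hw : 0 < w by rewrite /w; lra.
  apply: (Rmult_le_reg_r (1 + w)); first lra.
  have -> : - w * - w / (2 * (1 + w)) * (1 + w) = w * w / 2 by field; lra.
  case: (MVT_gen (fun t => (1 + t) * exp (- t) - 1 + t * t / 2) 0 w (fun t => t * (1 - exp (- t)))).
  + by move=> x _; auto_derive => //; field.
  + move=> x _; apply: derivable_continuous_pt; exists (x * (1 - exp (- x))); apply/is_derive_Reals.
    by auto_derive => //; field.
  + rewrite Rmin_left ?Rmax_right; try lra; move=> x [Hx Heq].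
    rewrite Ropp_0 exp_0 in Heq.
    have : exp (- x) <= 1 by rewrite -[X in _ <= X]exp_0; apply: exp_le; lra.
    move=> H; have : 0 <= x * (1 - exp (- x)) * (w - 0) by apply: Rmult_le_pos; [apply: Rmult_le_pos|]; lra.
    lra.
Qed.

Lemma atan_taylor (x : R) : Rabs (atan x - x) <= x * x * Rabs x.
Proof.
case: (MVT_gen (fun t => atan t - t) 0 x (fun t => - (t * t) / (1 + t * t))).
- by move=> y _; auto_derive => //; rewrite /Rsqr; field; nra.
- move=> y _; apply: derivable_continuous_pt; exists (- (y * y) / (1 + y * y)); apply/is_derive_Reals.
  by auto_derive => //; rewrite /Rsqr; field; nra.
- move=> y [Hy]; rewrite atan_0 => Heq.
  have -> : atan x - x = - (y * y) / (1 + y * y) * (x - 0) by lra.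
  rewrite Rabs_mult Rminus_0_r; apply: Rmult_le_compat_r; first exact: Rabs_pos.
  have H1 : Rabs y <= Rabs x.
    move: Hy; rewrite /Rmin /Rmax; case: Rle_dec => ? ?; rewrite /Rabs; do 2 case: Rcase_abs; lra.
  have H2 : y * y <= x * x.
    have -> : y * y = Rabs y * Rabs y by rewrite -Rabs_mult Rabs_right //; nra.
    have -> : x * x = Rabs x * Rabs x by rewrite -Rabs_mult Rabs_right //; nra.
    by have := Rabs_pos y; nra.
  have -> : - (y * y) / (1 + y * y) = - (y * y / (1 + y * y)) by field; nra.
  rewrite Rabs_Ropp Rabs_right; last first.
    by apply: Rle_ge; apply: Rmult_le_pos; [nra | left; apply: Rinv_0_lt_compat; nra].
  apply: Rle_trans H2; apply: (Rmult_le_reg_r (1 + y * y)); first nra.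
  have -> : y * y / (1 + y * y) * (1 + y * y) = y * y by field; nra.
  nra.
Qed.

Lemma ln_1p_taylor (x : R) : 0 <= x -> Rabs (ln (1 + x) - x) <= x * x.
Proof.
move=> Hx; apply: Rabs_le; split.
- have H : / (1 + x) <= 1 by rewrite -[X in _ <= X]Rinv_1; apply: Rinv_le_contravar; lra.
  have := exp_ineq1_le (- ln (1 + x)); rewrite exp_Ropp exp_ln; last lra.
  move=> H1.
  have H2 : 1 - / (1 + x) <= ln (1 + x) by lra.
  have : x - x * x <= 1 - / (1 + x).
    apply: (Rmult_le_reg_r (1 + x)); first lra.
    have -> : (1 - / (1 + x)) * (1 + x) = x by field; lra.
    nra.
  lra.
- have := exp_ineq1_le (ln (1 + x)); rewrite exp_ln; nra.
Qed.

(** [hG a] and [hK a] are the integrands of [Gamma a] and [LI _ (2 a - 1) 0], centred at their saddle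
    points and normalised there. *)
Definition hG (a y : R) : R := exp (- (a * (exp (y / sqrt a) - 1 - y / sqrt a))).
Definition hK (a s : R) : C :=
  cexp (- RtoC (2 * a - 1) * (ln (1 + s * s / a) / 2, - atan (s / sqrt a)) + (- (s * s), - 2 * sqrt a * s)).

Lemma sqrt_sqr_pos (a : R) : 0 < a -> 0 < sqrt a /\ sqrt a * sqrt a = a.
Proof. by move=> Ha; split; [apply: sqrt_lt_R0 | apply: sqrt_sqrt; lra]. Qed.

Lemma hG_gl (a y : R) : 0 < a ->
  RtoC (hG a y) = (RtoC (exp (a - a * ln a)) * gl a (/ sqrt a * y + ln a)%R)%C.
Proof.
move=> Ha; case: (sqrt_sqr_pos a Ha) => Hs Hss.
rewrite /hG /gl -RtoC_mult -exp_plus; congr (RtoC (exp _)).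
rewrite exp_plus exp_ln //.
have -> : / sqrt a * y = y / sqrt a by field; lra.
ring.
Qed.

Lemma hG_line (a : R) : 0 < a ->
  is_line (fun y => RtoC (hG a y)) (RtoC (exp (a - a * ln a) * sqrt a * Gamma a)).
Proof.
move=> Ha; case: (sqrt_sqr_pos a Ha) => Hs Hss.
case: (gl_bound a Ha) => K [HK H].
have Hmu : 0 < / sqrt a by apply: Rinv_0_lt_compat.
have L1 := line_affine _ K (/ sqrt a) (ln a) _ HK (rcont_gl a) H Hmu (Gamma_is_line a Ha).
have Hc : forall y, rcont (fun y => RtoC (/ sqrt a) * gl a (/ sqrt a * y + ln a)%R)%C y.
  move=> y; apply: Clim_mult; first exact: Clim_const.
  apply: (Clim_RtoC (fun y => exp (a * (/ sqrt a * y + ln a) - exp (/ sqrt a * y + ln a)))).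
  apply: (ex_derive_continuous (fun y => exp (a * (/ sqrt a * y + ln a) - exp (/ sqrt a * y + ln a)))).
  by auto_derive.
have L2 := line_scal _ (RtoC (exp (a - a * ln a) * sqrt a)) _ Hc L1.
rewrite RtoC_mult.
apply: Clim_ext L2 => S.
apply: (@RInt_ext C_R_CompleteNormedModule) => t _.
rewrite (hG_gl a t Ha) RtoC_mult RtoC_inv; last lra.
have Hs0 : RtoC (sqrt a) <> 0 by move/RtoC_inj; lra.
by rewrite Cmult_assoc; congr Cmult; field.
Qed.

Lemma hK_lk (a s : R) : 0 < a ->
  hK a s = (RtoC (exp ((2 * a - 1) * ln (sqrt a) - a)) * lk (sqrt a) (2 * a - 1) 0 s)%C.
Proof.
move=> Ha; case: (sqrt_sqr_pos a Ha) => Hs Hss.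
rewrite /hK /lk -cexp_RtoC -cexp_plus; congr cexp.
rewrite /zl clog_right // Cmod_sqrt.
have -> : - s / sqrt a = - (s / sqrt a) by field; lra.
rewrite atan_opp.
have Hp : 0 < 1 + s * s / a.
  have : 0 <= s * s / a by apply: Rmult_le_pos; [nra | left; exact: Rinv_0_lt_compat].
  lra.
have -> : ln (sqrt (sqrt a * sqrt a + - s * - s)) = ln (sqrt a) + ln (1 + s * s / a) / 2.
  rewrite Hss; have -> : a + - s * - s = a * (1 + s * s / a) by field; lra.
  rewrite sqrt_mult; try lra.
  rewrite ln_mult //; last exact: sqrt_lt_R0.
  congr (_ + _); rewrite -{2}(sqrt_sqrt (1 + s * s / a)); last lra.
  by rewrite ln_mult; [field | |]; apply: sqrt_lt_R0.
apply: injective_projections; rewrite /=.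
- have -> : 0 * sqrt a - 0 * - s + (sqrt a * sqrt a - - s * - s) = a - s * s by rewrite Hss; ring.
  ring.
- ring.
Qed.

Lemma hK_line (a : R) : 0 < a ->
  is_line (hK a) (RtoC (exp ((2 * a - 1) * ln (sqrt a) - a)) * LI (sqrt a) (2 * a - 1) 0)%C.
Proof.
move=> Ha; case: (sqrt_sqr_pos a Ha) => Hs Hss.
have L := line_scal _ (RtoC (exp ((2 * a - 1) * ln (sqrt a) - a))) _
  (fun s => rcont_lk (sqrt a) (2 * a - 1) 0 s Hs) (LI_correct (sqrt a) (2 * a - 1) 0 Hs).
apply: Clim_ext L => S.
apply: (@RInt_ext C_R_CompleteNormedModule) => t _.
by rewrite hK_lk.
Qed.

(** The bound must not depend on [a]. By [exp_sub_lb] the exponent is at least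
    [y^2 / (2 (1 + |y|))], hence at least [(|y| - 1) / 2]. *)
Lemma hG_bound (a y : R) : 1 <= a -> hG a y <= 32 / (1 + y * y).
Proof.
move=> Ha; case: (sqrt_sqr_pos a ltac:(lra)) => Hs Hss.
have Hs1 : 1 <= sqrt a by rewrite -sqrt_1; apply: sqrt_le_1; lra.
have Hy0 := Rabs_pos y.
have Hyy : y * y = Rabs y * Rabs y by rewrite -Rabs_mult Rabs_right //; nra.
have H1 := exp_sub_lb (y / sqrt a).
have H2 : (Rabs y - 1) / 2 <= a * (exp (y / sqrt a) - 1 - y / sqrt a).
  apply: (Rle_trans _ (a * (y / sqrt a * (y / sqrt a) / (2 * (1 + Rabs (y / sqrt a)))))); last by apply: Rmult_le_compat_l; lra.
  have E : Rabs (y / sqrt a) <= Rabs y.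
    rewrite Rabs_div; last lra.
    rewrite (Rabs_right (sqrt a)); last lra.
    apply: (Rmult_le_reg_r (sqrt a)) => //.
    have -> : Rabs y / sqrt a * sqrt a = Rabs y by field; lra.
    nra.
  have E0 := Rabs_pos (y / sqrt a).
  have -> : a * (y / sqrt a * (y / sqrt a) / (2 * (1 + Rabs (y / sqrt a)))) = y * y / (2 * (1 + Rabs (y / sqrt a))).
    by rewrite -{1}Hss; field; lra.
  apply: (Rle_trans _ (y * y / (2 * (1 + Rabs y)))).
    apply: (Rmult_le_reg_r (2 * (1 + Rabs y))); first lra.
    have -> : y * y / (2 * (1 + Rabs y)) * (2 * (1 + Rabs y)) = y * y by field; lra.
    rewrite Hyy; nra.
  rewrite /Rdiv; apply: Rmult_le_compat_l; first nra.
  by apply: Rinv_le_contravar; lra.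
rewrite /hG.
apply: (Rle_trans _ (exp (/ 2) * exp (- (Rabs y / 2)))).
  by rewrite -exp_plus; apply: exp_le; lra.
rewrite exp_Ropp.
have H3 := exp_ge_quarter_sqr (Rabs y / 2) ltac:(lra).
have H4 : exp (/ 2) <= 2.
  have H5 : exp (/ 2) * exp (/ 2) <= 3.
    rewrite -exp_plus (_ : / 2 + / 2 = 1); [exact: exp_le_3 | field].
  have := exp_pos (/ 2); nra.
apply: (Rle_trans _ (2 * / (1 + Rabs y / 2 * (Rabs y / 2) / 4))).
  apply: Rmult_le_compat => //; first by left; exact: exp_pos.
    by left; apply: Rinv_0_lt_compat; exact: exp_pos.
  by apply: Rinv_le_contravar; nra.
apply: (Rmult_le_reg_r ((1 + Rabs y / 2 * (Rabs y / 2) / 4) * (1 + y * y))); first nra.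
have -> : 2 * / (1 + Rabs y / 2 * (Rabs y / 2) / 4) * ((1 + Rabs y / 2 * (Rabs y / 2) / 4) * (1 + y * y)) = 2 * (1 + y * y) by field; nra.
have -> : 32 / (1 + y * y) * ((1 + Rabs y / 2 * (Rabs y / 2) / 4) * (1 + y * y)) = 32 * (1 + Rabs y / 2 * (Rabs y / 2) / 4) by field; nra.
nra.
Qed.

Lemma hK_bound (a s : R) : 1 <= a -> Cmod (hK a s) <= 2 / (1 + s * s).
Proof.
move=> Ha.
rewrite /hK Cmod_cexp.
apply: (Rle_trans _ (exp (- (s * s) / 2))); last exact: exp_half_sqr_le.
apply: exp_le; rewrite /Re /Im /=.
have Hp : 0 <= s * s / a by apply: Rmult_le_pos; [nra | left; apply: Rinv_0_lt_compat; lra].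
have : 0 <= ln (1 + s * s / a).
  by rewrite -ln_1; case: Hp => [Hp|<-]; [left; apply: ln_increasing; lra | rewrite Rplus_0_r; right].
nra.
Qed.

(** The part common to both applications of Laplace's method: the exponents differ from the limiting
    ones by [O(1 / sqrt (a + N))] on [|s| <= A]. *)
Lemma unif_cexp (a A M D : R) (g : R -> C) (d : nat -> R -> C) :
  0 < a -> (forall s, Rabs s <= A -> Cmod (g s) <= M) ->
  (forall N s, Rabs s <= A -> 1 <= a + INR N -> Cmod (d N s) <= D / sqrt (a + INR N)) ->
  Clim (unif A) (fun p => g (snd p) * cexp (d (fst p) (snd p)) - g (snd p))%C 0.
Proof.
move=> Ha HM Hd.
have Hd0 : Clim (unif A) (fun p => d (fst p) (snd p)) 0.
  move=> e He.
  have Hp : 0 <= (D / e) ^ 2 by exact: pow2_ge_0.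
  case: (INR_unbounded ((D / e) ^ 2 + 1)) => N0 HN0.
  exists N0 => N s HN Hs /=.
  have HNN : INR N0 <= INR N by apply: le_INR.
  have -> : (d N s - 0)%C = d N s by ring.
  apply: Rle_lt_trans; first by apply: Hd => //; lra.
  have Hq : 0 < a + INR N by lra.
  have Hs0 : 0 < sqrt (a + INR N) by apply: sqrt_lt_R0.
  apply: (Rmult_lt_reg_r (sqrt (a + INR N))) => //.
  have -> : D / sqrt (a + INR N) * sqrt (a + INR N) = D by field; lra.
  have H1 : Rabs (D / e) < sqrt (a + INR N).
    rewrite -(sqrt_Rsqr_abs (D / e)); apply: sqrt_lt_1; [exact: Rle_0_sqr | lra |].
    by move: Hp HN0; rewrite /= Rmult_1_r /Rsqr; lra.
  have H2 := Rle_abs (D / e).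
  have -> : D = e * (D / e) by field; lra.
  by apply: Rmult_lt_compat_l; lra.
apply: (Clim_ext (fun p => (cexp (d (fst p) (snd p)) - 1) * g (snd p))%C).
  by move=> p; ring.
apply: (Clim_0_mult_bounded _ _ M).
  have -> : RtoC 0 = (cexp 0 - 1)%C by rewrite cexp_0; ring.
  by apply: Clim_minus; [exact: Clim_cexp | exact: Clim_const].
by exists 0%nat => N s _ Hs; apply: HM.
Qed.

Lemma hG_dist_bound (a A y : R) : 1 <= a -> Rabs y <= A ->
  Rabs (- (a * (exp (y / sqrt a) - 1 - y / sqrt a) - y * y / 2)) <= A * A * (A * exp A) / sqrt a.
Proof.
move=> Ha Hy; case: (sqrt_sqr_pos a ltac:(lra)) => Hs Hss.
have Hs1 : 1 <= sqrt a by rewrite -sqrt_1; apply: sqrt_le_1; lra.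
have Hy0 := Rabs_pos y.
set u := y / sqrt a.
have Eau : a * (u * u) = y * y by rewrite -{1}Hss /u; field; lra.
have -> : a * (exp u - 1 - u) - y * y / 2 = a * (exp u - 1 - u - u * u / 2) by rewrite -Eau; field.
rewrite Rabs_Ropp Rabs_mult Rabs_right; last lra.
have H := exp_taylor2 u.
apply: (Rle_trans _ (y * y * (exp (Rabs u) - 1))).
  rewrite -Eau Rmult_assoc; apply: Rmult_le_compat_l; lra.
have Hu : Rabs u = Rabs y / sqrt a.
  by rewrite /u Rabs_div ?(Rabs_right (sqrt a)); lra.
have Hu1 : Rabs u <= A / sqrt a.
  by rewrite Hu; apply: Rmult_le_compat_r => //; left; exact: Rinv_0_lt_compat.
have Hu2 : Rabs u <= A.
  apply: Rle_trans Hu1 _; apply: (Rmult_le_reg_r (sqrt a)) => //.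
  have -> : A / sqrt a * sqrt a = A by field; lra.
  nra.
have He : exp (Rabs u) - 1 <= Rabs u * exp A.
  have E1 := exp_ineq1_le (- Rabs u); rewrite exp_Ropp in E1.
  have E2 : exp (Rabs u) <= exp A by apply: exp_le.
  have E3 := exp_pos (Rabs u); have E0 := Rabs_pos u.
  have E4 : (1 - Rabs u) * exp (Rabs u) <= 1.
    apply: (Rle_trans _ (/ exp (Rabs u) * exp (Rabs u))); first by apply: Rmult_le_compat_r; lra.
    by right; field; lra.
  nra.
have -> : A * A * (A * exp A) / sqrt a = A * A * (A / sqrt a * exp A) by field; lra.
have He0 : 0 <= exp (Rabs u) - 1 by have := exp_ineq1_le (Rabs u); have := Rabs_pos u; lra.
have Hyy : y * y <= A * A.
  have -> : y * y = Rabs y * Rabs y by rewrite -Rabs_mult Rabs_right //; nra.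
  nra.
apply: Rmult_le_compat => //; first nra.
apply: Rle_trans He _; apply: Rmult_le_compat_r => //; left; exact: exp_pos.
Qed.

(** For large [a] the logarithm contributes another [- s^2] to the exponent, and
    [(2 a - 1) * atan (s / sqrt a)] cancels against [2 * sqrt a * s]. Hence the limit
    [exp (- 2 s^2)]. *)
Lemma hK_dist_bound (a A s : R) : 1 <= a -> Rabs s <= A ->
  Cmod (- (2 * a - 1) * (ln (1 + s * s / a) / 2) + s * s, (2 * a - 1) * atan (s / sqrt a) - 2 * sqrt a * s) <=
    (A * A * (A * A) + A * A + 2 * (A * A) * A + A) / sqrt a.
Proof.
move=> Ha Hy; case: (sqrt_sqr_pos a ltac:(lra)) => Hs Hss.
have Hs1 : 1 <= sqrt a by rewrite -sqrt_1; apply: sqrt_le_1; lra.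
have Hsa : sqrt a <= a by rewrite -{2}Hss; nra.
have Hy0 := Rabs_pos s.
have Hyy : s * s <= A * A.
  have -> : s * s = Rabs s * Rabs s by rewrite -Rabs_mult Rabs_right //; nra.
  nra.
have Hss0 : 0 <= s * s by nra.
have HA : 0 <= A by lra.
set x := s * s / a; set e := s / sqrt a.
have Hx : 0 <= x by apply: Rmult_le_pos => //; left; apply: Rinv_0_lt_compat; lra.
apply: Rle_trans; first exact: Cmod_le_sum.
rewrite /Re /Im /=.
have Hia : / a <= / sqrt a by apply: Rinv_le_contravar.
have Hia0 : 0 < / a by apply: Rinv_0_lt_compat; lra.
have B1 : Rabs (- (2 * a - 1) * (ln (1 + x) / 2) + s * s) <= (A * A * (A * A) + A * A) / sqrt a.
  have -> : - (2 * a - 1) * (ln (1 + x) / 2) + s * s = - ((a - / 2) * (ln (1 + x) - x)) + s * s / (2 * a).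
    by rewrite /x; field; lra.
  apply: Rle_trans; first exact: Rabs_triang.
  rewrite Rabs_Ropp Rabs_mult (Rabs_right (a - / 2)); last lra.
  have H1 := ln_1p_taylor x Hx.
  have H2 : (a - / 2) * Rabs (ln (1 + x) - x) <= A * A * (A * A) * / a.
    apply: (Rle_trans _ (a * (x * x))).
      by apply: Rmult_le_compat; [lra | exact: Rabs_pos | lra | done].
    have -> : a * (x * x) = s * s * (s * s) * / a by rewrite /x; field; lra.
    apply: Rmult_le_compat_r; first lra.
    by apply: Rmult_le_compat.
  have H3 : Rabs (s * s / (2 * a)) <= A * A * / a.
    rewrite Rabs_right; last by apply: Rle_ge; apply: Rmult_le_pos => //; left; apply: Rinv_0_lt_compat; lra.
    apply: Rmult_le_compat => //; first by left; apply: Rinv_0_lt_compat; lra.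
    by apply: Rinv_le_contravar; lra.
  have H4 : (A * A * (A * A) + A * A) * / a <= (A * A * (A * A) + A * A) / sqrt a.
    by apply: Rmult_le_compat_l => //; nra.
  lra.
have B2 : Rabs ((2 * a - 1) * atan e - 2 * sqrt a * s) <= (2 * (A * A) * A + A) / sqrt a.
  have -> : (2 * a - 1) * atan e - 2 * sqrt a * s = (2 * a - 1) * (atan e - e) + - e.
    have E : a * e = sqrt a * s by rewrite -{1}Hss /e; field; lra.
    transitivity ((2 * a - 1) * atan e - 2 * (a * e)); [by rewrite E; ring | ring].
  apply: Rle_trans; first exact: Rabs_triang.
  rewrite Rabs_Ropp Rabs_mult (Rabs_right (2 * a - 1)); last lra.
  have H1 := atan_taylor e.
  have Ee : Rabs e = Rabs s / sqrt a by rewrite /e Rabs_div ?(Rabs_right (sqrt a)); lra.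
  have H2 : (2 * a - 1) * Rabs (atan e - e) <= 2 * (A * A) * A / sqrt a.
    apply: (Rle_trans _ (2 * a * (e * e * Rabs e))).
      by apply: Rmult_le_compat; [lra | exact: Rabs_pos | lra | done].
    have -> : 2 * a * (e * e * Rabs e) = 2 * (s * s) * Rabs s / sqrt a.
      by rewrite Ee -{1}Hss /e; field; lra.
    apply: Rmult_le_compat_r; first by left; exact: Rinv_0_lt_compat.
    apply: Rmult_le_compat => //; nra.
  have H3 : Rabs e <= A / sqrt a.
    by rewrite Ee; apply: Rmult_le_compat_r => //; left; exact: Rinv_0_lt_compat.
  have -> : (2 * (A * A) * A + A) / sqrt a = 2 * (A * A) * A / sqrt a + A / sqrt a by field; lra.
  lra.
have -> : (A * A * (A * A) + A * A + 2 * (A * A) * A + A) / sqrt a =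
  (A * A * (A * A) + A * A) / sqrt a + (2 * (A * A) * A + A) / sqrt a by field; lra.
lra.
Qed.

Lemma rcont_RtoC_exp (k s : R) : rcont (fun s => RtoC (exp (k * (s * s)))) s.
Proof.
apply: (Clim_RtoC (fun s => exp (k * (s * s)))).
by apply: (ex_derive_continuous (fun s => exp (k * (s * s)))); auto_derive.
Qed.

Lemma rcont_hG (a s : R) : rcont (fun s => RtoC (hG a s)) s.
Proof.
by apply: (Clim_RtoC (hG a)); apply: (ex_derive_continuous (hG a)); rewrite /hG; auto_derive.
Qed.

Lemma rcont_hK (a s : R) : 0 < a -> rcont (hK a) s.
Proof.
move=> Ha; case: (sqrt_sqr_pos a Ha) => Hs Hss.
apply: (Clim_ext (fun s => RtoC (exp ((2 * a - 1) * ln (sqrt a) - a)) * lk (sqrt a) (2 * a - 1) 0 s)%C).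
  by move=> t; rewrite hK_lk.
rewrite hK_lk //; apply: Clim_mult; [exact: Clim_const | exact: rcont_lk].
Qed.

Lemma gauss_bound (k s : R) : k <= - / 2 -> Cmod (RtoC (exp (k * (s * s)))) <= 2 / (1 + s * s).
Proof.
move=> Hk; rewrite Cmod_R Rabs_right; last by left; exact: exp_pos.
apply: Rle_trans (exp_half_sqr_le s); apply: exp_le; nra.
Qed.

Lemma gauss_line (k : R) : k <= - / 2 -> exists L, is_line (fun s => RtoC (exp (k * (s * s)))) L.
Proof.
move=> Hk; apply: (line_ex _ 2); [lra | exact: rcont_RtoC_exp |].
by move=> s; apply: gauss_bound.
Qed.

Lemma Gamma_limit (a : R) (L : C) : 0 < a -> is_line (fun s => RtoC (exp (- / 2 * (s * s)))) L ->
  Clim eventually (fun N => RtoC (exp (a + INR N - (a + INR N) * ln (a + INR N)) * sqrt (a + INR N) * Gamma (a + INR N))) L.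
Proof.
move=> Ha HL.
have HaN : forall N, 0 < a + INR N by move=> N; have := pos_INR N; lra.
apply: (dominated_convergence _ (fun N s => RtoC (hG (a + INR N) s)) L (fun s => RtoC (exp (- / 2 * (s * s)))) 64).
- lra.
- exact: rcont_RtoC_exp.
- by move=> A HA; exists 0%nat => N s _ _; exact: rcont_hG.
- move=> A HA; exists 1%nat => N HN.
  have H1 : 1 <= a + INR N by have : INR 1 <= INR N by [apply: le_INR]; rewrite /=; lra.
  have -> : 64 / A = 2 * 32 / A by field; lra.
  apply: (line_tail (fun s => RtoC (hG (a + INR N) s))) => //; first lra.
  + exact: rcont_hG.
  + move=> s; rewrite Cmod_R Rabs_right; first exact: hG_bound.
    by left; exact: exp_pos.
  + exact: hG_line.
- move=> A HA; apply: (Rle_trans _ (2 * 2 / A)).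
    apply: (line_tail _ 2) HL HA => //; [lra | exact: rcont_RtoC_exp |].
    by move=> s; apply: gauss_bound; lra.
  by apply: Rmult_le_compat_r; [left; exact: Rinv_0_lt_compat | lra].
- move=> A HA.
  pose d N s := RtoC (- ((a + INR N) * (exp (s / sqrt (a + INR N)) - 1 - s / sqrt (a + INR N)) - s * s / 2)).
  apply: (Clim_ext (fun p => RtoC (exp (- / 2 * (snd p * snd p))) * cexp (d (fst p) (snd p)) - RtoC (exp (- / 2 * (snd p * snd p))))%C).
    move=> [N s] /=; rewrite /d cexp_RtoC -RtoC_mult -exp_plus /hG.
    congr Cminus; congr RtoC; congr exp; field.
    by have := sqrt_lt_R0 _ (HaN N); lra.
  apply: (unif_cexp a A 1 (A * A * (A * exp A)) (fun s => RtoC (exp (- / 2 * (s * s)))) d Ha).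
    move=> s _; rewrite Cmod_R Rabs_right; last by left; exact: exp_pos.
    by rewrite -[X in _ <= X]exp_0; apply: exp_le; nra.
  by move=> N s Hs H1; rewrite /d Cmod_R; exact: hG_dist_bound.
Qed.

(** The abscissa [sqrt (a + N)] moves with [N] to stay near the saddle; [LI_indep] later brings all
    these lines back to abscissa 1. *)
Lemma LI_limit (a : R) (L : C) : 0 < a -> is_line (fun s => RtoC (exp (- 2 * (s * s)))) L ->
  Clim eventually (fun N => RtoC (exp ((2 * (a + INR N) - 1) * ln (sqrt (a + INR N)) - (a + INR N))) * LI (sqrt (a + INR N)) (2 * (a + INR N) - 1) 0)%C L.
Proof.
move=> Ha HL.
have HaN : forall N, 0 < a + INR N by move=> N; have := pos_INR N; lra.
apply: (dominated_convergence _ (fun N s => hK (a + INR N) s) L (fun s => RtoC (exp (- 2 * (s * s)))) 4).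
- lra.
- exact: rcont_RtoC_exp.
- by move=> A HA; exists 0%nat => N s _ _; exact: rcont_hK.
- move=> A HA; exists 1%nat => N HN.
  have H1 : 1 <= a + INR N by have : INR 1 <= INR N by [apply: le_INR]; rewrite /=; lra.
  have -> : 4 / A = 2 * 2 / A by field; lra.
  apply: (line_tail (hK (a + INR N))) => //; first lra.
  + by move=> s; exact: rcont_hK.
  + by move=> s; exact: hK_bound.
  + exact: hK_line.
- move=> A HA; have -> : 4 / A = 2 * 2 / A by field; lra.
  apply: (line_tail _ 2) HL HA => //; [lra | exact: rcont_RtoC_exp |].
  by move=> s; apply: gauss_bound; lra.
- move=> A HA.
  pose d N s : C := (- (2 * (a + INR N) - 1) * (ln (1 + s * s / (a + INR N)) / 2) + s * s,
    (2 * (a + INR N) - 1) * atan (s / sqrt (a + INR N)) - 2 * sqrt (a + INR N) * s).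
  apply: (Clim_ext (fun p => RtoC (exp (- 2 * (snd p * snd p))) * cexp (d (fst p) (snd p)) - RtoC (exp (- 2 * (snd p * snd p))))%C).
    move=> [N s] /=; rewrite /hK -cexp_RtoC -cexp_plus; congr (cexp _ - _)%C.
    by apply: injective_projections; rewrite /d /=; ring.
  apply: (unif_cexp a A 1 (A * A * (A * A) + A * A + 2 * (A * A) * A + A) (fun s => RtoC (exp (- 2 * (s * s)))) d Ha).
    move=> s _; rewrite Cmod_R Rabs_right; last by left; exact: exp_pos.
    by rewrite -[X in _ <= X]exp_0; apply: exp_le; nra.
  by move=> N s Hs H1; exact: hK_dist_bound.
Qed.

(** At [xi = 0] the recurrence [LI_rec] loses its middle term, and at order [2 b] it is inverse to
    [Gamma (b + 1) = b * Gamma b]. *)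
Lemma LI_Gamma_shift (a : R) (N : nat) : 0 < a ->
  (RtoC (Gamma (a + INR N)) * LI 1 (2 * (a + INR N) - 1) 0)%C = (RtoC (Gamma a) * LI 1 (2 * a - 1) 0)%C.
Proof.
move=> Ha; elim: N => [|N <-]; first by rewrite Rplus_0_r.
rewrite S_INR -Rplus_assoc.
set b := a + INR N.
have Hb : 0 < b by rewrite /b; have := pos_INR N; lra.
rewrite (Gamma_succ b) // RtoC_mult.
have := LI_rec 1 (2 * b) 0 Rlt_0_1.
have -> : 2 * (b + 1) - 1 = 2 * b + 1 by ring.
have -> : RtoC (2 * b) = (2 * RtoC b)%C by rewrite RtoC_mult.
move=> H.
have H1 : (RtoC b * LI 1 (2 * b + 1) 0)%C = LI 1 (2 * b - 1) 0.
  have -> : (RtoC b * LI 1 (2 * b + 1) 0)%C = (/ 2 * (2 * RtoC b * LI 1 (2 * b + 1) 0))%C.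
    by field.
  by rewrite H; field.
by rewrite -H1; ring.
Qed.

(* [Gamma a * LI 1 (2 a - 1) 0] is 1-periodic, and by Laplace's method for both factors it tends to a
   constant, which its value at [a = 1] identifies. *)
Theorem LI_Gamma (c sg : R) : 0 < c -> -1 < sg ->
  (RtoC (Gamma ((1 + sg) / 2)) * LI c sg 0)%C = RtoC PI.
Proof.
move=> Hc Hsg; rewrite (LI_indep c 1 sg 0 Hc Rlt_0_1).
case: (gauss_line (- / 2) ltac:(lra)) => L1 HL1.
case: (gauss_line (-2) ltac:(lra)) => L2 HL2.
have H : forall a, 0 < a -> (RtoC (Gamma a) * LI 1 (2 * a - 1) 0)%C = (L1 * L2)%C.
  move=> a Ha.
  have P := Clim_mult _ _ _ _ (Gamma_limit a L1 Ha HL1) (LI_limit a L2 Ha HL2).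
  apply: (Clim_unique (F := eventually) _ _ _ _ _ (P _)).
  apply: (Clim_ext (fun _ => RtoC (Gamma a) * LI 1 (2 * a - 1) 0)%C); last exact: Clim_const.
  move=> N; rewrite -(LI_Gamma_shift a N Ha).
  set b := a + INR N.
  have Hb : 0 < b by rewrite /b; have := pos_INR N; lra.
  have Hs : 0 < sqrt b by apply: sqrt_lt_R0.
  rewrite (LI_indep (sqrt b) 1) //; last lra.
  have -> : (RtoC (exp (b - b * ln b) * sqrt b * Gamma b) * (RtoC (exp ((2 * b - 1) * ln (sqrt b) - b)) * LI 1 (2 * b - 1) 0))%C =
    (RtoC (exp (b - b * ln b) * sqrt b * exp ((2 * b - 1) * ln (sqrt b) - b)) * (RtoC (Gamma b) * LI 1 (2 * b - 1) 0))%C.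
    by rewrite !RtoC_mult; ring.
  (* The two Laplace normalisations are exactly inverse to each other. So the product equals
     [L1 * L2] for every [a], and neither Gaussian integral has to be evaluated. *)
  have -> : exp (b - b * ln b) * sqrt b * exp ((2 * b - 1) * ln (sqrt b) - b) = 1.
    rewrite -{1}(exp_ln (sqrt b)) // -!exp_plus -[RHS]exp_0; congr exp.
    have E : ln b = 2 * ln (sqrt b).
      by rewrite -{1}(sqrt_sqrt b); [rewrite ln_mult //; ring | lra].
    by rewrite E; ring.
  ring.
have -> : sg = 2 * ((1 + sg) / 2) - 1 by field.
have -> : (1 + (2 * ((1 + sg) / 2) - 1)) / 2 = (1 + sg) / 2 by field.
rewrite H; last lra.
(* The constant is read off at [a = 1], that is at [sg = 1], where [LI_1] applies. *)
rewrite -(H 1 Rlt_0_1) Gamma_1.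
have -> : 2 * 1 - 1 = 1 by ring.
by rewrite LI_1 //; [ring | lra].
Qed.

Lemma Gamma_nonneg (a : R) : 0 < a -> 0 <= Gamma a.
Proof.
move=> Ha; apply: Rnot_lt_le => Hneg.
case: (Gamma_is_line a Ha (- Gamma a)) => [|M HM]; first lra.
have M1 := Rmax_l 1 (M + 1); have M2 := Rmax_r 1 (M + 1).
have := HM (Rmax 1 (M + 1)) ltac:(lra).
set S := Rmax 1 (M + 1) in M1 M2 *.
have C1 : Cis (gl a) (- S) S (cint (gl a) (- S) S) by apply: Cis_cint => [|t _]; [lra | exact: rcont_gl].
have := is_RInt_fct_extend_fst _ _ _ _ C1 => C2.
have H0 : 0 <= Re (cint (gl a) (- S) S).
  apply: (is_RInt_le (fun _ => 0) (fun t => fst (gl a t)) (- S) S) C2 _; first lra.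
  - have := @is_RInt_const R_NormedModule (- S) S 0.
    by rewrite /scal /= /mult /= Rmult_0_r.
  - by move=> x _; left; exact: exp_pos.
have := re_le_Cmod (cint (gl a) (- S) S - RtoC (Gamma a)).
rewrite re_plus re_opp re_RtoC; have := Rle_abs (Re (cint (gl a) (- S) S) + - Gamma a).
lra.
Qed.

(** Positivity of the integrand gives only a weak inequality in the limit; strictness comes from the
    product formula, whose value [PI] is not 0. *)
Lemma Gamma_pos (a : R) : 0 < a -> 0 < Gamma a.
Proof.
move=> Ha; case: (Gamma_nonneg a Ha) => // H.
have := LI_Gamma 1 (2 * a - 1) Rlt_0_1 ltac:(lra).
have -> : (1 + (2 * a - 1)) / 2 = a by field.
rewrite -H Cmult_0_l => /RtoC_inj; have := PI_RGT_0; lra.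
Qed.

Lemma LI_xi0 (c sg : R) : 0 < c -> -1 < sg -> LI c sg 0 = RtoC (PI / Gamma ((1 + sg) / 2)).
Proof.
move=> Hc Hsg; have HG := Gamma_pos ((1 + sg) / 2) ltac:(lra).
have HG' : RtoC (Gamma ((1 + sg) / 2)) <> 0 by move/RtoC_inj; lra.
have -> : LI c sg 0 = (RtoC (Gamma ((1 + sg) / 2)) * LI c sg 0 / RtoC (Gamma ((1 + sg) / 2)))%C by field.
by rewrite LI_Gamma // RtoC_div //; lra.
Qed.

(* With [M = Re LI (sg+1)], [M' = Re LI sg] and [2 M'' + xi M' = sg M], the product
   [M (exp (xi^2/4) M')] is nondecreasing and positive at 0. *)
Theorem LI_neq0 (c sg xi : R) : 0 < c -> 0 <= sg -> 0 <= xi -> LI c sg xi <> 0.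
Proof.
move=> Hc Hsg Hxi H0.
pose M x := Re (LI c (sg + 1) x); pose N x := Re (LI c sg x).
have DM : forall x, is_derive M x (N x).
  move=> x; have := LI_derive c (sg + 1) x Hc.
  by have -> : sg + 1 - 1 = sg by ring.
have DN : forall x, is_derive N x (Re (LI c (sg - 1) x)) by move=> x; apply: LI_derive.
have Rec : forall x, Re (LI c (sg - 1) x) = (sg * M x - x * N x) / 2.
  move=> x; have := f_equal Re (LI_rec c sg x Hc).
  rewrite re_plus !re_scal_l -/(M x) -/(N x); lra.
pose p x := M x * (exp (x * x / 4) * N x).
have Dp : forall x, is_derive p x (exp (x * x / 4) * (N x * N x + sg / 2 * (M x * M x))).
  have De : forall x : R, is_derive (fun x : R => exp (x * x / 4)) x (x / 2 * exp (x * x / 4)).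
    by move=> x; rewrite /Rdiv; auto_derive => //; field.
  move=> x.
  have D1 := is_derive_mult _ _ _ _ _ (De x) (DN x) Rmult_comm.
  have D2 := is_derive_mult _ _ _ _ _ (DM x) D1 Rmult_comm.
  have -> : exp (x * x / 4) * (N x * N x + sg / 2 * (M x * M x)) =
    plus (mult (N x) (mult (exp (x * x / 4)) (N x)))
     (mult (M x) (plus (mult (x / 2 * exp (x * x / 4)) (N x)) (mult (exp (x * x / 4)) (Re (LI c (sg - 1) x))))).
    by rewrite Rec /plus /mult /=; field.
  exact: D2.
have P0 : 0 < p 0.
  rewrite /p /M /N !LI_xi0 //; try lra.
  have HP := PI_RGT_0.
  have G1 := Gamma_pos ((1 + (sg + 1)) / 2) ltac:(lra).
  have G2 := Gamma_pos ((1 + sg) / 2) ltac:(lra).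
  apply: Rmult_lt_0_compat; first exact: Rdiv_lt_0_compat.
  by apply: Rmult_lt_0_compat; [exact: exp_pos | exact: Rdiv_lt_0_compat].
have PX : p xi = 0 by rewrite /p /N H0 /=; ring.
case: (MVT_gen p 0 xi (fun x => exp (x * x / 4) * (N x * N x + sg / 2 * (M x * M x)))).
- by move=> x _; exact: Dp.
- move=> x _; apply: derivable_continuous_pt.
  by exists (exp (x * x / 4) * (N x * N x + sg / 2 * (M x * M x))); apply/is_derive_Reals.
- move=> x [Hx Heq].
  have E1 := exp_pos (x * x / 4).
  have E2 : 0 <= N x * N x + sg / 2 * (M x * M x).
    apply: Rplus_le_le_0_compat; first nra.
    by apply: Rmult_le_pos; [lra | nra].
  have : 0 <= exp (x * x / 4) * (N x * N x + sg / 2 * (M x * M x)) * (xi - 0).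
    by apply: Rmult_le_pos; [apply: Rmult_le_pos; lra | lra].
  lra.
Qed.

(** * The cycle index *)

Fixpoint rsum (a : nat -> R) (n : nat) : R :=
  match n with O => 0 | S m => rsum a m + a m end.

Module CycleIndex.
From mathcomp Require Import all_boot all_fingroup ssralg.
From mathcomp Require Import Rstruct.
Import GRing.Theory.
Local Open Scope ring_scope.

Set Implicit Arguments.
Unset Strict Implicit.
Section CycleIndex.
Variables (T : finType) (R : comPzRingType) (x : nat -> R).
Implicit Types (A : {set T}) (s : {perm T}).

Lemma porbit_agree s s' z :
  {in porbit s z, s =1 s'} -> porbit s' z = porbit s z.
Proof.
move=> H.
have E n : (s' ^+ n)%g z = (s ^+ n)%g z.
  elim: n => [|n IH]; first by rewrite !expg0.
  by rewrite !expgSr !permM IH H // mem_porbit.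
apply/setP => y; apply/porbitP/porbitP => [[i ->]|[i ->]]; exists i; by rewrite E.
Qed.

(** A permutation of [A] is a permutation of [T] supported on [A]; the condition [c \subset A]
    discards the fixed points outside. *)
Definition cycle_weight A s : R := \prod_(c in porbits s | c \subset A) x #|c|.
Definition W A : R := \sum_(s | perm_on A s) cycle_weight A s.

(* The cycle through [a] is counted as if it were longer by [k]. *)
Definition V (a : T) (k : nat) A : R :=
  \sum_(s | perm_on A s) x (#|porbit s a| + k)%N *
    \prod_(c in porbits s | (c \subset A) && (a \notin c)) x #|c|.

Lemma porbit_subset A s a : perm_on A s -> a \in A -> porbit s a \subset A.
Proof.
move=> sA aA; apply/subsetP => y /porbitP [i ->].
elim: i => [|i IH]; first by rewrite expg0 perm1.
by rewrite expgSr permM (perm_closed _ sA).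
Qed.

Lemma W_V A a : a \in A -> W A = V a 0 A.
Proof.
move=> aA; apply: eq_bigr => s sA.
rewrite addn0 /cycle_weight (bigD1 (porbit s a)) /=; last first.
  by rewrite imset_f ?inE //= porbit_subset.
congr (_ * _); apply: eq_bigl => c; rewrite -andbA.
case cs: (c \in porbits s) => //=; congr (_ && _).
case/imsetP: cs => z _ ->.
by rewrite eq_porbit_mem porbit_sym.
Qed.

Lemma perm_on_fix A s a : perm_on A s -> s a = a -> perm_on (A :\ a) s.
Proof.
move=> sA sa; apply/subsetP => y Hy; rewrite !inE; apply/andP; split.
  by apply: contraTneq Hy => ->; rewrite inE sa eqxx.
by apply: (subsetP sA).
Qed.

Section RemoveSuccessor.
Variables (a b : T) (s' : {perm T}).
Hypothesis s'b : s' b = b.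
(** This inserts the fixed point [b] of [s'] into the cycle of [a], right after [a]: products act
    from the left, so [s a = b] and [s b = s' a]. *)
Let s := (tperm a b * s')%g.

Let sa : s a = b.
Proof. by rewrite permM tpermL. Qed.

Let s_agree z : z != a -> z != b -> s z = s' z.
Proof. by move=> za zb; rewrite permM tpermD // eq_sym. Qed.

Let b_in : b \in porbit s a.
Proof. by rewrite -sa -{1}[s]expg1 mem_porbit. Qed.

Let porbit_b : porbit s' b = [set b].
Proof.
apply/setP => y; rewrite !inE; apply/porbitP/eqP => [[i ->]|->]; last by exists 0%N; rewrite expg0 perm1.
by elim: i => [|i IH]; rewrite ?expg0 ?perm1 // expgSr permM IH.
Qed.

Let avoid_s z : a \notin porbit s z -> porbit s' z = porbit s z.
Proof.
move=> az; apply: porbit_agree => y yz; apply: s_agree.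
  by apply: contraNneq az => <-.
apply: contraNneq az => yb; move: yz; rewrite yb -eq_porbit_mem => /eqP <-.
by rewrite porbit_sym.
Qed.

Let avoid_s' z : a \notin porbit s' z -> b \notin porbit s' z -> porbit s z = porbit s' z.
Proof.
move=> az bz; apply: porbit_agree => y yz; rewrite s_agree //.
  by apply: contraNneq az => <-.
by apply: contraNneq bz => <-.
Qed.

Lemma b_notin_porbit : a != b -> b \notin porbit s' a.
Proof. by move=> ab; rewrite porbit_sym porbit_b inE. Qed.

Lemma porbit_insert : porbit s a = b |: porbit s' a.
Proof.
apply/setP => z; rewrite in_setU1; apply/idP/idP.
- apply: contraTT; rewrite negb_or => /andP [zb za].
  have az : a \notin porbit s' z by rewrite porbit_sym.
  have bz : b \notin porbit s' z by rewrite porbit_sym porbit_b inE.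
  by rewrite porbit_sym avoid_s'.
- case/orP => [/eqP -> //|za]; apply: contraTT za => za.
  have az : a \notin porbit s z by rewrite porbit_sym.
  by rewrite porbit_sym avoid_s.
Qed.

Lemma porbits_insert A c :
  (c \in porbits s) && ((c \subset A) && (a \notin c)) =
  (c \in porbits s') && ((c \subset A :\ b) && (a \notin c)).
Proof.
apply/andP/andP => -[/imsetP [z _ ->] /andP [H1 H2]].
- rewrite -(avoid_s H2) imset_f ?inE // avoid_s // H2 andbT; split=> //.
  rewrite subsetD1 H1 /=; apply: contra H2 => bz.
  by move: bz; rewrite -eq_porbit_mem => /eqP <-; rewrite porbit_sym.
- move: H1; rewrite subsetD1 => /andP [H1 H3].
  by rewrite -(avoid_s' H2 H3) imset_f ?inE // avoid_s' // H1 H2.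
Qed.

End RemoveSuccessor.

(** Sort by [s a]. If [a] is fixed, the rest is any permutation of [A :\ a]. If [s a = b], taking
    [b] out of the cycle is a bijection onto the permutations of [A :\ b], and [k.+1] remembers the
    lost unit of length. *)
Lemma V_rec A a k : a \in A ->
  V a k A = x k.+1 * W (A :\ a) + \sum_(b in A :\ a) V a k.+1 (A :\ b).
Proof.
move=> aA; rewrite /V (bigID (fun s : {perm T} => s a == a)) /=; congr (_ + _).
- rewrite /W big_distrr /=; apply: eq_big => s.
    apply/andP/idP => [[sA /eqP sa]|sA]; first exact: perm_on_fix.
    split; last by apply/eqP; apply: (out_perm sA); rewrite !inE eqxx.
    by apply: subset_trans sA _; rewrite subD1set.
  case/andP => sA /eqP sa.
  have Ea : porbit s a = [set a].
    apply/setP => y; rewrite !inE; apply/porbitP/eqP => [[i ->]|->]; last by exists 0%N; rewrite expg0 perm1.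
    by elim: i => [|i IH]; rewrite ?expg0 ?perm1 // expgSr permM IH.
  rewrite Ea cards1 add1n; congr (_ * _); apply: eq_bigl => c.
  by rewrite subsetD1.
- rewrite (partition_big (fun s : {perm T} => s a) (fun b => b \in A :\ a)) /=; last first.
    by move=> s /andP [sA sa]; rewrite !inE sa (perm_closed _ sA).
  apply: eq_bigr => b; rewrite !inE => /andP [ba bA].
  have ab : a != b by rewrite eq_sym.
  rewrite (reindex_onto (fun s' => (tperm a b * s')%g) (fun s => (tperm a b * s)%g)) /=; last first.
    by move=> s _; rewrite mulgA tperm2 mul1g.
  apply: eq_big => s'.
    rewrite mulgA tperm2 mul1g eqxx andbT permM tpermL.
    apply/andP/idP => [[/andP [sA _] /eqP sb]|sA].
      apply/subsetP => y; rewrite !inE => Hy.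
      have yb : y != b by apply: contraNneq Hy => ->; rewrite sb.
      rewrite yb /=; case: (eqVneq y a) => [-> //|ya].
      by apply: (subsetP sA); rewrite inE permM tpermD // eq_sym.
    have sb : s' b = b by apply: (out_perm sA); rewrite !inE eqxx.
    rewrite sb ba eqxx; split=> //; rewrite andbT.
    apply/subsetP => y; rewrite inE permM => Hy.
    case: (eqVneq y a) => [-> //|ya]; case: (eqVneq y b) => [-> //|yb].
    have Ey : tperm a b y = y by rewrite tpermD // eq_sym.
    have : y \in A :\ b by apply: (subsetP sA); rewrite inE -{1}Ey.
    by rewrite inE => /andP [].
  rewrite mulgA tperm2 mul1g eqxx andbT permM tpermL => /andP [_ /eqP sb].
  rewrite (porbit_insert a sb) cardsU1 (b_notin_porbit sb ab) add1n addSnnS; congr (_ * _).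
  by apply: eq_bigl => c; apply: (porbits_insert a sb).
Qed.

Lemma W_set0 : W set0 = 1.
Proof.
rewrite /W (big_pred1 1%g); last first.
  move=> s; apply/idP/eqP => [s0|->]; last exact: perm_on1.
  by apply/permP => y; rewrite perm1; apply: (out_perm s0); rewrite inE.
rewrite /cycle_weight big1 // => c /andP [/imsetP [z _ ->]].
by rewrite subset0 => /eqP c0; have := porbit_id 1%g z; rewrite c0 inE.
Qed.

(** The falling factorial counts the ordered choices of the [j] elements that follow [a] in a cycle
    of length [j + 1]. The inner induction unrolls [V_rec]; the outer one, on the size of [A],
    supplies [W] of what remains. *)
Theorem W_card (u : nat -> R) :
  u 0%N = 1 ->
  (forall n, u n.+1 = \sum_(j < n.+1) ((n ^_ j)%:R * x j.+1 * u (n - j)%N)) ->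
  forall A, W A = u #|A|.
Proof.
move=> u0 uS A.
have [n le_n] := ubnP #|A|; elim: n A le_n => // n IH A le_n.
have VE : forall m (B : {set T}) a k, a \in B -> #|B| = m.+1 -> (m < n)%N ->
    V a k B = \sum_(j < m.+1) ((m ^_ j)%:R * x (k + j).+1 * u (m - j)%N).
  elim=> [|m IHm] B a k aB cB lt_m.
    have cBa : #|B :\ a| = 0%N by move: (cardsD1 a B); rewrite aB cB add1n => -[].
    rewrite V_rec // (cards0_eq cBa) W_set0 big_set0 addr0 big_ord1.
    by rewrite ffactn0 addn0 subn0 u0 mul1r.
  have cBa : #|B :\ a| = m.+1 by move: (cardsD1 a B); rewrite aB cB add1n => -[].
  rewrite V_rec // IH ?cBa //.
  rewrite (eq_bigr (fun=> \sum_(j < m.+1) ((m ^_ j)%:R * x (k.+1 + j).+1 * u (m - j)%N))); last first.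
    move=> b; rewrite !inE => /andP [ba bB].
    apply: IHm; rewrite ?(ltnW lt_m) //.
      by rewrite !inE eq_sym ba.
    by move: (cardsD1 b B); rewrite bB cB add1n => -[].
  rewrite sumr_const cBa [RHS]big_ord_recl ffactn0 addn0 subn0 mul1r; congr (_ + _).
  rewrite -mulr_natl big_distrr /=; apply: eq_bigr => j _.
  rewrite /bump /= add1n subSS ffactSS natrM addSnnS.
  by rewrite !mulrA.
have [/eqP A0|[a aA]] := set_0Vmem A; first by rewrite (eqP A0) W_set0 cards0 u0.
have cA : #|A| = #|A|.-1.+1 by rewrite prednK // card_gt0; apply/set0Pn; exists a.
rewrite (W_V aA) (VE #|A|.-1) //; last by rewrite -ltnS -cA.
by rewrite [in RHS]cA uS.
Qed.

End CycleIndex.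

Lemma card_set_ord_lt (N : nat) (c : {set 'I_N}) : (#|c| < N.+1)%N.
Proof. by rewrite ltnS -[X in (_ <= X)%N](card_ord N) max_card. Qed.

Lemma prod_cycle_count (N : nat) (R : comPzRingType) (x : nat -> R) (s : 'S_N) :
  \prod_(j < N) x j.+1 ^+ #|[set c in porbits s | #|c| == j.+1]| =
  cycle_weight x [set: 'I_N] s.
Proof.
rewrite /cycle_weight (eq_bigl (fun c => c \in porbits s)); last first.
  by move=> c; rewrite subsetT andbT.
(* Cycles are sorted by length in ['I_N.+1]. The class of length 0 is split off next and is empty,
   since an orbit contains a point. *)
rewrite (partition_big (fun c : {set 'I_N} => inord #|c| : 'I_N.+1) predT) //=.
rewrite big_ord_recl [X in _ = X * _]big1 ?mul1r; last first.
  move=> c /andP [/imsetP [z _ ->] /eqP] /(congr1 val).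
  rewrite /= inordK ?card_set_ord_lt //.
  by move=> H; have := card_porbit_neq0 s z; rewrite H.
apply: eq_bigr => j _.
rewrite (eq_bigr (fun=> x j.+1)); last first.
  move=> c /andP [_ /eqP] /(congr1 val).
  by rewrite /= inordK ?card_set_ord_lt // => ->.
rewrite prodr_const; congr (_ ^+ _); apply: eq_card => c; rewrite !inE.
congr (_ && _); apply/eqP/eqP => [H|].
  by apply: val_inj; rewrite /= inordK ?H // ltnS.
by move=> /(congr1 val); rewrite /= inordK ?card_set_ord_lt.
Qed.

Lemma factE (n : nat) : Factorial.fact n = (n`!)%N.
Proof. by elim: n => [|n IH] //; rewrite /= factS mulSn -IH plusE multE. Qed.

Lemma rsumE (a : nat -> R) (n : nat) : rsum a n = \sum_(i < n) a i.
Proof. by elim: n => [|n IH]; rewrite ?big_ord0 // big_ord_recr /= -IH. Qed.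

(** Multiplied by [n!], the recurrence for [h] is the one of [W_card], since
    [n! = (n ^_ k) * (n - k)!]. *)
Lemma HN_recurrence (theta kappa : nat -> R) (N : nat) (h : nat -> R) :
  h 0%N = R1 ->
  (forall n, Rmult (INR n.+1) (h n.+1) =
     rsum (fun k => Rmult (Rplus (theta k.+1) (Rmult (INR N) (kappa k.+1))) (h (Nat.sub n k))) n.+1) ->
  HN theta kappa N = h N.
Proof.
move=> h0 hS.
pose x j : R := theta j + INR N * kappa j.
pose u n : R := (n`!)%:R * h n.
have HW : W x [set: 'I_N] = u N.
  rewrite (@W_card _ _ x u) ?cardsT ?card_ord //.
    by rewrite /u fact0 mul1r h0.
  move=> n; rewrite /u factS mulnC natrM -mulrA.
  have -> : (n.+1)%:R * h n.+1 = \sum_(k < n.+1) x k.+1 * h (n - k)%N :> R.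
    by rewrite -INRE; have := hS n; rewrite rsumE.
  rewrite big_distrr; apply: eq_bigr => k _.
  have kn : (k <= n)%N by rewrite -ltnS ltn_ord.
  by rewrite /= -(ffact_fact kn) natrM !mulrA; congr (_ * _); rewrite mulrAC.
have HS : \sum_(s : 'S_N) \prod_(j < N) x j.+1 ^+ cycle_count s j.+1 = W x [set: 'I_N].
  rewrite /W; apply: eq_big => s; last by move=> _; exact: prod_cycle_count.
  by apply/esym/subsetP => y _; rewrite inE.
rewrite /HN HS HW /u factE INRE RmultE mulrA.
have nz : (N`!)%:R != 0 :> R by rewrite -INRE; apply/eqP; rewrite -factE; exact: INR_fact_neq_0.
by rewrite RinvE mulVf ?mul1r.
Qed.

End CycleIndex.

Lemma Re_csum_rsum (a : nat -> C) (n : nat) : Re (csum a n) = rsum (fun k => Re (a k)) n.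
Proof. by elim: n => [|n IH] //=; rewrite -IH. Qed.

Lemma rsum_ext (a b : nat -> R) (n : nat) : (forall k, a k = b k) -> rsum a n = rsum b n.
Proof. by move=> H; elim: n => [|n IH] //=; rewrite IH H. Qed.

Lemma gser_0 (c : nat -> R) : gser c 0 = 0.
Proof.
rewrite /gser /cseries.
have E : forall n, (RtoC (gcoef c n) * 0 ^ n)%C = 0.
  by case=> [|n] /=; ring.
have Z : Series (fun _ : nat => 0) = 0.
  rewrite -[RHS](Rmult_0_l (Series (fun _ : nat => 0))) -Series_scal_l.
  by apply: Series_ext => n; ring.
have E1 : Series (fun n => Re (RtoC (gcoef c n) * 0 ^ n)) = 0.
  by rewrite -[RHS]Z; apply: Series_ext => n; rewrite E.
have E2 : Series (fun n => Im (RtoC (gcoef c n) * 0 ^ n)) = 0.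
  by rewrite -[RHS]Z; apply: Series_ext => n; rewrite E.
by rewrite E1 E2.
Qed.

(** The division by [j] in [gcoef] makes [k + 1] times the coefficient of [GN] equal to the weight
    of a cycle of length [k + 1], so [exp_coef_rec] is the recurrence of the cycle index. *)
Theorem HN_zcoef (theta kappa : nat -> R) (Rad : R) (N : nat) :
  0 < Rad -> CV_radius (gcoef theta) = Finite Rad -> CV_radius (gcoef kappa) = Finite Rad ->
  holo Rad (gser theta) -> holo Rad (gser kappa) ->
  HN theta kappa N = Re (zcoef N (fun z => cexp (GN theta kappa N z))).
Proof.
move=> HR Ct Ck Ht Hk.
have HG : holo Rad (GN theta kappa N) by apply: holo_plus => //; apply: holo_scal.
have Ecoef : forall k, (RtoC (INR (S k)) * zcoef (S k) (GN theta kappa N))%C =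
    RtoC (theta (S k) + INR N * kappa (S k)).
  move=> k.
  rewrite (zcoef_plus _ _ _ Rad) // ?(zcoef_scal _ _ _ Rad) //; last exact: holo_scal.
  rewrite !(zcoef_gser _ Rad) // -!RtoC_mult -RtoC_plus -RtoC_mult; congr RtoC.
  by rewrite /gcoef; field; apply: not_0_INR.
apply: (@CycleIndex.HN_recurrence theta kappa N (fun n => Re (zcoef n (fun z => cexp (GN theta kappa N z))))).
  by rewrite zcoef_0 /GN !gser_0 Cmult_0_r Cplus_0_l cexp_0.
move=> n; rewrite -re_scal_l (exp_coef_rec _ Rad) // Re_csum_rsum.
apply: rsum_ext => k.
by rewrite Ecoef re_scal_l.
Qed.

(** * The power series on circles *)

(** A point of the closed disc other than [Rad] has real part below [Rad], so the argument of
    [z - Rad] exceeds [PI / 2] in absolute value; and [cos phi > 0] makes the radius of [Delta0]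
    larger than [Rad]. *)
Lemma disc_Delta0 (Rad eta phi : R) (z : C) :
  0 < Rad -> 0 < eta -> 0 < phi < PI / 2 -> Cmod z <= Rad -> z <> RtoC Rad ->
  Delta0 Rad eta phi z.
Proof.
move=> HR He Hp Hz Hne.
have HP0 := PI_RGT_0.
have Hcos : 0 < cos phi by apply: cos_gt_0; lra.
split; last split=> //.
- apply: Rle_lt_trans Hz _.
  rewrite -{1}(Rmult_1_r Rad); apply: Rmult_lt_compat_l => //.
  apply: Rlt_le_trans (Rle_trans _ _ _ (Rle_abs _) (re_le_Cmod _)).
  rewrite re_plus re_scal_l /cexp /= exp_0; nra.
- have Hre : Re z < Rad.
    have := Rle_trans _ _ _ (Rle_abs _) (re_le_Cmod z) => H.
    case: (Rle_lt_or_eq_dec (Re z) Rad) => [|//|E]; first lra.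
    exfalso; apply: Hne.
    have : Cmod z ^ 2 <= Rad ^ 2 by apply: pow_incr; split; [exact: Cmod_ge_0 | done].
    rewrite Cmod2_alt E => H2.
    have H3 : Im z * Im z = 0 by nra.
    have Im0 : Im z = 0 by case/Rmult_integral: H3.
    by apply: injective_projections => /=.
  rewrite /carg.
  have Ex : Re (z - RtoC Rad) = Re z - Rad by rewrite re_plus re_opp.
  have Ey : Im (z - RtoC Rad) = Im z by rewrite im_plus im_opp /=; ring.
  rewrite Ex Ey.
  case: Rlt_dec => H1; first lra.
  case: Rlt_dec => H2; last lra.
  have Hinv : / (Re z - Rad) < 0 by apply: Rinv_lt_0_compat.
  case: Rle_dec => H3.
  + have : atan (Im z / (Re z - Rad)) <= 0.
      rewrite -atan_0; have : Im z / (Re z - Rad) <= 0 by rewrite /Rdiv; nra.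
      by case=> [H|->]; [left; exact: atan_increasing | right].
    have := atan_bound (Im z / (Re z - Rad)) => H4 H5.
    by rewrite Rabs_right; lra.
  + have : 0 < atan (Im z / (Re z - Rad)).
      by rewrite -atan_0; apply: atan_increasing; rewrite /Rdiv; nra.
    have := atan_bound (Im z / (Re z - Rad)) => H4 H5.
    by rewrite Rabs_left; lra.
Qed.

Lemma holomorphic_cdiff (U : C -> Prop) (f : C -> C) (z : C) :
  holomorphic_on U f -> U z -> exists l, cdiff f z l.
Proof. by move=> H /H [l Hl]; exists l; apply/cdiff_derive. Qed.

Lemma Cmod_cpow (a : C) (d : R) : a <> 0 -> Cmod (cpow a (RtoC d)) = exp (d * ln (Cmod a)).
Proof.
move=> Ha; rewrite /cpow; case: Ceq_dec => // _.
by rewrite Cmod_cexp re_scal_l.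
Qed.

Lemma Cmod_cpow_le (a : C) (d e : R) : 0 < d -> 0 < e -> Cmod a <= exp (ln e / d) ->
  Cmod (cpow a (RtoC d)) <= e.
Proof.
move=> Hd He Ha; case: (Ceq_dec a 0) => [->|H0].
  by rewrite /cpow; case: Ceq_dec => // _; rewrite Cmod_0; lra.
have Hp : 0 < Cmod a by apply/Cmod_gt_0.
rewrite Cmod_cpow // -[X in _ <= X](exp_ln e) //; apply: exp_le.
have : ln (Cmod a) <= ln e / d.
  rewrite -(ln_exp (ln e / d)); case: Ha => [Ha|->]; last by right.
  by left; apply: ln_increasing.
move=> H; have E : d * (ln e / d) = ln e by field; lra.
by have := Rmult_le_compat_l d _ _ (Rlt_le _ _ Hd) H; rewrite E.
Qed.

(** Compactness of the closed disc, bisecting the square around it. At [Rad] the O-condition bounds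
    [f], at the other points of the closed disc continuity does, and near points outside there is
    nothing to bound. *)
Lemma bounded_on_disc (Rad eta phi delta : R) (f : C -> C) :
  0 < Rad -> 0 < eta -> 0 < phi < PI / 2 -> 0 < delta ->
  holomorphic_on (Delta0 Rad eta phi) f ->
  bigO_near (Delta0 Rad eta phi) Rad (fun z => f z - 1)%C
    (fun z => cpow (1 - z / RtoC Rad)%C (RtoC delta)) ->
  exists M, 0 <= M /\ forall z, Cmod z < Rad -> Cmod (f z) <= M.
Proof.
move=> HR He Hp Hd Hf [M0 [eps [Heps HO]]].
have Hin : forall z, Cmod z < Rad -> Delta0 Rad eta phi z.
  move=> z Hz; apply: disc_Delta0 => //; first lra.
  by move=> E; move: Hz; rewrite E Cmod_R Rabs_right; lra.
pose P (a b c d : R) := exists M, 0 <= M /\ forall x y, a <= x <= b -> c <= y <= d ->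
  Cmod (x, y) < Rad -> Cmod (f (x, y)) <= M.
suff [M [HM H]] : P (- Rad) Rad (- Rad) Rad.
  exists M; split=> // -[x y] Hz; apply: H => //.
  - by have := re_le_Cmod (x, y); rewrite /Re /=; move/Rabs_le_between; lra.
  - by have := im_le_Cmod (x, y); rewrite /Im /=; move/Rabs_le_between; lra.
apply: rect_induction; try lra.
- move=> a b c d Hab Hcd [M1 [P1 Q1]] [M2 [P2 Q2]] [M3 [P3 Q3]] [M4 [P4 Q4]].
  exists (M1 + M2 + M3 + M4); split; first lra.
  move=> x y Hx Hy Hz.
  case: (Rle_dec x ((a + b) / 2)) => H1; case: (Rle_dec y ((c + d) / 2)) => H2.
  + by have := Q1 x y ltac:(lra) ltac:(lra) Hz; lra.
  + by have := Q3 x y ltac:(lra) ltac:(lra) Hz; lra.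
  + by have := Q2 x y ltac:(lra) ltac:(lra) Hz; lra.
  + by have := Q4 x y ltac:(lra) ltac:(lra) Hz; lra.
- move=> x y Hx Hy.
  suff [r [Hr [M [HM H]]]] : exists r, 0 < r /\ exists M, 0 <= M /\ forall w, Cmod (w - (x, y)) < r ->
      Cmod w < Rad -> Cmod (f w) <= M.
    exists (r / 2); split; first lra.
    move=> a' b' c' d' Ha' Hb' Hc' Hd' Hs1 Hs2; exists M; split=> // x1 y1 Hx1 Hy1 Hz.
    apply: H => //; apply: Rle_lt_trans; first exact: Cmod_le_sum.
    rewrite /Re /Im /=.
    have : Rabs (x1 + - x) < r / 2 by apply: Rabs_def1; lra.
    have : Rabs (y1 + - y) < r / 2 by apply: Rabs_def1; lra.
    lra.
  case: (Rle_dec (Cmod (x, y)) Rad) => Hz.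
  + case: (Ceq_dec (x, y) (RtoC Rad)) => [->|Hne].
    * have Hm : 0 < Rmin eps Rad by apply: Rmin_pos.
      have M1 := Rmin_l eps Rad; have M2 := Rmin_r eps Rad.
      exists (Rmin eps Rad); split=> //.
      exists (1 + Rabs M0); split; first by have := Rabs_pos M0; lra.
      move=> w Hw Hwr.
      have := HO w (Hin w Hwr) ltac:(lra) => H.
      have Hq : Cmod (cpow (1 - w / RtoC Rad) (RtoC delta)) <= 1.
        apply: Cmod_cpow_le => //; first lra.
        rewrite ln_1 /Rdiv Rmult_0_l exp_0.
        have HRc : RtoC Rad <> 0 by move/RtoC_inj; lra.
        have -> : (1 - w / RtoC Rad)%C = (- (w - RtoC Rad) / RtoC Rad)%C by field.
        rewrite Cmod_div // Cmod_opp Cmod_R (Rabs_right Rad); last lra.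
        apply: (Rmult_le_reg_r Rad) => //.
        have -> : Cmod (w - RtoC Rad) / Rad * Rad = Cmod (w - RtoC Rad) by field; lra.
        lra.
      have := Cmod_triangle_sub (f w) 1; rewrite Cmod_1.
      have := Rle_abs M0; have := Rabs_pos M0; have := Cmod_ge_0 (cpow (1 - w / RtoC Rad) (RtoC delta)).
      nra.
    * case: (holomorphic_cdiff _ _ _ Hf (disc_Delta0 _ _ _ _ HR He Hp Hz Hne)) => l /cdiff_cont Hc.
      case/locally_C: (Hc 1 Rlt_0_1) => r [Hr H].
      exists r; split=> //; exists (Cmod (f (x, y)) + 1); split; first by have := Cmod_ge_0 (f (x, y)); lra.
      by move=> w Hw _; have := H w Hw; have := Cmod_triangle_sub (f w) (f (x, y)); lra.
  + exists (Cmod (x, y) - Rad); split; first lra.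
    exists 0; split; first lra.
    move=> w Hw Hwr; exfalso.
    by have := Cmod_triangle_sub (x, y) w; rewrite Cmod_sub_sym; lra.
Qed.

Lemma cexp_pow (x t : R) (n : nat) : (cexp (x, t) ^ n)%C = cexp (INR n * x, INR n * t).
Proof.
rewrite -cexp_nat; congr cexp.
by apply: injective_projections; rewrite /=; ring.
Qed.

Lemma exp_INR (x : R) (n : nat) : exp (INR n * x) = exp x ^ n.
Proof.
elim: n => [|n IH]; first by rewrite Rmult_0_l exp_0.
by rewrite S_INR Rmult_plus_distr_r exp_plus IH Rmult_1_l /=; ring.
Qed.

Lemma Re_gser (c : nat -> R) (x t : R) :
  Re (gser c (cexp (x, t))) = Series (fun n => gcoef c n * exp x ^ n * cos (INR n * t)).
Proof.
rewrite /gser /cseries /Re /=; apply: Series_ext => n.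
by rewrite cexp_pow /cexp /= -exp_INR; ring.
Qed.

Section NonnegativeSeries.
Variables (c : nat -> R) (Rad : R).
Hypotheses (HR : 0 < Rad) (Hc : forall j, (1 <= j)%nat -> 0 <= c j)
  (Hrad : CV_radius (gcoef c) = Finite Rad).

Lemma gser_ex (x t : R) : exp x < Rad ->
  ex_series (fun n => gcoef c n * exp x ^ n * cos (INR n * t)).
Proof.
move=> Hx; have Hp := exp_pos x.
apply: (@ex_series_le R_AbsRing R_CompleteNormedModule _ (fun n => Rabs (gcoef c n) * exp x ^ n)).
  move=> n; rewrite /norm /= /abs /= !Rabs_mult (Rabs_right (exp x ^ n)); last by apply: Rle_ge; apply: pow_le; lra.
  rewrite -[X in _ <= X]Rmult_1_r; apply: Rmult_le_compat_l.
    by apply: Rmult_le_pos; [exact: Rabs_pos | apply: pow_le; lra].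
  by apply: Rabs_le; have := COS_bound (INR n * t); lra.
by apply: (gcoef_summable c Rad) => //; lra.
Qed.

Lemma gcoef_term_pos (x t : R) (n : nat) : 0 <= gcoef c n * exp x ^ n * (1 - cos (INR n * t)).
Proof.
have := gcoef_nonneg c n Hc => H.
apply: Rmult_le_pos; first by apply: Rmult_le_pos => //; apply: pow_le; left; exact: exp_pos.
by have := COS_bound (INR n * t); lra.
Qed.

Lemma Re_gser_diff (x t : R) : exp x < Rad ->
  Re (gser c (cexp (x, 0))) - Re (gser c (cexp (x, t))) =
  Series (fun n => gcoef c n * exp x ^ n * (1 - cos (INR n * t))).
Proof.
move=> Hx; rewrite !Re_gser -Series_minus; [|exact: gser_ex|exact: gser_ex].
by apply: Series_ext => n; rewrite Rmult_0_r cos_0; ring.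
Qed.

Lemma gser_diff_ex (x t : R) : exp x < Rad ->
  ex_series (fun n => gcoef c n * exp x ^ n * (1 - cos (INR n * t))).
Proof.
move=> Hx.
apply: ex_series_ext (ex_series_minus _ _ (gser_ex x 0 Hx) (gser_ex x t Hx)) => n.
by rewrite Rmult_0_r cos_0 /minus /plus /opp /=; ring.
Qed.

Lemma Series_ge_term (a : nat -> R) (j : nat) :
  (forall n, 0 <= a n) -> ex_series a -> a j <= Series a.
Proof.
move=> Ha Hex.
have H0 : 0 <= Series a - sum_n a j.
  have := Series_tail_le (fun _ => 0) a j _ Hex => H.
  have {}H := H (fun n => eq_ind_r (fun y => y <= a n) (Ha n) Rabs_R0).
  by apply: Rle_trans H; exact: Rabs_pos.
have H1 : forall k, 0 <= sum_n a k.
  elim=> [|k IH]; first by rewrite sum_O.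
  by rewrite sum_Sn; apply: Rplus_le_le_0_compat.
have H2 : a j <= sum_n a j.
  case: (j) => [|k]; first by rewrite sum_O; right.
  by rewrite sum_Sn /plus /=; have := H1 k; lra.
lra.
Qed.

Lemma Re_gser_le (x t : R) : exp x < Rad ->
  Re (gser c (cexp (x, t))) <= Re (gser c (cexp (x, 0))).
Proof.
move=> Hx.
have := Series_ge_term _ 0 (gcoef_term_pos x t) (gser_diff_ex x t Hx).
rewrite -Re_gser_diff //=; have := COS_bound (0 * t); lra.
Qed.

Lemma cos_eq_1 (y : R) : cos y = 1 -> exists k : Z, y = 2 * IZR k * PI.
Proof.
move=> H.
have : sin (y / 2) = 0.
  have := cos_2a_sin (y / 2); have -> : 2 * (y / 2) = y by field.
  rewrite H => H1; have : sin (y / 2) * sin (y / 2) = 0 by lra.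
  by move/Rmult_integral; lra.
by move/sin_eq_0_0 => [k Hk]; exists k; lra.
Qed.

Hypothesis Hna : non_arithmetic c.

(** If the difference were 0, every term would vanish and [j * t] would be a multiple of [2 * PI]
    for each [j] in the support. The positive [n] with this property are the multiples of the least
    one, [m], and [0 < t <= PI] excludes [m = 1]: an arithmetic support. *)
Lemma gser_diff_pos (x t : R) : exp x < Rad -> 0 < t <= PI ->
  0 < Re (gser c (cexp (x, 0))) - Re (gser c (cexp (x, t))).
Proof.
move=> Hx Ht; apply: Rnot_le_lt; rewrite Re_gser_diff // => Hle.
have HP0 := PI_RGT_0.
have Hint : forall j, (1 <= j)%nat -> c j <> 0 -> exists k : Z, INR j * t = 2 * IZR k * PI.
  move=> j Hj Hcj; apply: cos_eq_1.
  have := Series_ge_term _ j (gcoef_term_pos x t) (gser_diff_ex x t Hx) => H.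
  have H0 := gcoef_term_pos x t j.
  have Hg : 0 < gcoef c j.
    case: (j) Hj Hcj => [|i] Hj Hcj; first lia.
    apply: Rdiv_lt_0_compat; last by apply: lt_0_INR; lia.
    by have := Hc (S i) Hj; lra.
  have Hpw : 0 < exp x ^ j by apply: pow_lt; exact: exp_pos.
  have : gcoef c j * exp x ^ j * (1 - cos (INR j * t)) = 0 by lra.
  have Hgp : 0 < gcoef c j * exp x ^ j by apply: Rmult_lt_0_compat.
  by move/Rmult_integral; lra.
pose Q n := (1 <= n)%nat /\ exists k : Z, INR n * t = 2 * IZR k * PI.
have Hleast : forall n, Q n -> exists m, Q m /\ forall i, Q i -> (m <= i)%nat.
  elim/(well_founded_ind Wf_nat.lt_wf) => n IH Qn.
  case: (excluded_middle_informative (exists i, (i < n)%nat /\ Q i)) => [[i [Hi Qi]]|Hno].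
    exact: (IH i Hi Qi).
  exists n; split=> // i Qi; case: (Nat.le_gt_cases n i) => // Hlt.
  by case: Hno; exists i.
case: (excluded_middle_informative (exists n, Q n)) => [[n Qn]|Hno]; last first.
  (* With no such [n] the support is empty, and divisibility by 2 holds vacuously. *)
  apply: Hna; exists 2%nat; split=> //.
  by move=> j /(ssrbool.elimT ssrnat.leP) Hj Hcj; case: Hno; exists j; split=> //; exact: Hint.
case: (Hleast n Qn) => m [[Hm [k Hk]] Hmin].
apply: Hna; exists m; split.
  apply: (ssrbool.introT ssrnat.ltP); case: (Nat.eq_dec m 1) => [E|]; last lia.
  exfalso; move: Hk; rewrite E Rmult_1_l => Hk.
  have K1 : 0 < IZR k by nra.
  have K2 : IZR k < 1 by nra.
  have /lt_IZR ? : IZR 0 < IZR k := K1.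
  have /lt_IZR ? : IZR k < IZR 1 := K2.
  lia.
move=> j /(ssrbool.elimT ssrnat.leP) Hj Hcj; case: (Hint j Hj Hcj) => k' Hk'.
apply/Nat.Lcm0.mod_divide.
case: (Nat.eq_dec (j mod m) 0) => // Hr; exfalso.
have Hrm : (j mod m < m)%nat by apply: Nat.mod_upper_bound; lia.
have : Q (j mod m)%nat.
  split; first lia.
  exists (k' - k * Z.of_nat (j / m))%Z.
  have Ej : INR j = INR m * INR (j / m) + INR (j mod m).
    by rewrite -mult_INR -plus_INR; congr INR; exact: Nat.div_mod_eq.
  rewrite minus_IZR mult_IZR -INR_IZR_INZ.
  have : INR (j mod m) * t = INR j * t - INR (j / m) * (INR m * t) by rewrite Ej; ring.
  by rewrite Hk Hk' => ->; ring.
by move/Hmin; lia.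
Qed.

End NonnegativeSeries.

(** The second-order bound is integrated along the segment from 0 to [h]; the 6 is [2 * 3], with
    [exp 1 <= 3]. *)
Lemma cexp_taylor3 (h : C) : Cmod h <= 1 ->
  Cmod (cexp h - 1 - h - h * h / 2) <= 6 * Cmod h ^ 3.
Proof.
move=> Hh; have Hh0 := Cmod_ge_0 h.
pose F (t : R) := (cexp (RtoC t * h) - (RtoC t * h) - (RtoC t * h) * (RtoC t * h) * / 2)%C.
pose F' (t : R) := ((cexp (RtoC t * h) - 1 - RtoC t * h) * h)%C.
have Hd : forall t, rdiff F t (F' t).
  move=> t.
  have Hlin : rdiff (fun s => RtoC s * h)%C t h.
    have := rdiff_affine 0 h t => H.
    case: H => p [H1 [H2 H3]]; exists p; split=> // s.
    by have := H1 s; rewrite !Cplus_0_l.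
  have D1 : cdiff (fun z => cexp z - z - z * z * / 2)%C (RtoC t * h)%C (cexp (RtoC t * h) - 1 - ((1 * (RtoC t * h) + (RtoC t * h) * 1) * / 2 + (RtoC t * h) * (RtoC t * h) * 0))%C.
    apply: cdiff_minus; first by apply: cdiff_minus; [exact: cdiff_cexp | exact: cdiff_id].
    apply: cdiff_mult; last exact: cdiff_const.
    by apply: cdiff_mult; exact: cdiff_id.
  have := cdiff_curve _ _ _ _ _ D1 Hlin.
  rewrite (_ : ((cexp (RtoC t * h) - 1 - ((1 * (RtoC t * h) + (RtoC t * h) * 1) * / 2 + (RtoC t * h) * (RtoC t * h) * 0)) * h)%C = F' t) //.
  by rewrite /F'; field.
have Hc : forall t, rcont F' t.
  move=> t; rewrite /F'.
  have Hlin : Clim (locally t) (fun s => RtoC s * h)%C (RtoC t * h)%C.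
    by apply: Clim_mult; [exact: Clim_RtoC_id | exact: Clim_const].
  apply: Clim_mult; last exact: Clim_const.
  apply: Clim_minus => //; apply: Clim_minus; last exact: Clim_const.
  exact: Clim_cexp.
have Hi := Cis_FTC F F' 0 1 (Rle_0_1) (fun t _ => Hd t) (fun t _ => Hc t).
have E : (F 1 - F 0 = cexp h - 1 - h - h * h / 2)%C.
  by rewrite /F !Cmult_1_l !Cmult_0_l cexp_0; field.
rewrite -E.
have -> : 6 * Cmod h ^ 3 = (1 - 0) * (6 * Cmod h ^ 3) by ring.
apply: (Cis_bound_const F') Hi => //; first lra.
move=> t Ht; rewrite /F' Cmod_mult.
have H1 : Cmod (RtoC t * h) <= Cmod h by rewrite Cmod_mult Cmod_R Rabs_right; nra.
have H0 := Cmod_ge_0 (RtoC t * h).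
have H2 := cexp_sub1_sub_le (RtoC t * h).
have H3 : exp (Cmod (RtoC t * h)) <= 3.
  by apply: Rle_trans (exp_le_3); apply: exp_le; lra.
have H4 : Cmod (RtoC t * h) ^ 2 <= Cmod h ^ 2 by apply: pow_incr.
have H5 := pow2_ge_0 (Cmod (RtoC t * h)).
have H6 := exp_pos (Cmod (RtoC t * h)).
have H7 : Cmod (cexp (RtoC t * h) - 1 - RtoC t * h) <= 6 * Cmod h ^ 2 by nra.
have -> : 6 * Cmod h ^ 3 = 6 * Cmod h ^ 2 * Cmod h by ring.
exact: Rmult_le_compat_r.
Qed.

Lemma cos_quadratic_le (a : R) : Rabs a <= 1 -> cos a <= 1 - a * a / 4.
Proof.
move/Rabs_le_between => Ha.
have := pre_cos_bound a 0 ltac:(lra) ltac:(lra) => -[_].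
rewrite /cos_approx /= /cos_term /=.
have : a * a <= 1 by nra.
have := pow2_ge_0 a => H1 H2.
nra.
Qed.

Lemma clog_near_1 (z : C) : Cmod (z - 1) <= / 2 -> Cmod (clog z) <= 6 * Cmod (z - 1).
Proof.
set d := Cmod (z - 1) => Hd.
have Hd0 : 0 <= d := Cmod_ge_0 _.
have H1 := re_le_Cmod (z - 1); have H2 := im_le_Cmod (z - 1); rewrite -/d in H1 H2.
move: H1 H2; rewrite re_plus im_plus re_opp im_opp /= => /Rabs_le_between H1 /Rabs_le_between H2.
have H3 := Cmod_triangle_sub z 1; have H4 := Cmod_triangle_sub 1 z.
rewrite Cmod_sub_sym in H4; rewrite -/d Cmod_1 in H3 H4.
have Hz : 1 - d <= Cmod z <= 1 + d by lra.
move: d Hd Hd0 H1 H2 H3 H4 Hz => d Hd Hd0; case: z => x y; rewrite /= => H1 H2 _ _ Hz.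
rewrite clog_right; last lra.
apply: Rle_trans; first exact: Cmod_le_sum.
rewrite /Re /Im /=.
have L1 : Rabs (ln (Cmod (x, y))) <= 2 * d.
  apply: Rabs_le; split.
  - have K1 : - ln (Cmod (x, y)) <= / Cmod (x, y) - 1.
      rewrite -ln_Rinv; last lra.
      have K2 : 0 < / Cmod (x, y) by apply: Rinv_0_lt_compat; lra.
      by have := exp_ineq1_le (ln (/ Cmod (x, y))); rewrite exp_ln //; lra.
    have K3 : / Cmod (x, y) <= 1 + 2 * d.
      apply: (Rmult_le_reg_l (Cmod (x, y))); first lra.
      rewrite Rinv_r; nra.
    lra.
  - by have := exp_ineq1_le (ln (Cmod (x, y))); rewrite exp_ln; lra.
have L2 : Rabs (y / x) <= 2 * d.
  rewrite /Rdiv Rabs_mult (Rabs_right (/ x)); last by apply: Rle_ge; left; apply: Rinv_0_lt_compat; lra.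
  apply: (Rmult_le_reg_r x); first lra.
  rewrite Rmult_assoc Rinv_l; last lra.
  have : Rabs y <= d by apply: Rabs_le; lra.
  nra.
have L3 : Rabs (atan (y / x)) <= 2 * Rabs (y / x).
  have := atan_taylor (y / x).
  have -> : y / x * (y / x) = Rabs (y / x) * Rabs (y / x) by rewrite -Rabs_mult Rabs_right //; nra.
  have := Rabs_triang (atan (y / x) - y / x) (y / x).
  have -> : atan (y / x) - y / x + y / x = atan (y / x) by ring.
  have := Rabs_pos (y / x); nra.
lra.
Qed.

(** It suffices to treat the radius [Rad / 2], since the difference is a series with nonnegative
    terms that increase with the radius. For [|t| <= 1 / j] the single term of index [j] gives a
    quadratic bound; on the rest of the half circle the difference has a positive minimum by
    compactness. *)
Lemma gser_gauss (c : nat -> R) (Rad : R) : 0 < Rad ->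
  (forall j, (1 <= j)%nat -> 0 <= c j) -> CV_radius (gcoef c) = Finite Rad ->
  non_arithmetic c -> (exists j, (2 <= j)%nat /\ 0 < c j) -> holo Rad (gser c) ->
  exists c0, 0 < c0 /\ forall x t, ln (Rad / 2) <= x -> exp x < Rad -> Rabs t <= PI ->
    Re (gser c (cexp (x, t))) <= Re (gser c (cexp (x, 0))) - c0 * (t * t).
Proof.
move=> HR Hc Hrad Hna [j [Hj Hcj]] Hh.
have HP0 := PI_RGT_0; have HP4 := PI_4; have HP2 := PI2_1.
set x0 := ln (Rad / 2).
have Ex0 : exp x0 = Rad / 2 by rewrite /x0 exp_ln; lra.
have Hx0 : exp x0 < Rad by lra.
pose H t := Re (gser c (cexp (x0, 0))) - Re (gser c (cexp (x0, t))).
have Hmono : forall x t, x0 <= x -> exp x < Rad ->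
    H t <= Re (gser c (cexp (x, 0))) - Re (gser c (cexp (x, t))).
  move=> x t Hx Hx'; rewrite /H (Re_gser_diff _ Rad) // (Re_gser_diff _ Rad) //.
  apply: Series_le; last exact: (gser_diff_ex c Rad).
  move=> n; split; first exact: gcoef_term_pos.
  apply: Rmult_le_compat_r; first by have := COS_bound (INR n * t); lra.
  apply: Rmult_le_compat_l; first exact: gcoef_nonneg.
  by apply: pow_incr; split; [left; exact: exp_pos | exact: exp_le].
have Hj1 : 1 <= INR j by apply: (le_INR 1); lia.
have Hinvj : 0 < / INR j <= 1.
  split; first by apply: Rinv_0_lt_compat; lra.
  by rewrite -Rinv_1; apply: Rinv_le_contravar; lra.
have Hcont : forall t, continuity_pt H t.
  move=> t; apply: continuity_pt_minus; first by apply: continuity_pt_const.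
  apply/continuity_pt_filterlim.
  apply: (Clim_Re (fun t => gser c (cexp (x0, t)))).
  apply: (ccont_vertical (fun z => gser c (cexp z))).
  apply: ccont_comp_cexp.
  have [|l Hl] := Hh (cexp (x0, t)); first by rewrite Cmod_cexp_pair.
  exact: cdiff_cont Hl.
have [m [Hm Hm']] : exists m, 0 < m /\ forall t, / INR j <= t <= PI -> m <= H t.
  have [tm [Ht1 Ht2]] := continuity_ab_min H (/ INR j) PI ltac:(lra) (fun t _ => Hcont t).
  exists (H tm); split=> //.
  by apply: (gser_diff_pos c Rad) => //; lra.
set g0 := gcoef c j * exp x0 ^ j.
have Hg0 : 0 < g0.
  apply: Rmult_lt_0_compat; last by apply: pow_lt; exact: exp_pos.
  case: (j) Hj Hcj => [|i] Hj' Hcj'; first lia.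
  by apply: Rdiv_lt_0_compat => //; apply: lt_0_INR; lia.
(* The first constant comes from [1 - cos y >= y^2 / 4] for [|y| <= 1], the second from [t^2 <= 16],
   as [PI <= 4]. *)
set c0 := Rmin (g0 / 4) (m / 16).
have Hc0 : 0 < c0 by apply: Rmin_pos; lra.
have C1 : c0 <= g0 / 4 := Rmin_l _ _.
have C2 : c0 <= m / 16 := Rmin_r _ _.
have Hpos : forall t, 0 <= t <= PI -> c0 * (t * t) <= H t.
  move=> t Ht; case: (Rle_dec t (/ INR j)) => Htj.
  - have Hjt : INR j * t <= 1.
      by have := Rmult_le_compat_l (INR j) _ _ ltac:(lra) Htj; rewrite Rinv_r; lra.
    have Q1 := cos_quadratic_le (INR j * t) ltac:(rewrite Rabs_right; nra).
    rewrite /H (Re_gser_diff _ Rad) //.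
    apply: Rle_trans (Series_ge_term _ j (gcoef_term_pos c Hc x0 t) (gser_diff_ex c Rad Hrad x0 t Hx0)).
    rewrite -/g0.
    have Q2 : t * t / 4 <= 1 - cos (INR j * t).
      have : t * t <= INR j * t * (INR j * t).
        have : t <= INR j * t by nra.
        nra.
      lra.
    have Q3 := Rmult_le_compat_l g0 _ _ (Rlt_le _ _ Hg0) Q2.
    have Q4 : c0 * (t * t) <= g0 / 4 * (t * t) by apply: Rmult_le_compat_r => //; nra.
    lra.
  - have Q1 := Hm' t ltac:(lra).
    have Q2 : t * t <= 16 by nra.
    nra.
exists c0; split=> // x t Hx Hx' Ht.
have : c0 * (t * t) <= H t.
  case: (Rle_dec 0 t) => Hs.
    by apply: Hpos; rewrite Rabs_right in Ht; lra.
  have -> : H t = H (- t).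
    rewrite /H !Re_gser; congr Rminus; apply: Series_ext => n.
    by rewrite -(cos_neg (INR n * t)); congr (_ * cos _); ring.
  have -> : t * t = - t * - t by ring.
  by apply: Hpos; rewrite Rabs_left in Ht; lra.
have := Hmono x t Hx Hx'; lra.
Qed.

Lemma holo_of_Delta0 (Rad eta phi : R) (f g : C -> C) :
  0 < Rad -> 0 < eta -> 0 < phi < PI / 2 -> holomorphic_on (Delta0 Rad eta phi) f ->
  (forall z, Cmod z < Rad -> f z = g z) -> holo Rad g.
Proof.
move=> HR He Hp Hf Hfg; apply: (holo_ext Rad f) => // z Hz.
apply: (holomorphic_cdiff _ _ _ Hf); apply: disc_Delta0 => //; first lra.
by move=> E; move: Hz; rewrite E Cmod_R Rabs_right; lra.
Qed.

(** * Asymptotic expansion at the saddle point *)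

(** To be read with [n = sqrt N], [l = sad_lam], [z = 1 - i s], [a = exp (- u / n)],
    [q = 1 - exp (- w)], with [lm], [cz], [cr] the logarithms of the three factors of [q] and [r1],
    [r2] the remainders of the two expansions. The assumption on [l] normalises the quadratic term
    to [z^2]. The first group on the right is the exponent of J; each further term will tend to
    0. *)
Lemma exponent_identity (n l z a ph r1 r2 g k2 u ts lm cz cr : C) :
  n <> 0 -> l <> 0 -> (l * l * (1 + k2) = 2)%C ->
  let w := (l / n * z)%C in let q := (w * (1 - w * ph))%C in
  (a * (- ts * (lm + cz + cr) + r1) + ts * lm + n * n * a * (g - q + k2 / 2 * (q * q) + r2)
    + n * n * w - (n * n * g - n * u * g + / 2 * (u * u) * g))%C =
  ((- ts * cz + (u * l * z + z * z)) +
   (- ts * ((a - 1) * lm) - ts * ((a - 1) * cz) - ts * (a * cr) + a * r1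
    + g * (n * n * (a - 1 - - u / n - (u * u) / (n * n) / 2))
    + l * z * (n * (1 - a) - u)
    + l * l * (z * z) * (a * ph - / 2 + k2 / 2 * (a * ((1 - w * ph) * (1 - w * ph)) - 1))
    + a * (n * n * r2)))%C.
Proof.
move=> Hn Hl Hk w q.
have E : k2 = (l * l * (1 + k2) / (l * l) - 1)%C by field.
rewrite Hk in E; rewrite E /q /w; field; split=> //.
Qed.

Lemma Clim_seq_squeeze (a : nat -> C) (l : C) (b : nat -> R) :
  eventually (fun N => Cmod (a N - l) <= b N) -> is_lim_seq b 0 -> Clim eventually a l.
Proof.
move=> H Hb; apply: (Clim_squeeze _ b _ H) => e He.
have /filterlim_locally H' : filterlim b eventually (locally 0) := Hb.
apply: (Fimp (H' (mkposreal e He))) => N.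
by rewrite /ball /= /AbsRing_ball /= /abs /= /minus /plus /opp /=; move/Rabs_def2; lra.
Qed.

Lemma Clim_unif (A : R) (a : nat -> C) (l : C) :
  Clim eventually a l -> Clim (unif A) (fun p => a (fst p)) l.
Proof. by move=> H e He; case: (H e He) => N0 H0; exists N0 => N s HN _; exact: H0. Qed.

Lemma unif_bounded (A : R) : unif A (fun p => Rabs (snd p) <= A).
Proof. by exists 0%nat. Qed.

Lemma lim_sqrt_INR : is_lim_seq (fun N => sqrt (INR N)) p_infty.
Proof.
apply: (is_lim_comp_seq sqrt INR p_infty p_infty); first exact: is_lim_sqrt_p.
  by exists 0%nat.
exact: is_lim_seq_INR.
Qed.

Lemma lim_inv_sqrt : is_lim_seq (fun N => / sqrt (INR N)) 0.
Proof. by have := is_lim_seq_inv _ _ lim_sqrt_INR => /(_ ltac:(done)). Qed.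

Lemma sqrt_INR_ge1 (N : nat) : (1 <= N)%nat -> 1 <= sqrt (INR N).
Proof. by move=> H; rewrite -sqrt_1; apply: sqrt_le_1_alt; apply: (le_INR 1). Qed.

(** * Expansions of [exp (- u / sqrt N)] to the order required *)

Section Sequences.
Variables (u lam : R).
Hypotheses (Hu : 0 <= u) (Hlam : 0 < lam).
Let v N := - u / sqrt (INR N).

Lemma lim_scale : is_lim_seq (fun N => lam / sqrt (INR N)) 0.
Proof. by have := is_lim_seq_scal_l _ lam _ lim_inv_sqrt; rewrite /= Rmult_0_r. Qed.

Lemma lim_v : is_lim_seq v 0.
Proof. by have := is_lim_seq_scal_l _ (- u) _ lim_inv_sqrt; rewrite /= Rmult_0_r. Qed.

Lemma lim_exp_v : is_lim_seq (fun N => exp (v N)) 1.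
Proof.
rewrite -exp_0; apply: is_lim_seq_continuous lim_v.
exact: derivable_continuous_pt (derivable_pt_exp 0).
Qed.

Lemma lim_exp_Rabs_v : is_lim_seq (fun N => exp (Rabs (v N)) - 1) 0.
Proof.
rewrite -(Rminus_diag_eq 1 1) //.
apply: is_lim_seq_minus'; last exact: is_lim_seq_const.
rewrite -exp_0; apply: is_lim_seq_continuous; first exact: derivable_continuous_pt (derivable_pt_exp 0).
by rewrite -Rabs_R0; apply: (is_lim_seq_abs _ 0) lim_v.
Qed.

Lemma sqr_v (N : nat) : (1 <= N)%nat ->
  sqrt (INR N) * sqrt (INR N) * (v N * v N) = u * u.
Proof. by move=> /sqrt_INR_ge1 H; rewrite /v; field; lra. Qed.

(** Times [g], this reduces [N * exp (- u / sqrt N) * g] to the exponent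
    [N g - sqrt N u g + u^2 g / 2] of the claim, up to a null sequence. *)
Lemma lim_third_order : Clim eventually (fun N => RtoC (sqrt (INR N) * sqrt (INR N) *
    (exp (v N) - 1 - - u / sqrt (INR N) - u * u / (sqrt (INR N) * sqrt (INR N)) / 2))) 0.
Proof.
apply: (Clim_seq_squeeze _ _ (fun N => u * u * (exp (Rabs (v N)) - 1))).
- exists 1%nat => N HN; have Hs := sqrt_INR_ge1 N HN.
  rewrite -RtoC_minus Cmod_R Rminus_0_r Rabs_mult Rabs_right; last nra.
  have -> : u * u / (sqrt (INR N) * sqrt (INR N)) / 2 = v N * v N / 2 by rewrite /v; field; lra.
  rewrite -(sqr_v N HN) (Rmult_assoc _ (v N * v N)); apply: Rmult_le_compat_l; first nra.
  exact: exp_taylor2.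
- by have := is_lim_seq_scal_l _ (u * u) _ lim_exp_Rabs_v; rewrite /= Rmult_0_r.
Qed.

(** The origin of the linear term of the limit exponent: damped by [exp (- u / sqrt N)], the linear
    part of [gser kappa] no longer cancels [N * w] entirely. *)
Lemma lim_second_order :
  Clim eventually (fun N => RtoC (sqrt (INR N) * (1 - exp (v N)))) (RtoC u).
Proof.
apply: (Clim_seq_squeeze _ _ (fun N => u * u * / sqrt (INR N) * (/ 2 + (exp (Rabs (v N)) - 1)))).
- exists 1%nat => N HN; have Hs := sqrt_INR_ge1 N HN.
  rewrite -RtoC_minus Cmod_R.
  have -> : sqrt (INR N) * (1 - exp (v N)) - u =
     - (sqrt (INR N) * (exp (v N) - 1 - v N - v N * v N / 2) + sqrt (INR N) * (v N * v N) / 2).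
    by rewrite /v; field; lra.
  have E : sqrt (INR N) * (v N * v N) = u * u * / sqrt (INR N) by rewrite /v; field; lra.
  have H := Rmult_le_compat_l (sqrt (INR N)) _ _ ltac:(lra) (exp_taylor2 (v N)).
  have Hp : 0 <= u * u * / sqrt (INR N) by rewrite -E; have := pow2_ge_0 (v N); nra.
  rewrite Rabs_Ropp; apply: Rle_trans; first exact: Rabs_triang.
  rewrite Rabs_mult (Rabs_right (sqrt _)); last lra.
  rewrite E (Rabs_right (_ / 2)); last lra.
  rewrite -Rmult_assoc E in H; lra.
- have := is_lim_seq_mult' _ _ _ _ (is_lim_seq_scal_l _ (u * u) _ lim_inv_sqrt)
    (is_lim_seq_plus' _ _ _ _ (is_lim_seq_const (/ 2)) lim_exp_Rabs_v).
  by rewrite /= Rmult_0_r Rmult_0_l.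
Qed.

(** The damping also acts on the logarithmic singularity, of size [ln N]; its deviation from 1 is
    [O(1 / sqrt N)], which wins. *)
Lemma lim_log : Clim eventually
  (fun N => RtoC ((exp (v N) - 1) * ln (lam / sqrt (INR N)))) 0.
Proof.
apply: (Clim_seq_squeeze _ _ (fun N => u * Rabs (ln lam) * / sqrt (INR N) +
   u * (ln (sqrt (INR N)) / sqrt (INR N)))).
- exists 1%nat => N HN; have Hs := sqrt_INR_ge1 N HN.
  rewrite -RtoC_minus Cmod_R Rminus_0_r Rabs_mult ln_div //; last lra.
  have L0 : 0 <= ln (sqrt (INR N)) by rewrite -ln_1; apply: ln_le; lra.
  have Hi : 0 < / sqrt (INR N) by apply: Rinv_0_lt_compat; lra.
  have E1 : Rabs (exp (v N) - 1) <= u * / sqrt (INR N).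
    have E := exp_ineq1_le (v N).
    have : exp (v N) <= 1 by rewrite -exp_0; apply: exp_le; rewrite /v /Rdiv; nra.
    by move=> H; rewrite Rabs_left1; [rewrite /v /Rdiv in E *; lra | lra].
  have E2 : Rabs (ln lam - ln (sqrt (INR N))) <= Rabs (ln lam) + ln (sqrt (INR N)).
    by apply: Rle_trans (Rabs_triang _ _) _; rewrite Rabs_Ropp (Rabs_right (ln (sqrt _))); lra.
  apply: Rle_trans (Rmult_le_compat _ _ _ _ (Rabs_pos _) (Rabs_pos _) E1 E2) _.
  by right; rewrite /Rdiv; ring.
- have H1 : is_lim_seq (fun N => ln (sqrt (INR N)) / sqrt (INR N)) 0.
    apply: (is_lim_comp_seq (fun y => ln y / y) _ p_infty 0); first exact: is_lim_div_ln_p.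
      by exists 0%nat.
    exact: lim_sqrt_INR.
  have := is_lim_seq_plus' _ _ _ _ (is_lim_seq_scal_l _ (u * Rabs (ln lam)) _ lim_inv_sqrt)
    (is_lim_seq_scal_l _ u _ H1).
  by rewrite /= !Rmult_0_r Rplus_0_r.
Qed.

End Sequences.

(** * The local variable [1 - z / Rad] near the singularity *)

Section UniformLimits.
Variables (A lam : R).
Hypothesis Hlam : 0 < lam.

Let n (p : nat * R) := sqrt (INR (fst p)).
Let ze (p : nat * R) := zl 1 (snd p).
Definition sad_w (N : nat) (s : R) : C := (RtoC (lam / sqrt (INR N)) * zl 1 s)%C.
Let w p := sad_w (fst p) (snd p).
(** [1 - exp (- w) = w * sad_rho w], where [sad_ph] tends to [1/2] at the origin. *)
Definition sad_ph (w : C) : C := ((w - 1 + cexp (- w)) / (w * w))%C.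
Definition sad_rho (w : C) : C := (1 - w * sad_ph w)%C.

Lemma zl1_bound (s : R) : Rabs s <= A -> Cmod (zl 1 s) <= 1 + A.
Proof.
move=> Hs; apply: Rle_trans; first exact: Cmod_le_sum.
by rewrite /zl /Re /Im /= Rabs_Ropp Rabs_R1; lra.
Qed.

Lemma zeta_bound : unif A (fun p => Cmod (ze p) <= 1 + A).
Proof. by apply: (Fimp (unif_bounded A)) => p; exact: zl1_bound. Qed.

Lemma n_ge1 : unif A (fun p => 1 <= n p).
Proof. by exists 1%nat => N s HN _; exact: sqrt_INR_ge1. Qed.

Lemma RtoC_neq0 (x : R) : x <> 0 -> RtoC x <> 0.
Proof. by move=> H /RtoC_inj. Qed.

Lemma w_to_0 : Clim (unif A) w 0.
Proof.
apply: (Clim_0_mult_bounded _ ze (1 + A)); last exact: zeta_bound.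
apply: (Clim_unif A (fun N => RtoC (lam / sqrt (INR N)))).
exact: (Clim_RtoC _ _ (lim_scale lam)).
Qed.

Lemma w_neq0 : unif A (fun p => w p <> 0).
Proof.
apply: (Fimp n_ge1) => p Hn; rewrite /w /sad_w.
have N1 : RtoC (lam / n p) <> 0.
  by apply: RtoC_neq0; apply: Rgt_not_eq; apply: Rdiv_lt_0_compat; lra.
have N3 := zl_neq0 1 (snd p) Rlt_0_1.
exact: Cmult_neq_0.
Qed.

Lemma ph_limit : Clim (unif A) (fun p => sad_ph (w p)) (/ 2)%C.
Proof.
apply: (Clim_squeeze _ (fun p => 6 * Cmod (w p))); last first.
  move=> e He; have He6 : 0 < e / 6 by lra.
  apply: (Fimp (w_to_0 _ He6)) => p.
  have -> : (w p - 0)%C = w p by ring.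
  lra.
apply: (Fimp (filter_and _ _ w_neq0 (w_to_0 1 Rlt_0_1))) => p [Hw Hw1].
have H0 : (w p - 0)%C = w p by ring.
rewrite H0 in Hw1.
have Hp : 0 < Cmod (w p) by apply/Cmod_gt_0.
have -> : (sad_ph (w p) - / 2)%C = ((cexp (- w p) - 1 - - w p - (- w p) * (- w p) / 2) / (w p * w p))%C.
  by rewrite /sad_ph; field.
have := cexp_taylor3 (- w p); rewrite Cmod_opp => /(_ ltac:(lra)) H.
rewrite Cmod_div; last exact: Cmult_neq_0.
rewrite Cmod_mult; apply: (Rmult_le_reg_r (Cmod (w p) * Cmod (w p))); first nra.
rewrite /Rdiv Rmult_assoc Rinv_l; last nra.
by apply: Rle_trans (_ : 6 * Cmod (w p) ^ 3 <= _); [lra | right; ring].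
Qed.

Lemma rho_limit : Clim (unif A) (fun p => sad_rho (w p)) 1.
Proof.
have -> : RtoC 1 = (1 - 0 * / 2)%C by ring.
apply: Clim_minus; first exact: Clim_const.
by apply: Clim_mult; [exact: w_to_0 | exact: ph_limit].
Qed.

Lemma one_sub_cexp (z : C) : z <> 0 -> (1 - cexp (- z) = z * sad_rho z)%C.
Proof. by move=> Hz; rewrite /sad_rho /sad_ph; field. Qed.

Lemma q_limit : Clim (unif A) (fun p => 1 - cexp (- w p))%C 0.
Proof.
have -> : RtoC 0 = (1 - cexp (- 0))%C by rewrite Copp_0 cexp_0; ring.
apply: Clim_minus; first exact: Clim_const.
by apply: Clim_cexp; apply: Clim_opp; exact: w_to_0.
Qed.

Let half_pos : 0 < / 2 := ltac:(lra).

Lemma clog_rho_limit : Clim (unif A) (fun p => clog (sad_rho (w p))) 0.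
Proof.
apply: (Clim_squeeze _ (fun p => 6 * Cmod (sad_rho (w p) - 1))); last first.
  move=> e He; have He6 : 0 < e / 6 by lra.
  by apply: (Fimp (rho_limit _ He6)) => p; lra.
apply: (Fimp (rho_limit _ half_pos)) => p Hp.
have -> : (clog (sad_rho (w p)) - 0)%C = clog (sad_rho (w p)) by ring.
by apply: clog_near_1; lra.
Qed.

(** The logarithm of the product splits because the factors lie in the right half-plane; for
    [sad_rho] this is true only for large [N]. *)
Lemma clog_q : unif A (fun p =>
  clog (1 - cexp (- w p)) = (RtoC (ln (lam / n p)) + clog (ze p) + clog (sad_rho (w p)))%C).
Proof.
apply: (Fimp (filter_and _ _ w_neq0 (filter_and _ _ n_ge1 (rho_limit _ half_pos)))) => p [Hw [Hn Hr]].
rewrite one_sub_cexp //.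
have Hl : 0 < lam / n p by apply: Rdiv_lt_0_compat; lra.
have Ew : w p = (RtoC (lam / n p) * ze p)%C.
  by [].
have Hrho : 0 < Re (sad_rho (w p)).
  have := re_le_Cmod (sad_rho (w p) - 1); rewrite re_plus re_opp /= => /Rabs_le_between; lra.
have Hz : 0 < Re (ze p) by rewrite /ze /zl /=; lra.
rewrite clog_mult_right //; last by rewrite Ew re_scal_l; nra.
rewrite {1}Ew clog_mult_right //=.
congr (_ + _ + _)%C.
rewrite /RtoC clog_right // /Rdiv Rmult_0_l atan_0; congr (ln _, _).
by rewrite -/(RtoC _) Cmod_R Rabs_right //; lra.
Qed.

Lemma bigO_limit (U : C -> Prop) (Rad d : R) (h : C -> C) :
  0 < Rad -> 0 < d ->
  bigO_near U Rad h (fun z => cpow (1 - z / RtoC Rad)%C (RtoC d)) ->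
  unif A (fun p => U (RtoC Rad * cexp (- w p))%C) ->
  Clim (unif A) (fun p => h (RtoC Rad * cexp (- w p))%C) 0.
Proof.
move=> HR Hd [M [e0 [He0 HO]]] HU e He.
have HRc : RtoC Rad <> 0 by apply: RtoC_neq0; lra.
set M' := Rabs M + 1.
have HM' : 0 < M' by have := Rabs_pos M; rewrite /M'; lra.
have He' : 0 < e / 2 / M' by apply: Rdiv_lt_0_compat; lra.
have He1 : 0 < exp (ln (e / 2 / M') / d) by exact: exp_pos.
have He2 : 0 < e0 / Rad by apply: Rdiv_lt_0_compat.
apply: (Fimp (filter_and _ _ HU (filter_and _ _ (q_limit _ He1) (q_limit _ He2)))).
move=> p [H1 [H3 H4]].
have E0 : (1 - cexp (- w p) - 0)%C = (1 - cexp (- w p))%C by ring.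
rewrite E0 in H3 H4.
have Hclose : Cmod (RtoC Rad * cexp (- w p) - RtoC Rad) < e0.
  have -> : (RtoC Rad * cexp (- w p) - RtoC Rad)%C = (- (RtoC Rad * (1 - cexp (- w p))))%C by ring.
  rewrite Cmod_opp Cmod_mult Cmod_R Rabs_right; last lra.
  have := Rmult_lt_compat_l Rad _ _ HR H4.
  by have -> : Rad * (e0 / Rad) = e0 by field; lra.
have := HO _ H1 Hclose.
have -> : (1 - RtoC Rad * cexp (- w p) / RtoC Rad)%C = (1 - cexp (- w p))%C by field.
have H6 := Cmod_cpow_le (1 - cexp (- w p)) d _ Hd He' (Rlt_le _ _ H3).
have -> : (h (RtoC Rad * cexp (- w p)) - 0)%C = h (RtoC Rad * cexp (- w p))%C by ring.
move=> H5; apply: Rle_lt_trans H5 _.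
move: H6; set c := Cmod (cpow _ _) => H6.
have c0 : 0 <= c by exact: Cmod_ge_0.
have A2 : M * c <= M' * c by have := Rle_abs M; rewrite /M'; nra.
have A3 := Rmult_le_compat_l M' _ _ (Rlt_le _ _ HM') H6.
have A4 : M' * (e / 2 / M') = e / 2 by field; lra.
lra.
Qed.

(** The remainder of [gser kappa] is multiplied by [N], and [N * q^2] stays bounded at scale [mu].
    Hence only its quotient by [q^2] has to tend to 0, which is of order [d] and falls under
    [bigO_limit]. *)
Lemma bigO_near_div_sqr (U : C -> Prop) (Rad d : R) (h : C -> C) :
  0 < Rad -> (forall z, U z -> z <> RtoC Rad) ->
  bigO_near U Rad h (fun z => cpow (1 - z / RtoC Rad)%C (RtoC (2 + d))) ->
  bigO_near U Rad (fun z => h z / ((1 - z / RtoC Rad) * (1 - z / RtoC Rad)))%C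
    (fun z => cpow (1 - z / RtoC Rad)%C (RtoC d)).
Proof.
move=> HR HU [M [e [He HO]]]; exists M, e; split=> // z Uz Hz.
have := HO z Uz Hz; set q := (1 - z / RtoC Rad)%C.
have HRc : RtoC Rad <> 0 by apply: RtoC_neq0; lra.
have Hq : q <> 0.
  move=> Eq; apply: (HU z Uz).
  have -> : z = (RtoC Rad * (1 - q))%C by rewrite /q; field.
  by rewrite Eq; ring.
have Hp : 0 < Cmod q by apply/Cmod_gt_0.
rewrite !Cmod_cpow // Cmod_div ?Cmod_mult; last exact: Cmult_neq_0.
have -> : (2 + d) * ln (Cmod q) = ln (Cmod q) + ln (Cmod q) + d * ln (Cmod q) by ring.
rewrite !exp_plus exp_ln // => H.
apply: (Rmult_le_reg_r (Cmod q * Cmod q)); first nra.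
rewrite /Rdiv Rmult_assoc Rinv_l; nra.
Qed.

End UniformLimits.

Section NullLimits.
Context {T : Type} {F : (T -> Prop) -> Prop} {FF : Filter F}.

Lemma Clim0_plus (u v : T -> C) : Clim F u 0 -> Clim F v 0 -> Clim F (fun x => u x + v x)%C 0.
Proof. by move=> Hu Hv; rewrite -(Cplus_0_l 0); exact: Clim_plus. Qed.

Lemma Clim0_opp (u : T -> C) : Clim F u 0 -> Clim F (fun x => - u x)%C 0.
Proof. by move=> Hu; rewrite -Copp_0; exact: Clim_opp. Qed.

Lemma Clim0_mult_l (u v : T -> C) (M : R) :
  F (fun x => Cmod (u x) <= M) -> Clim F v 0 -> Clim F (fun x => u x * v x)%C 0.
Proof.
move=> Hu Hv; apply: (Clim_ext (fun x => v x * u x)%C); first by move=> x; ring.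
exact: (Clim_0_mult_bounded v u M).
Qed.

Lemma Clim0_scal (k : C) (v : T -> C) : Clim F v 0 -> Clim F (fun x => k * v x)%C 0.
Proof. by apply: (Clim0_mult_l _ _ (Cmod k)); apply: filter_forall => _; right. Qed.

Lemma Clim_sub_limit (u : T -> C) (a : C) : Clim F u a -> Clim F (fun x => u x - a)%C 0.
Proof. by move=> Hu; rewrite -(Cplus_opp_r a); apply: Clim_minus => //; exact: Clim_const. Qed.

End NullLimits.

(** * The normalised integrand and its limit *)

Section Saddle.
Variables (theta kappa : nat -> R) (Rad eta phi gk2 ts delta u g : R) (Gth Gk f : C -> C).
Hypotheses (HR : 0 < Rad) (Heta : 0 < eta) (Hphi : 0 < phi < PI / 2) (Hgk2 : 0 < gk2)
  (Hdelta : 0 < delta) (Hu : 0 <= u)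
  (HGth : forall z, Cmod z < Rad -> Gth z = gser theta z)
  (HGk : forall z, Cmod z < Rad -> Gk z = gser kappa z).
Let D := Delta0 Rad eta phi.
Hypotheses
  (Oth : bigO_near D Rad (fun z => Gth z + RtoC ts * clog (1 - z / RtoC Rad))%C
     (fun z => cpow (1 - z / RtoC Rad)%C (RtoC delta)))
  (Ok : bigO_near D Rad (fun z => let q := (1 - z / RtoC Rad)%C in
        Gk z - (RtoC g - q + RtoC (gk2 / 2) * (q * q)))%C
     (fun z => cpow (1 - z / RtoC Rad)%C (RtoC (2 + delta))))
  (Of : bigO_near D Rad (fun z => f z - 1)%C (fun z => cpow (1 - z / RtoC Rad)%C (RtoC delta))).

(** The scale is [mu = sad_lam / sqrt N], and [u * sad_lam] is the parameter of J in the claim. *)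
Definition sad_lam : R := sqrt (2 / (1 + gk2)).
Let lam := sad_lam.
Let n N := sqrt (INR N).
Definition sad_z (N : nat) (s : R) : C := (RtoC Rad * cexp (- sad_w lam N s))%C.
Definition sad_al (N : nat) : R := exp (- u / n N).
Definition sad_E (N : nat) : R := INR N * g - n N * u * g + / 2 * u ^ 2 * g.
(** The logarithm of the normalised integrand apart from [f]: [N * sad_w] comes from [z^(-N)], the
    logarithm of [mu] rescales the singular factor, and [sad_E] is the exponent of the claim. *)
Definition sad_expo (N : nat) (s : R) : C :=
  (RtoC (sad_al N) * GN theta kappa N (sad_z N s) + RtoC (ts * ln (lam / n N))
    + RtoC (INR N) * sad_w lam N s - RtoC (sad_E N))%C.
Definition sad_lexp (s : R) : C :=
  (- RtoC ts * clog (zl 1 s) + (RtoC (u * lam) * zl 1 s + zl 1 s * zl 1 s))%C.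

Lemma lam_pos : 0 < lam.
Proof. by apply: sqrt_lt_R0; apply: Rdiv_lt_0_compat; lra. Qed.

Lemma lam_sqr : lam * lam * (1 + gk2) = 2.
Proof.
rewrite /lam /sad_lam sqrt_sqrt; first by field; lra.
by left; apply: Rdiv_lt_0_compat; lra.
Qed.

Lemma mu_pos (N : nat) : (1 <= N)%nat -> 0 < lam / n N.
Proof. by move/sqrt_INR_ge1 => H; apply: Rdiv_lt_0_compat; [exact: lam_pos | rewrite /n; lra]. Qed.

Lemma sad_z_cexp (N : nat) (s : R) :
  sad_z N s = cexp (ln Rad - lam / n N, lam / n N * s)%R.
Proof.
rewrite /sad_z -{1}(exp_ln Rad) // -cexp_RtoC -cexp_plus; congr cexp.
by apply: injective_projections; rewrite /sad_w /zl /n /=; ring.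
Qed.

Lemma Cmod_sad_z (N : nat) (s : R) : Cmod (sad_z N s) = exp (ln Rad - lam / n N).
Proof. by rewrite sad_z_cexp Cmod_cexp_pair. Qed.

Lemma sad_radius (N : nat) : (1 <= N)%nat -> exp (ln Rad - lam / n N) < Rad.
Proof.
move/mu_pos => H; rewrite -[X in _ < X](exp_ln Rad) //; apply: exp_increasing; lra.
Qed.

Lemma sad_z_disc (N : nat) (s : R) : (1 <= N)%nat -> Cmod (sad_z N s) < Rad.
Proof. by move=> HN; rewrite Cmod_sad_z; exact: sad_radius. Qed.

Lemma sad_z_Delta0 (A : R) : unif A (fun p => D (sad_z (fst p) (snd p))).
Proof.
exists 1%nat => N s HN _ /=; have H := sad_z_disc N s HN.
apply: disc_Delta0 => //; first lra.
by move=> E; move: H; rewrite E Cmod_R Rabs_right; lra.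
Qed.

Lemma clog_zl_bound (A : R) : 0 < A ->
  unif A (fun p => Cmod (clog (zl 1 (snd p))) <= 3 + A).
Proof.
move=> HA; apply: (Fimp (unif_bounded A)) => p Hp.
apply: Rle_trans; first exact: Cmod_le_sum.
have H1 := ln_Cmod_zl 1 (snd p) Rlt_0_1; rewrite ln_1 Rabs_R0 in H1.
have H2 := carg_right_bound (zl 1 (snd p)) Rlt_0_1.
have H3 : Rabs (Im (clog (zl 1 (snd p)))) <= 2 by have := PI_4 => H4; apply: Rabs_le; lra.
have -> : Re (clog (zl 1 (snd p))) = ln (Cmod (zl 1 (snd p))) by [].
lra.
Qed.

Lemma al_limit (A : R) : Clim (unif A) (fun p => RtoC (sad_al (fst p))) 1.
Proof. by apply: (Clim_unif A (fun N => RtoC (sad_al N))); exact: (Clim_RtoC _ _ (lim_exp_v u)). Qed.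

Let r1 (z : C) := (Gth z + RtoC ts * clog (1 - z / RtoC Rad))%C.
Let r2 (z : C) := ((Gk z - (RtoC g - (1 - z / RtoC Rad) + RtoC (gk2 / 2) *
   ((1 - z / RtoC Rad) * (1 - z / RtoC Rad)))) / ((1 - z / RtoC Rad) * (1 - z / RtoC Rad)))%C.

Lemma r1_limit (A : R) : Clim (unif A) (fun p => r1 (sad_z (fst p) (snd p))) 0.
Proof.
apply: (bigO_limit A lam D Rad delta r1) => //.
exact: sad_z_Delta0.
Qed.

Lemma r2_limit (A : R) : Clim (unif A) (fun p => r2 (sad_z (fst p) (snd p))) 0.
Proof.
apply: (bigO_limit A lam D Rad delta r2) => //; last exact: sad_z_Delta0.
apply: (bigO_near_div_sqr D Rad delta _ HR _ Ok).
by move=> z [_ []].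
Qed.

Lemma f_limit (A : R) : Clim (unif A) (fun p => f (sad_z (fst p) (snd p))) 1.
Proof.
apply: Clim_sub0.
apply: (bigO_limit A lam D Rad delta (fun z => f z - 1)%C) => //.
exact: sad_z_Delta0.
Qed.

(** The expansions of both series at [sad_z] are inserted into [exponent_identity]; [X] is what
    remains beside the exponent of the kernel. *)
Lemma expo_limit (A : R) : 0 < A ->
  Clim (unif A) (fun p => sad_expo (fst p) (snd p) - sad_lexp (snd p))%C 0.
Proof.
move=> HA; have Hl := lam_pos; have HRc : RtoC Rad <> 0 by apply: RtoC_neq0; lra.
pose a (p : nat * R) := RtoC (sad_al (fst p)).
pose nn (p : nat * R) := RtoC (n (fst p)).
pose z (p : nat * R) := zl 1 (snd p).
pose w (p : nat * R) := sad_w lam (fst p) (snd p).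
pose ph p := sad_ph (w p).
pose rho p := sad_rho (w p).
pose zz (p : nat * R) := sad_z (fst p) (snd p).
pose lm (p : nat * R) := RtoC (ln (lam / n (fst p))).
pose l := RtoC lam.
pose X p := (- RtoC ts * ((a p - 1) * lm p) - RtoC ts * ((a p - 1) * clog (z p)) - RtoC ts * (a p * clog (rho p))
  + a p * r1 (zz p)
  + RtoC g * (nn p * nn p * (a p - 1 - - RtoC u / nn p - (RtoC u * RtoC u) / (nn p * nn p) / 2))
  + l * z p * (nn p * (1 - a p) - RtoC u)
  + l * l * (z p * z p) * (a p * ph p - / 2 + RtoC gk2 / 2 * (a p * (rho p * rho p) - 1))
  + a p * (l * l * (z p * z p) * (rho p * rho p) * r2 (zz p)))%C.
have Ha : Clim (unif A) a 1 := al_limit A.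
have Hn := n_ge1 A.
have Hz := zeta_bound A.
have Hl0 : l <> 0 by apply: RtoC_neq0; lra.
have Hrho : Clim (unif A) rho 1 := rho_limit A lam Hl.
have Hr2 := r2_limit A.
apply: (Clim_ext_loc X).
  apply: (Fimp (filter_and _ _ (filter_and _ _ Hn (w_neq0 A lam Hl)) (clog_q A lam Hl))) => p [[Hn1 Hw0] Hlog].
  have Hnn : nn p <> 0 by apply: RtoC_neq0; rewrite /n; lra.
  have Hdisc : Cmod (zz p) < Rad.
    rewrite /zz; apply: sad_z_disc.
    case: (fst p) Hn1 => [|N] H; last lia.
    by rewrite /= sqrt_0 in H; lra.
  have Ew : w p = (l / nn p * z p)%C by rewrite /w /sad_w RtoC_div //; rewrite /n; lra.
  have Eq : (1 - zz p / RtoC Rad)%C = (w p * (1 - w p * ph p))%C.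
    rewrite -(one_sub_cexp (w p) Hw0) /zz /sad_z -/(w p); field => //.
  have Hq0 : (w p * (1 - w p * ph p))%C <> 0.
    rewrite -Eq => E0; have E1 : zz p = RtoC Rad.
      have -> : zz p = (RtoC Rad * (1 - (1 - zz p / RtoC Rad)))%C by field.
      by rewrite E0; ring.
    by move: Hdisc; rewrite E1 Cmod_R Rabs_right; lra.
  have Ek : (l * l * (1 + RtoC gk2) = 2)%C.
    by rewrite /l -RtoC_plus -!RtoC_mult lam_sqr.
  have Eg1 : gser theta (zz p) = (- RtoC ts * (lm p + clog (z p) + clog (rho p)) + r1 (zz p))%C.
    rewrite /r1 HGth // /zz /sad_z.
    have -> : (1 - RtoC Rad * cexp (- sad_w lam (fst p) (snd p)) / RtoC Rad)%C = (1 - cexp (- w p))%C by rewrite /w; field.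
    by rewrite Hlog /lm /z /rho /n /w; ring.
  have Eg2 : gser kappa (zz p) = (RtoC g - w p * (1 - w p * ph p) + RtoC gk2 / 2 *
     ((w p * (1 - w p * ph p)) * (w p * (1 - w p * ph p))) +
     (w p * (1 - w p * ph p)) * (w p * (1 - w p * ph p)) * r2 (zz p))%C.
    rewrite /r2 HGk // Eq RtoC_div //; field; split=> // E0.
    by apply: Hq0; rewrite E0; ring.
  have En : RtoC (INR (fst p)) = (nn p * nn p)%C.
    by rewrite /nn /n -RtoC_mult sqrt_sqrt //; exact: pos_INR.
  have I := exponent_identity (nn p) l (z p) (a p) (ph p) (r1 (zz p))
    ((w p * (1 - w p * ph p)) * (w p * (1 - w p * ph p)) * r2 (zz p)) (RtoC g) (RtoC gk2)
    (RtoC u) (RtoC ts) (lm p) (clog (z p)) (clog (rho p)) Hnn Hl0 Ek.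
  rewrite /= -Ew in I.
  rewrite /sad_expo /sad_lexp /GN -/(zz p) -/(z p) -/(w p) -/(a p) Eg1 Eg2 En.
  have -> : RtoC (sad_E (fst p)) = (nn p * nn p * RtoC g - nn p * RtoC u * RtoC g + / 2 * (RtoC u * RtoC u) * RtoC g)%C.
    rewrite /sad_E RtoC_plus RtoC_minus !RtoC_mult En RtoC_inv; last lra.
    by rewrite /nn /=; ring.
  rewrite !RtoC_mult -/(lm p) -/l.
  have Er : rho p = (1 - w p * ph p)%C by [].
  have Eq2 : (nn p * nn p * (w p * (1 - w p * ph p) * (w p * (1 - w p * ph p)) * r2 (zz p)) =
      l * l * (z p * z p) * (rho p * rho p) * r2 (zz p))%C.
    by rewrite -Er; move: (rho p) => R1; rewrite Ew; field.
  rewrite Eq2 -Er in I.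
  have fin : forall e L x : C, e = (L + x)%C -> x = (e - L)%C by move=> e L x ->; ring.
  apply: fin; apply: eq_trans _ I.
  by rewrite -Er; ring.
have B1 : unif A (fun p => Cmod (l * z p) <= lam * (1 + A)).
  apply: (Fimp Hz) => p H; rewrite Cmod_mult Cmod_R Rabs_right; last lra.
  by apply: Rmult_le_compat_l => //; lra.
have B2 : unif A (fun p => Cmod (l * l * (z p * z p)) <= lam * (1 + A) * (lam * (1 + A))).
  apply: (Fimp B1) => p H.
  have -> : (l * l * (z p * z p))%C = (l * z p * (l * z p))%C by ring.
  by rewrite Cmod_mult; apply: Rmult_le_compat => //; exact: Cmod_ge_0.
have Ha0 : Clim (unif A) (fun p => a p - 1)%C 0 by apply: Clim_sub_limit.
have Hrr : Clim (unif A) (fun p => rho p * rho p)%C 1.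
  by rewrite -(Cmult_1_l 1); apply: Clim_mult.
(* The eight summands of [X], in their order. *)
repeat apply: Clim0_plus.
- apply: Clim0_scal.
  apply: (Clim_ext (fun p => RtoC ((sad_al (fst p) - 1) * ln (lam / n (fst p))))).
    by move=> p; rewrite RtoC_mult RtoC_minus.
  apply: (Clim_unif A (fun N => RtoC ((sad_al N - 1) * ln (lam / n N)))).
  exact: (lim_log u lam Hu Hl).
- by apply: Clim0_opp; apply: Clim0_scal; apply: (Clim_0_mult_bounded _ _ _ Ha0 (clog_zl_bound A HA)).
- apply: Clim0_opp; apply: Clim0_scal; rewrite -(Cmult_0_r 1); apply: Clim_mult => //.
  exact: clog_rho_limit.
- by rewrite -(Cmult_0_r 1); apply: Clim_mult => //; exact: r1_limit.
- apply: Clim0_scal.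
  apply: (Clim_ext_loc (fun p => RtoC (n (fst p) * n (fst p) *
    (sad_al (fst p) - 1 - - u / n (fst p) - u * u / (n (fst p) * n (fst p)) / 2)))).
    apply: (Fimp Hn) => p Hn1.
    have Hnn : n (fst p) <> 0 by rewrite /n; lra.
    have Hnn2 : n (fst p) * n (fst p) <> 0 by apply: Rmult_integral_contrapositive.
    rewrite !RtoC_mult !RtoC_minus !RtoC_div // RtoC_opp !RtoC_mult //.
  apply: (Clim_unif A (fun N => RtoC (n N * n N * (sad_al N - 1 - - u / n N - u * u / (n N * n N) / 2)))).
  exact: lim_third_order.
- apply: (Clim0_mult_l _ _ _ B1); apply: Clim_sub_limit.
  apply: (Clim_ext (fun p => RtoC (n (fst p) * (1 - sad_al (fst p))))).
    by move=> p; rewrite RtoC_mult RtoC_minus.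
  apply: (Clim_unif A (fun N => RtoC (n N * (1 - sad_al N)))).
  exact: lim_second_order.
- apply: (Clim0_mult_l _ _ _ B2).
  have -> : RtoC 0 = (1 * / 2 - / 2 + RtoC gk2 / 2 * (1 * 1 - 1))%C by field.
  apply: Clim_plus; first apply: Clim_minus; first apply: Clim_mult => //.
  + exact: ph_limit.
  + exact: Clim_const.
  + apply: Clim_mult; first exact: Clim_const.
    by apply: Clim_minus; [apply: Clim_mult | exact: Clim_const].
- rewrite -(Cmult_0_r 1); apply: Clim_mult => //.
  apply: (Clim0_mult_l _ _ (lam * (1 + A) * (lam * (1 + A)) * 2)); last exact: Hr2.
  have Hb := Clim_bounded _ _ Hrr; rewrite Cmod_1 in Hb.
  apply: (Fimp (filter_and _ _ B2 (Hb (unif_filter A)))) => p [H1 H2].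
  rewrite Cmod_mult; apply: Rmult_le_compat => //; try exact: Cmod_ge_0.
  lra.
Qed.

Hypotheses
  (Hth0 : forall j, (1 <= j)%nat -> 0 <= theta j) (Hka0 : forall j, (1 <= j)%nat -> 0 <= kappa j)
  (Hrth : CV_radius (gcoef theta) = Finite Rad) (Hrka : CV_radius (gcoef kappa) = Finite Rad)
  (Hna : non_arithmetic kappa) (Hex : exists j, (2 <= j)%nat /\ 0 < kappa j)
  (holo_th : holo Rad (gser theta)) (holo_ka : holo Rad (gser kappa))
  (Hf : holomorphic_on D f).

Definition sad_F (N : nat) (z : C) : C := (f z * cexp (RtoC (sad_al N) * GN theta kappa N z))%C.
(** This is [Rad^N * exp (- sad_E) * mu^ts], the normalisation up to a power of [mu] from the
    substitution. *)
Definition sad_c (N : nat) : R := exp (INR N * ln Rad - sad_E N + ts * ln (lam / n N)).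
Definition sad_h (N : nat) (s : R) : C :=
  (RtoC (sad_c N) * (sad_F N (sad_z N s) / sad_z N s ^ N))%C.

Lemma holo_F (N : nat) : holo Rad (sad_F N).
Proof.
apply: holo_mult; first exact: (holo_of_Delta0 Rad eta phi f f).
apply: holo_cexp; apply: holo_scal; apply: holo_plus => //; exact: holo_scal.
Qed.

Lemma sad_h_expo (N : nat) (s : R) : sad_h N s = (f (sad_z N s) * cexp (sad_expo N s))%C.
Proof.
have Ez : (sad_z N s ^ N)%C = cexp (RtoC (INR N) * (RtoC (ln Rad) - sad_w lam N s))%C.
  rewrite cexp_nat; congr Cpow.
  by rewrite /sad_z -{1}(exp_ln Rad) // -cexp_RtoC -cexp_plus.
rewrite /sad_h Ez /sad_F /sad_c -cexp_RtoC /Cdiv -cexp_opp.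
set P := cexp (RtoC _); set Q := cexp (_ * GN _ _ _ _)%C; set S := cexp (- _)%C.
have -> : (P * (f (sad_z N s) * Q * S) = f (sad_z N s) * (P * Q * S))%C by ring.
congr Cmult; rewrite /P /Q /S -!cexp_plus; congr cexp.
rewrite /sad_expo RtoC_plus RtoC_minus RtoC_mult; ring.
Qed.

Lemma sad_h_limit (A : R) : 0 < A ->
  Clim (unif A) (fun p => sad_h (fst p) (snd p) - lk 1 ts (u * lam) (snd p))%C 0.
Proof.
move=> HA.
have [K [HK Hlk]] := lk_bound0 1 ts (u * lam) Rlt_0_1.
apply: (Clim_ext (fun p => lk 1 ts (u * lam) (snd p) *
   (f (sad_z (fst p) (snd p)) * cexp (sad_expo (fst p) (snd p) - sad_lexp (snd p)) - 1))%C).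
  move=> p; rewrite sad_h_expo.
  have -> : (sad_expo (fst p) (snd p) = sad_lexp (snd p) + (sad_expo (fst p) (snd p) - sad_lexp (snd p)))%C by ring.
  have -> : lk 1 ts (u * lam) (snd p) = cexp (sad_lexp (snd p)) by [].
  rewrite cexp_plus.
  have -> : (sad_lexp (snd p) + (sad_expo (fst p) (snd p) - sad_lexp (snd p)) - sad_lexp (snd p) = sad_expo (fst p) (snd p) - sad_lexp (snd p))%C by ring.
  ring.
apply: (Clim0_mult_l _ _ K).
  apply: filter_forall => p; apply: Rle_trans (Hlk _) _.
  have H := pow2_ge_0 (snd p); apply: (Rmult_le_reg_r (1 + snd p * snd p)); first nra.
  rewrite /Rdiv Rmult_assoc Rinv_l; nra.
rewrite -(Cplus_opp_r 1); apply: Clim_minus; last exact: Clim_const.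
rewrite -(Cmult_1_l 1); apply: Clim_mult; first exact: f_limit.
by rewrite -cexp_0; apply: Clim_cexp; exact: expo_limit.
Qed.

Lemma rcont_sad_h (N : nat) (s : R) : (1 <= N)%nat -> rcont (sad_h N) s.
Proof.
move=> HN; apply: Clim_mult; first exact: Clim_const.
have Hz : rcont (sad_z N) s.
  rewrite /rcont.
  apply: (Clim_ext (fun s => cexp (ln Rad - lam / n N, lam / n N * s)%R)).
    by move=> s0; rewrite sad_z_cexp.
  rewrite sad_z_cexp; apply: Clim_cexp.
  apply: (Clim_ext (fun s => (RtoC (ln Rad - lam / n N) + RtoC s * (RtoC (lam / n N) * Ci))%C)).
    by move=> s0; apply: injective_projections; rewrite /=; ring.
  have -> : (ln Rad - lam / n N, lam / n N * s)%R = (RtoC (ln Rad - lam / n N) + RtoC s * (RtoC (lam / n N) * Ci))%C.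
    by apply: injective_projections; rewrite /=; ring.
  exact: (rdiff_cont _ _ _ (rdiff_affine _ _ s)).
apply: (Clim_comp _ (sad_z N) (fun z => sad_F N z / z ^ N)%C (sad_z N s)) => //.
apply: (ccont_coef _ _ Rad); first exact: holo_F.
- exact: sad_z_disc.
- by rewrite sad_z_cexp; exact: cexp_neq_0.
Qed.

Lemma sad_h_integral (N : nat) : (1 <= N)%nat ->
  cint (sad_h N) (- (PI / (lam / n N))) (PI / (lam / n N)) =
  (RtoC (sad_c N / (lam / n N) * (2 * PI)) * zcoef N (sad_F N))%C.
Proof.
move=> HN; have Hm := mu_pos N HN; apply: Cis_unique.
have H := circ_coef_correct (sad_F N) N Rad _ (holo_F N) (sad_radius N HN).
have E1 : lam / n N * - (PI / (lam / n N)) + 0 = - PI by move: Hm; generalize (lam / n N) => m Hm; field; lra.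
have E2 : lam / n N * (PI / (lam / n N)) + 0 = PI by move: Hm; generalize (lam / n N) => m Hm; field; lra.
have {}H := Cis_comp_lin _ (lam / n N) 0 (- (PI / (lam / n N))) (PI / (lam / n N)) _
  (eq_ind_r (fun b => Cis _ _ b _) (eq_ind_r (fun a => Cis _ a _ _) H E1) E2).
have {}H := Cis_scal _ _ _ (RtoC (sad_c N / (lam / n N))) _ H.
have -> : (RtoC (sad_c N / (lam / n N) * (2 * PI)) * zcoef N (sad_F N) =
  RtoC (sad_c N / (lam / n N)) * (RtoC (2 * PI) * zcoef N (sad_F N)))%C by rewrite RtoC_mult; ring.
have Hab : - (PI / (lam / n N)) <= PI / (lam / n N).
  have HP := PI_RGT_0; have : 0 < PI / (lam / n N) by apply: Rdiv_lt_0_compat.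
  lra.
apply: (Cis_ext _ _ _ _ _ Hab _ H) => t _.
rewrite Rplus_0_r -sad_z_cexp Cmult_assoc -RtoC_mult /sad_h.
have -> // : sad_c N / (lam / n N) * (lam / n N) = sad_c N.
by move: Hm; generalize (lam / n N) => m Hm; field; lra.
Qed.

Lemma exp_neg_sqr_le (c s : R) : 0 < c -> exp (- (c * (s * s))) <= (1 + / c) / (1 + s * s).
Proof.
move=> Hc; have Hs : 0 <= s * s by nra.
have Hi : 0 < / c by apply: Rinv_0_lt_compat.
have Hcc : c * / c = 1 by field; lra.
rewrite exp_Ropp; apply: (Rmult_le_reg_r (1 + s * s)); first lra.
rewrite /Rdiv Rmult_assoc Rinv_l ?Rmult_1_r; last lra.
have H1 := exp_ineq1_le (c * (s * s)).
have H0 : 0 <= c * (s * s) by nra.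
apply: (Rmult_le_reg_l (exp (c * (s * s)))); first exact: exp_pos.
rewrite -Rmult_assoc Rinv_r ?Rmult_1_l; last by apply: Rgt_not_eq; exact: exp_pos.
apply: Rle_trans (_ : (1 + c * (s * s)) * (1 + / c) <= _); first nra.
by apply: Rmult_le_compat_r; lra.
Qed.

(** Everything is compared with [s = 0]. The series for [theta] is largest on the positive axis and
    the one for [kappa] loses a quadratic term by [gser_gauss], while the exponent at [s = 0]
    converges by [expo_limit]. The bound holds on the full circle, not just for bounded [s]. *)
Lemma sad_h_bound : exists K, 0 <= K /\ eventually (fun N => forall s,
  - (PI / (lam / n N)) <= s <= PI / (lam / n N) -> Cmod (sad_h N s) <= K / (1 + s * s)).
Proof.
have Hl := lam_pos; have HP := PI_RGT_0.
have [M [HM Hfb]] := bounded_on_disc Rad eta phi delta f HR Heta Hphi Hdelta Hf Of.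
have [c0 [Hc0 Hgauss]] := gser_gauss kappa Rad HR Hka0 Hrka Hna Hex holo_ka.
(* The factor [lam^2] comes from [N * (mu * s)^2], the 1/2 from the damping factor, which is at
   least [/ 2] for large [N]. *)
set c1 := c0 * (lam * lam) / 2.
have Hc1 : 0 < c1 by apply: Rdiv_lt_0_compat; [repeat apply: Rmult_lt_0_compat | lra].
set B := exp (Re (sad_lexp 0) + 1).
have HB : 0 < B by exact: exp_pos.
have Hi : 0 < / c1 by apply: Rinv_0_lt_compat.
exists (M * B * (1 + / c1)); split.
  by apply: Rmult_le_pos; [apply: Rmult_le_pos; lra | lra].
have [N1 H1] := expo_limit 1 Rlt_0_1 1 Rlt_0_1.
have [N2 H2] := al_limit 1 (/ 2) ltac:(lra).
(* Once [mu] is below [ln 2], the radius exceeds [Rad / 2], as [gser_gauss] demands. *)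
have Hln2 : 0 < ln 2 by rewrite -ln_1; apply: ln_increasing; lra.
have [N3 H3] := Clim_RtoC _ _ (lim_scale lam) (ln 2) Hln2.
exists (Nat.max 1 (Nat.max N1 (Nat.max N2 N3))) => N HN s Hs.
have HN1 : (1 <= N)%nat by lia.
have {}H1 := H1 N 0 ltac:(lia) ltac:(rewrite Rabs_R0; lra).
have {}H2 := H2 N 0 ltac:(lia) ltac:(rewrite Rabs_R0; lra).
have {}H3 := H3 N ltac:(lia).
rewrite /= in H1 H2; rewrite -RtoC_minus Cmod_R in H2; rewrite -RtoC_minus Cmod_R Rminus_0_r in H3.
have Hmu := mu_pos N HN1.
have Hal : / 2 <= sad_al N by move/Rabs_def2: H2; lra.
rewrite Rabs_right in H3; last by apply: Rle_ge; left.
have Hx1 : ln (Rad / 2) <= ln Rad - lam / n N by rewrite ln_div; [rewrite /n; lra | lra | lra].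
have Hx2 := sad_radius N HN1.
have Ht : Rabs (lam / n N * s) <= PI.
  have E2 : lam / n N * (PI / (lam / n N)) = PI by move: Hmu; generalize (lam / n N) => m Hm; field; lra.
  apply: Rabs_le; split; nra.
rewrite sad_h_expo Cmod_mult Cmod_cexp.
have HE : Re (sad_expo N s) <= Re (sad_expo N 0) - c1 * (s * s).
  have G1 := Re_gser_le theta Rad Hth0 Hrth _ (lam / n N * s) Hx2.
  have G2 := Hgauss _ (lam / n N * s) Hx1 Hx2 Ht.
  have Ez0 : sad_z N 0 = cexp (ln Rad - lam / n N, 0)%R by rewrite sad_z_cexp Rmult_0_r.
  rewrite -Ez0 -sad_z_cexp in G1 G2.
  have HNn : INR N = n N * n N by rewrite /n sqrt_sqrt //; exact: pos_INR.
  have Hn1 := sqrt_INR_ge1 N HN1; rewrite -/(n N) in Hn1.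
  have Emu : n N * n N * (lam / n N * s * (lam / n N * s)) = lam * lam * (s * s) by field; lra.
  have ER : forall t, Re (sad_expo N t) = sad_al N * (Re (gser theta (sad_z N t)) + n N * n N * Re (gser kappa (sad_z N t)))
      + ts * ln (lam / n N) + n N * n N * (lam / n N) - sad_E N.
    move=> t; rewrite /sad_expo /GN !re_plus re_opp !re_scal_l !re_plus !re_scal_l -/(n N) HNn.
    have -> : Re (zl 1 t) = 1 by [].
    by rewrite /=; ring.
  rewrite !ER.
  have K1 : n N * n N * Re (gser kappa (sad_z N s)) <= n N * n N * Re (gser kappa (sad_z N 0)) - c0 * (lam * lam * (s * s)).
    have -> : c0 * (lam * lam * (s * s)) = n N * n N * (c0 * (lam / n N * s * (lam / n N * s))) by rewrite -Emu; ring.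
    by rewrite -Rmult_minus_distr_l; apply: Rmult_le_compat_l => //; nra.
  have K2 : 0 <= c0 * (lam * lam * (s * s)) by apply: Rmult_le_pos; [lra | nra].
  have K3 : c1 * (s * s) = / 2 * (c0 * (lam * lam * (s * s))) by rewrite /c1; field.
  have K4 : sad_al N * (Re (gser theta (sad_z N s)) + n N * n N * Re (gser kappa (sad_z N s))) <=
     sad_al N * (Re (gser theta (sad_z N 0)) + n N * n N * Re (gser kappa (sad_z N 0)) - c0 * (lam * lam * (s * s))).
    by apply: Rmult_le_compat_l; lra.
  have K5 : / 2 * (c0 * (lam * lam * (s * s))) <= sad_al N * (c0 * (lam * lam * (s * s))) by apply: Rmult_le_compat_r.
  rewrite K3; lra.
have HE0 : Re (sad_expo N 0) <= Re (sad_lexp 0) + 1.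
  have := re_le_Cmod (sad_expo N 0 - sad_lexp 0 - 0); rewrite !re_plus !re_opp.
  move/Rabs_le_between; rewrite /= in H1 *; lra.
have Hexp : exp (Re (sad_expo N s)) <= B * exp (- (c1 * (s * s))).
  by rewrite -exp_plus; apply: exp_le; lra.
have Hz := Hfb _ (sad_z_disc N s HN1).
have Hg := exp_neg_sqr_le c1 s Hc1.
apply: Rle_trans (_ : M * (B * ((1 + / c1) / (1 + s * s))) <= _); last by right; rewrite /Rdiv; ring.
apply: Rmult_le_compat => //; [exact: Cmod_ge_0 | left; exact: exp_pos |].
apply: Rle_trans Hexp _; apply: Rmult_le_compat_l => //; lra.
Qed.

Theorem saddle_limit : Clim eventually
  (fun N => RtoC (sad_c N / (lam / n N) * (2 * PI)) * zcoef N (sad_F N))%C (LI 1 ts (u * lam)).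
Proof.
have Hl := lam_pos; have HP := PI_RGT_0.
have [K1 [HK1 [N0 HK]]] := sad_h_bound.
have [K2 [HK2 Hlk]] := lk_bound0 1 ts (u * lam) Rlt_0_1.
apply: (Clim_ext_loc (fun N => cint (sad_h N) (- (PI / (lam / n N))) (PI / (lam / n N)))).
  by exists 1%nat => N; exact: sad_h_integral.
apply: (dominated_convergence _ sad_h _ (lk 1 ts (u * lam)) (2 * K1 + 2 * K2)).
- lra.
- by move=> s; apply: rcont_lk; exact: Rlt_0_1.
- by move=> A HA; exists 1%nat => N s HN _; exact: rcont_sad_h.
- move=> A HA.
  have Hpos : 0 < PI / A by apply: Rdiv_lt_0_compat.
  have [N1 H1] := Clim_RtoC _ _ (lim_scale lam) (PI / A) Hpos.
  exists (Nat.max 1 (Nat.max N0 N1)) => N HN.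
  have {}H1 := H1 N ltac:(lia); rewrite -RtoC_minus Cmod_R Rminus_0_r in H1.
  have HN1 : (1 <= N)%nat by lia.
  have Hmu := mu_pos N HN1.
  rewrite -/(n N) Rabs_right in H1; last lra.
  have HAB : A <= PI / (lam / n N).
    apply: (Rmult_le_reg_r (lam / n N)) => //.
    have -> : PI / (lam / n N) * (lam / n N) = PI by move: Hmu; generalize (lam / n N) => m Hm; field; lra.
    have := Rmult_lt_compat_l A _ _ HA H1.
    have -> : A * (PI / A) = PI by field; lra.
    by left.
  apply: Rle_trans (cint_sym_tail (sad_h N) K1 A (PI / (lam / n N)) HK1 (conj HA HAB) _ _) _.
  + by move=> s _; exact: rcont_sad_h.
  + by move=> s; apply: HK; lia.
  + by apply: Rmult_le_compat_r; [left; exact: Rinv_0_lt_compat | lra].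
- move=> A HA; apply: Rle_trans (line_tail _ K2 A _ HK2 _ Hlk (LI_correct 1 ts (u * lam) Rlt_0_1) HA) _.
  + by move=> s; apply: rcont_lk; exact: Rlt_0_1.
  + by apply: Rmult_le_compat_r; [left; exact: Rinv_0_lt_compat | lra].
- exact: sad_h_limit.
Qed.

End Saddle.

(** * Asymptotic equivalence *)

(** The weights [k] turn the right-hand side into the constant [L]; a relative error is then an
    ordinary limit, provided that [L] is not 0. *)
Lemma asym_equiv_of_Clim (k : nat -> R) (a b : nat -> C) (L : C) :
  L <> 0 -> eventually (fun N => 0 < k N /\ (RtoC (k N) * b N)%C = L) ->
  Clim eventually (fun N => RtoC (k N) * a N)%C L -> asym_equiv a b.
Proof.
move=> HL [N1 H1] Hlim e He.
have HLp : 0 < e * Cmod L by apply: Rmult_lt_0_compat => //; apply/Cmod_gt_0.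
have [N2 H2] := Hlim _ HLp.
exists (Nat.max N1 N2) => N /(ssrbool.elimT ssrnat.leP) HN.
have [Hk Hb] := H1 N ltac:(lia).
have {}H2 := H2 N ltac:(lia).
apply: (Rmult_le_reg_l (k N)) => //.
have Ek : forall z, k N * Cmod z = Cmod (RtoC (k N) * z) by move=> z; rewrite Cmod_mult Cmod_R Rabs_right; lra.
rewrite Ek.
have -> : k N * (e * Cmod (b N)) = e * (k N * Cmod (b N)) by ring.
rewrite Ek Hb; left.
have -> : (RtoC (k N) * (a N - b N))%C = (RtoC (k N) * a N - RtoC (k N) * b N)%C by ring.
by rewrite Hb.
Qed.

(** [HN] is matched with the real part of a coefficient; as the comparison sequence is real, passing
    to real parts does not enlarge the error. *)
Lemma asym_equiv_Re (a : nat -> C) (b : nat -> R) :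
  asym_equiv a (fun N => RtoC (b N)) ->
  asym_equiv (fun N => RtoC (Re (a N))) (fun N => RtoC (b N)).
Proof.
move=> H e He; have [N0 H0] := H e He; exists N0 => N HN.
apply: Rle_trans (H0 N HN); rewrite -RtoC_minus Cmod_R.
have -> : Re (a N) - b N = Re (a N - RtoC (b N)) by rewrite re_plus re_opp.
exact: re_le_Cmod.
Qed.

Lemma asym_equiv_ext (a a' b b' : nat -> C) :
  (forall N, a N = a' N) -> (forall N, (1 <= N)%nat -> b N = b' N) ->
  asym_equiv a b -> asym_equiv a' b'.
Proof.
move=> Ha Hb H e He; have [N0 H0] := H e He.
exists (Nat.max 1 N0) => N /(ssrbool.elimT ssrnat.leP) HN.
rewrite -Ha -Hb; last lia.
by apply: H0; apply: (ssrbool.introT ssrnat.leP); lia.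
Qed.

(** Since [N * b2 / 2 = mu^(-2)], the power in the claim is [mu^(1 - ts)] and cancels the one in the
    normalisation. The remaining [2 * PI] meets the denominator of [J / (2 pi i)]. *)
Lemma prefactor_identity (Rad ts g gk2 u : R) (N : nat) :
  0 < Rad -> 0 < gk2 -> (1 <= N)%nat ->
  sad_c Rad gk2 ts u g N / (sad_lam gk2 / sqrt (INR N)) * (2 * PI) *
  (exp (INR N * g - sqrt (INR N) * u * g + / 2 * u ^ 2 * g) / Rad ^ N *
   Rpower (/ 2 * INR N * (1 + gk2)) ((ts - 1) / 2)) = 2 * PI.
Proof.
move=> HR Hg HN; have Hm := mu_pos gk2 Hg N HN.
have Hn := sqrt_INR_ge1 N HN; have Hl := lam_pos gk2 Hg; have Hl2 := lam_sqr gk2 Hg.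
have En : INR N = sqrt (INR N) * sqrt (INR N) by rewrite sqrt_sqrt //; exact: pos_INR.
rewrite /sad_c /sad_E.
move: Hm; set mu := sad_lam gk2 / sqrt (INR N) => Hm.
have Eb : / 2 * INR N * (1 + gk2) = / (mu * mu).
  have Eg : 1 + gk2 = 2 / (sad_lam gk2 * sad_lam gk2) by rewrite -Hl2; field; lra.
  by rewrite Eg {1}En /mu; field; lra.
rewrite Eb /Rpower ln_Rinv; last nra.
rewrite ln_mult //.
have -> : (ts - 1) / 2 * - (ln mu + ln mu) = ln mu - ts * ln mu by field.
move: (INR N * g - sqrt (INR N) * u * g + / 2 * u ^ 2 * g) => E0.
have -> : exp (INR N * ln Rad - E0 + ts * ln mu) = Rad ^ N * / exp E0 * exp (ts * ln mu).
  by rewrite !exp_plus exp_Ropp exp_INR exp_ln.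
rewrite exp_plus exp_Ropp exp_ln //.
have P1 := exp_pos E0; have P2 := exp_pos (ts * ln mu); have P3 := pow_lt Rad N HR.
by field; repeat split; lra.
Qed.

Theorem theorem3p12
  (theta kappa : nat -> R) (Rad : R)
  (* standing assumptions *)
  (Htheta_nonneg : forall j : nat, (1 <= j)%nat -> 0 <= theta j)
  (Hkappa_nonneg : forall j : nat, (1 <= j)%nat -> 0 <= kappa j)
  (Hnonarith : non_arithmetic kappa)
  (Hkappa_pos : exists j : nat, (2 <= j)%nat /\ 0 < kappa j)
  (* radius of convergence R > 0 *)
  (HRpos : 0 < Rad)
  (Hrad_theta : CV_radius (gcoef theta) = Finite Rad)
  (Hrad_kappa : CV_radius (gcoef kappa) = Finite Rad)
  (* g_kappa^{1}(R) = 1 and 0 < g_kappa^{2}(R) = gk2 < oo *)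
  (Hg1 : gbrace_at_R_is kappa 1 Rad 1)
  (gk2 : R) (Hgk2_pos : 0 < gk2) (Hg2 : gbrace_at_R_is kappa 2 Rad gk2)
  (* the domain Delta_0 *)
  (eta phi : R) (Heta : 0 < eta) (Hphi : 0 < phi < PI / 2)
  (* holomorphic continuations of g_theta, g_kappa to Delta_0 *)
  (Gth Gk : C -> C)
  (HGth_hol : holomorphic_on (Delta0 Rad eta phi) Gth)
  (HGk_hol : holomorphic_on (Delta0 Rad eta phi) Gk)
  (HGth_ext : forall z : C, Cmod z < Rad -> Gth z = gser theta z)
  (HGk_ext : forall z : C, Cmod z < Rad -> Gk z = gser kappa z)
  (* singular expansions *)
  (theta_star delta : R) (Htheta_star : 0 <= theta_star) (Hdelta : 0 < delta)
  (Hexp_theta : bigO_near (Delta0 Rad eta phi) Rad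
     (fun z => Cplus (Gth z)
        (Cmult (RtoC theta_star) (clog (Cminus 1 (Cdiv z (RtoC Rad))))))
     (fun z => cpow (Cminus 1 (Cdiv z (RtoC Rad))) (RtoC delta)))
  (Hexp_kappa : bigO_near (Delta0 Rad eta phi) Rad
     (fun z => let q := Cminus 1 (Cdiv z (RtoC Rad)) in
        Cminus (Gk z)
          (Cplus (Cminus (RtoC (greal kappa Rad)) q)
                 (Cmult (RtoC (gk2 / 2)) (Cmult q q))))
     (fun z => cpow (Cminus 1 (Cdiv z (RtoC Rad))) (RtoC (2 + delta)))) :
  let gkR := greal kappa Rad in
  let b2 := 1 + gk2 in
  (forall f : C -> C,
     holomorphic_on (Delta0 Rad eta phi) f ->
     bigO_near (Delta0 Rad eta phi) Rad
       (fun z => Cminus (f z) 1)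
       (fun z => cpow (Cminus 1 (Cdiv z (RtoC Rad))) (RtoC delta)) ->
     forall u : R, 0 <= u ->
       asym_equiv
         (fun N : nat =>
            zcoef N (fun z => Cmult (f z)
              (cexp (Cmult (RtoC (exp (- u / sqrt (INR N)))) (GN theta kappa N z)))))
         (fun N : nat =>
            Cmult
              (RtoC (exp (INR N * gkR - sqrt (INR N) * u * gkR + / 2 * u ^ 2 * gkR)
                     / Rad ^ N
                     * Rpower (/ 2 * INR N * b2) ((theta_star - 1) / 2)))
              (Cdiv (Jfun (u * sqrt (2 / b2)) (RtoC theta_star))
                    (Cmult (RtoC (2 * PI)) Ci))))
  /\
  asym_equiv
    (fun N : nat => RtoC (HN theta kappa N))
    (fun N : nat =>
       RtoC (exp (INR N * gkR) * Rpower (/ 2 * INR N * b2) ((theta_star - 1) / 2)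
             / (2 * Rad ^ N * Gamma ((1 + theta_star) / 2)))).
Proof.
move=> gkR b2; have HP := PI_RGT_0.
have holo_th := holo_of_Delta0 _ _ _ _ _ HRpos Heta Hphi HGth_hol HGth_ext.
have holo_ka := holo_of_Delta0 _ _ _ _ _ HRpos Heta Hphi HGk_hol HGk_ext.
have H2pi : RtoC (2 * PI) <> 0 by apply: RtoC_neq0; lra.
have HCi : Ci <> 0 by move/(f_equal snd) => /=; lra.
(* The second claim is derived from the first, which is therefore kept as a hypothesis. *)
have conj_dep : forall P Q : Prop, P -> (P -> Q) -> P /\ Q by move=> P Q p pq; split=> //; exact: pq.
apply: conj_dep.
  move=> f Hf HO u Hu.
  have Hlim := saddle_limit theta kappa Rad eta phi gk2 theta_star delta u gkR Gth Gk f
    HRpos Heta Hphi Hgk2_pos Hdelta Hu HGth_ext HGk_ext Hexp_theta Hexp_kappa HO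
    Htheta_nonneg Hkappa_nonneg Hrad_theta Hrad_kappa Hnonarith Hkappa_pos holo_th holo_ka Hf.
  apply: (asym_equiv_of_Clim _ _ _ _ _ _ Hlim).
  - apply: LI_neq0 => //; first exact: Rlt_0_1.
    by apply: Rmult_le_pos => //; exact: sqrt_pos.
  - exists 1%nat => N HN; split.
      apply: Rmult_lt_0_compat; last lra.
      by apply: Rdiv_lt_0_compat; [exact: exp_pos | exact: mu_pos].
    rewrite Cmult_assoc -RtoC_mult prefactor_identity // (Jfun_line 1); last exact: Rlt_0_1.
    by rewrite -/(sad_lam gk2); field.
move=> Hpart1.
have HO1 : bigO_near (Delta0 Rad eta phi) Rad (fun z => Cminus 1 1)
       (fun z => cpow (Cminus 1 (Cdiv z (RtoC Rad))) (RtoC delta)).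
  exists 0, 1; split; first lra.
  move=> z _ _; have -> : (1 - 1)%C = 0 by ring.
  by rewrite Cmod_0; right; ring.
have Hhol1 : holomorphic_on (Delta0 Rad eta phi) (fun _ => RtoC 1).
  by move=> z _; exists (RtoC 0); apply/cdiff_derive; exact: cdiff_const.
have HG : 0 < Gamma ((1 + theta_star) / 2) by apply: Gamma_pos; lra.
(* With [f = 1] and [u = 0] the coefficients are those of [exp G_N]. *)
have Hu0 := Hpart1 (fun _ => RtoC 1) Hhol1 HO1 0 (Rle_refl 0).
apply: (asym_equiv_ext (fun N => RtoC (Re (zcoef N (fun z => cexp (GN theta kappa N z))))) _
   (fun N => RtoC (exp (INR N * gkR) * Rpower (/ 2 * INR N * b2) ((theta_star - 1) / 2)
             / (2 * Rad ^ N * Gamma ((1 + theta_star) / 2))))) => //.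
  by move=> N; rewrite (HN_zcoef theta kappa Rad N).
apply: asym_equiv_Re; apply: asym_equiv_ext Hu0 => N.
- symmetry; apply: (zcoef_ext N _ _ Rad) => //.
    by apply: holo_cexp; apply: holo_plus => //; exact: holo_scal.
  by move=> z _; rewrite Ropp_0 /Rdiv Rmult_0_l exp_0 !Cmult_1_l.
- move=> HN; rewrite Rmult_0_l (Jfun_line 1); last exact: Rlt_0_1.
  rewrite LI_xi0; [|exact: Rlt_0_1|lra].
  have -> : INR N * gkR - sqrt (INR N) * 0 * gkR + / 2 * 0 ^ 2 * gkR = INR N * gkR by ring.
  (* The value of [J / (2 pi i)] at parameter 0, by [LI_xi0]. *)
  have -> : (Ci * RtoC (PI / Gamma ((1 + theta_star) / 2)) / (RtoC (2 * PI) * Ci))%C = RtoC (/ (2 * Gamma ((1 + theta_star) / 2))).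
    have -> : PI / Gamma ((1 + theta_star) / 2) = 2 * PI * / (2 * Gamma ((1 + theta_star) / 2)) by field; lra.
    by rewrite RtoC_mult; field.
  rewrite -RtoC_mult; congr RtoC; field; split; first lra.
  by apply: pow_nonzero; lra.
Qed.
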